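(* Let $X$ be a compact metric space, $f\colon X\to X$ a homeomorphism, and $\phi\colon X\to\mathbb{R}$ continuous. Suppose there are $\delta,\varepsilon>0$ with $\varepsilon>40\delta$ such that $P^\perp_{\exp}(\phi,\varepsilon)<P(\phi)$ and there exists $\mathcal{D}\subset X\times\mathbb{N}$ which admits a decomposition $(\mathcal{P},\mathcal{G},\mathcal{S})$ such that: (I$'$) for every $M\in\mathbb{N}$, $\mathcal{G}^M$ has tail (W)-specification at scale $\delta$; (II) $\phi$ has the Bowen property at scale $\varepsilon$ on $\mathcal{G}$; (III$'$) $P(\mathcal{P}\cup\mathcal{S}\cup\mathcal{D}^c,\phi,\delta,\varepsilon)<P(\phi)$. Then $(X,f,\phi)$ has a unique equilibrium state.
   Context: $d$ the metric; $\mathbb{N}_0=\mathbb{N}\cup\{0\}$. $d_n(x,y)=\max_{0\le k<n}d(f^kx,f^ky)$, $B_n(x,\delta)=\{y:d_n(x,y)<\delta\}$; $E$ is $(n,\delta)$-separated if $d_n(x,y)>\delta$ for distinct $x,y\in E$. Pairs $(x,n)$ are orbit segments $\{f^kx:0\le k<n\}$ ($(x,0)$ empty); $\mathcal{C}_n=\{x:(x,n)\in\mathcal{C}\}$; $\mathcal{D}^c=(X\times\mathbb{N})\setminus\mathcal{D}$. $\Phi_\varepsilon(x,n)=\sup_{y\in B_n(x,\varepsilon)}\sum_{k=0}^{n-1}\phi(f^ky)$; $\Lambda(\mathcal{C},\phi,\delta,\varepsilon,n)=\sup\{\sum_{x\in E}e^{\Phi_\varepsilon(x,n)}:E\subset\mathcal{C}_n\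 (n,\delta)\text{-separated}\}$; $P(\mathcal{C},\phi,\delta,\varepsilon)=\limsup_n\frac1n\log\Lambda(\mathcal{C},\phi,\delta,\varepsilon,n)$; $P(\phi)$ topological pressure. Equilibrium state: $f$-invariant Borel probability measure maximizing $h_\mu(f)+\int\phi\,d\mu$. $\Gamma_\varepsilon(x)=\{y:d(f^nx,f^ny)\le\varepsilon\ \forall n\in\mathbb{Z}\}$, $\mathrm{NE}(\varepsilon)=\{x:\Gamma_\varepsilon(x)\ne\{x\}\}$, $P^\perp_{\exp}(\phi,\varepsilon)=\sup\{h_\mu(f)+\int\phi\,d\mu:\mu\text{ ergodic},\ \mu(\mathrm{NE}(\varepsilon))>0\}$. Decomposition for $\mathcal{D}$: $\mathcal{P},\mathcal{G},\mathcal{S}\subset X\times\mathbb{N}_0$ and $p,g,s:\mathcal{D}\to\mathbb{N}_0$ with $n=p+g+s$, $(x,p)\in\mathcal{P}$, $(f^px,g)\in\mathcal{G}$, $(f^{p+g}x,s)\in\mathcal{S}$ for each $(x,n)\in\mathcal{D}$; standing assumption $X\times\{0\}\subset\mathcal{P}\cap\mathcal{G}\cap\mathcal{S}$. $\mathcal{G}^M=\{(x,n)\in\mathcal{D}:p\le M,\ s\le M\}$. (W)-specification at scale $\delta$: there is $\tau\in\mathbb{N}$ such that for every $\{(x_i,n_i)\}_{i=1}^k$ in the collection there are $y$ and $\tau_1,\dots,\tau_{k-1}\in\mathbb{N}$, $\tau_i\le\tau$, with $d_{n_j}(f^{N_{j-1}+\tau_{j-1}}y,x_j)<\delta$ for all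 $j$, where $N_j=\sum_{i\le j}n_i+\sum_{i\le j-1}\tau_i$, $N_0=\tau_0=0$. Tail (W)-specification at scale $\delta$: there is $N_0\in\mathbb{N}$ such that the subcollection of segments with $n\ge N_0$ has (W)-specification at scale $\delta$. Bowen property at scale $\varepsilon$ on $\mathcal{C}$: there is $K$ with $|\Phi_0(x,n)-\Phi_0(y,n)|\le K$ for all $(x,n)\in\mathcal{C}$, $y\in B_n(x,\varepsilon)$. *)

(* Defs.v *)
From HB Require Import structures.
From mathcomp Require Import all_boot all_order all_algebra.
From mathcomp Require Import all_classical all_reals all_analysis.
Set Implicit Arguments. Unset Strict Implicit. Unset Printing Implicit Defensive.
Import Order.TTheory GRing.Theory Num.Theory.
Local Open Scope classical_set_scope.
Local Open Scope ring_scope.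

Section Dynamics.
Context {R : realType} {X : Type}.
Variable dist : X -> X -> R.

Definition is_metric : Prop :=
  (forall x y, 0 <= dist x y) /\ (forall x y, dist x y = 0 <-> x = y) /\
  (forall x y, dist x y = dist y x) /\
  (forall x y z, dist x z <= dist x y + dist y z).

Definition dopen (U : set X) : Prop :=
  forall x, U x -> exists2 r : R, 0 < r & forall y, dist x y < r -> U y.

Definition dcompact : Prop :=
  forall F : set (set X), (forall U, F U -> dopen U) ->
    (forall x, exists2 U, F U & U x) ->
    exists s : seq (set X), (forall i, (i < size s)%N -> F (nth set0 s i)) /\
      (forall x, exists2 i, (i < size s)%N & nth set0 s i x).

Definition dcontinuous (h : X -> X) : Prop :=
  forall x (e : R), 0 < e -> exists2 r : R, 0 < r &
    forall y, dist x y < r -> dist (h x) (h y) < e.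

Definition rcontinuous (h : X -> R) : Prop :=
  forall x (e : R), 0 < e -> exists2 r : R, 0 < r &
    forall y, dist x y < r -> `|h x - h y| < e.

Definition homeomorphism (f : X -> X) : Prop :=
  exists g : X -> X, [/\ cancel f g, cancel g f, dcontinuous f & dcontinuous g].

Variable f : X -> X.
Variable phi : X -> R.

Definition dn (n : nat) (x y : X) : R :=
  \big[Num.max/0]_(k < n) dist (iter k f x) (iter k f y).

Definition birkhoff (x : X) (n : nat) : R := \sum_(k < n) phi (iter k f x).

(** Phi_eps(x,n) = sup_{y in B_n(x,eps)} S_n phi(y).  We take the sup over
    B_n(x,eps) U {x}: identical for eps > 0 (x is in the ball) and equal to
    the Birkhoff sum S_n phi(x) for eps = 0 (the paper's convention Phi_0). *)
Definition PhiE (eps : R) (x : X) (n : nat) : \bar R :=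
  ereal_sup [set (birkhoff y n)%:E | y in [set y | y = x \/ dn n x y < eps]].

(** E : 'I_k -> X is an (n,delta)-separated family (finite sets; sup over
    finite sets equals the sup over all sets since terms are nonnegative) *)
Definition separated (n : nat) (delta : R) (k : nat) (E : 'I_k -> X) : Prop :=
  forall i j : 'I_k, i != j -> delta < dn n (E i) (E j).

Definition Lambda (C : set (X * nat)) (delta eps : R) (n : nat) : \bar R :=
  ereal_sup [set v | exists (k : nat) (E : 'I_k -> X),
     [/\ separated n delta E, (forall i, C (E i, n)) &
          v = (\sum_(i < k) expeR (PhiE eps (E i) n))%E]].

Definition elog (a : \bar R) : \bar R :=
  match a with
  | r%:E => if (0 < r)%R then (ln r)%:E else -oo
  | +oo => +oo
  | -oo => -oo
  end%E.

Definition elimsup (u : nat -> \bar R) : \bar R :=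
  ereal_inf [set ereal_sup [set u n | n in [set n | (N <= n)%N]] | N in [set: nat]].

Definition Pcol (C : set (X * nat)) (delta eps : R) : \bar R :=
  elimsup (fun n => ((n%:R)^-1)%:E * elog (Lambda C delta eps n))%E.

(** topological pressure P(phi) = lim_{delta -> 0} P(X x N, phi, delta, 0) *)
Definition Ptop : \bar R :=
  ereal_sup [set Pcol [set: X * nat] delta 0 | delta in [set delta : R | 0 < delta]].

Definition Wspec (C : set (X * nat)) (delta : R) : Prop :=
  exists tau : nat, forall (k : nat) (xs : 'I_k -> X) (ns : 'I_k -> nat),
    (forall i, C (xs i, ns i)) ->
    exists (y : X) (taus : nat -> nat),
      (forall i, (i.+1 < k)%N -> (1 <= taus i <= tau)%N) /\
      forall j : 'I_k,
        dn (ns j) (iter (\sum_(i < k | (i < j)%N) (ns i + taus i)) f y) (xs j)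
          < delta.

Definition tailWspec (C : set (X * nat)) (delta : R) : Prop :=
  exists N0 : nat, Wspec [set p | C p /\ (N0 <= p.2)%N] delta.

Definition Bowen (C : set (X * nat)) (eps : R) : Prop :=
  exists K : R, forall x n y, C (x, n) -> dn n x y < eps ->
    `|birkhoff x n - birkhoff y n| <= K.

Definition decomposition (D P G S : set (X * nat)) (p g s : X -> nat -> nat) :=
  (forall x, P (x, 0%N) /\ G (x, 0%N) /\ S (x, 0%N)) /\
  forall x n, D (x, n) ->
    [/\ n = (p x n + g x n + s x n)%N, P (x, p x n),
        G (iter (p x n) f x, g x n) & S (iter (p x n + g x n) f x, s x n)].

Definition GM (D : set (X * nat)) (p s : X -> nat -> nat) (M : nat) :=
  [set q | D q /\ (p q.1 q.2 <= M)%N /\ (s q.1 q.2 <= M)%N].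

(** Gamma_eps(x) and NE(eps); negative times expressed through backward orbits *)
Definition Gamma (eps : R) (x : X) : set X :=
  [set y | (forall n, dist (iter n f x) (iter n f y) <= eps) /\
     forall m x' y', iter m f x' = x -> iter m f y' = y -> dist x' y' <= eps].

Definition NE (eps : R) : set X := [set x | exists2 y, Gamma eps x y & y <> x].
End Dynamics.

Section Measures.
Context {R : realType} {dX : measure_display} {X : measurableType dX}.
Variable f : X -> X.
Variable mu : probability X R.

Definition invariant : Prop :=
  forall A, measurable A -> mu (f @^-1` A) = mu A.

Definition ergodic : Prop :=
  invariant /\ forall A, measurable A -> f @^-1` A = A -> mu A = 0%E \/ mu A = 1%E.

Definition mpartition (xi : seq (set X)) : Prop :=
  (forall i, (i < size xi)%N -> measurable (nth set0 xi i)) /\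
  (forall i j, (i < size xi)%N -> (j < size xi)%N -> i <> j ->
     nth set0 xi i `&` nth set0 xi j = set0) /\
  (forall x, exists2 i, (i < size xi)%N & nth set0 xi i x).

Definition pjoin (xi eta : seq (set X)) : seq (set X) :=
  [seq A `&` B | A <- xi, B <- eta].

Fixpoint prefine (xi : seq (set X)) (n : nat) : seq (set X) :=
  match n with
  | 0 => [:: setT]
  | m.+1 => pjoin (prefine xi m) [seq iter m f @^-1` A | A <- xi]
  end.

Definition xlogx (t : R) : R := if t == 0 then 0 else t * ln t.

Definition Hpart (xi : seq (set X)) : R :=
  - \sum_(A <- xi) xlogx (fine (mu A)).

Definition hpart (xi : seq (set X)) : \bar R :=
  elimsup (fun n => ((n%:R)^-1 * Hpart (prefine xi n))%:E).

Definition hmu : \bar R :=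
  ereal_sup [set hpart xi | xi in mpartition].
End Measures.

Definition freeEnergy {R : realType} {dX : measure_display} {X : measurableType dX}
  (f : X -> X) (phi : X -> R) (mu : probability X R) : \bar R :=
  (hmu f mu + \int[mu]_x (phi x)%:E)%E.

Definition equilibrium {R : realType} {dX : measure_display} {X : measurableType dX}
  (f : X -> X) (phi : X -> R) (mu : probability X R) : Prop :=
  invariant f mu /\
  forall nu : probability X R, invariant f nu ->
    (freeEnergy f phi nu <= freeEnergy f phi mu)%E.

Definition Pperp {R : realType} {dX : measure_display} {X : measurableType dX}
  (dist : X -> X -> R) (f : X -> X) (phi : X -> R) (eps : R) : \bar R :=
  ereal_sup [set freeEnergy f phi mu | mu in [set mu : probability X R |
     ergodic f mu /\ (0 < mu (NE dist f eps))%E]].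

(* Main.v *)
(* Write P for the topological pressure.  All measures are produced as limits of finitely
   additive ones along an ultrafilter.  A measure charging NE(eps) splits off a part which,
   by maximising a strictly convex and upper semicontinuous perturbation of the free energy,
   is dominated by an ergodic measure charging NE(eps); hence measures of nearly maximal free
   energy give no mass to NE(eps), and on those any partition of d_n-diameter at most eps
   already computes the entropy.  Specification on G^M bounds the partition sums over
   separated subsets of G^M by B e^{nP}; cutting an orbit segment into its prefix, core and
   suffix and coding prefix and suffix by delta-separated sets gives a recurrence whose
   solution extends this bound to all separated sets, with an arbitrarily small contribution
   from outside G^M.  Gluing four segments then shows that the limit mu of empirical measures
   satisfies mu(V) >= c > 0, where V is the set of points that follow some segment of a family
   carrying a fixed proportion of e^{nP} and, after a bounded gap, one of a second such family.
   If two equilibrium states lived on disjoint invariant sets A1 and A2, the two families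
   could be chosen near A1 and near A2, and mu(V) would tend to 0.  So every equilibrium
   state is ergodic, and so is the average of two of them, which therefore coincide. *)
From Pilot Require Import Defs.
From HB Require Import structures.
From mathcomp Require Import all_boot all_order all_algebra.
From mathcomp Require Import all_classical all_reals all_analysis.
From mathcomp Require Import ring lra.
From mathcomp Require Import measurable_realfun random_variable.
(* Imported again because MathComp shadows [separated] and [invariant]. *)
Import Pilot.Defs.
Set Implicit Arguments. Unset Strict Implicit. Unset Printing Implicit Defensive.
Import Order.TTheory GRing.Theory Num.Theory.
Import numFieldNormedType.Exports.
Local Open Scope classical_set_scope.
Local Open Scope ring_scope.

(** * Entropy of finite distributions *)

(** The gap hypothesis only bounds ergodic measures, and no ergodic decomposition is invoked: the
    perturbed maximisation carries the bound over to any invariant measure living on [NE], and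
    near-affinity of entropy ([hh_mix]) treats measures charging [NE] partially. All scales are
    multiples of [delta]. Counting is done at [3 * delta], so that points shadowing different
    segments within [delta] are still [delta]-separated. Segments glued into a net are separated at
    [9 * delta]: shadowing costs [delta] and moving to the net [3 * delta], and twice [4 * delta] is
    below [9 * delta], so a net point still remembers its segments. Birkhoff sums are maximised over
    balls of radius [10 * delta], which contain the partition cells of radius [9 * delta]; the cells
    have diameter [18 * delta], within [eps], hence generate off [NE]. Bounds must hold up to a
    constant factor, not merely exponentially. This is why powers of one partition sum are compared
    and why the exponential gain outside the good segments is summed over all prefix and suffix
    lengths. *)

Section FiniteEntropy.
Context {R : realType} {S : finType}.
Variable p : S -> R.

Definition pm (T : finType) (a : S -> T) (t : T) : R := \sum_(s | a s == t) p s.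

Definition ent (T : finType) (a : S -> T) : R :=
  - \sum_t xlogx (pm a t).

Definition pairf (A B : finType) (a : S -> A) (b : S -> B) (s : S) : A * B :=
  (a s, b s).

(** Conditional entropy of [a] given [b], written by the chain rule so that no conditional
    probability, and no division by zero, occurs. *)
Definition cent (A B : finType) (a : S -> A) (b : S -> B) : R :=
  ent (pairf a b) - ent b.

Hypothesis p0 : forall s, 0 <= p s.

Lemma xlogxE (x : R) : xlogx x = x * ln x.
Proof. by rewrite /xlogx; case: eqP => [->|//]; rewrite mul0r. Qed.

Lemma pm_ge0 (T : finType) (a : S -> T) t : 0 <= pm a t.
Proof. exact: sumr_ge0. Qed.

Lemma pm_ge (T : finType) (a : S -> T) s : p s <= pm a (a s).
Proof. by rewrite /pm (bigD1 s) //= lerDl sumr_ge0. Qed.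

Lemma pm_gt0 (T : finType) (a : S -> T) s : 0 < p s -> 0 < pm a (a s).
Proof. by move=> h; apply: lt_le_trans h (pm_ge _ _). Qed.

Lemma sum_pm (T : finType) (a : S -> T) (F : T -> R) :
  \sum_t pm a t * F t = \sum_s p s * F (a s).
Proof.
rewrite (partition_big a predT) //=; apply: eq_bigr => t _.
by rewrite /pm mulr_suml; apply: eq_bigr => s /eqP ->.
Qed.

Lemma entE (T : finType) (a : S -> T) :
  ent a = - \sum_s p s * ln (pm a (a s)).
Proof. by rewrite /ent -(sum_pm a (fun t => ln (pm a t))); under eq_bigr do rewrite xlogxE. Qed.

Lemma le_pm (A B : finType) (a : S -> A) (b : S -> B) s :
  (forall s', b s = b s' -> a s = a s') -> pm b (b s) <= pm a (a s).
Proof.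
move=> h; rewrite /pm [leRHS](bigID (fun s' => b s' == b s)) /= -[leLHS]addr0.
rewrite lerD ?sumr_ge0 //.
rewrite [leRHS](eq_bigl (fun s' => b s' == b s)) // => s'.
by case: (b s' =P b s) => [/esym /h ->|]; rewrite ?eqxx ?andbF.
Qed.

Lemma ent_le (A B : finType) (a : S -> A) (b : S -> B) :
  (forall s s', b s = b s' -> a s = a s') -> ent a <= ent b.
Proof.
move=> h; rewrite !entE lerN2; apply: ler_sum => s _.
have := p0 s; rewrite le_eqVlt => /orP[/eqP <-|ps]; first by rewrite !mul0r.
by rewrite ler_pM2l // ler_ln ?posrE ?pm_gt0 //; apply: le_pm => s' /h.
Qed.

Lemma ent_eq (A B : finType) (a : S -> A) (b : S -> B) :
  (forall s s', (a s == a s') = (b s == b s')) -> ent a = ent b.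
Proof.
move=> h; apply/eqP; rewrite eq_le !ent_le // => s s' /eqP e; apply/eqP.
  by rewrite -h.
by rewrite h.
Qed.

Hypothesis p1 : \sum_s p s = 1.

Lemma sum_pm1 (T : finType) (a : S -> T) : \sum_t pm a t = 1.
Proof.
have := sum_pm a (fun=> 1); under eq_bigr do rewrite mulr1.
by under [RHS]eq_bigr do rewrite mulr1; rewrite p1.
Qed.

Lemma pm_le1 (T : finType) (a : S -> T) t : pm a t <= 1.
Proof. by rewrite -(sum_pm1 a) (bigD1 t) //= lerDl sumr_ge0 // => *; exact: pm_ge0. Qed.

Lemma ent_ge0 (T : finType) (a : S -> T) : 0 <= ent a.
Proof.
rewrite entE oppr_ge0; apply: sumr_le0 => s _.
by rewrite mulr_ge0_le0 // ln_le0 // pm_le1.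
Qed.

(** Gibbs' inequality, from [ln x <= x - 1] with [x] the ratio of predicted to true joint mass. The
    predictor [q] may be a subprobability kernel. The entropy upper bounds below are choices of [q]:
    a coarser conditional law, the uniform law, a guess with uniform noise, normalised exponential
    weights. *)
Lemma cross (T B : finType) (a : S -> T) (b : S -> B) (q : T -> B -> R) :
  (forall t y, 0 <= q t y) -> (forall y, \sum_t q t y <= 1) ->
  (forall s, 0 < p s -> 0 < q (a s) (b s)) ->
  cent a b <= - \sum_s p s * ln (q (a s) (b s)).
Proof.
move=> q0 q1 qp; rewrite /cent !entE opprK.
suff h : \sum_s p s * ln (q (a s) (b s)) + \sum_s p s * ln (pm b (b s))
    - \sum_s p s * ln (pm (pairf a b) (pairf a b s)) <= 0.
  by move: h; lra.
pose P := pm (pairf a b).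
have : \sum_s p s * ln (q (a s) (b s)) + \sum_s p s * ln (pm b (b s))
    - \sum_s p s * ln (P (pairf a b s)) <=
  \sum_s p s * (q (a s) (b s) * pm b (b s) / P (pairf a b s) - 1).
  rewrite -big_split /= -sumrB; apply: ler_sum => s _.
  have := p0 s; rewrite le_eqVlt => /orP[/eqP <-|ps].
    by rewrite !mul0r addr0 subr0.
  rewrite -mulrDr -mulrBr ler_pM2l //.
  have Pp : 0 < P (pairf a b s) by exact: pm_gt0.
  have bp : 0 < pm b (b s) by exact: pm_gt0.
  have qq := qp _ ps.
  rewrite -lnM ?posrE // -ln_div ?posrE ?mulr_gt0 //.
  have := @le_ln1Dx R (q (a s) (b s) * pm b (b s) / P (pairf a b s) - 1).
  rewrite addrCA subrr addr0; apply.
  by rewrite -subr_gt0 opprK addrNK ?divr_gt0 ?mulr_gt0.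
move=> /le_trans; apply.
have -> : \sum_s p s * (q (a s) (b s) * pm b (b s) / P (pairf a b s) - 1) =
  \sum_s p s * (q (a s) (b s) * pm b (b s) / P (pairf a b s)) - 1.
  by under eq_bigr do rewrite mulrBr mulr1; rewrite sumrB p1.
rewrite subr_le0.
have := sum_pm (pairf a b) (fun z => q z.1 z.2 * pm b z.2 / P z) => /= <-.
apply: (@le_trans _ _ (\sum_(z : T * B) q z.1 z.2 * pm b z.2)).
  apply: ler_sum => -[t y] _ /=; rewrite -/(P (t, y)).
  have := pm_ge0 (pairf a b) (t, y); rewrite -/P le_eqVlt => /orP[/eqP <-|h].
    by rewrite mul0r mulr_ge0 // pm_ge0.
  by rewrite mulrC divfK ?gt_eqF.
rewrite -(pair_bigA _ (fun t y => q t y * pm b y)) /= exchange_big /=.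
rewrite -(sum_pm1 b); apply: ler_sum => y _; rewrite -mulr_suml.
by rewrite ler_piMl // pm_ge0.
Qed.

Lemma cent_mono (A B C : finType) (a : S -> A) (b : S -> B) (h : B -> C) :
  cent a b <= cent a (h \o b).
Proof.
(* The predictor that knows [b] but uses only the coarser variable: the conditional law of [a] given
   [h \o b]. *)
pose q (t : A) (y : B) := pm (pairf a (h \o b)) (t, h y) / pm (h \o b) (h y).
have -> : cent a (h \o b) = - \sum_s p s * ln (q (a s) (b s)).
  rewrite /cent !entE opprK addrC -sumrB -sumrN; apply: eq_bigr => s _.
  have := p0 s; rewrite le_eqVlt => /orP[/eqP <-|ps].
    by rewrite !mul0r subr0 oppr0.
  rewrite -mulrBr -mulrN ln_div ?posrE ?opprB //; first exact: (pm_gt0 (pairf a (h \o b)) ps).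
  exact: (pm_gt0 (h \o b) ps).
apply: cross => [t y|y|s ps].
- by rewrite divr_ge0 ?pm_ge0.
- rewrite -mulr_suml.
  have <- : pm (h \o b) (h y) = \sum_i pm (pairf a (h \o b)) (i, h y).
    rewrite /pm (partition_big a predT) //=; apply: eq_bigr => t _.
    by apply: eq_bigl => s; rewrite /pairf xpair_eqE andbC.
  by have [->|/divff ->] := eqVneq (pm (h \o b) (h y)) 0; rewrite ?mul0r.
- apply: divr_gt0; first exact: (pm_gt0 (pairf a (h \o b)) ps).
  exact: (pm_gt0 (h \o b) ps).
Qed.

Lemma ent_const (T : finType) (a : S -> T) :
  (forall s s', a s = a s') -> ent a = 0.
Proof.
move=> h; rewrite entE big1 ?oppr0 // => s _.
rewrite /pm (eq_bigl xpredT) ?p1 ?ln1 ?mulr0 // => s'.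
by rewrite (h s' s) eqxx.
Qed.

Lemma ent_cent (T : finType) (a : S -> T) : ent a = cent a (fun=> tt).
Proof.
rewrite /cent (ent_const (a := fun=> tt)) // subr0; apply: ent_eq => s s'.
by rewrite /pairf xpair_eqE eqxx andbT.
Qed.

Lemma ent_cross (T : finType) (a : S -> T) (q : T -> R) :
  (forall t, 0 <= q t) -> \sum_t q t <= 1 ->
  (forall s, 0 < p s -> 0 < q (a s)) ->
  ent a <= - \sum_s p s * ln (q (a s)).
Proof. by move=> q0 q1 qp; rewrite ent_cent; apply: (@cross _ _ _ _ (fun t _ => q t)). Qed.

Lemma ent_ln_card (T : finType) (a : S -> T) : ent a <= ln #|T|%:R.
Proof.
case: (pickP (@predT S)) => [s0 _|S0]; last first.
  by move: p1; rewrite big_pred0 // => /esym /eqP; rewrite oner_eq0.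
have T0 : 0 < #|T|%:R :> R by rewrite ltr0n; apply/card_gt0P; exists (a s0).
have := @ent_cross _ a (fun=> #|T|%:R^-1).
rewrite -mulr_suml p1 mul1r lnV ?posrE // opprK; apply.
- by move=> _; rewrite invr_ge0 ltW.
- by rewrite sumr_const -[X in X *+ _]mul1r -mulrnAr -mulr_natr mul1r mulVf ?gt_eqF.
- by move=> s _; rewrite invr_gt0.
Qed.

Lemma ent_pair (A B : finType) (a : S -> A) (b : S -> B) :
  ent (pairf a b) <= ent a + ent b.
Proof.
rewrite -lerBlDr -/(cent a b) ent_cent; exact: (@cent_mono _ _ _ _ _ (fun=> tt)).
Qed.

Lemma cent_pair (A B C : finType) (a : S -> A) (b : S -> B) (c : S -> C) :
  cent (pairf a b) c <= cent a c + cent b c.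
Proof.
have := cent_mono a (pairf b c) snd.
have -> : (snd \o pairf b c) = c by [].
rewrite /cent.
have -> : ent (pairf a (pairf b c)) = ent (pairf (pairf a b) c).
  by apply: ent_eq => s s'; rewrite /pairf !xpair_eqE andbA.
by lra.
Qed.

Lemma cent_tuple (I T C : finType) (x : I -> S -> T) (r : seq I) (c : S -> C) :
  cent (fun s => map_tuple (x^~ s) (in_tuple r)) c <= \sum_(i <- r) cent (x i) c.
Proof.
elim: r => [|i r IH]; first by rewrite big_nil /cent lerBlDr add0r ent_le // => s s' e; rewrite /pairf e; congr (_, _); apply/val_inj.
rewrite big_cons; apply: le_trans (lerD (lexx _) IH).
apply: le_trans (cent_pair _ _ _).
rewrite /cent lerD2r ent_le // => s s' [e1 e2 e3].
by rewrite /pairf e3; congr (_, _); apply/val_inj; rewrite /= e1 e2.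
Qed.

Lemma ent_fam (I T T' : finType) (x : I -> S -> T) (r : seq I) (a : S -> T') :
  (forall s s', (forall i, i \in r -> x i s = x i s') -> a s = a s') ->
  ent a <= \sum_(i <- r) ent (x i).
Proof.
move=> h; apply: (@le_trans _ _ (ent (fun s => map_tuple (x^~ s) (in_tuple r)))).
  apply: ent_le => s s' e; apply: h => i ir.
  move/(congr1 val): e => /= /eq_in_map; exact.
rewrite ent_cent; apply: le_trans (cent_tuple _ _ _) _.
by apply: ler_sum => i _; rewrite -ent_cent.
Qed.

(* Used when each [x i] is nearly determined by the function [h i] of the single code [c]. *)
Lemma ent_fam_cent (I T T' C B : finType) (x : I -> S -> T) (r : seq I)
    (a : S -> T') (c : S -> C) (h : I -> C -> B) :
  (forall s s', (forall i, i \in r -> x i s = x i s') -> a s = a s') ->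
  ent a <= ent c + \sum_(i <- r) cent (x i) (h i \o c).
Proof.
move=> ha; apply: (@le_trans _ _ (ent (pairf (fun s => map_tuple (x^~ s) (in_tuple r)) c))).
  apply: ent_le => s s' [e _]; apply: ha => i ir.
  move/eq_in_map: e; exact.
rewrite -lerBlDl; apply: le_trans (cent_tuple _ _ _) _.
by apply: ler_sum => i _; apply: cent_mono.
Qed.

(** Fano's inequality with a free parameter: the predictor puts [1 - e] on the guess and spreads [e]
    uniformly. A right guess costs at most [- ln (1 - e)], a wrong one at most [ln #|T| - ln e], and
    wrong guesses have total mass at most [k]. *)
Lemma cent_fano (T B : finType) (a : S -> T) (b : S -> B) (g : B -> T) (k e : R) :
  0 < e -> e < 1 -> \sum_(s | a s != g (b s)) p s <= k ->
  cent a b <= - ln (1 - e) + k * (ln #|T|%:R - ln e).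
Proof.
move=> e0 e1 hk.
case: (pickP (@predT S)) => [s0 _|S0]; last first.
  by move: p1; rewrite big_pred0 // => /esym /eqP; rewrite oner_eq0.
have T1 : 1 <= #|T|%:R :> R by rewrite ler1n; apply/card_gt0P; exists (a s0).
have T0 : 0 < #|T|%:R :> R by apply: lt_le_trans T1.
have f0 : 0 < e / #|T|%:R by rewrite divr_gt0.
pose q (t : T) (y : B) := (if t == g y then 1 - e else 0) + e / #|T|%:R.
have q0 t y : 0 < q t y.
  by rewrite /q ltr_wpDl //; case: ifP => // _; rewrite subr_ge0 ltW.
apply: (@le_trans _ _ (- \sum_s p s * ln (q (a s) (b s)))).
  apply: cross => [t y|y|s _]; [exact: ltW| |exact: q0].
  rewrite /q big_split /= -big_mkcond /= big_pred1_eq sumr_const.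
  rewrite -[X in X *+ _]mulr1 -mulrnAr mulrAC -mulrA divff ?gt_eqF // mulr1.
  by rewrite subrK.
rewrite -sumrN (bigID (fun s => a s == g (b s))) /=; apply: lerD.
  apply: (@le_trans _ _ (\sum_(s | a s == g (b s)) p s * - ln (1 - e))).
    apply: ler_sum => s /eqP h; rewrite -mulrN ler_wpM2l // lerN2.
    rewrite ler_ln; first by rewrite /q h eqxx lerDl ltW.
      by rewrite posrE subr_gt0.
    by rewrite posrE; exact: q0.
  rewrite -mulr_suml ler_piMl //.
    by rewrite oppr_ge0 ln_le0 // gerBl ltW.
  by rewrite -p1 [leRHS](bigID (fun s => a s == g (b s))) /= lerDl sumr_ge0.
apply: (@le_trans _ _ (\sum_(s | a s != g (b s)) p s * (ln #|T|%:R - ln e))).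
  apply: ler_sum => s h; rewrite -mulrN ler_wpM2l //.
  rewrite /q (negbTE h) add0r ln_div ?posrE // opprB //.
rewrite -mulr_suml ler_wpM2r // subr_ge0.
by apply: (@le_trans _ _ 0); rewrite ?ln_ge0 // ln_le0 // ltW.
Qed.

(** The predictor normalises the exponential weights separately on [D] and off [D], giving each part
    mass at most one half. Keeping the two normalisations apart is what later converts mass carried
    by [D] into a lower bound for the partition sum over [D]. *)
Lemma ent_variational (T : finType) (a : S -> T) (phi : T -> R) (D : pred T) (u v : R) :
  0 < u -> 0 < v ->
  \sum_(t | D t) expR (phi t) <= u -> \sum_(t | ~~ D t) expR (phi t) <= v ->
  ent a + \sum_t pm a t * phi t <=
    (\sum_(t | D t) pm a t) * ln (2 * u) + (\sum_(t | ~~ D t) pm a t) * ln (2 * v).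
Proof.
move=> u0 v0 hu hv.
pose q t := expR (phi t) / (if D t then 2 * u else 2 * v).
have q0 t : 0 < q t by rewrite /q divr_gt0 ?expR_gt0 //; case: ifP; rewrite mulr_gt0.
have := @ent_cross _ a q (fun t => ltW (q0 t)) _ (fun s _ => q0 _).
have q1 : \sum_t q t <= 1.
  rewrite (bigID D) /=.
  have -> : 1 = 2^-1 + 2^-1 :> R by lra.
  apply: lerD.
    rewrite (eq_bigr (fun t => expR (phi t) * (2 * u)^-1)); last by move=> t; rewrite /q => ->.
    by rewrite -mulr_suml ler_pdivrMr ?mulr_gt0 // mulrA mulVf // mul1r.
  rewrite (eq_bigr (fun t => expR (phi t) * (2 * v)^-1)); last by move=> t; rewrite /q => /negbTE ->.
  by rewrite -mulr_suml ler_pdivrMr ?mulr_gt0 // mulrA mulVf // mul1r.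
move=> /(_ q1); rewrite -(sum_pm a (fun t => ln (q t))) => h.
rewrite -lerBrDr; apply: le_trans h _.
rewrite lerBrDr -sumrN -big_split /= (bigID D) /= !mulr_suml.
apply: lerD; apply: ler_sum => t Dt; rewrite /q.
  by rewrite Dt -mulrN -mulrDr ler_wpM2l ?pm_ge0 // ln_div ?posrE ?expR_gt0 ?mulr_gt0 // expRK opprB subrK.
by rewrite (negbTE Dt) -mulrN -mulrDr ler_wpM2l ?pm_ge0 // ln_div ?posrE ?expR_gt0 ?mulr_gt0 // expRK opprB subrK.
Qed.

End FiniteEntropy.

Section Windows.
Context {R : realType} {S : finType}.
Variable p : S -> R.
Hypothesis p0 : forall s, 0 <= p s.
Hypothesis p1 : \sum_s p s = 1.

(** For each residue [j] modulo [q], the word is recovered from its first [j] letters and the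
    windows starting at positions congruent to [j]; summing over the [q] residues uses every window
    once. Windows may run past [N], since [x] is defined at all times. *)
Lemma ent_windows (T : finType) (x : nat -> S -> T) (q N : nat) :
  (0 < q)%N ->
  q%:R * ent p (fun s => [ffun i : 'I_N => x i s]) <=
  \sum_(k < N) ent p (fun s => [ffun i : 'I_q => x (k + i)%N s])
   + q%:R * (q%:R * ln #|T|%:R).
Proof.
move=> q0.
have key (j : 'I_q) : ent p (fun s => [ffun i : 'I_N => x i s]) <=
    \sum_(k < N | (k %% q)%N == j) ent p (fun s => [ffun i : 'I_q => x (k + i)%N s])
     + q%:R * ln #|T|%:R.
  pose u s := [ffun i : 'I_j => x i s].
  pose w (k : 'I_N) s := [ffun i : 'I_q => x (k + i)%N s].
  pose r := [seq k : 'I_N <- enum 'I_N | (k %% q)%N == j].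
  pose v s := map_tuple (w^~ s) (in_tuple r).
  apply: (@le_trans _ _ (ent p (pairf v u))).
    apply: ent_le => // s s' [ev eu]; apply/ffunP => i; rewrite !ffunE.
    have [ij|ji] := ltnP i j.
      by have /ffunP/(_ (Ordinal ij)) := eu; rewrite !ffunE.
    (* The window containing position [i] starts at [i - d], which is congruent to [j] modulo
       [q]. *)
    pose d := ((i - j) %% q)%N.
    have dq : (d < q)%N by rewrite ltn_mod.
    have di : (i - d < N)%N by apply: leq_ltn_trans (ltn_ord i); rewrite leq_subr.
    have dle : (d <= i - j)%N by apply: leq_mod.
    have kr : Ordinal di \in r.
      rewrite mem_filter mem_enum andbT /=; apply/eqP.
      have -> : (i - d = (i - j) %/ q * q + j)%N.
        have e := divn_eq (i - j) q; rewrite -/d in e.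
        by apply/eqP; rewrite -(eqn_add2r d) subnK ?(leq_trans dle) ?leq_subr // addnAC -e subnK.
      by rewrite modnMDl modn_small.
    have := ev => /eq_in_map /(_ _ kr) /ffunP /(_ (Ordinal dq)); rewrite !ffunE /=.
    by rewrite subnK // (leq_trans dle) ?leq_subr.
  apply: le_trans (ent_pair p0 p1 _ _) _; apply: lerD.
    apply: le_trans (ent_fam p0 p1 (x := w) (r := r) _) _.
      by move=> s s' h; apply/val_inj/eq_in_map.
    by rewrite big_filter big_enum_cond.
  apply: le_trans (ent_fam p0 p1 (x := fun (i : 'I_j) s => x i s) (r := enum 'I_j) _) _.
    by move=> s s' h; apply/ffunP => i; rewrite !ffunE h // mem_enum.
  apply: (@le_trans _ _ (\sum_(i <- enum 'I_j) ln #|T|%:R)).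
    by apply: ler_sum => i _; apply: ent_ln_card.
  rewrite big_const_seq count_predT size_enum_ord iter_addr addr0 -[leLHS]mulr_natl ler_wpM2r ?ler_nat //; last by rewrite ltnW.
  have [->|Tn] := posnP #|T|; first by rewrite ln0.
  by rewrite ln_ge0 // ler1n.
apply: (@le_trans _ _ (\sum_(j < q) (\sum_(k < N | (k %% q)%N == j) ent p (fun s => [ffun i : 'I_q => x (k + i)%N s])
     + q%:R * ln #|T|%:R))).
  by rewrite mulr_natl -[X in _ *+ X]card_ord -sumr_const; apply: ler_sum.
rewrite big_split /= [X in _ + X <= _]sumr_const card_ord [X in _ <= _ + X]mulr_natl lerD2r.
rewrite [leRHS](partition_big (fun k : 'I_N => Ordinal (ltn_pmod k q0)) xpredT) //=.
Qed.

End Windows.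

(** * Ultralimits and compact metric spaces *)

Section UltraLimits.
Context {R : realType} (U : set_system nat) {UU : UltraFilter U}.

(** A total function; it is a genuine limit for [ubnd] sequences, by compactness of segments along
    an ultrafilter ([ulim_cvg]). *)
Definition ulim (u : nat -> R) : R := lim (u @ U).

Definition ubnd (u : nat -> R) := exists C : R, \forall n \near U, `|u n| <= C.

Lemma ultra_ex2 (P Q : nat -> Prop) :
  (\forall n \near U, P n) -> (\forall n \near U, Q n) -> exists n, P n /\ Q n.
Proof. by move=> hP hQ; apply: (@filter_ex _ U); exact: filterI. Qed.

Lemma ultra_ex3 (P Q V : nat -> Prop) :
  (\forall n \near U, P n) -> (\forall n \near U, Q n) -> (\forall n \near U, V n) ->
  exists n, [/\ P n, Q n & V n].
Proof.
move=> hP hQ hV; have [|n [h1 [h2 h3]]] := ultra_ex2 hP (Q := fun n => Q n /\ V n).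
  exact: filterI.
by exists n.
Qed.

Lemma ultra_map (T : Type) (g : nat -> T) : UltraFilter (g @ U).
Proof.
split; first exact: fmap_proper_filter.
move=> G GF sG; rewrite predeqE => A; split; last exact: sG.
move=> GA; have [//|h] := in_ultra_setVsetC (g @^-1` A) UU.
have GC : G (~` A) by apply: sG.
by have [|x []] := @filter_ex _ G GF (A `&` ~` A); first exact: filterI.
Qed.

Lemma ulim_cvg (u : nat -> R) : ubnd u -> u @ U --> ulim u.
Proof.
move=> [C hC]; have := @segment_compact R (- C) C; rewrite compact_ultra.
move=> /(_ _ (ultra_map u)) [|l [_ /= h]].
  by apply: filterS hC => n; rewrite /= in_itv /= ler_norml.
by apply: cvgP h.
Qed.

Lemma ulimE (u : nat -> R) l : u @ U --> l -> ulim u = l.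
Proof. by move=> h; apply/cvg_lim. Qed.

Lemma ubnd01 (u : nat -> R) : (forall n, 0 <= u n <= 1) -> ubnd u.
Proof. by move=> h; exists 1; apply: nearW => n; have /andP[h1 h2] := h n; rewrite ger0_norm. Qed.

Lemma ulim_cst c : ulim (fun=> c) = c.
Proof. by apply: ulimE; exact: cvg_cst. Qed.

Lemma ulimD u v : ubnd u -> ubnd v -> ulim (fun n => u n + v n) = ulim u + ulim v.
Proof. by move=> /ulim_cvg hu /ulim_cvg hv; apply: ulimE; exact: cvgD. Qed.

Lemma ulimN u : ubnd u -> ulim (fun n => - u n) = - ulim u.
Proof. by move=> /ulim_cvg hu; apply: ulimE; exact: cvgN. Qed.

Lemma ulimM u v : ubnd u -> ubnd v -> ulim (fun n => u n * v n) = ulim u * ulim v.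
Proof. by move=> /ulim_cvg hu /ulim_cvg hv; apply: ulimE; exact: cvgM. Qed.

Lemma ubndD u v : ubnd u -> ubnd v -> ubnd (fun n => u n + v n).
Proof.
move=> [C hC] [D hD]; exists (C + D); apply: filterS2 hC hD => n h1 h2.
by apply: le_trans (ler_normD _ _) _; exact: lerD.
Qed.

Lemma ubndM u v : ubnd u -> ubnd v -> ubnd (fun n => u n * v n).
Proof.
move=> [C hC] [D hD]; exists (C * D); apply: filterS2 hC hD => n h1 h2.
by rewrite normrM ler_pM.
Qed.

Lemma ubndN u : ubnd u -> ubnd (fun n => - u n).
Proof. by move=> [C hC]; exists C; apply: filterS hC => n; rewrite normrN. Qed.

Lemma ubnd_cst c : ubnd (fun=> c).
Proof. by exists `|c|; exact: nearW. Qed.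

Lemma ubnd_sum (I : Type) (r : seq I) (P : pred I) (u : I -> nat -> R) :
  (forall i, ubnd (u i)) -> ubnd (fun n => \sum_(i <- r | P i) u i n).
Proof.
move=> h; elim: r => [|i r IH].
  by have [C hC] := ubnd_cst 0; exists C; apply: filterS hC => n; rewrite big_nil.
have [C hC] := IH; have [D hD] := h i; exists (`|D| + C); apply: filterS2 hC hD => n h1 h2.
rewrite big_cons; case: ifP => _; last by rewrite (le_trans h1) // lerDr.
by apply: le_trans (ler_normD _ _) _; apply: lerD => //; rewrite (le_trans h2) // ler_norm.
Qed.

Lemma ulim_sum (I : Type) (r : seq I) (P : pred I) (u : I -> nat -> R) :
  (forall i, ubnd (u i)) ->
  ulim (fun n => \sum_(i <- r | P i) u i n) = \sum_(i <- r | P i) ulim (u i).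
Proof.
move=> h; elim: r => [|i r IH].
  by under eq_fun do rewrite big_nil; rewrite big_nil ulim_cst.
under eq_fun do rewrite big_cons; rewrite big_cons; case: ifP => // _.
by rewrite ulimD ?IH //; exact: ubnd_sum.
Qed.

Lemma ulim_le u v : ubnd u -> ubnd v -> (\forall n \near U, u n <= v n) ->
  ulim u <= ulim v.
Proof. by move=> /ulim_cvg hu /ulim_cvg hv h; apply: ler_lim => //; apply/cvg_ex; eexists; eassumption. Qed.

Lemma ulim_lec u c : ubnd u -> (\forall n \near U, u n <= c) -> ulim u <= c.
Proof. by move=> hu h; rewrite -[c]ulim_cst; apply: ulim_le => //; exact: ubnd_cst. Qed.

Lemma ulim_gec u c : ubnd u -> (\forall n \near U, c <= u n) -> c <= ulim u.
Proof. by move=> hu h; rewrite -[c]ulim_cst; apply: ulim_le => //; exact: ubnd_cst. Qed.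

End UltraLimits.

(** Choosing an ultrafilter that contains an unbounded set [A] replaces passing to a subsequence. It
    is needed where a limsup gives information along infinitely many lengths only. *)
Lemma free_ultra (A : set nat) : (forall n, exists2 k, (n <= k)%N & A k) ->
  exists U : set_system nat, [/\ UltraFilter U, U A & \oo `<=` U].
Proof.
move=> hA.
have PF : ProperFilter (within A \oo).
  apply: Build_ProperFilter_ex => B [n _ hn].
  by have [k nk Ak] := hA n; exists k; apply: hn.
have [U [UU sU]] := ultraFilterLemma PF.
exists U; split => //.
  by apply: sU; apply: nearW => n.
move=> B hB; apply: sU; move: hB; apply: filterS => n //.
Qed.

Lemma free_ultraT : exists U : set_system nat, UltraFilter U /\ \oo `<=` U.
Proof.
have [|U [h1 _ h2]] := @free_ultra setT; last by exists U.
by move=> n; exists n.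
Qed.

Section Metric.
Context {R : realType} {X : Type} (dist : X -> X -> R).
Hypothesis dM : is_metric dist.
Hypothesis dK : dcompact dist.

Definition dclosed (A : set X) := dopen dist (~` A).

Lemma dist_ge0 x y : 0 <= dist x y. Proof. by case: dM. Qed.
Lemma distxx x : dist x x = 0. Proof. by case: dM => _ [/(_ x x) h _]; apply/h. Qed.
Lemma dist0 x y : dist x y = 0 -> x = y. Proof. by case: dM => _ [/(_ x y) h _]; apply h. Qed.
Lemma distC x y : dist x y = dist y x. Proof. by case: dM => _ [_ []]. Qed.
Lemma dist_tri x y z : dist x z <= dist x y + dist y z.
Proof. by case: dM => _ [_ [_]]. Qed.

Lemma dopen_bigcup (I : Type) (P : set I) (F : I -> set X) :
  (forall i, P i -> dopen dist (F i)) -> dopen dist (\bigcup_(i in P) F i).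
Proof.
move=> h x [i Pi Fx]; have [r r0 hr] := h i Pi x Fx; exists r => // y /hr ?.
by exists i.
Qed.

Lemma dopenU A B : dopen dist A -> dopen dist B -> dopen dist (A `|` B).
Proof.
by move=> hA hB x [/hA|/hB] [r r0 h]; exists r => // y /h; [left|right].
Qed.

Lemma dopenI A B : dopen dist A -> dopen dist B -> dopen dist (A `&` B).
Proof.
move=> hA hB x [/hA[r r0 h] /hB[s s0 k]]; exists (Num.min r s).
  by rewrite lt_min r0.
by move=> y; rewrite lt_min => /andP[/h ? /k ?].
Qed.

Lemma dopenT : dopen dist setT. Proof. by move=> x _; exists 1. Qed.
Lemma dopen0 : dopen dist set0. Proof. by []. Qed.
Lemma dclosedT : dclosed setT. Proof. by rewrite /dclosed setCT. Qed.
Lemma dclosed0 : dclosed set0. Proof. by rewrite /dclosed setC0; exact: dopenT. Qed.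
Lemma dclosedC A : dopen dist A -> dclosed (~` A).
Proof. by rewrite /dclosed setCK. Qed.

Lemma dclosedU A B : dclosed A -> dclosed B -> dclosed (A `|` B).
Proof. by rewrite /dclosed setCU; exact: dopenI. Qed.

Lemma dclosedI A B : dclosed A -> dclosed B -> dclosed (A `&` B).
Proof. by rewrite /dclosed setCI; exact: dopenU. Qed.

Lemma dclosed_bigcap (I : Type) (P : set I) (F : I -> set X) :
  (forall i, P i -> dclosed (F i)) -> dclosed (\bigcap_(i in P) F i).
Proof. by move=> h; rewrite /dclosed setC_bigcap; exact: dopen_bigcup. Qed.

Lemma dopen_ball x r : dopen dist [set y | dist x y < r].
Proof.
move=> y /= h; exists (r - dist x y); first by rewrite subr_gt0.
by move=> z; rewrite ltrBrDl => /(le_lt_trans (dist_tri _ _ _)).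
Qed.

Lemma dclosed_ball x r : dclosed [set y | dist x y <= r].
Proof.
move=> y /= /negP; rewrite -ltNge => h; exists (dist x y - r); first by rewrite subr_gt0.
move=> z hz; apply/negP; rewrite -ltNge; have := dist_tri x z y.
by rewrite (distC z y); lra.
Qed.

Lemma dcontinuous_iter (f : X -> X) k : dcontinuous dist f -> dcontinuous dist (iter k f).
Proof.
move=> cf; elim: k => [|k IH] x e e0; first by exists e.
have [r r0 hr] := cf (iter k f x) e e0.
by have [s s0 hs] := IH x r r0; exists s => // y /hs /hr.
Qed.

Lemma dopen_preimage (f : X -> X) A : dcontinuous dist f -> dopen dist A -> dopen dist (f @^-1` A).
Proof.
move=> cf oA x /= /oA[r r0 h]; have [s s0 hs] := cf x r r0.
by exists s => // y /hs /h.
Qed.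

Lemma dclosed_preimage (f : X -> X) A : dcontinuous dist f -> dclosed A -> dclosed (f @^-1` A).
Proof. by move=> cf; rewrite /dclosed preimage_setC; exact: dopen_preimage. Qed.

Section UCvg.
Context (U : set_system nat) {UU : UltraFilter U}.

Definition ucvg (x : nat -> X) (y : X) := forall r : R, 0 < r ->
  \forall n \near U, dist y (x n) < r.

(** Otherwise every point has a ball that the sequence avoids for almost all indices; finitely many
    such balls cover the space, so some index would avoid all of them. *)
Lemma ultra_compact (x : nat -> X) : exists y, ucvg x y.
Proof.
apply/not_existsP => h.
pose F := [set B : set X | dopen dist B /\ U [set n | ~ B (x n)]].
have [|y|s [hs1 hs2]] := dK (F := F).
- by move=> B [].
- have /existsNP[r /not_implyP[r0 hr]] := h y.
  exists [set z | dist y z < r]; last by rewrite /= distxx.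
  split; first exact: dopen_ball.
  by have [//|k] := in_ultra_setVsetC [set n | dist y (x n) < r] UU.
have : U [set n | forall i, (i < size s)%N -> ~ nth set0 s i (x n)].
  have H : forall k, (k <= size s)%N ->
    U [set n | forall i, (i < k)%N -> ~ nth set0 s i (x n)].
    elim=> [_|k IH ks]; first by apply: nearW.
    apply: filterS2 (IH (ltnW ks)) (hs1 k ks).2 => n h1 h2 i.
    by rewrite ltnS leq_eqVlt => /orP[/eqP ->|/h1].
  exact: H.
by move=> /filter_ex[n hn]; have [i /hn] := hs2 (x n).
Qed.

Lemma ucvg_closed (x : nat -> X) y (A : set X) : ucvg x y -> dclosed A ->
  (\forall n \near U, A (x n)) -> A y.
Proof.
move=> xy cA hA; apply: contrapT => /cA[r r0 hr].
by have [n [An /hr]] := ultra_ex2 hA (xy r r0).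
Qed.

Lemma ucvg_cont (x : nat -> X) y (f : X -> X) : ucvg x y -> dcontinuous dist f ->
  ucvg (f \o x) (f y).
Proof. by move=> xy cf r /(cf y)[s /xy h hs]; apply: filterS h => n /hs. Qed.

Lemma ucvg_dist_le (x z : nat -> X) y w e : ucvg x y -> ucvg z w ->
  (\forall n \near U, dist (x n) (z n) <= e) -> dist y w <= e.
Proof.
move=> xy zw h; apply/ler_addgt0Pr => r r0.
have r2 : 0 < r / 2 by rewrite divr_gt0.
have [n [h1 h2 h3]] := ultra_ex3 h (xy _ r2) (zw _ r2).
have := dist_tri y (x n) w; have := dist_tri (x n) (z n) w.
by rewrite (distC (z n)); lra.
Qed.

Lemma ucvg_dist_ge (x z : nat -> X) y w e : ucvg x y -> ucvg z w ->
  (\forall n \near U, e <= dist (x n) (z n)) -> e <= dist y w.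
Proof.
move=> xy zw h; apply/ler_addgt0Pr => r r0.
have r2 : 0 < r / 2 by rewrite divr_gt0.
have [n [h1 h2 h3]] := ultra_ex3 h (xy _ r2) (zw _ r2).
have := dist_tri (x n) y (z n); have := dist_tri y w (z n).
by rewrite (distC (x n) y); lra.
Qed.

End UCvg.

Lemma closed_cover (K : set X) (F : nat -> set X) : dclosed K ->
  (forall n, dopen dist (F n)) -> K `<=` \bigcup_n F n ->
  exists N, K `<=` \bigcup_(i in [set i | (i < N)%N]) F i.
Proof.
move=> cK oF KF; apply: contrapT => /forallNP h.
have hx N : exists x, K x /\ forall i, (i < N)%N -> ~ F i x.
  have /existsNP[x /not_implyP[Kx hx]] := h N; exists x; split => // i iN Fx.
  by apply: hx; exists i.
have [x xP] := choice hx.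
have [U [UU Uoo]] := free_ultraT.
have [y xy] := ultra_compact (U := U) x.
have Ky : K y by apply: (ucvg_closed xy cK); apply: nearW => n; case: (xP n).
have [i _ Fy] := KF y Ky.
apply: (ucvg_closed xy (dclosedC (oF i))) Fy.
apply: Uoo; exists i.+1 => // n /= ni; exact: (xP n).2.
Qed.

(** [F' k n] keeps the points of [F n] with more than [1 / k.+1] of room; strictness makes it open.
    Compactness applied to the unions [G k] bounds the index and the radius at the same time. *)
Lemma lebesgue_number (K : set X) (F : nat -> set X) : dclosed K ->
  (forall n, dopen dist (F n)) -> K `<=` \bigcup_n F n ->
  exists N, exists2 r : R, 0 < r & forall x, K x ->
    exists2 i, (i < N)%N & forall y, dist x y < r -> F i y.
Proof.
move=> cK oF KF.
pose F' (k : nat) (n : nat) := [set x | exists2 s : R, k.+1%:R^-1 < s & forall y, dist x y < s -> F n y].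
have oF' k n : dopen dist (F' k n).
  move=> x [s ks hs]; pose t := (s - k.+1%:R^-1) / 2.
  have t0 : 0 < t by rewrite divr_gt0 // subr_gt0.
  exists t => // y xy; exists (s - t); first by rewrite /t; move: ks; set c := (k.+1%:R^-1); lra.
  move=> z yz; apply: hs; have := dist_tri x y z; lra.
pose G k := \bigcup_(n in [set n | (n < k)%N]) F' k n.
have [] := @closed_cover K G cK.
- by move=> k; apply: dopen_bigcup => *; exact: oF'.
- move=> x /KF[n _ Fx]; have [r r0 hr] := oF n x Fx.
  have [k kP] : exists k : nat, k.+1%:R^-1 < r by have [k _ /(_ k (leqnn k)) /= h] := near_infty_natSinv_lt (PosNum r0); exists k.
  exists (maxn k n.+1) => //; exists n => //=; first by rewrite leq_max ltnSn orbT.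
  exists r => //; apply: le_lt_trans kP; rewrite lef_pV2 ?posrE ?ltr0Sn // ler_nat ltnS leq_max.
  by rewrite leqnn.
move=> N hN; exists N, N.+1%:R^-1; first by rewrite invr_gt0 ltr0Sn.
move=> x /hN[k /= kN [n /= nk [s ks hs]]]; exists n; first exact: ltn_trans nk kN.
move=> y xy; apply: hs; apply: lt_trans ks; apply: lt_le_trans xy _.
by rewrite lef_pV2 ?posrE ?ltr0Sn // ler_nat ltnS ltnW.
Qed.

Lemma finite_cover (r : X -> R) : (forall x, 0 < r x) ->
  exists n (c : 'I_n -> X), forall x, exists i, dist (c i) x < r (c i).
Proof.
move=> r0; have [|x|s [hs1 hs2]] := dK (F := [set [set y | dist x y < r x] | x in setT]).
- by move=> _ [x _ <-]; exact: dopen_ball.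
- by exists [set y | dist x y < r x]; [exists x|rewrite /= distxx].
have hx (i : 'I_(size s)) : exists x, nth set0 s i = [set y | dist x y < r x].
  by have [x _ <-] := hs1 i (ltn_ord i); exists x.
have [c cP] := choice hx.
exists (size s), c => x.
have [i si six] := hs2 x; exists (Ordinal si).
by move: six; have /= -> := cP (Ordinal si).
Qed.

End Metric.

(** * Probability measures from finitely additive ones *)

Section MkProbability.
Context {R : realType} {d : measure_display} {T : measurableType d}.
Variable m : set T -> \bar R.
Hypothesis m0 : m set0 = 0%E.
Hypothesis m_ge0 : forall A, (0 <= m A)%E.
Hypothesis m_add : semi_sigma_additive m.
Hypothesis m1 : m setT = 1%E.

(** An alias of [m] that carries the three proofs as arguments, so that the canonical measure
    structures can be attached to it. *)
Definition mk_measure (_ : m set0 = 0%E) (_ : forall A, (0 <= m A)%E)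
  (_ : semi_sigma_additive m) := m.
HB.instance Definition _ := isMeasure.Build d T R (mk_measure m0 m_ge0 m_add) m0 m_ge0 m_add.
HB.instance Definition _ := Measure_isProbability.Build d T R (mk_measure m0 m_ge0 m_add) m1.

Lemma mk_probability : exists P : probability T R, forall A, P A = m A.
Proof. by exists (mk_measure m0 m_ge0 m_add : probability T R). Qed.
End MkProbability.

Section OuterFromFap.
Context {R : realType} {T : Type} (dist : T -> T -> R).
Hypothesis dM : is_metric dist.
Hypothesis dK : dcompact dist.
Variable m : set T -> R.
Hypothesis m_ge0 : forall A, 0 <= m A.
Variable Q : set T -> Prop.
Hypothesis Qopen : forall U, dopen dist U -> Q U.
Hypothesis QC : forall A, Q A -> Q (~` A).
Hypothesis QU : forall A B, Q A -> Q B -> Q (A `|` B).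
Hypothesis mU : forall A B, Q A -> Q B -> A `&` B = set0 -> m (A `|` B) = m A + m B.

Lemma Qclosed K : dclosed dist K -> Q K.
Proof. by move=> cK; rewrite -(setCK K); apply: QC; exact: Qopen. Qed.

Lemma QI A B : Q A -> Q B -> Q (A `&` B).
Proof.
by move=> QA QB; rewrite -(setCK (A `&` B)) setCI; apply: QC; apply: QU; exact: QC.
Qed.

Lemma QD A B : Q A -> Q B -> Q (A `\` B).
Proof. by move=> QA QB; rewrite setDE; apply: QI => //; exact: QC. Qed.

(* A finitely additive [m] is turned into a Borel measure by inner approximation of open
   sets by closed ones, then outer approximation by open sets. *)
Definition lam (U : set T) : \bar R :=
  ereal_sup [set (m K)%:E | K in [set K | dclosed dist K /\ K `<=` U]].

Definition mustar (A : set T) : \bar R :=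
  ereal_inf [set lam U | U in [set U | dopen dist U /\ A `<=` U]].

Lemma fa0 : m set0 = 0.
Proof.
have Q0 : Q set0 by apply: Qopen.
by have := mU Q0 Q0 (setI0 _); rewrite setU0; lra.
Qed.

Lemma fa_mono A B : Q A -> Q B -> A `<=` B -> m A <= m B.
Proof.
move=> QA QB AB; rewrite -(setDUK AB) mU //; [by rewrite lerDl|exact: QD|].
by rewrite setDE setICA setICr setI0.
Qed.

Lemma faU A B : Q A -> Q B -> m (A `|` B) <= m A + m B.
Proof.
move=> QA QB; have -> : A `|` B = A `|` (B `\` A).
  by rewrite setDE setUIr setUCr setIT.
rewrite mU //; [|exact: QD|by rewrite setDE setICA setICr setI0].
by rewrite lerD2l; apply: fa_mono; [exact: QD|by []|move=> x []].
Qed.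

Lemma lam_ge0 U : (0 <= lam U)%E.
Proof.
by apply: ereal_sup_ubound; exists set0; [split => //; exact: dclosed0|rewrite fa0].
Qed.

Lemma lam_ge K U : dclosed dist K -> K `<=` U -> ((m K)%:E <= lam U)%E.
Proof. by move=> cK KU; apply: ereal_sup_ubound; exists K. Qed.

Lemma lam_le U : Q U -> (lam U <= (m U)%:E)%E.
Proof.
move=> QV; apply/ereal_supP => _ [K [cK KU] <-]; rewrite lee_fin; apply: fa_mono => //.
exact: Qclosed.
Qed.

Lemma lam_mono U V : U `<=` V -> (lam U <= lam V)%E.
Proof.
move=> UV; apply/ereal_supP => _ [K [cK KU] <-]; apply: lam_ge => //.
exact: subset_trans UV.
Qed.

(** A Lebesgue number splits a closed set inside the union into finitely many closed pieces, each
    inside one [F i]; finite subadditivity of [m] then suffices. *)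
Lemma lam_subadd (F : nat -> set T) : (forall n, dopen dist (F n)) ->
  (lam (\bigcup_n F n) <= \sum_(i <oo) lam (F i))%E.
Proof.
move=> oF; apply/ereal_supP => _ [K [cK KF] <-].
have [N [r r0 hr]] := lebesgue_number dM dK cK oF KF.
pose Ki i := K `&` [set x | forall y, dist x y < r -> F i y].
have cKi i : dclosed dist (Ki i).
  apply: dclosedI => // x /= /existsNP[y /not_implyP[xy nFy]].
  exists (r - dist x y); first by rewrite subr_gt0.
  move=> z xz; apply/existsNP; exists y; apply/not_implyP; split => //.
  have := dist_tri dM z x y; rewrite (distC dM z x); lra.
have KiF i : Ki i `<=` F i.
  by move=> x [_ /(_ x)]; apply; rewrite distxx.
apply: le_trans (nneseries_lim_ge (m := 0) (P := xpredT) (u_ := fun i => lam (F i)) N _); last first.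
  by move=> *; exact: lam_ge0.
have H : forall k (L : set T), Q L -> L `<=` \bigcup_(i in [set i | (i < k)%N]) Ki i ->
    ((m L)%:E <= \sum_(0 <= i < k) lam (F i))%E.
  elim=> [|k IH] L QL hL.
    rewrite big_nil (_ : L = set0) ?fa0 // -subset0.
    by move=> x /hL[].
  rewrite big_nat_recr //=.
  have LE : L = (L `\` Ki k) `|` (L `&` Ki k) by rewrite setUC setDE -setIUr setUCr setIT.
  rewrite {1}LE; apply: (@le_trans _ _ ((m (L `\` Ki k))%:E + (m (L `&` Ki k))%:E)%E).
    by rewrite lee_fin; apply: faU; [exact/(QD QL)/Qclosed|exact/(QI QL)/Qclosed].
  apply: leeD.
    apply: IH; first exact/(QD QL)/Qclosed.
    move=> x [/hL[i /= ik Kx] nKx]; exists i => //=.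
    by move: ik; rewrite ltnS leq_eqVlt => /orP[/eqP ik|//]; rewrite ik in Kx.
  apply: (@le_trans _ _ (m (Ki k))%:E); last exact: lam_ge.
  by rewrite lee_fin; apply: fa_mono; [exact/(QI QL)/Qclosed|exact: Qclosed|move=> x []].
by apply: H => [|x Kx]; first exact: Qclosed;  have [i iN hi] := hr x Kx; exists i.
Qed.

Lemma mustar_open U : dopen dist U -> mustar U = lam U.
Proof.
move=> oU; apply/eqP; rewrite eq_le; apply/andP; split.
  by apply: ereal_inf_lbound; exists U => //; split.
by apply/ereal_infP => _ [V [_ UV] <-]; exact: lam_mono.
Qed.

Lemma mustar_ge0 A : (0 <= mustar A)%E.
Proof. by apply/ereal_infP => _ [V _ <-]; exact: lam_ge0. Qed.

Lemma mustar_mono A B : A `<=` B -> (mustar A <= mustar B)%E.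
Proof.
move=> AB; apply/ereal_infP => _ [V [oV BV] <-]; apply: ereal_inf_lbound; exists V => //.
by split => //; exact: subset_trans BV.
Qed.

Lemma mustar_le A U : dopen dist U -> A `<=` U -> (mustar A <= lam U)%E.
Proof. by move=> oU AU; apply: ereal_inf_lbound; exists U. Qed.

Lemma mustar_leT A : (mustar A <= (m setT)%:E)%E.
Proof.
apply: le_trans (mustar_le (dopenT dist) (@subsetT _ A)) _.
by apply: lam_le; apply: Qopen; exact: dopenT.
Qed.

Lemma mustar_fin A : mustar A \is a fin_num.
Proof. by rewrite ge0_fin_numE ?mustar_ge0 //; apply: le_lt_trans (mustar_leT A) _; rewrite ltry. Qed.

Lemma mustar_adh A (e : R) : 0 < e ->
  exists2 U, dopen dist U /\ A `<=` U & (lam U < mustar A + e%:E)%E.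
Proof.
move=> e0; have /ereal_inf_lt[_ [U hU <-] h] : (mustar A < mustar A + e%:E)%E.
  by rewrite lteDl ?mustar_fin // lte_fin.
by exists U.
Qed.

Lemma mustar_closed K : dclosed dist K -> ((m K)%:E <= mustar K)%E.
Proof. by move=> cK; apply/ereal_infP => _ [U [_ KU] <-]; exact: lam_ge. Qed.

Lemma mustar0 : mustar set0 = 0%E.
Proof.
apply/eqP; rewrite eq_le mustar_ge0 andbT.
have h : set0 `<=` (set0 : set T) by [].
apply: le_trans (mustar_le (@dopen0 _ _ dist) h) _.
by apply: le_trans (lam_le _) _; rewrite ?fa0 //; exact: Qopen.
Qed.

Lemma mustar_subadd : sigma_subadditive mustar.
Proof.
move=> A; apply/lee_addgt0Pr => e e0.
apply: le_trans (epsilon_trick xpredT (fun n => mustar_ge0 (A n)) (ltW e0)).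
have H n : exists U, [/\ dopen dist U, A n `<=` U & (lam U <= mustar (A n) + (e / (2 ^ n.+1)%:R)%:E)%E].
  have [|U [oU AU] h] := @mustar_adh (A n) (e / (2 ^ n.+1)%:R).
    by rewrite divr_gt0 // ltr0n expn_gt0.
  by exists U; split => //; exact: ltW.
have [U hU] := choice H.
apply: le_trans (mustar_le (U := \bigcup_n U n) _ _) _.
- by apply: dopen_bigcup => n _; have [] := hU n.
- by move=> x [n _ Ax]; exists n => //; have [_ + _] := hU n; apply.
apply: le_trans (lam_subadd _) _; first by move=> n; have [] := hU n.
apply: lee_nneseries => [n _ _|n _]; first exact: lam_ge0.
by have [] := hU n.
Qed.

HB.instance Definition _ := isOuterMeasure.Build R T mustar
  mustar0 mustar_ge0 mustar_mono mustar_subadd.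

(** For open [V], approximate [V] intersected with [U] from inside by a closed [K], then [V] minus
    [K] by a closed [L]. These are disjoint closed subsets of [V], and additivity of [m] on them
    gives the Caratheodory inequality up to the two errors [e / 2]. *)
Lemma mustar_cara U : dopen dist U -> mustar.-caratheodory U.
Proof.
move=> oU; apply: le_caratheodory_measurable => A /=.
apply/ereal_infP => _ [V [oV AV] <-].
have -> : lam V = mustar V by rewrite mustar_open.
apply: (@le_trans _ _ (mustar (V `&` U) + mustar (V `&` ~` U))%E).
  by apply: leeD; apply: mustar_mono => x [/AV].
apply/lee_addgt0Pr => e e0.
have e2 : 0 < e / 2 by rewrite divr_gt0.
rewrite (mustar_open (dopenI oV oU)).
have fl W : dopen dist W -> lam W \is a fin_num by move=> oW; rewrite -mustar_open // mustar_fin.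
have [_ [K [cK KV] <-] hK] := ub_ereal_sup_adherent e2 (fl _ (dopenI oV oU)).
have oVK : dopen dist (V `&` ~` K) by apply: dopenI.
have [_ [L [cL LV] <-] hL] := ub_ereal_sup_adherent e2 (fl _ oVK).
rewrite -/(lam _) in hK hL.
have h1 : (mustar (V `&` ~` U) <= lam (V `&` ~` K))%E.
  by apply: mustar_le => // x [Vx nUx]; split => // /KV[].
have h2 : ((m K)%:E + (m L)%:E <= mustar V)%E.
  rewrite mustar_open // -EFinD -mU; [|exact: Qclosed|exact: Qclosed|].
    apply: lam_ge; first exact: dclosedU.
    by move=> x [/KV[]|/LV[]].
  by rewrite -subset0 => x [Kx /LV[]].
have {}hL : (lam (V `&` ~` K) - (e / 2)%:E < (m L)%:E)%E by [].
have {}hK : (lam (V `&` U) - (e / 2)%:E < (m K)%:E)%E by [].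
move: hK hL h1 h2.
have := fl _ (dopenI oV oU); have := fl _ oVK; have := mustar_fin V; have := mustar_fin (V `&` ~` U).
case: (lam (V `&` U)) => [a| |] //; case: (lam (V `&` ~` K)) => [b| |] //.
case: (mustar V) => [c| |] //; case: (mustar (V `&` ~` U)) => [u| |] // _ _ _ _.
rewrite -!EFinD !lee_fin !lte_fin; lra.
Qed.

Definition mustar_outer : outer_measure R T := mustar.

Lemma mustar_sT : mustar setT = (m setT)%:E.
Proof.
apply/eqP; rewrite eq_le mustar_leT; apply: mustar_closed; exact: dclosedT.
Qed.

Lemma mustar_le_open U : dopen dist U -> (mustar U <= (m U)%:E)%E.
Proof. by move=> oU; rewrite mustar_open //; apply: lam_le; exact: Qopen. Qed.

(** Closed sets are pulled back by [f] for one inequality and by [g] for the other, hence the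
    continuity of both. *)
Lemma mustar_preimage (f g : T -> T) A : cancel f g -> cancel g f ->
  dcontinuous dist f -> dcontinuous dist g ->
  (forall A, Q A -> m (f @^-1` A) = m A) -> mustar (f @^-1` A) = mustar A.
Proof.
move=> fK gK cf cg mf.
have mg K : dclosed dist K -> m (g @^-1` K) = m K.
  move=> cK; rewrite -mf; last by apply: Qclosed; exact: dclosed_preimage.
  by congr m; apply/funext => x; rewrite /preimage /= fK.
have gf B : f @^-1` (g @^-1` B) = B by apply/funext => x; rewrite /preimage /= fK.
have lamf U : lam (f @^-1` U) = lam U.
  apply/eqP; rewrite eq_le; apply/andP; split; apply/ereal_supP => _ [K [cK KU] <-].
    rewrite -mg //; apply: lam_ge; first exact: dclosed_preimage.
    by move=> x /KU /=; rewrite gK.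
  rewrite -mf; last exact: Qclosed.
  apply: lam_ge; first exact: dclosed_preimage.
  by move=> x /KU.
apply/eqP; rewrite eq_le; apply/andP; split; apply/ereal_infP => _ [U [oU AU] <-].
  rewrite -lamf; apply: mustar_le; first exact: dopen_preimage.
  by move=> x /AU.
rewrite -(gf U) lamf.
apply: mustar_le; first exact: dopen_preimage.
by move=> x Ax; apply: AU; rewrite /= gK.
Qed.

End OuterFromFap.

Section Radonize.
Context {R : realType} {dX : measure_display} {X : measurableType dX}.
Variables (dist : X -> X -> R).
Hypothesis dM : is_metric dist.
Hypothesis dK : dcompact dist.
Hypothesis borel : @measurable dX X = <<s dopen dist >>.

Lemma measurable_open U : dopen dist U -> measurable U.
Proof. by move=> oU; rewrite borel; exact: sub_sigma_algebra. Qed.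

Lemma measurable_closed K : dclosed dist K -> measurable K.
Proof. by move=> cK; rewrite -(setCK K); apply: measurableC; exact: measurable_open. Qed.

(** For [m] an ultralimit of probabilities, the two inequalities are those of the portmanteau
    theorem, and they are all that is remembered of [m] besides its invariance. Thus weak limits
    arise without duality with continuous functions. *)
Lemma radonize (m : set X -> R) : (forall A, 0 <= m A) ->
  (forall A B, measurable A -> measurable B -> A `&` B = set0 -> m (A `|` B) = m A + m B) ->
  m setT = 1 ->
  exists P : probability X R,
    [/\ forall U, dopen dist U -> (P U <= (m U)%:E)%E,
        forall K, dclosed dist K -> ((m K)%:E <= P K)%E &
        forall f g : X -> X, cancel f g -> cancel g f ->
          dcontinuous dist f -> dcontinuous dist g ->
          (forall A, measurable A -> m (f @^-1` A) = m A) ->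
          forall A, P (f @^-1` A) = P A].
Proof.
move=> m_ge0 mU m1.
have mC : forall A : set X, measurable A -> measurable (~` A) by move=> A; exact: measurableC.
have mUn : forall A B : set X, measurable A -> measurable B -> measurable (A `|` B) by move=> A B; exact: measurableU.
pose mu : outer_measure R X := mustar_outer dM dK m_ge0 measurable_open mC mUn mU.
have subC : @measurable dX X `<=` mu.-cara.-measurable.
  rewrite borel; apply: smallest_sub; last first.
    by move=> U oU; exact: (mustar_cara dM dK m_ge0 measurable_open mC mUn mU oU).
  have [h1 h2 h3] := sigma_algebra_measurable (caratheodory_type mu).
  by split.
have add : semi_sigma_additive (mustar dist m : set X -> \bar R).
  move=> F family_measurable tF mUF; apply: (@caratheodory_measure_sigma_additive _ _ mu) => //.
  - by move=> i; exact: subC.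
  - exact: subC.
have [|||P PE] := mk_probability _ _ add.
- exact: outer_measure0 mu.
- by move=> A; exact: outer_measure_ge0 mu A.
- by have := mustar_sT m_ge0 measurable_open mC mUn mU; rewrite m1.
exists P; split.
- by move=> U oU; rewrite PE; exact: (mustar_le_open m_ge0 measurable_open mC mUn mU oU).
- by move=> K cK; rewrite PE; apply: mustar_closed.
- by move=> f g fK gK cf cg mf A; rewrite !PE;
  exact: (@mustar_preimage _ _ _ m measurable measurable_open mC f g A fK gK cf cg mf).
Qed.

End Radonize.

(** * Real-valued probabilities: continuity, conditioning and mixtures *)

Section RealProbability.
Context {R : realType} {d : measure_display} {T : measurableType d}.
Implicit Types P Q : probability T R.

Definition pr P (A : set T) : R := fine (P A).

Lemma prE P A : measurable A -> P A = (pr P A)%:E.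
Proof. by move=> mA; rewrite /pr fineK // fin_num_measure. Qed.

Lemma pr_ge0 P A : 0 <= pr P A.
Proof. by rewrite /pr fine_ge0. Qed.

Lemma prT P : pr P setT = 1.
Proof. by rewrite /pr probability_setT. Qed.

Lemma pr0 P : pr P set0 = 0.
Proof. by rewrite /pr measure0. Qed.

Lemma prU P A B : measurable A -> measurable B -> A `&` B = set0 ->
  pr P (A `|` B) = pr P A + pr P B.
Proof.
move=> mA mB AB; apply/EFin_inj; rewrite EFinD -!prE //; last exact: measurableU.
exact: measureU.
Qed.

Lemma pr_mono P A B : measurable A -> measurable B -> A `<=` B -> pr P A <= pr P B.
Proof. by move=> mA mB AB; rewrite -lee_fin -!prE // le_measure ?inE. Qed.

Lemma pr_le1 P A : measurable A -> pr P A <= 1.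
Proof. by move=> mA; rewrite -(prT P) pr_mono. Qed.

Lemma prD P A B : measurable A -> measurable B -> B `<=` A ->
  pr P (A `\` B) = pr P A - pr P B.
Proof.
move=> mA mB BA; have : pr P (B `|` (A `\` B)) = pr P B + pr P (A `\` B).
  apply: prU => //; first exact: measurableD.
  by rewrite setDE setICA setICr setI0.
by rewrite setDUK // => ->; rewrite addrAC subrr add0r.
Qed.

Lemma prC P A : measurable A -> pr P (~` A) = 1 - pr P A.
Proof. by move=> mA; rewrite -setTD prD // prT. Qed.

Lemma prU_le P A B : measurable A -> measurable B -> pr P (A `|` B) <= pr P A + pr P B.
Proof.
move=> mA mB; have -> : A `|` B = A `|` (B `\` A) by rewrite setDE setUIr setUCr setIT.
rewrite prU //; [|exact: measurableD|by rewrite setDE setICA setICr setI0].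
by rewrite lerD2l; apply: pr_mono; [exact: measurableD|exact: mB|move=> x []].
Qed.

Lemma pr_bigU_le P (I : Type) (r : seq I) (F : I -> set T) (A : set T) :
  measurable A -> (forall i, measurable (F i)) ->
  (forall x, A x -> exists2 i, List.In i r & F i x) ->
  pr P A <= \sum_(i <- r) pr P (F i).
Proof.
move=> mA family_measurable; elim: r A mA => [|i r IH] A mA hA.
  rewrite big_nil (_ : A = set0) ?pr0 // -subset0.
  by move=> x /hA[].
rewrite big_cons; apply: (@le_trans _ _ (pr P (F i `|` (A `\` F i)))).
  apply: pr_mono => //; first by apply: measurableU => //; exact: measurableD.
  by move=> x Ax; have [?|?] := pselect (F i x); [left|right].
apply: le_trans (prU_le _ _ _) _ => //; first exact: measurableD.
rewrite lerD2l; apply: IH; first exact: measurableD.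
by move=> x [/hA[j /= [-> //|jr] Fj] _]; exists j.
Qed.

Lemma pr_decr P (F : nat -> set T) (e : R) : (forall n, measurable (F n)) ->
  (forall n, F n.+1 `<=` F n) -> 0 < e ->
  exists n, pr P (F n) < pr P (\bigcap_n F n) + e.
Proof.
move=> family_measurable dF e0.
have mI : measurable (\bigcap_n F n) by exact: bigcapT_measurable.
have h : (P \o F) n @[n --> \oo] --> P (\bigcap_n F n).
  apply: nonincreasing_cvg_mu => //.
    by rewrite -ge0_fin_numE ?measure_ge0 // fin_num_measure.
  by apply/nonincreasing_seqP => n; apply/subsetPset.
have : \forall n \near \oo, (P (F n) < P (\bigcap_n F n) + e%:E)%E.
  move: h; rewrite (prE P mI) => /(_ [set x | (x < (pr P (\bigcap_n F n) + e)%:E)%E]); apply.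
  apply: (@open_nbhs_nbhs _ _ _); split; last by rewrite /= lte_fin ltrDl.
  exact: open_ereal_lt_ereal.
move=> [n _ /(_ n (leqnn n)) /=]; rewrite !prE // -EFinD lte_fin => hn.
by exists n.
Qed.

Lemma pr_incr P (F : nat -> set T) (e : R) : (forall n, measurable (F n)) ->
  (forall n, F n `<=` F n.+1) -> 0 < e ->
  exists n, pr P (\bigcup_n F n) - e < pr P (F n).
Proof.
move=> family_measurable dF e0.
have [|n|n] := @pr_decr P (fun n => ~` F n) e _ _ e0.
- by move=> n; exact: measurableC.
- exact: subsetC.
have mU : measurable (\bigcup_n F n) by exact: bigcupT_measurable.
by rewrite -setC_bigcup !prC // => h; exists n; move: h; lra.
Qed.

Lemma pr_sub_geo P (F : nat -> set T) (e : R) : (forall n, measurable (F n)) -> 0 <= e ->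
  (forall n, pr P (F n) <= e / (2 ^ n.+1)%:R) -> pr P (\bigcup_n F n) <= e.
Proof.
move=> family_measurable e0 h; have mU : measurable (\bigcup_n F n) by exact: bigcupT_measurable.
rewrite -lee_fin -prE //.
have sU : \bigcup_n F n `<=` \bigcup_n F n by [].
have h1 : (P (\bigcup_n F n) <= \sum_(n <oo) P (F n))%E by exact: measure_sigma_subadditive.
apply: le_trans h1 _.
apply: le_trans (epsilon_trick0 xpredT e0).
by apply: lee_nneseries => // n _; rewrite prE // lee_fin.
Qed.

(** Finite additivity together with continuity at the empty set gives countable additivity: the
    tails of a disjoint union decrease to the empty set. *)
Lemma mk_pr (m : set T -> R) : m setT = 1 -> (forall A, measurable A -> 0 <= m A) ->
  (forall A B, measurable A -> measurable B -> A `&` B = set0 -> m (A `|` B) = m A + m B) ->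
  (forall (F : nat -> set T) e, (forall n, measurable (F n)) -> (forall n, F n.+1 `<=` F n) ->
     \bigcap_n F n = set0 -> 0 < e -> exists n, m (F n) < e) ->
  exists P, forall A, measurable A -> pr P A = m A.
Proof.
move=> m1 m_ge0 mU mc.
have m0 : m set0 = 0 by have := mU _ _ measurable0 measurable0 (setI0 _); rewrite setU0; lra.
have mono A B : measurable A -> measurable B -> A `<=` B -> m A <= m B.
  move=> mA mB AB; rewrite -(setDUK AB) mU //; last first.
  - by rewrite setDE setICA setICr setI0.
  - exact: measurableD.
  by rewrite lerDl m_ge0 //; exact: measurableD.
(* [mk_probability] wants a nonnegative function on all sets, so non-measurable sets receive the
   value 0. *)
pose M (A : set T) : \bar R := if `[< measurable A >] then (m A)%:E else 0%E.
have ME A : measurable A -> M A = (m A)%:E by move=> mA; rewrite /M asboolT.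
have add : semi_sigma_additive M.
  move=> F family_measurable tF mUF.
  have fin n : m (\big[setU/set0]_(i < n) F i) = \sum_(i < n) m (F i).
    elim: n => [|n IH]; first by rewrite !big_ord0.
    rewrite !big_ord_recr /= mU ?IH //; first exact: bigsetU_measurable.
    rewrite -bigcup_mkord -subset0 => x [[i /= ni Fi] Fn].
    have ein : i = n by apply: (tF i n Logic.I Logic.I); exists x.
    by move: ni; rewrite ein ltnn.
  rewrite ME //.
  rewrite (_ : (fun n => _) = (fun n => (m (\big[setU/set0]_(i < n) F i))%:E)); last first.
    apply/funext => n; rewrite fin big_mkord -sumEFin; apply: eq_bigr => i _.
    by rewrite ME.
  apply/cvg_EFin; first exact: nearW.
  apply/cvgrPdist_lt => e e0.
  pose B n := \bigcup_(i in [set i | (i < n)%N]) F i.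
  have BE n : \big[setU/set0]_(i < n) F i = B n by rewrite -bigcup_mkord.
  pose G n := (\bigcup_n F n) `\` B n.
  have mB n : measurable (B n) by rewrite -BE; exact: bigsetU_measurable.
  have mG n : measurable (G n) by apply: measurableD.
  have [||n hn] := mc G e mG _ _ e0.
  - move=> n x [Ux nx]; split => // -[i /= ni Fi]; apply: nx; exists i => //=.
    exact: ltnW.
  - rewrite -subset0 => x h; have [[i _ Fi] _] := h 0%N Logic.I.
    by have [_] := h i.+1 Logic.I; apply; exists i => /=.
  exists n => // k /= nk.
  have sub : B k `<=` \bigcup_n F n by move=> x [i _ Fi]; exists i.
  rewrite BE; have -> : m (\bigcup_n F n) - m (B k) = m (G k).
    rewrite -{1}(setDUK sub) mU //; [by rewrite addrAC subrr add0r|exact: mG|].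
    by rewrite setDE setICA setICr setI0.
  rewrite ger0_norm ?m_ge0 //; apply: le_lt_trans hn; apply: mono => //.
  move=> x [Ux nx]; split => // -[i /= ni Fi]; apply: nx; exists i => //=.
  exact: leq_trans nk.
have [|||P PE] := @mk_probability R d T M _ _ add.
- by rewrite ME // m0.
- by move=> A; rewrite /M; case: asboolP => // mA; rewrite lee_fin m_ge0.
- by rewrite ME // m1.
by exists P => A mA; rewrite /pr PE ME.
Qed.

Lemma pr_cond P (A : set T) : measurable A -> 0 < pr P A ->
  exists Q, forall B, measurable B -> pr Q B = pr P (B `&` A) / pr P A.
Proof.
move=> mA A0; apply: mk_pr.
- by rewrite setTI divff // gt_eqF.
- by move=> B mB; rewrite divr_ge0 ?pr_ge0.
- move=> B C mB mC BC; rewrite setIUl prU //; [by rewrite mulrDl|exact: measurableI|exact: measurableI|].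
  by rewrite setIACA BC set0I.
- move=> F e family_measurable dF F0 e0.
  have [| | |n h] := @pr_decr P (fun n => F n `&` A) (e * pr P A).
  + by move=> n; exact: measurableI.
  + by move=> n; exact: setSI.
  + by rewrite mulr_gt0.
  exists n; rewrite ltr_pdivrMr //; move: h.
  have -> : \bigcap_n (F n `&` A) = set0 by rewrite -subset0 => x hx; rewrite -F0 => k _; have [] := hx k Logic.I.
  by rewrite pr0 add0r.
Qed.

Lemma pr_mix P Q (t : R) : 0 <= t <= 1 ->
  exists S : probability T R, forall B, measurable B -> pr S B = t * pr P B + (1 - t) * pr Q B.
Proof.
move=> /andP[t0 t1]; have t1' : 0 <= 1 - t by rewrite subr_ge0.
apply: mk_pr.
- by rewrite !prT; lra.
- by move=> A mA; rewrite addr_ge0 ?mulr_ge0 ?pr_ge0.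
- by move=> A B mA mB AB; rewrite !prU //; lra.
- move=> F e family_measurable dF F0 e0.
  have e2 : 0 < e / 2 by rewrite divr_gt0.
  have [n hn] := pr_decr P family_measurable dF e2; have [k hk] := pr_decr Q family_measurable dF e2.
  have dec i j : F (i + j)%N `<=` F i.
    by elim: j => [|j IH]; rewrite ?addn0 // addnS; exact: subset_trans (dF _) IH.
  exists (n + k)%N; move: hn hk; rewrite F0 !pr0 !add0r => hn hk.
  have h1 : pr P (F (n + k)%N) < e / 2 by apply: le_lt_trans hn; apply: pr_mono.
  have h2 : pr Q (F (n + k)%N) < e / 2 by apply: le_lt_trans hk; apply: pr_mono; rewrite // addnC.
  have := pr_ge0 P (F (n + k)%N); have := pr_ge0 Q (F (n + k)%N); nra.
Qed.

End RealProbability.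

(** * Inner regularity of Borel probabilities by closed sets *)

Section Regularity.
Context {R : realType} {dX : measure_display} {X : measurableType dX}.
Variables (dist : X -> X -> R).
Hypothesis dM : is_metric dist.
Hypothesis borel : @measurable dX X = <<s dopen dist >>.

Definition inner_closed (U : set X) k := [set x | forall y, ~ U y -> k.+1%:R^-1 <= dist x y].

Lemma inner_closed_closed (U : set X) k : dclosed dist (inner_closed U k).
Proof.
move=> x /= /existsNP[y /not_implyP[nU /negP]]; rewrite -ltNge => h.
exists (k.+1%:R^-1 - dist x y); first by rewrite subr_gt0.
move=> z xz; apply/existsNP; exists y; apply/not_implyP; split => //.
apply/negP; rewrite -ltNge; have := dist_tri dM z x y; rewrite (distC dM z x).
move: xz; set c := (_^-1); lra.
Qed.

Lemma inner_closed_sub U k : inner_closed U k `<=` U.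
Proof.
move=> x h; apply: contrapT => nU; have := h x nU; rewrite distxx //.
by rewrite leNgt invr_gt0 ltr0Sn.
Qed.

Lemma inner_closed_mono U k : inner_closed U k `<=` inner_closed U k.+1.
Proof.
move=> x h y /h; apply: le_trans; rewrite lef_pV2 ?posrE ?ltr0Sn //.
by rewrite ler_nat.
Qed.

Lemma inner_closed_cover U : dopen dist U -> \bigcup_k inner_closed U k = U.
Proof.
move=> oU; apply/seteqP; split => [x [k _ /inner_closed_sub]//|x Ux].
have [r r0 hr] := oU x Ux.
have [k _ /(_ k (leqnn k)) /= hk] := near_infty_natSinv_lt (PosNum r0).
exists k => // y nU; rewrite leNgt; apply/negP => h; apply: nU; apply: hr.
exact: lt_trans h hk.
Qed.

(** The sets that are inner regular together with their complement form a sigma-algebra, and open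
    sets belong to it because they are exhausted by the closed sets [inner_closed U k]. *)
Lemma regular (P : probability X R) (A : set X) (e : R) : measurable A -> 0 < e ->
  exists K, [/\ dclosed dist K, K `<=` A & pr P (A `\` K) < e].
Proof.
pose reg A := forall e : R, 0 < e -> exists K, [/\ dclosed dist K, K `<=` A & pr P (A `\` K) < e].
pose Rg := [set A | [/\ measurable A, reg A & reg (~` A)]].
have mcl := measurable_closed borel.
suff : <<s dopen dist >> `<=` Rg.
  move=> h mA e0; have [|_ + _] := h A; first by rewrite -borel.
  exact.
apply: smallest_sub; last first.
  move=> U oU; split; first exact: (measurable_open borel).
    move=> {}e e0.
    have [||n] := @pr_incr _ _ _ P (inner_closed U) e _ _ e0.
    - by move=> n; apply/mcl/inner_closed_closed.
    - exact: inner_closed_mono.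
    rewrite inner_closed_cover // => h; exists (inner_closed U n); split.
    - exact: inner_closed_closed.
    - exact: inner_closed_sub.
    rewrite prD; [by move: h; lra|exact: (measurable_open borel)| |exact: inner_closed_sub].
    exact/mcl/inner_closed_closed.
  move=> {}e e0; exists (~` U); split => //; first exact: dclosedC.
  by rewrite setDv pr0.
split.
- split => //; move=> {}e e0.
    by exists set0; split; [exact: dclosed0|by []|rewrite set0D pr0].
  by exists setT; split; rewrite ?setC0 //; [exact: dclosedT|rewrite setDv pr0].
- by move=> B [mB h1 h2]; rewrite setTD; split; rewrite ?setCK //; exact: measurableC.
move=> F hF.
have family_measurable n : measurable (F n) by have [] := hF n.
have mU : measurable (\bigcup_n F n) by exact: bigcupT_measurable.
have gp (e1 : R) n : 0 < e1 -> 0 < e1 / (2 ^ n.+1)%:R by move=> ?; rewrite divr_gt0 // ltr0n expn_gt0.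
split => // {}e e0.
  have e2 : 0 < e / 2 by rewrite divr_gt0.
  have /choice[K hK] : forall n, exists K : set X,
      [/\ dclosed dist K, K `<=` F n & pr P (F n `\` K) < e / 2 / (2 ^ n.+1)%:R].
    move=> n; have [_ h _] := hF n; apply: h; exact: gp.
  have cK n : dclosed dist (K n) by have [] := hK n.
  have mK n : measurable (K n) by exact: mcl.
  (* A countable union of closed sets need not be closed, so it is truncated to a finite one at the
     price of the second [e / 2]. *)
  pose L n := \big[setU/set0]_(i < n) K i.
  have cL n : dclosed dist (L n).
    by rewrite /L; elim/big_ind: _ => //; [exact: dclosed0|move=> *; exact: dclosedU].
  have LP n x : L n x <-> exists2 i, (i < n)%N & K i x.
    by rewrite /L -bigcup_mkord; split => -[i]; exists i.
  have [||n hn] := @pr_incr _ _ _ P L (e / 2) _ _ e2.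
  - by move=> n; exact: mcl.
  - by move=> n x /LP[i ni Ki]; apply/LP; exists i => //; exact: ltnW.
  have LU : L n `<=` \bigcup_n F n by move=> x /LP[i _ Ki]; exists i => //; have [_ + _] := hK i; apply.
  exists (L n); split => //.
  have mLU : measurable (\bigcup_n L n) by apply: bigcupT_measurable => k; exact: mcl.
  have LLU : \bigcup_n L n `<=` \bigcup_n F n by move=> x [k _ /LP[i _ Ki]]; exists i => //; have [_ + _] := hK i; apply.
  rewrite prD //; last exact: mcl.
  have : pr P (\bigcup_n F n `\` \bigcup_n L n) <= e / 2.
    apply: (@le_trans _ _ (pr P (\bigcup_n (F n `\` K n)))).
      apply: pr_mono; [exact: measurableD|by apply: bigcupT_measurable => k; exact: measurableD|].
      move=> x [[i _ Fi] nL]; exists i => //; split => // Ki; apply: nL.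
      by exists i.+1 => //; apply/LP; exists i.
    apply: pr_sub_geo; [by move=> k; exact: measurableD|exact: ltW|].
    by move=> k; have [_ _ /ltW] := hK k.
  by rewrite prD //; move: hn; lra.
have e2 : 0 < e / 2 by rewrite divr_gt0.
have /choice[K hK] : forall n, exists K : set X,
    [/\ dclosed dist K, K `<=` ~` F n & pr P (~` F n `\` K) < e / 2 / (2 ^ n.+1)%:R].
  move=> n; have [_ _ h] := hF n; apply: h; exact: gp.
have cK n : dclosed dist (K n) by have [] := hK n.
exists (\bigcap_n K n); split.
- by apply: dclosed_bigcap => n _.
- by rewrite setC_bigcup => x h k _; have [_ + _] := hK k; apply; exact: h.
have mK : measurable (\bigcap_n K n) by apply: bigcapT_measurable => k; exact: mcl.
apply: (@le_lt_trans _ _ (e / 2)); last by lra.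
apply: (@le_trans _ _ (pr P (\bigcup_n (~` F n `\` K n)))).
  apply: pr_mono.
  - by apply: measurableD => //; exact: measurableC.
  - by apply: bigcupT_measurable => k; apply: measurableD; [exact: measurableC|exact: mcl].
  rewrite setC_bigcup => x [nF /existsNP[i /not_implyP[_ nK]]]; exists i => //; split => //.
  exact: nF.
apply: pr_sub_geo; [|exact: ltW|by move=> k; have [_ _ /ltW] := hK k].
by move=> k; apply: measurableD; [exact: measurableC|exact: mcl].
Qed.

End Regularity.

(** * Codes and entropy rates *)

Lemma nat_ub (R : realType) (x : R) : exists N : nat, x <= N%:R.
Proof.
exists (Num.bound `|x|); apply: ltW; apply: le_lt_trans (ler_norm _) _.
by apply: archi_boundP; exact: normr_ge0.
Qed.

Section Codes.
Context {R : realType} {d : measure_display} {T : measurableType d}.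

(** Entropy needs finite additivity only, so the same lemmas serve probabilities and the weighted
    empirical distributions [emp], which are never made into measures. *)
Record fap (m : set T -> R) : Prop := Fap {
  fapT : m setT = 1;
  fap_ge0 : forall A, measurable A -> 0 <= m A;
  fapU : forall A B, measurable A -> measurable B -> A `&` B = set0 ->
           m (A `|` B) = m A + m B }.

(* Finite measurable partitions are encoded as measurable maps to a finite type. *)
Definition mcode (C : finType) (a : T -> C) := forall t, measurable (a @^-1` [set t]).

Definition word (f : T -> T) (C : finType) (a : T -> C) (n : nat) (x : T)
  : {ffun 'I_n -> C} := [ffun i : 'I_n => a (iter i f x)].

Definition H (m : set T -> R) (C : finType) (a : T -> C) : R :=
  - \sum_t xlogx (m (a @^-1` [set t])).

Lemma pr_fap (P : probability T R) : fap (pr P).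
Proof. by split => [|A _|A B mA mB AB]; [exact: prT|exact: pr_ge0|exact: prU]. Qed.

Section Fap.
Variable m : set T -> R.
Hypothesis mm : fap m.

Lemma fap0 : m set0 = 0.
Proof. have := fapU mm measurable0 measurable0 (setI0 _); rewrite setU0; lra. Qed.

Lemma fap_mono A B : measurable A -> measurable B -> A `<=` B -> m A <= m B.
Proof.
move=> mA mB AB; rewrite -(setDUK AB) fapU //.
- by rewrite lerDl fap_ge0 //; exact: measurableD.
- exact: measurableD.
- by rewrite setDE setICA setICr setI0.
Qed.

Lemma fap_bigU (C : finType) (a : T -> C) (P : pred C) : mcode a ->
  m (a @^-1` [set t | P t]) = \sum_(t | P t) m (a @^-1` [set t]).
Proof.
move=> ma; have H0 : forall r : seq C, uniq r ->
    measurable (a @^-1` [set t | t \in r]) /\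
    m (a @^-1` [set t | t \in r]) = \sum_(t <- r) m (a @^-1` [set t]).
  elim=> [_|t r IH /= /andP[tr ur]].
    by rewrite big_nil (_ : a @^-1` _ = set0) ?fap0 // -subset0.
  have [mr er] := IH ur.
  have E : a @^-1` [set u | u \in t :: r] = a @^-1` [set t] `|` a @^-1` [set u | u \in r].
    apply/seteqP; split => x /=; rewrite inE; first by case/orP => [/eqP ->|?]; [left|right].
    by case=> [->|->]; rewrite ?eqxx ?orbT.
  rewrite E big_cons fapU ?er //; first by split => //; exact: measurableU.
  by rewrite -subset0 => x [/= -> h]; rewrite h in tr.
have [_ e] := H0 (enum P) (enum_uniq _).
rewrite -big_enum -e; congr m; apply/seteqP; split => x /=; by rewrite mem_enum.
Qed.

End Fap.

Lemma mcode_set (C : finType) (a : T -> C) (P : pred C) : mcode a ->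
  measurable (a @^-1` [set t | P t]).
Proof.
move=> ma; rewrite (_ : _ @^-1` _ = \bigcup_(t in [set t | P t]) (a @^-1` [set t])).
  by apply: fin_bigcup_measurable => // t _; exact: ma.
by apply/seteqP; split => [x Px|x [t Pt /= ->]//]; exists (a x).
Qed.

Lemma mcode_comp (C D : finType) (a : T -> C) (g : C -> D) : mcode a -> mcode (g \o a).
Proof.
move=> ma t; rewrite (_ : _ @^-1` _ = a @^-1` [set u | g u == t]); first exact: mcode_set.
by apply/seteqP; split => x /= => [->|/eqP].
Qed.

Lemma mcode_ffun (I : finType) (C : finType) (a : I -> T -> C) :
  (forall i, mcode (a i)) -> mcode (fun x => [ffun i => a i x]).
Proof.
move=> ma t.
rewrite (_ : _ @^-1` _ = \bigcap_(i in [set: I]) (a i @^-1` [set t i])).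
  by apply: fin_bigcap_measurable => // i _; exact: ma.
apply/seteqP; split => x /=.
  by move=> <- i _; rewrite /= ffunE.
by move=> h; apply/ffunP => i; rewrite ffunE; exact: h.
Qed.

Lemma mcode_pair (C D : finType) (a : T -> C) (b : T -> D) : mcode a -> mcode b ->
  mcode (fun x => (a x, b x)).
Proof.
move=> ma mb [t u]; rewrite (_ : _ @^-1` _ = a @^-1` [set t] `&` b @^-1` [set u]).
  exact: measurableI.
by apply/seteqP; split => x /= [-> ->].
Qed.

Definition jd (m : set T -> R) (C : finType) (a : T -> C) (t : C) := m (a @^-1` [set t]).

Section FapEntropy.
Variable m : set T -> R.
Hypothesis mm : fap m.

Lemma jd_ge0 (C : finType) (a : T -> C) : mcode a -> forall t, 0 <= jd m a t.
Proof. by move=> ma t; apply: fap_ge0 => //; exact: ma. Qed.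

Lemma jd_sum (C : finType) (a : T -> C) : mcode a -> \sum_t jd m a t = 1.
Proof.
move=> ma; rewrite -(fap_bigU mm xpredT ma) -(fapT mm); congr m.
by apply/seteqP; split.
Qed.

Lemma jd_pm (C D : finType) (a : T -> C) (g : C -> D) : mcode a ->
  forall t, pm (jd m a) g t = jd m (g \o a) t.
Proof.
move=> ma t; rewrite /pm /jd -(fap_bigU mm _ ma); congr m.
by apply/seteqP; split => x /= => [/eqP|->].
Qed.

Lemma H_ent (C D : finType) (a : T -> C) (g : C -> D) : mcode a ->
  H m (g \o a) = ent (jd m a) g.
Proof.
move=> ma; rewrite /H /ent; congr (- _); apply: eq_bigr => t _.
by rewrite jd_pm.
Qed.

Lemma H_self (C : finType) (a : T -> C) : H m a = ent (jd m a) id.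
Proof.
rewrite /H /ent; congr (- _); apply: eq_bigr => t _.
by rewrite /pm big_pred1_eq.
Qed.

Lemma H_ge0 (C : finType) (a : T -> C) : mcode a -> 0 <= H m a.
Proof. by move=> ma; rewrite H_self ent_ge0 //; [exact: jd_ge0|exact: jd_sum]. Qed.

Lemma H_ln_card (C : finType) (a : T -> C) : mcode a -> H m a <= ln #|C|%:R.
Proof. by move=> ma; rewrite H_self ent_ln_card //; [exact: jd_ge0|exact: jd_sum]. Qed.

Lemma H_le (C D : finType) (a : T -> C) (b : T -> D) : mcode a -> mcode b ->
  (forall x y, b x = b y -> a x = a y) -> H m a <= H m b.
Proof.
move=> ma mb h; have mc := mcode_pair ma mb.
have -> : a = fst \o (fun x => (a x, b x)) by [].
have {2}-> : b = snd \o (fun x => (a x, b x)) by [].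
have [[x0 _]|n0] := pselect (exists x : T, True); last first.
  rewrite !H_ent // !entE !big1 // => s _; have -> : jd m (fun x => (a x, b x)) s = 0; rewrite ?mul0r //;
  by rewrite /jd (_ : _ @^-1` _ = set0) ?fap0 // -subset0 => x; case: n0; exists x.
(* The hypothesis speaks of points of [T], not of all values of the joint code, so [ent_le] does not
   apply directly; values that are not attained have mass zero and drop out. *)
have key u : 0 < jd m (fun x => (a x, b x)) u -> exists x, u = (a x, b x).
  move=> h0; apply: contrapT => /forallNP hn; move: h0.
  rewrite /jd (_ : _ @^-1` _ = set0) ?fap0 ?ltxx // -subset0 => x /= e.
  by apply: (hn x); rewrite e.
rewrite !H_ent // !entE lerN2; apply: ler_sum => s _.
have := jd_ge0 mc s; rewrite le_eqVlt => /orP[/eqP <-|ps]; first by rewrite !mul0r.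
have p0 := jd_ge0 mc.
rewrite ler_pM2l // ler_ln ?posrE ?pm_gt0 //.
rewrite !jd_pm //; apply: fap_mono => //.
by have [x ->] := key _ ps; move=> y /= /h ->.
Qed.

Lemma H_pair (C D : finType) (a : T -> C) (b : T -> D) : mcode a -> mcode b ->
  H m (fun x => (a x, b x)) <= H m a + H m b.
Proof.
move=> ma mb; have mc := mcode_pair ma mb.
have -> : H m a = ent (jd m (fun x => (a x, b x))) fst by rewrite -H_ent.
have -> : H m b = ent (jd m (fun x => (a x, b x))) snd by rewrite -H_ent.
rewrite H_self.
apply: le_trans (ent_pair (jd_ge0 mc) (jd_sum mc) fst snd).
by apply: ent_le; [exact: jd_ge0|move=> [? ?] [? ?] [-> ->]].
Qed.

End FapEntropy.

Section Invariant.
Variables (f : T -> T) (m : set T -> R).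
Hypothesis mm : fap m.
Hypothesis fm : forall A, measurable A -> measurable (f @^-1` A).
Hypothesis minv : forall A, measurable A -> m (f @^-1` A) = m A.

Lemma iter_preimage k A : iter k.+1 f @^-1` A = f @^-1` (iter k f @^-1` A).
Proof. by apply/funext => x; rewrite /preimage /mkset iterSr. Qed.

Lemma measurable_iter k A : measurable A -> measurable (iter k f @^-1` A).
Proof. by move=> mA; elim: k => [//|k IH]; rewrite iter_preimage; exact: fm. Qed.

Lemma fap_iter k A : measurable A -> m (iter k f @^-1` A) = m A.
Proof.
move=> mA; elim: k => [//|k <-]; rewrite -(minv (measurable_iter k mA)).
by rewrite iter_preimage.
Qed.

Lemma mcode_iter k (C : finType) (a : T -> C) : mcode a -> mcode (a \o iter k f).
Proof. by move=> ma t; exact: (measurable_iter k (ma t)). Qed.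

Lemma mcode_word (C : finType) (a : T -> C) n : mcode a -> mcode (word f a n).
Proof. by move=> ma; apply: mcode_ffun => i; exact: mcode_iter. Qed.

Lemma H_iter k (C : finType) (a : T -> C) : mcode a -> H m (a \o iter k f) = H m a.
Proof.
move=> ma; rewrite /H; congr (- _); apply: eq_bigr => t _; congr xlogx.
exact: (fap_iter k (ma t)).
Qed.

Lemma H_word_add (C : finType) (a : T -> C) k l : mcode a ->
  H m (word f a (k + l)) <= H m (word f a k) + H m (word f a l).
Proof.
move=> ma; rewrite -(H_iter k (mcode_word (n := l) ma)).
have mk := mcode_word (n := k) ma; have ml := mcode_iter k (mcode_word (n := l) ma).
apply: le_trans (H_pair mm mk ml); apply: H_le => //; first exact: mcode_word.
  exact: mcode_pair.
move=> x y [e1 e2]; apply/ffunP => i; rewrite !ffunE.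
have [ik|ki] := ltnP i k; first by have /ffunP/(_ (Ordinal ik)) := e1; rewrite !ffunE.
have il : (i - k < l)%N by rewrite ltn_subLR.
have /ffunP/(_ (Ordinal il)) := e2; rewrite !ffunE /= -!iterD subnK //.
Qed.

Lemma H_word_mul (C : finType) (a : T -> C) q k r : mcode a ->
  H m (word f a (k * q + r)) <= k%:R * H m (word f a q) + r%:R * ln #|C|%:R.
Proof.
move=> ma; have h1 : H m (word f a r) <= r%:R * ln #|C|%:R.
  elim: r => [|r IH].
    rewrite mul0r; apply: le_trans (H_ln_card mm (mcode_word (n := 0) ma)) _.
    by rewrite card_ffun card_ord expn0 ln1.
  rewrite -addn1; apply: le_trans (H_word_add _ _ ma) _.
  rewrite natrD mulrDl mul1r; apply: lerD => //.
  apply: le_trans (H_ln_card mm (mcode_word (n := 1) ma)) _.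
  by rewrite card_ffun card_ord expn1.
elim: k => [|k IH]; first by rewrite mul0n mul0r !add0r.
rewrite mulSn -addnA; apply: le_trans (H_word_add _ _ ma) _.
rewrite -[k.+1]addn1 natrD mulrDl mul1r; lra.
Qed.

(* By subadditivity of [n |-> H (word a n)] this infimum is the limit. *)
Definition hh (C : finType) (a : T -> C) : R :=
  inf [set H m (word f a n.+1) / n.+1%:R | n in [set: nat]].

Lemma hh_has_inf (C : finType) (a : T -> C) : mcode a ->
  has_inf [set H m (word f a n.+1) / n.+1%:R | n in [set: nat]].
Proof.
move=> ma; split; first by exists (H m (word f a 1) / 1%:R), 0%N.
by exists 0 => _ [n _ <-]; rewrite divr_ge0 // H_ge0 //; exact: mcode_word.
Qed.

Lemma hh_le (C : finType) (a : T -> C) n : mcode a -> (0 < n)%N ->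
  hh a <= H m (word f a n) / n%:R.
Proof.
move=> ma n0; apply: inf_lbound; first by have [] := hh_has_inf ma.
by exists n.-1 => //; rewrite prednK.
Qed.

Lemma hh_ge (C : finType) (a : T -> C) c : mcode a ->
  (forall n, (0 < n)%N -> c <= H m (word f a n) / n%:R) -> c <= hh a.
Proof.
move=> ma h; apply: lb_le_inf; first by have [] := hh_has_inf ma.
by move=> _ [n _ <-]; exact: h.
Qed.

Lemma hh_adh (C : finType) (a : T -> C) (e : R) : mcode a -> 0 < e ->
  exists2 n, (0 < n)%N & H m (word f a n) / n%:R < hh a + e.
Proof.
move=> ma e0; have [_ [n _ <-] h] := inf_adherent e0 (hh_has_inf ma).
by exists n.+1.
Qed.

Lemma hh_ge0 (C : finType) (a : T -> C) : mcode a -> 0 <= hh a.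
Proof.
move=> ma; apply: hh_ge => // n n0.
by rewrite divr_ge0 // H_ge0 //; exact: mcode_word.
Qed.

Lemma hh_ln_card (C : finType) (a : T -> C) : mcode a -> hh a <= ln #|C|%:R.
Proof.
move=> ma; apply: le_trans (hh_le ma (ltnSn 0)) _; rewrite divr1.
apply: le_trans (H_ln_card mm (mcode_word (n := 1) ma)) _.
by rewrite card_ffun card_ord expn1.
Qed.

Lemma hh_mono (C D : finType) (a : T -> C) (b : T -> D) : mcode a -> mcode b ->
  (forall x y, b x = b y -> a x = a y) -> hh a <= hh b.
Proof.
move=> ma mb h; apply: hh_ge => // n n0; apply: le_trans (hh_le ma n0) _.
rewrite ler_pM2r ?invr_gt0 ?ltr0n //; apply: H_le => //; [exact: mcode_word|exact: mcode_word|].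
move=> x y /ffunP e; apply/ffunP => i; have := e i; rewrite !ffunE; exact: h.
Qed.

Lemma hh_fekete (C : finType) (a : T -> C) (e : R) : mcode a -> 0 < e ->
  exists N, forall n, (N <= n)%N -> H m (word f a n) / n%:R <= hh a + e.
Proof.
move=> ma e0; have e2 : 0 < e / 2 by rewrite divr_gt0.
have [q q0 hq] := hh_adh ma e2.
pose c := q%:R * ln #|C|%:R : R.
have [N hN] : exists N : nat, c / (e / 2) <= N%:R.
  exact: nat_ub.
exists N.+1 => n Nn; have n0 : 0 < n%:R :> R by rewrite ltr0n; exact: leq_ltn_trans Nn.
have hw := H_word_mul q (n %/ q) (n %% q) ma; rewrite -divn_eq in hw.
rewrite ler_pdivrMr //; apply: le_trans hw _.
have C1 : 0 <= ln #|C|%:R :> R.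
  have [->|Cn] := posnP #|C|; first by rewrite ln0.
  by rewrite ln_ge0 // ler1n.
have h1 : (n %% q)%:R * ln #|C|%:R <= n%:R * (e / 2).
  apply: (@le_trans _ _ c); first by rewrite ler_wpM2r // ler_nat ltnW // ltn_mod.
  rewrite -ler_pdivrMr // (le_trans hN) // ler_nat; exact: ltnW.
have h2 : (n %/ q)%:R * H m (word f a q) <= n%:R * (hh a + e / 2).
  apply: (@le_trans _ _ ((n %/ q)%:R * (q%:R * (hh a + e / 2)))).
    by rewrite ler_wpM2l // mulrC -ler_pdivrMr ?ltr0n // ltW.
  rewrite mulrA -natrM ler_wpM2r ?ler_nat ?leq_divM //.
  by rewrite addr_ge0 ?hh_ge0 // ltW.
apply: le_trans (lerD h2 h1) _; rewrite -mulrDr mulrC ler_wpM2r ?(ltW n0) //; lra.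
Qed.

End Invariant.

Section Mixture.
Variables (f : T -> T).
Hypothesis fm : forall A, measurable A -> measurable (f @^-1` A).

Lemma xlogx_mix (t x y : R) : 0 <= t <= 1 -> 0 <= x -> 0 <= y ->
  t * xlogx x + (1 - t) * xlogx y + x * xlogx t + y * xlogx (1 - t) <=
  xlogx (t * x + (1 - t) * y).
Proof.
move=> /andP[t0 t1] x0 y0.
have h (s z w : R) : 0 <= s -> 0 <= z -> s * z <= w -> s * xlogx z + z * xlogx s <= s * z * ln w.
  move=> s0 z0 hw; rewrite !xlogxE.
  have [->|sn0] := eqVneq s 0; first by rewrite !mul0r mulr0 addr0.
  have [->|zn0] := eqVneq z 0; first by rewrite !mulr0 !mul0r mulr0 addr0.
  have sp : 0 < s by rewrite lt_def sn0.
  have zp : 0 < z by rewrite lt_def zn0.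
  rewrite mulrCA [z * (s * _)]mulrA [z * s]mulrC mulrA [z * s]mulrC -mulrDr ler_pM2l ?mulr_gt0 //.
  rewrite addrC -lnM ?posrE // ler_ln ?posrE ?mulr_gt0 //.
  by apply: lt_le_trans hw; rewrite mulr_gt0.
have t1' : 0 <= 1 - t by rewrite subr_ge0.
have h1 := h t x (t * x + (1 - t) * y) t0 x0.
have h2 := h (1 - t) y (t * x + (1 - t) * y) t1' y0.
have {h1} := h1 _; rewrite lerDl mulr_ge0 // => /(_ erefl) h1.
have {h2} := h2 _; rewrite lerDr mulr_ge0 // => /(_ erefl) h2.
rewrite [leRHS]xlogxE mulrDl; lra.
Qed.

(** The entropy of a mixture exceeds the mixture of the entropies by at most [K], the entropy of the
    coin choosing the component; divided by the word length it disappears. The reverse inequality is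
    [hh_concave]. *)
Lemma hh_mix (m1 m2 m : set T -> R) (t : R) (C : finType) (a : T -> C) : fap m1 -> fap m2 -> fap m ->
  (forall A, measurable A -> m1 (f @^-1` A) = m1 A) ->
  (forall A, measurable A -> m2 (f @^-1` A) = m2 A) ->
  (forall A, measurable A -> m (f @^-1` A) = m A) ->
  0 <= t <= 1 ->
  (forall A, measurable A -> m A = t * m1 A + (1 - t) * m2 A) -> mcode a ->
  hh f m a <= t * hh f m1 a + (1 - t) * hh f m2 a.
Proof.
move=> f1 f2 f0 i1 i2 i0 t01 mE ma.
have /andP[t0 t1] := t01; have t1' : 0 <= 1 - t by rewrite subr_ge0.
pose K := - xlogx t - xlogx (1 - t).
have key n : H m (word f a n) <= t * H m1 (word f a n) + (1 - t) * H m2 (word f a n) + K.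
  have mw := mcode_word fm (n := n) ma.
  have s1 := jd_sum f1 mw; have s2 := jd_sum f2 mw.
  have g1 := jd_ge0 f1 mw; have g2 := jd_ge0 f2 mw.
  have : \sum_s (t * xlogx (jd m1 (word f a n) s) + (1 - t) * xlogx (jd m2 (word f a n) s)
     + jd m1 (word f a n) s * xlogx t + jd m2 (word f a n) s * xlogx (1 - t)) <=
     \sum_s xlogx (jd m (word f a n) s).
    apply: ler_sum => s _; rewrite /jd mE; last exact: mw.
    exact: (xlogx_mix t01 (g1 s) (g2 s)).
  rewrite !big_split /= -!mulr_sumr -!mulr_suml s1 s2 /H -/(jd _ _ _) /K /jd; lra.
apply/ler_addgt0Pr => e e0; have e2 : 0 < e / 4 by rewrite divr_gt0.
have [N1 h1] := hh_fekete f1 fm i1 ma e2.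
have [N2 h2] := hh_fekete f2 fm i2 ma e2.
have [N3 h3] : exists N : nat, K / (e / 4) <= N%:R.
  exact: nat_ub.
pose n := (N1 + N2 + N3).+1.
have n0 : 0 < n%:R :> R by rewrite ltr0n.
apply: le_trans (hh_le f0 fm ma (ltn0Sn (N1 + N2 + N3))) _; rewrite -/n.
have {}h1 := h1 n _; have {}h2 := h2 n _.
have /h1 {}h1 : (N1 <= n)%N by rewrite /n ltnW // ltnS -addnA leq_addr.
have /h2 {}h2 : (N2 <= n)%N by rewrite /n ltnW // ltnS addnAC leq_addl.
have {}h3 : K / n%:R <= e / 4.
  rewrite ler_pdivrMr // mulrC -ler_pdivrMr // (le_trans h3) // ler_nat /n ltnW // ltnS leq_addl //.
apply: (@le_trans _ _ (t * (H m1 (word f a n) / n%:R) + (1 - t) * (H m2 (word f a n) / n%:R) + K / n%:R)).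
  by rewrite !mulrA -!mulrDl ler_pM2r ?invr_gt0.
have := ler_wpM2l t0 h1; have := ler_wpM2l t1' h2; lra.
Qed.

End Mixture.
End Codes.

(** * Partitions given by lists of sets, read as codes *)

Section Partitions.
Context {R : realType} {d : measure_display} {T : measurableType d}.
Variables (f : T -> T).

Definition code_partition (C : finType) (a : T -> C) : seq (set T) :=
  [seq a @^-1` [set t] | t <- enum C].

(** The two enumerations of cells are compared only through sums of an arbitrary [F], which is all
    that [Hpart] sees and spares matching their orders. The general [F] also makes the induction go
    through. *)
Lemma prefine_sum (F : set T -> R) (C : finType) (a : T -> C) n :
  \sum_(A <- prefine f (code_partition a) n) F A =
  \sum_(w : {ffun 'I_n -> C}) F (word f a n @^-1` [set w]).
Proof.
elim: n F => [|n IH] F.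
  have e0 (v w : {ffun 'I_0 -> C}) : v = w by apply/ffunP => -[].
  pose w0 : {ffun 'I_0 -> C} := [ffun i : 'I_0 => False_rect C (notF (ltn_ord i))].
  rewrite big_seq1 (bigD1 w0) //= big1 => [|w]; last by rewrite (e0 w w0) eqxx.
  rewrite addr0; congr F; apply/seteqP; split => // x _; exact: e0.
rewrite /= /pjoin big_allpairs_dep /= IH.
(* A word is split into its first [n] letters and its last one, because [prefine] adds the latest
   time at each step. *)
pose h (z : {ffun 'I_n -> C} * C) : {ffun 'I_n.+1 -> C} :=
  [ffun i => if unlift ord_max i is Some j then z.1 j else z.2].
pose g (w : {ffun 'I_n.+1 -> C}) : {ffun 'I_n -> C} * C :=
  ([ffun j => w (lift ord_max j)], w ord_max).
have hK : cancel h g.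
  by move=> [w t]; congr (_, _); rewrite ?ffunE ?unlift_none //; apply/ffunP => j; rewrite !ffunE liftK.
have gK : cancel g h.
  by move=> w; apply/ffunP => i; rewrite ffunE; case: unliftP => [j ->|->] //=; rewrite ffunE.
rewrite [RHS](reindex h) /=; last by apply: onW_bij; exists g.
rewrite -(pair_bigA _ (fun w t => F (word f a n.+1 @^-1` [set h (w, t)]))) /=.
apply: eq_bigr => w _; rewrite big_map /code_partition big_map big_enum /=; apply: eq_bigr => t _; congr F.
apply/seteqP; split => x /= [].
  move=> ew et; apply/ffunP => i; rewrite !ffunE.
  case: unliftP => [j ->|->] //=.
  by rewrite -ew ffunE /= /bump leqNgt ltn_ord.
move=> /ffunP e; split.
  by apply/ffunP => j; have := e (lift ord_max j); rewrite !ffunE liftK /= /bump leqNgt ltn_ord.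
by have := e ord_max; rewrite !ffunE unlift_none.
Qed.

Lemma HpartE (P : probability T R) (C : finType) (a : T -> C) n :
  Hpart P (prefine f (code_partition a) n) = H (pr P) (word f a n).
Proof. by rewrite /Hpart prefine_sum. Qed.

Lemma mpartition_code (xi : seq (set T)) : mpartition xi ->
  exists a : T -> 'I_(size xi), mcode a /\ xi = code_partition a.
Proof.
move=> [m1 [m2 m3]].
have /choice[a ha] : forall x, exists i : 'I_(size xi), nth set0 xi i x.
  by move=> x; have [i hi xi_x] := m3 x; exists (Ordinal hi).
have aE (i : 'I_(size xi)) : nth set0 xi i = a @^-1` [set i].
  apply/seteqP; split => x /=; last by move=> <-; exact: ha.
  move=> hx; apply/eqP; apply: contraT => /eqP ne.
  have h : (nth set0 xi (a x) `&` nth set0 xi i) x by split => //; exact: ha.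
  by move: h; rewrite m2 // => e; apply: ne; apply/val_inj.
exists a; split; first by move=> i; rewrite -aE; exact: m1.
apply: (@eq_from_nth _ set0); first by rewrite size_map size_enum_ord.
move=> i hi; rewrite (nth_map (Ordinal hi)) ?size_enum_ord //.
have -> : nth (Ordinal hi) (enum 'I_(size xi)) i = Ordinal hi by apply/val_inj; rewrite /= nth_enum_ord.
exact: (aE (Ordinal hi)).
Qed.

Lemma code_mpartition (C : finType) (a : T -> C) : mcode a -> mpartition (code_partition a).
Proof.
move=> ma; have sz : size (code_partition a) = #|C| by rewrite size_map cardE.
have nthE i : (i < size (code_partition a))%N -> exists2 t, nth set0 (code_partition a) i = a @^-1` [set t] & index t (enum C) = i.
  move=> hi; have hi' : (i < size (enum C))%N by rewrite size_map in hi.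
  have [t _] : exists t : C, True by case: (enum C) hi' => // t; exists t.
  exists (nth t (enum C) i); first by rewrite (nth_map t).
  by rewrite index_uniq // enum_uniq.
split; first by move=> i /nthE[t -> _]; exact: ma.
split => [i j /nthE[t -> it] /nthE[u -> ju] ij|x].
  rewrite -subset0 => x [/= e1 e2]; apply: ij; rewrite -it -ju -e1 -e2 //.
exists (index (a x) (enum C)); first by rewrite sz cardE index_mem mem_enum.
by rewrite (nth_map (a x)) ?index_mem ?mem_enum // nth_index ?mem_enum.
Qed.

Hypothesis fm : forall A, measurable A -> measurable (f @^-1` A).

Definition inv_pr (P : probability T R) := forall A, measurable A -> pr P (f @^-1` A) = pr P A.

Lemma invariant_pr (P : probability T R) : invariant f P <-> inv_pr P.
Proof.
split => h A mA; first by rewrite /pr h.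
by rewrite !prE ?h //; exact: fm.
Qed.

(** The limsup is at most the infimum by Fekete's lemma. Conversely every tail contains the term of
    index [N.+1], which is positive and hence above the infimum. *)
Lemma hpartE (P : probability T R) (C : finType) (a : T -> C) : inv_pr P -> mcode a ->
  hpart f P (code_partition a) = (hh f (pr P) a)%:E.
Proof.
move=> iP ma; apply/eqP; rewrite eq_le; apply/andP; split.
  apply/lee_addgt0Pr => e e0; have [N hN] := hh_fekete (pr_fap P) fm iP ma e0.
  apply: (@le_trans _ _ (ereal_sup [set (n%:R^-1 * Hpart P (prefine f (code_partition a) n))%:E | n in [set n | (N <= n)%N]])).
    by apply: ereal_inf_lbound; exists N.
  apply/ereal_supP => _ [n /= Nn <-]; rewrite -EFinD lee_fin HpartE mulrC.
  exact: hN.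
apply/ereal_infP => _ [N _ <-].
apply: (@le_trans _ _ (N.+1%:R^-1 * Hpart P (prefine f (code_partition a) N.+1))%:E); last first.
  by apply: ereal_sup_ubound; exists N.+1 => //=.
rewrite HpartE lee_fin mulrC; exact: (hh_le (pr_fap P) fm ma).
Qed.

Lemma hmu_ge (P : probability T R) (C : finType) (a : T -> C) : inv_pr P -> mcode a ->
  ((hh f (pr P) a)%:E <= hmu f P)%E.
Proof.
move=> iP ma; rewrite -hpartE //; apply: ereal_sup_ubound.
by exists (code_partition a) => //; exact: code_mpartition.
Qed.

Lemma hmu_le (P : probability T R) c : inv_pr P ->
  (forall n (a : T -> 'I_n), mcode a -> hh f (pr P) a <= c) -> (hmu f P <= c%:E)%E.
Proof.
move=> iP h; apply/ereal_supP => _ [xi /mpartition_code[a [ma ->]] <-].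
by rewrite hpartE // lee_fin h.
Qed.

End Partitions.

(** * Integrals of bounded functions through finite codes *)

Section Integrals.
Context {R : realType} {d : measure_display} {T : measurableType d}.
Implicit Types (P : probability T R) (psi : T -> R).

Definition bm psi := measurable_fun setT psi /\ exists M, forall x, `|psi x| <= M.

Definition intr P psi : R := Rintegral P setT psi.

Lemma bm_integrable P psi : bm psi -> P.-integrable setT (EFin \o psi).
Proof.
move=> [mpsi [M hM]]; apply: measurable_bounded_integrable => //.
  by rewrite (_ : _ setT = 1%E) ?ltry //; exact: (probability_setT P).
exists M; split; rewrite ?num_real // => z Mz x _; exact: le_trans (hM x) (ltW Mz).
Qed.

Lemma intrE P psi : bm psi -> (\int[P]_x (psi x)%:E)%E = (intr P psi)%:E.
Proof.
move=> h; rewrite /intr /Rintegral fineK //.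
exact: (integrable_fin_num _ (bm_integrable P h)).
Qed.

Lemma bmD psi1 psi2 : bm psi1 -> bm psi2 -> bm (fun x => psi1 x + psi2 x).
Proof.
move=> [m1 [M1 h1]] [m2 [M2 h2]]; split; first exact: measurable_funD.
exists (M1 + M2) => x; apply: le_trans (ler_normD _ _) _; exact: lerD.
Qed.

Lemma bm_cst c : bm (fun=> c).
Proof. by split; [exact: measurable_cst|exists `|c|]. Qed.

Lemma bm_indic (A : set T) : measurable A -> bm (\1_A : T -> R).
Proof.
move=> mA; split; first exact: measurable_indic.
by exists 1 => x; rewrite indicE; case: (x \in A); rewrite ?normr1 ?normr0.
Qed.

Lemma bmZ c psi : bm psi -> bm (fun x => c * psi x).
Proof.
move=> [m [M h]]; split; first by apply: measurable_funM => //; exact: measurable_cst.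
by exists (`|c| * M) => x; rewrite normrM ler_wpM2l.
Qed.

Lemma bm_sum (I : Type) (r : seq I) (psi : I -> T -> R) : (forall i, bm (psi i)) ->
  bm (fun x => \sum_(i <- r) psi i x).
Proof.
move=> h; elim: r => [|i r IH]; first by under eq_fun do rewrite big_nil; exact: bm_cst.
by under eq_fun do rewrite big_cons; exact: bmD.
Qed.

Lemma intr_sum P (I : Type) (r : seq I) (psi : I -> T -> R) : (forall i, bm (psi i)) ->
  intr P (fun x => \sum_(i <- r) psi i x) = \sum_(i <- r) intr P (psi i).
Proof.
move=> h; elim: r => [|i r IH].
  under eq_fun do rewrite big_nil; rewrite big_nil.
  by rewrite /intr Rintegral_cst // mul0r.
under eq_fun do rewrite big_cons; rewrite big_cons -IH.
by rewrite /intr RintegralD //; apply: bm_integrable => //; exact: bm_sum.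
Qed.

Lemma intr_le P psi1 psi2 : bm psi1 -> bm psi2 -> (forall x, psi1 x <= psi2 x) ->
  intr P psi1 <= intr P psi2.
Proof. by move=> h1 h2 h; apply: le_Rintegral => //; exact: bm_integrable. Qed.

Lemma code_indic (C : finType) (b : T -> C) (c : C -> R) x :
  c (b x) = \sum_(t <- enum C) c t * \1_(b @^-1` [set t]) x.
Proof.
rewrite big_enum (bigD1 (b x)) //= indicE mem_set // mulr1 big1 ?addr0 // => t tb.
by rewrite indicE memNset ?mulr0 //= => e; rewrite e eqxx in tb.
Qed.

Lemma bm_code (C : finType) (b : T -> C) (c : C -> R) : mcode b -> bm (c \o b).
Proof.
move=> mb; rewrite (_ : c \o b = fun x => \sum_(t <- enum C) c t * \1_(b @^-1` [set t]) x).
  by apply: bm_sum => t; apply: bmZ; apply: bm_indic; exact: mb.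
by apply/funext => x; exact: code_indic.
Qed.

Lemma intr_code P (C : finType) (b : T -> C) (c : C -> R) : mcode b ->
  intr P (c \o b) = \sum_t c t * pr P (b @^-1` [set t]).
Proof.
move=> mb; rewrite (_ : c \o b = fun x => \sum_(t <- enum C) c t * \1_(b @^-1` [set t]) x); last first.
  by apply/funext => x; exact: code_indic.
rewrite intr_sum; last by move=> t; apply: bmZ; apply: bm_indic; exact: mb.
rewrite big_enum; apply: eq_bigr => t _.
rewrite /intr RintegralZl //; last by apply: bm_integrable; apply: bm_indic; exact: mb.
by rewrite /Rintegral integral_indic ?setIT //; exact: mb.
Qed.

Lemma intr_le_code P psi (C : finType) (b : T -> C) (c : C -> R) : bm psi -> mcode b ->
  (forall x, psi x <= c (b x)) -> intr P psi <= \sum_t c t * pr P (b @^-1` [set t]).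
Proof. by move=> h mb hc; rewrite -intr_code //; apply: intr_le => //; exact: bm_code. Qed.

Lemma intr_ge_code P psi (C : finType) (b : T -> C) (c : C -> R) : bm psi -> mcode b ->
  (forall x, c (b x) <= psi x) -> \sum_t c t * pr P (b @^-1` [set t]) <= intr P psi.
Proof. by move=> h mb hc; rewrite -intr_code //; apply: intr_le => //; exact: bm_code. Qed.

(** Uniform approximation by functions of finite codes. Statements on integrals, such as invariance
    and affinity in the measure, are thereby reduced to masses of cells. *)
Definition codable psi := forall e : R, 0 < e -> exists (C : finType) (b : T -> C) (c : C -> R),
  mcode b /\ forall x, `|psi x - c (b x)| <= e.

Lemma intr_apx P psi (C : finType) (b : T -> C) (c : C -> R) e : bm psi -> mcode b ->
  (forall x, `|psi x - c (b x)| <= e) ->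
  `|intr P psi - \sum_t c t * pr P (b @^-1` [set t])| <= e.
Proof.
move=> h mb hb.
have s1 := jd_sum (pr_fap P) mb.
have h1 : intr P psi <= \sum_t (c t + e) * pr P (b @^-1` [set t]).
  by apply: intr_le_code => // x; have := hb x; rewrite ler_norml; lra.
have h2 : \sum_t (c t - e) * pr P (b @^-1` [set t]) <= intr P psi.
  by apply: intr_ge_code => // x; have := hb x; rewrite ler_norml; lra.
have E (s : R) : \sum_t (c t + s) * pr P (b @^-1` [set t]) =
    \sum_t c t * pr P (b @^-1` [set t]) + s.
  by under eq_bigr do rewrite mulrDl; rewrite big_split /= -mulr_sumr s1 mulr1.
by move: h1 h2; rewrite !E ler_norml; lra.
Qed.

Lemma intr_mix P Q S psi t : bm psi -> codable psi -> 0 <= t <= 1 ->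
  (forall B, measurable B -> pr S B = t * pr P B + (1 - t) * pr Q B) ->
  intr S psi = t * intr P psi + (1 - t) * intr Q psi.
Proof.
move=> h hc /andP[t0 t1] hS; apply/eqP; rewrite -subr_eq0 -normr_le0.
apply/ler_addgt0Pr => e e0; rewrite add0r.
have e2 : 0 < e / 2 by rewrite divr_gt0.
have [C [b [c [mb hb]]]] := hc _ e2.
have := intr_apx S h mb hb; have := intr_apx P h mb hb; have := intr_apx Q h mb hb.
have -> : \sum_t0 c t0 * pr S (b @^-1` [set t0]) =
   t * (\sum_t0 c t0 * pr P (b @^-1` [set t0])) + (1 - t) * (\sum_t0 c t0 * pr Q (b @^-1` [set t0])).
  rewrite !mulr_sumr -big_split; apply: eq_bigr => u _; rewrite hS; last exact: mb.
  by rewrite /=; ring.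
set sP := \sum_t0 c t0 * pr P _; set sQ := \sum_t0 c t0 * pr Q _.
rewrite !ler_norml => /andP[h1 h2] /andP[h3 h4] /andP[h5 h6]; apply/andP; split; nra.
Qed.

Section Inv.
Variable f : T -> T.
Hypothesis fm : forall A, measurable A -> measurable (f @^-1` A).

Lemma bm_iter psi k : bm psi -> bm (psi \o iter k f).
Proof.
move=> [m [M h]]; split; last by exists M => x; exact: h.
apply: measurableT_comp => // _ A mA; rewrite setTI; exact: measurable_iter.
Qed.

Lemma intr_iter P psi k : bm psi -> codable psi -> inv_pr f P ->
  intr P (psi \o iter k f) = intr P psi.
Proof.
move=> h hc iP; apply/eqP; rewrite -subr_eq0 -normr_le0.
apply/ler_addgt0Pr => e e0; rewrite add0r.
have e2 : 0 < e / 2 by rewrite divr_gt0.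
have [C [b [c [mb hb]]]] := hc _ e2.
have := intr_apx P h mb hb.
have := intr_apx P (bm_iter k h) (mcode_iter fm k mb) (fun x => hb (iter k f x)).
rewrite (eq_bigr (fun t => c t * pr P (b @^-1` [set t]))); last first.
  move=> t _; congr (_ * _); exact: (fap_iter fm iP k (mb t)).
by rewrite !ler_norml; lra.
Qed.

Lemma intr_birkhoff P psi n (C : finType) (a : T -> C) (c : C -> R) : bm psi -> codable psi ->
  inv_pr f P -> mcode a -> (forall x, birkhoff f psi x n <= c (a x)) ->
  n%:R * intr P psi <= \sum_t c t * pr P (a @^-1` [set t]).
Proof.
move=> h hc iP ma ha.
have -> : n%:R * intr P psi = intr P (fun x => \sum_(k <- enum 'I_n) (psi \o iter k f) x).
  rewrite intr_sum; last by move=> k; exact: bm_iter.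
  rewrite (eq_bigr (fun=> intr P psi)); last by move=> k _; exact: intr_iter.
  by rewrite big_enum sumr_const card_ord mulr_natl.
apply: intr_le_code => //; first by apply: bm_sum => k; exact: bm_iter.
by move=> x; apply: le_trans (ha x); rewrite big_enum.
Qed.

Lemma freeEnergyE P psi : bm psi -> freeEnergy f psi P = (hmu f P + (intr P psi)%:E)%E.
Proof. by move=> h; rewrite /freeEnergy intrE. Qed.

Lemma freeEnergy_ge P psi (C : finType) (a : T -> C) : bm psi -> inv_pr f P -> mcode a ->
  ((hh f (pr P) a + intr P psi)%:E <= freeEnergy f psi P)%E.
Proof.
move=> h iP ma; rewrite freeEnergyE // EFinD leeD2r //; exact: hmu_ge.
Qed.

Lemma freeEnergy_le P psi c : bm psi -> inv_pr f P ->
  (forall n (a : T -> 'I_n), mcode a -> hh f (pr P) a + intr P psi <= c) ->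
  (freeEnergy f psi P <= c%:E)%E.
Proof.
move=> h iP hc; rewrite freeEnergyE // -leeBrDr // -EFinB; apply: hmu_le => // n a ma.
by rewrite lerBrDr; exact: hc.
Qed.

Lemma freeEnergy_gt P psi c : bm psi -> inv_pr f P -> (c%:E < freeEnergy f psi P)%E ->
  exists n (a : T -> 'I_n), mcode a /\ c < hh f (pr P) a + intr P psi.
Proof.
move=> h iP hc; apply: contrapT => hn; move: hc; apply/negP; rewrite -leNgt.
apply: freeEnergy_le => // n a ma; rewrite leNgt; apply/negP => hlt; apply: hn.
by exists n, a.
Qed.

End Inv.
End Integrals.

(** * Bowen metrics and pressure *)

Section Bowen.
Context {R : realType} {X : Type} (dist : X -> X -> R) (f : X -> X).
Hypothesis dM : is_metric dist.
Hypothesis dK : dcompact dist.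
Hypothesis cf : dcontinuous dist f.
Local Notation dn := (dn dist f).

Lemma dn_ge0 n x y : 0 <= dn n x y.
Proof. by rewrite /Defs.dn; elim/big_ind: _ => // [a b|i _]; [rewrite le_max => ->|exact: dist_ge0]. Qed.

Lemma dn_leP n x y r : 0 <= r ->
  dn n x y <= r <-> forall k, (k < n)%N -> dist (iter k f x) (iter k f y) <= r.
Proof.
move=> r0; split => [/bigmax_leP[_ h] k kn|h].
  exact: (h (Ordinal kn)).
by apply/bigmax_leP; split => // k _; exact: h.
Qed.

Lemma dn_ltP n x y r : 0 < r ->
  dn n x y < r <-> forall k, (k < n)%N -> dist (iter k f x) (iter k f y) < r.
Proof.
move=> r0; split => [/bigmax_ltP[_ h] k kn|h].
  exact: (h (Ordinal kn)).
by apply/bigmax_ltP; split => // k _; exact: h.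
Qed.

Lemma dn_gtP n x y r : 0 <= r ->
  r < dn n x y <-> exists2 k, (k < n)%N & r < dist (iter k f x) (iter k f y).
Proof.
move=> r0; split => [h|[k kn h]].
  apply: contrapT => hn; move: h; apply/negP; rewrite -leNgt; apply/dn_leP => // k kn.
  by rewrite leNgt; apply/negP => h; apply: hn; exists k.
by apply: lt_le_trans h _; have [+ _] := dn_leP n x y (dn_ge0 n x y); apply.
Qed.

Lemma dn_sym n x y : dn n x y = dn n y x.
Proof. by rewrite /Defs.dn; apply: eq_bigr => k _; exact: distC. Qed.

Lemma dn_xx n x : dn n x x = 0.
Proof.
apply/eqP; rewrite eq_le dn_ge0 andbT; apply/dn_leP => // k _.
by rewrite distxx.
Qed.

Lemma dn_tri n x y z : dn n x z <= dn n x y + dn n y z.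
Proof.
apply/dn_leP => [|k kn]; first by rewrite addr_ge0 ?dn_ge0.
apply: le_trans (dist_tri dM _ (iter k f y) _) _.
have [h1 _] := dn_leP n x y (dn_ge0 n x y); have [h2 _] := dn_leP n y z (dn_ge0 n y z).
by apply: lerD; [exact: h1|exact: h2].
Qed.

Lemma dn_sub n x y k l : (k + l <= n)%N -> dn l (iter k f x) (iter k f y) <= dn n x y.
Proof.
move=> kl; apply/dn_leP => [|i il]; first exact: dn_ge0.
rewrite -!iterD; have [+ _] := dn_leP n x y (dn_ge0 n x y); apply; first exact: lexx.
by apply: leq_trans kl; rewrite addnC ltn_add2l.
Qed.

Lemma dn_cont n x (e : R) : 0 < e -> exists2 r : R, 0 < r & forall y, dist x y < r -> dn n x y < e.
Proof.
move=> e0; elim: n => [|n [r r0 hr]].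
  by exists 1 => // y _; apply/dn_ltP.
have [s s0 hs] := dcontinuous_iter n cf x e0.
exists (Num.min r s); first by rewrite lt_min r0.
move=> y; rewrite lt_min => /andP[/hr h1 /hs h2]; apply/dn_ltP => // k.
rewrite ltnS leq_eqVlt => /orP[/eqP -> //|kn].
by have [+ _] := dn_ltP n x y e0; apply.
Qed.

Lemma dn_closed n x r : dclosed dist [set y | dn n x y <= r].
Proof.
move=> y /= /negP; rewrite -ltNge => h.
have e0 : 0 < dn n x y - r by rewrite subr_gt0.
have [s s0 hs] := dn_cont n y e0; exists s => // z /hs hz.
apply/negP; rewrite -ltNge; have := dn_tri n x z y; rewrite (dn_sym n z y); lra.
Qed.

(** Separation relative to a predicate, so that a family can be split and regrouped without
    reindexing. *)
Definition sepOn (I : finType) n r (E : I -> X) (A : pred I) :=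
  forall i j, A i -> A j -> i != j -> r < dn n (E i) (E j).

Lemma sep_bound n (r : R) : 0 < r ->
  exists N, forall (I : finType) (E : I -> X) (A : pred I), sepOn n r E A -> (#|A| <= N)%N.
Proof.
move=> r0; have r2 : 0 < r / 2 by rewrite divr_gt0.
have /choice[s hs] : forall x, exists s : R, 0 < s /\ forall y, dist x y < s -> dn n x y < r / 2.
  by move=> x; have [s s0 h] := dn_cont n x r2; exists s.
have [N [c hc]] := finite_cover dM dK (fun x => (hs x).1).
exists N => I E A sep.
have /choice[h hP] : forall i, exists j : 'I_N, dist (c j) (E i) < s (c j) by move=> i; exact: hc.
have inj : {in A &, injective h}.
  move=> i j Ai Aj e; apply/eqP; apply: contraT => ne.
  have := sep i j Ai Aj ne; have := (hs (c (h i))).2 _ (hP i).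
  have := hP j; rewrite -e => /((hs (c (h i))).2 _).
  have := dn_tri n (E i) (c (h i)) (E j); rewrite (dn_sym n (E i) (c _)) => t1 t2 t3 t4.
  by exfalso; lra.
by rewrite -(card_in_image inj) -[leqRHS]card_ord; exact: max_card.
Qed.

Lemma max_sep (Y : set X) n (r : R) : 0 < r -> exists k (E : 'I_k -> X),
  [/\ forall i, Y (E i), separated dist f n r E & forall y, Y y -> exists i, dn n (E i) y <= r].
Proof.
move=> r0; have [N hN] := sep_bound n r0.
pose Q k := `[< exists E : 'I_k -> X, (forall i, Y (E i)) /\ separated dist f n r E >].
have exQ : exists k, Q k.
  by exists 0%N; apply/asboolP; exists (fun i : 'I_0 => False_rect X (notF (ltn_ord i))); split => [[]|[]].
have ubQ k : Q k -> (k <= N)%N.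
  move=> /asboolP[E [_ sep]]; have := hN _ E xpredT; rewrite cardT size_enum_ord; apply.
  by move=> i j _ _; exact: sep.
case: (ex_maxnP exQ ubQ) => k /asboolP[E [EY sep]] kmax.
exists k, E; split => // y Yy; apply: contrapT => /forallNP hy.
have : Q k.+1.
  apply/asboolP; exists (fun i => if unlift ord_max i is Some j then E j else y); split.
    by move=> i; case: unliftP.
  have hy' i : r < dn n (E i) y by rewrite ltNge; apply/negP; exact: hy.
  move=> i j; case: unliftP => [i' ->|->]; case: unliftP => [j' ->|->].
  - by rewrite (inj_eq lift_inj); exact: sep.
  - by rewrite hy'.
  - by rewrite dn_sym hy'.
  - by rewrite eqxx.
by move=> /kmax; rewrite ltnn.
Qed.

End Bowen.

(** * Birkhoff sums and partition sums over separated sets *)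

Section Potential.
Context {R : realType} {X : Type} (dist : X -> X -> R) (f : X -> X) (phi : X -> R).
Hypothesis dM : is_metric dist.
Variable M : R.
Hypothesis phiM : forall x, `|phi x| <= M.
Local Notation dn := (dn dist f).
Local Notation S := (birkhoff f phi).

Lemma birkhoff_norm x n : `|S x n| <= n%:R * M.
Proof.
rewrite /birkhoff; apply: le_trans (ler_norm_sum _ _ _) _.
by rewrite -[n in leRHS]card_ord mulr_natl -sumr_const; apply: ler_sum.
Qed.

Lemma birkhoff_add x k l : S x (k + l) = S x k + S (iter k f x) l.
Proof.
rewrite /birkhoff big_split_ord /=; congr (_ + _); apply: eq_bigr => i _.
by rewrite -iterD addnC.
Qed.

Definition Phi e x n : R := fine (PhiE dist f phi e x n).

Lemma PhiE_fin e x n : PhiE dist f phi e x n = (Phi e x n)%:E.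
Proof.
rewrite /Phi fineK // fin_numE; apply/andP; split.
  rewrite -ltNye; apply: (@lt_le_trans _ _ (S x n)%:E); first by rewrite ltNyr.
  by apply: ereal_sup_ubound; exists x => //; left.
rewrite -ltey; apply: (@le_lt_trans _ _ (n%:R * M)%:E); last by rewrite ltry.
apply/ereal_supP => _ [y _ <-]; rewrite lee_fin.
by apply: le_trans (ler_norm _) _; exact: birkhoff_norm.
Qed.

Lemma Phi_ge e x y n : (y = x \/ dn n x y < e) -> S y n <= Phi e x n.
Proof. by move=> h; rewrite -lee_fin -PhiE_fin; apply: ereal_sup_ubound; exists y. Qed.

Lemma Phi_le e x n c : (forall y, (y = x \/ dn n x y < e) -> S y n <= c) -> Phi e x n <= c.
Proof.
move=> h; rewrite -lee_fin -PhiE_fin; apply/ereal_supP => _ [y hy <-].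
by rewrite lee_fin h.
Qed.

Lemma Phi_le_norm e x n : Phi e x n <= n%:R * M.
Proof. by apply: Phi_le => y _; apply: le_trans (ler_norm _) _; exact: birkhoff_norm. Qed.

Lemma Phi0 x n : Phi 0 x n = S x n.
Proof.
apply/eqP; rewrite eq_le Phi_ge; last by left.
rewrite Phi_le // => y [->//|]; rewrite ltNge dn_ge0 //.
Qed.

(** A larger radius absorbs a change of centre; with it segments are replaced by nearby members of a
    net. *)
Lemma Phi_shift e e' x y n : 0 < e -> dn n y x + e <= e' -> Phi e x n <= Phi e' y n.
Proof.
move=> e0 h; apply: Phi_le => z hz; apply: Phi_ge; right.
have h1 := dn_tri f dM n y x z; apply: le_lt_trans h1 _; apply: lt_le_trans h.
by rewrite ltrD2l; case: hz => [->|//]; rewrite dn_xx.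
Qed.

Lemma Phi_add e x k l : 0 < e -> Phi e x (k + l) <= Phi e x k + Phi e (iter k f x) l.
Proof.
move=> e0; apply: Phi_le => y hy; rewrite birkhoff_add; apply: lerD; apply: Phi_ge.
  case: hy => [->|h]; [by left|right].
  apply: le_lt_trans h; have /= := dn_sub f dM x y (n := (k + l)%N) (k := 0%N) (l := k); apply.
  by rewrite add0n leq_addr.
case: hy => [->|h]; [by left|right].
by apply: le_lt_trans h; apply: dn_sub.
Qed.

Lemma expeR_PhiE e x n : expeR (PhiE dist f phi e x n) = (expR (Phi e x n))%:E.
Proof. by rewrite PhiE_fin. Qed.

Lemma Lambda_ge (C : set (X * nat)) delta e n (I : finType) (E : I -> X) (A : pred I) :
  sepOn dist f n delta E A -> (forall i, A i -> C (E i, n)) ->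
  ((\sum_(i | A i) expR (Phi e (E i) n))%:E <= Lambda dist f phi C delta e n)%E.
Proof.
move=> sep hC; apply: ereal_sup_ubound.
exists #|A|, (fun j => E (enum_val j)); split.
- move=> i j ij; apply: sep; [exact: enum_valP|exact: enum_valP|].
  by rewrite (inj_eq enum_val_inj).
- by move=> i; apply: hC; exact: enum_valP.
rewrite [RHS](eq_bigr (fun i => (expR (Phi e (E (enum_val i)) n))%:E)); last first.
  by move=> i _; rewrite expeR_PhiE.
rewrite sumEFin; congr (_%:E); rewrite -(big_enum_val (A := A) (fun i => expR (Phi e (E i) n))).
exact: eq_bigl.
Qed.

Lemma Lambda_gt (C : set (X * nat)) delta e n (c : R) :
  (c%:E < Lambda dist f phi C delta e n)%E ->
  exists k (E : 'I_k -> X), [/\ separated dist f n delta E, (forall i, C (E i, n)) &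
    c < \sum_i expR (Phi e (E i) n)].
Proof.
move=> /ereal_sup_gt[_ [k [E [sep hC ->]]] h]; exists k, E; split => //.
by move: h; under eq_bigr do rewrite expeR_PhiE; rewrite sumEFin lte_fin.
Qed.

Lemma Pcol_lt (C : set (X * nat)) delta e (c : R) :
  (Pcol dist f phi C delta e < c%:E)%E -> exists N, forall n, (N <= n)%N -> (0 < n)%N ->
  forall (I : finType) (E : I -> X) (A : pred I),
  sepOn dist f n delta E A -> (forall i, A i -> C (E i, n)) ->
  \sum_(i | A i) expR (Phi e (E i) n) <= expR (n%:R * c).
Proof.
move=> /ereal_inf_lt[_ [N _ <-] h]; exists N => n Nn n0 I E A sep hC.
have {}h : ((n%:R^-1)%:E * elog (Lambda dist f phi C delta e n) < c%:E)%E.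
  by apply: le_lt_trans h; apply: ereal_sup_ubound; exists n.
have h1 := Lambda_ge e sep hC.
have n0' : 0 < n%:R :> R by rewrite ltr0n.
set s := \sum_(i | _) _ in h1 *.
have [s0|s0] := lerP s 0; first by rewrite (le_trans s0) // expR_ge0.
move: h h1; case: (Lambda dist f phi C delta e n) => [L| |] //=.
- rewrite lee_fin => + sL; have L0 : 0 < L := lt_le_trans s0 sL.
  rewrite L0 -EFinM lte_fin mulrC ltr_pdivrMr // => hL.
  apply: le_trans sL _; rewrite -[L]lnK ?posrE // ler_expR mulrC; exact: ltW.
- by rewrite gt0_muley ?lte_fin ?invr_gt0 // ltNge leey.
Qed.

(** A limsup is only exceeded along infinitely many lengths, whereas [Pcol_lt] controls all large
    ones; hence arbitrarily large [n] and, later, an ultrafilter adapted to these lengths. *)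
Lemma Pcol_gt (C : set (X * nat)) delta e (c : R) :
  (c%:E < Pcol dist f phi C delta e)%E -> forall N, exists n k (E : 'I_k -> X),
  [/\ (N <= n)%N, (0 < n)%N, separated dist f n delta E, (forall i, C (E i, n)) &
    expR (n%:R * c) < \sum_i expR (Phi e (E i) n)].
Proof.
move=> h N.
have : (c%:E < ereal_sup [set (n%:R^-1)%:E * elog (Lambda dist f phi C delta e n) | n in [set n | (N.+1 <= n)%N]])%E.
  by apply: lt_le_trans h _; apply: ereal_inf_lbound; exists N.+1.
move=> /ereal_sup_gt[_ [n /= Nn <-] {}h].
have n0 : (0 < n)%N by exact: leq_ltn_trans Nn.
have n0' : 0 < n%:R :> R by rewrite ltr0n.
have hL : ((expR (n%:R * c))%:E < Lambda dist f phi C delta e n)%E.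
  move: h; case: (Lambda dist f phi C delta e n) => [L| |] /=.
  - case: ifPn => [L0|_]; last by rewrite gt0_muleNy ?lte_fin ?invr_gt0 // ltNge leNye.
    rewrite -EFinM !lte_fin mulrC ltr_pdivlMr // mulrC => hL.
    by rewrite -[L]lnK ?posrE // ltr_expR.
  - by move=> _; rewrite ltry.
  - by rewrite gt0_muleNy ?lte_fin ?invr_gt0 // ltNge leNye.
have [k [E [h1 h2 h3]]] := Lambda_gt hL.
by exists n, k, E; split => //; exact: ltnW.
Qed.

End Potential.

(** * Weak limits *)

Lemma enum_In (I : finType) (z : I) : List.In z (enum I).
Proof.
have : z \in enum I by rewrite mem_enum.
by elim: (enum I) => // y l IH; rewrite inE => /orP[/eqP ->|/IH]; [left|right].
Qed.

Section BorelDynamics.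
Context {R : realType} {dX : measure_display} {X : measurableType dX}.
Variables (dist : X -> X -> R).
Hypothesis dM : is_metric dist.
Hypothesis dK : dcompact dist.
Hypothesis borel : @measurable dX X = <<s dopen dist >>.

Lemma dcontinuous_measurable (h : X -> X) : dcontinuous dist h ->
  forall A, measurable A -> measurable (h @^-1` A).
Proof.
move=> ch; rewrite {1}borel.
suff : <<s dopen dist >> `<=` [set A | measurable (h @^-1` A)] by move=> s A /s.
apply: smallest_sub => [|U oU]; last by apply: (measurable_open borel); exact: dopen_preimage.
split => [|A mA|F family_measurable] /=.
- by rewrite preimage_set0.
- by rewrite setTD -preimage_setC; exact: measurableC.
- by rewrite preimage_bigcup; exact: bigcupT_measurable.
Qed.

Lemma rcontinuous_measurable (psi : X -> R) : rcontinuous dist psi ->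
  measurable_fun setT psi.
Proof.
move=> c; apply: (measurability _ (RGenOInfty.measurableE R)) => //.
move=> /= _ [_ [y ->] <-]; rewrite setTI; apply: (measurable_open borel).
move=> x /=; rewrite in_itv /= andbT => yx.
have [r r0 h] := c x (psi x - y) (ltac:(by rewrite subr_gt0)).
by exists r => // z /h; rewrite in_itv /= andbT ltr_distlC; lra.
Qed.

Lemma rcontinuous_bounded (psi : X -> R) : rcontinuous dist psi ->
  exists M, forall x, `|psi x| <= M.
Proof.
move=> c; have /choice[s hs] : forall x, exists s : R, 0 < s /\ forall y, dist x y < s -> `|psi x - psi y| < 1.
  by move=> x; have [s s0 h] := c x 1 ltr01; exists s.
have [n [z hz]] := finite_cover dM dK (fun x => (hs x).1).
exists (\sum_i `|psi (z i)| + 1) => x; have [i hi] := hz x.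
have h1 : `|psi (z i)| <= \sum_i `|psi (z i)| by rewrite (bigD1 i) //= lerDl sumr_ge0.
have h2 := (hs (z i)).2 _ hi.
have := ler_normB (psi (z i)) (psi (z i) - psi x); rewrite subKr; lra.
Qed.

Lemma dist_rcontinuous x : rcontinuous dist (dist x).
Proof.
move=> y e e0; exists e => // z yz; rewrite ltr_norml.
have := dist_tri dM x y z; have := dist_tri dM x z y; rewrite (distC dM z y).
by move=> h1 h2; apply/andP; split; lra.
Qed.

Definition ballcode (n : nat) (c : 'I_n -> X) (r : 'I_n -> R) (x : X) :
  {ffun 'I_n -> bool} := [ffun i => dist (c i) x < r i].

Lemma mcode_ballcode n (c : 'I_n -> X) (r : 'I_n -> R) : mcode (ballcode c r).
Proof.
apply: mcode_ffun => i b.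
have m1 : measurable [set y | dist (c i) y < r i].
  by apply: (measurable_open borel); exact: dopen_ball.
case: b; first exact: m1.
rewrite (_ : _ @^-1` _ = ~` [set y | dist (c i) y < r i]); first exact: measurableC.
by apply/seteqP; split => x /=; [move=> ->|move/negP/negbTE].
Qed.

(** Spheres of positive mass are atoms of the law of [dist x], so their radii form a countable set,
    which cannot contain an interval of positive Lebesgue measure. *)
Lemma null_radius (P : probability X R) x (a b : R) : a < b ->
  exists r, [/\ a < r, r < b & pr P [set y | dist x y = r] = 0].
Proof.
move=> ab; have mx := rcontinuous_measurable (dist_rcontinuous x).
pose Y : {RV P >-> R} := mfun_Sub (mem_set mx).
have cY := pmf_gt0_countable Y.
have l0 := countable_lebesgue_measure0 cY.
apply: contrapT => hn.
have sub : `]a, b[%classic `<=` [set r | 0 < pmf Y r].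
  move=> r /=; rewrite in_itv /= => /andP[ar rb].
  have h : pr P [set y | dist x y = r] <> 0 by move=> h; apply: hn; exists r.
  by rewrite lt_neqAle eq_sym; apply/andP; split; [apply/eqP|exact: pr_ge0].
have : (lebesgue_measure (`]a, b[%classic : set R) <= 0)%E.
  rewrite -l0; apply: le_measure; rewrite ?inE //.
  exact: countable_measurable.
by rewrite lebesgue_measure_itv /= lte_fin ab -EFinD lee_fin; lra.
Qed.

Section WeakLimits.
Variables (f g : X -> X).
Hypothesis fK : cancel f g.
Hypothesis gK : cancel g f.
Hypothesis cf : dcontinuous dist f.
Hypothesis cg : dcontinuous dist g.
Context (U : set_system nat) {UU : UltraFilter U}.

Definition wlim (s : nat -> set X -> R) (P : probability X R) :=
  (forall A, dopen dist A -> pr P A <= ulim U (s^~ A)) /\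
  (forall A, dclosed dist A -> ulim U (s^~ A) <= pr P A).

Lemma fap_le1 (m : set X -> R) A : fap m -> measurable A -> 0 <= m A <= 1.
Proof. by move=> h mA; rewrite fap_ge0 //= -(fapT h) fap_mono. Qed.

Lemma fap_ubnd (s : nat -> set X -> R) A : (forall n, fap (s n)) -> measurable A ->
  ubnd U (s^~ A).
Proof. by move=> h mA; apply: ubnd01 => n; exact: fap_le1. Qed.

Lemma weak_limit (s : nat -> set X -> R) : (forall n, fap (s n)) ->
  (forall A, measurable A -> ulim U (fun n => s n (f @^-1` A)) = ulim U (s^~ A)) ->
  exists P, wlim s P /\ inv_pr f P.
Proof.
move=> hs hi; pose m A := if `[< measurable A >] then ulim U (s^~ A) else 0.
have mE A : measurable A -> m A = ulim U (s^~ A) by move=> mA; rewrite /m asboolT.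
have [A|A B mA mB AB||P [h1 h2 h3]] := @radonize _ _ _ dist dM dK borel m.
- rewrite /m; case: asboolP => // mA.
  apply: ulim_gec; first exact: fap_ubnd.
  by apply: nearW => n; exact: (fap_ge0 (hs n) mA).
- rewrite !mE //; last exact: measurableU.
  rewrite -ulimD; [|exact: fap_ubnd|exact: fap_ubnd].
  by congr ulim; apply/funext => n; exact: (fapU (hs n)).
- rewrite mE // -[RHS](ulim_cst (U := U)).
  by congr ulim; apply/funext => n; exact: (fapT (hs n)).
exists P; split; first split.
- move=> A oA; have mA := measurable_open borel oA.
  by have := h1 A oA; rewrite mE // prE // lee_fin.
- move=> A cA; have mA := measurable_closed borel cA.
  by have := h2 A cA; rewrite mE // prE // lee_fin.
move=> A mA; rewrite /pr (h3 f g fK gK cf cg) // => {A mA} A mA.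
rewrite !mE //; first exact: hi.
exact: dcontinuous_measurable.
Qed.

Lemma wlim_sandwich s P A Ao Ac : (forall n, fap (s n)) -> wlim s P ->
  dopen dist Ao -> dclosed dist Ac -> measurable A -> Ao `<=` A -> A `<=` Ac ->
  pr P Ac <= pr P Ao -> ulim U (s^~ A) = pr P A.
Proof.
move=> hs [h1 h2] oA cA mA s1 s2 h.
have mo := measurable_open borel oA; have mc := measurable_closed borel cA.
have := h1 _ oA; have := h2 _ cA.
have u1 : ulim U (s^~ Ao) <= ulim U (s^~ A).
  by apply: ulim_le; [exact: fap_ubnd|exact: fap_ubnd|apply: nearW => n; exact: fap_mono].
have u2 : ulim U (s^~ A) <= ulim U (s^~ Ac).
  by apply: ulim_le; [exact: fap_ubnd|exact: fap_ubnd|apply: nearW => n; exact: fap_mono].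
have := pr_mono P mo mA s1; have := pr_mono P mA mc s2.
by move=> p1 p2 q1 q2; apply/eqP; rewrite eq_le; apply/andP; split; lra.
Qed.

(** A word cell lies between an open and a closed set that differ only by preimages of spheres.
    Those are null by the choice of the radii and by invariance, so the masses of word cells
    converge. *)
Lemma wlim_ballword s P n (c : 'I_n -> X) (r : 'I_n -> R) q (w : {ffun 'I_q -> {ffun 'I_n -> bool}}) :
  (forall n, fap (s n)) -> wlim s P -> inv_pr f P ->
  (forall i, pr P [set y | dist (c i) y = r i] = 0) ->
  ulim U (s^~ (word f (ballcode c r) q @^-1` [set w])) = pr P (word f (ballcode c r) q @^-1` [set w]).
Proof.
move=> hs hw iP h0.
have fm := dcontinuous_measurable cf.
pose Ao := \bigcap_(z in [set: 'I_q * 'I_n]) (iter z.1 f @^-1`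
   [set y | if w z.1 z.2 then dist (c z.2) y < r z.2 else r z.2 < dist (c z.2) y]).
pose Ac := \bigcap_(z in [set: 'I_q * 'I_n]) (iter z.1 f @^-1`
   [set y | if w z.1 z.2 then dist (c z.2) y <= r z.2 else r z.2 <= dist (c z.2) y]).
pose Sp (z : 'I_q * 'I_n) := iter z.1 f @^-1` [set y | dist (c z.2) y = r z.2].
have cge x e : dclosed dist [set y | e <= dist x y].
  rewrite /dclosed (_ : ~` _ = [set y | dist x y < e]); first exact: dopen_ball.
  by apply/seteqP; split => y /=; rewrite ltNge => /negP.
have ogt x e : dopen dist [set y | e < dist x y].
  rewrite (_ : [set y | _] = ~` [set y | dist x y <= e]); first exact: dclosed_ball.
  by apply/seteqP; split => y /=; rewrite ltNge => /negP.
have oAo : dopen dist Ao.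
  have H0 : forall l : seq ('I_q * 'I_n), dopen dist [set x | forall z, List.In z l -> (iter z.1 f @^-1`
   [set y | if w z.1 z.2 then dist (c z.2) y < r z.2 else r z.2 < dist (c z.2) y]) x].
    elim=> [|z l IH]; first by move=> x _; exists 1 => // y _ z [].
    rewrite (_ : [set x | _] = (iter z.1 f @^-1`
   [set y | if w z.1 z.2 then dist (c z.2) y < r z.2 else r z.2 < dist (c z.2) y]) `&` [set x | forall z, List.In z l -> (iter z.1 f @^-1`
   [set y | if w z.1 z.2 then dist (c z.2) y < r z.2 else r z.2 < dist (c z.2) y]) x]).
      apply: dopenI => //; apply: dopen_preimage; first exact: dcontinuous_iter.
      by case: (w _ _); [exact: dopen_ball|exact: ogt].
    apply/seteqP; split => x /= h; first by split => [|z' hz]; apply: h; [left|right].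
    by move=> z' [<-|]; [exact: h.1|exact: h.2].
  rewrite (_ : Ao = [set x | forall z, List.In z (enum {: 'I_q * 'I_n}) -> (iter z.1 f @^-1`
   [set y | if w z.1 z.2 then dist (c z.2) y < r z.2 else r z.2 < dist (c z.2) y]) x]) //.
  apply/seteqP; split => x h z hz; apply: h => //.
  exact: enum_In.
have cAc : dclosed dist Ac.
  apply: dclosed_bigcap => z _; apply: dclosed_preimage; first exact: dcontinuous_iter.
  by case: (w _ _); [exact: dclosed_ball|exact: cge].
have mA : measurable (word f (ballcode c r) q @^-1` [set w]).
  by apply: mcode_word => //; exact: mcode_ballcode.
have inA x : word f (ballcode c r) q x = w <-> forall z : 'I_q * 'I_n, (dist (c z.2) (iter z.1 f x) < r z.2) = w z.1 z.2.
  split => [<- z|h]; first by rewrite !ffunE.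
  by apply/ffunP => i; apply/ffunP => j; rewrite !ffunE; exact: (h (i, j)).
apply: (wlim_sandwich hs hw oAo cAc mA).
- move=> x hx; apply/inA => z; have := hx z Logic.I => /=.
  by case: (w _ _) => // h; apply/negbTE; rewrite -leNgt ltW.
- move=> x /inA hx z _ /=; rewrite -(hx z).
  by case: ltP => // /ltW.
have mSp z : measurable (Sp z).
  apply: (measurable_iter fm); apply: (measurable_closed borel).
  rewrite (_ : [set y | _] = [set y | dist (c z.2) y <= r z.2] `&` [set y | r z.2 <= dist (c z.2) y]).
    by apply: dclosedI => //; exact: dclosed_ball.
  apply/seteqP; split => y /=; first by move=> ->; rewrite lexx.
  by move=> [h1 h2]; apply/eqP; rewrite eq_le h1.
have mo := measurable_open borel oAo; have mc := measurable_closed borel cAc.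
have sub : Ao `<=` Ac.
  by move=> x hx z _; have := hx z Logic.I => /=; case: (w _ _) => /ltW.
rewrite -subr_le0 -prD //.
apply: (@le_trans _ _ (\sum_(z <- enum {: 'I_q * 'I_n}) pr P (Sp z))).
  apply: pr_bigU_le => //; first exact: measurableD.
  move=> x [hc /existsNP[z /not_implyP[_ ho]]]; exists z; first exact: enum_In.
  have := hc z Logic.I; move: ho => /=; rewrite /Sp /=.
  case: (w _ _) => /negP; rewrite -leNgt => h1 h2; apply/eqP; rewrite eq_le ?h1 ?h2 //.
rewrite big1 // => z _; rewrite /Sp -[RHS](h0 z.2).
apply: (fap_iter fm iP); apply: (measurable_closed borel).
rewrite (_ : [set y | _] = [set y | dist (c z.2) y <= r z.2] `&` [set y | r z.2 <= dist (c z.2) y]).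
  by apply: dclosedI => //; exact: dclosed_ball.
apply/seteqP; split => y /=; first by move=> ->; rewrite lexx.
by move=> [h1 h2]; apply/eqP; rewrite eq_le h1.
Qed.

End WeakLimits.

Lemma rcontinuous_codable (psi : X -> R) : rcontinuous dist psi -> codable psi.
Proof.
move=> c e e0; have /choice[s hs] : forall x, exists s : R, 0 < s /\ forall y, dist x y < s -> `|psi x - psi y| < e.
  by move=> x; have [s s0 h] := c x e e0; exists s.
have [n [z hz]] := finite_cover dM dK (fun x => (hs x).1).
pose c0 (t : {ffun 'I_n -> bool}) : R := if [pick i | t i] is Some i then psi (z i) else 0.
exists {ffun 'I_n -> bool}, (ballcode z (fun i => s (z i))), c0; split; first exact: mcode_ballcode.
move=> x; rewrite /c0; case: pickP => [i|h].
  by rewrite ffunE => /((hs _).2 _) h; rewrite distrC ltW.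
by have [i hi] := hz x; have := h i; rewrite ffunE hi.
Qed.

Lemma rcontinuous_bm (psi : X -> R) : rcontinuous dist psi -> bm psi.
Proof. by move=> c; split; [exact: rcontinuous_measurable|exact: rcontinuous_bounded]. Qed.

End BorelDynamics.

(** * Variational lower bound for empirical measures *)

Section XlogxLimits.
Context {R : realType}.

Lemma xlogx_tangent (m y : R) : 0 < m -> 0 <= y -> y * (ln m + 1) - m <= xlogx y.
Proof.
move=> m0; rewrite le_eqVlt => /orP[/eqP <-|y0].
  by rewrite xlogxE !mul0r sub0r oppr_le0 ltW.
rewrite xlogxE lerBlDr -lerBlDl -mulrBr.
have h : ln (m / y) <= m / y - 1.
  have := @le_ln1Dx R (m / y - 1); rewrite addrCA subrr addr0; apply.
  by rewrite ltrBrDr addNr divr_gt0.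
move: h; rewrite ln_div ?posrE // => h.
have : y * (ln m - ln y) <= y * (m / y - 1) by rewrite ler_pM2l.
by rewrite mulrBr [X in _ <= X -> _]mulrBr mulr1 mulrCA divff ?gt_eqF // mulr1; lra.
Qed.

Lemma xlogx_bound (y : R) : 0 <= y <= 1 -> `|xlogx y| <= 1.
Proof.
move=> /andP[y0 y1]; have := xlogx_tangent (@ltr01 R) y0.
rewrite ln1 add0r mulr1 => h.
have h2 : xlogx y <= 0 by rewrite xlogxE mulr_ge0_le0 // ln_le0.
by rewrite ler_norml; apply/andP; split; lra.
Qed.

(** The tangent of this convex function at the limit value is linear, so it passes to the
    ultralimit. When the limit is 0, where there is no tangent, those at small positive points are
    used. *)
Lemma ulim_xlogx (U : set_system nat) {UU : UltraFilter U} (u : nat -> R) :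
  (forall n, 0 <= u n <= 1) -> xlogx (ulim U u) <= ulim U (fun n => xlogx (u n)).
Proof.
move=> hu; have bu : ubnd U u by exact: ubnd01.
have bx : ubnd U (fun n => xlogx (u n)).
  by exists 1; apply: nearW => n; exact: xlogx_bound.
have l0 : 0 <= ulim U u by apply: ulim_gec => //; apply: nearW => n; case/andP: (hu n).
have key m : 0 < m -> ulim U u * (ln m + 1) - m <= ulim U (fun n => xlogx (u n)).
  move=> m0; rewrite -[ln m + 1](ulim_cst (U := U)) -[X in _ - X](ulim_cst (U := U)).
  rewrite -ulimM //; last exact: ubnd_cst.
  have bM : ubnd U (fun n => u n * (ln m + 1)) by apply: ubndM => //; exact: ubnd_cst.
  rewrite -ulimN; last exact: ubnd_cst.
  rewrite -ulimD //; last by apply: ubndN; exact: ubnd_cst.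
  apply: ulim_le => //; first by apply: ubndD => //; apply: ubndN; exact: ubnd_cst.
  by apply: nearW => n; apply: xlogx_tangent => //; case/andP: (hu n).
move: l0; rewrite le_eqVlt => /orP[/eqP e|l0].
  rewrite -e xlogxE mul0r; apply/ler_addgt0Pr => m m0.
  by have := key m m0; rewrite -e mul0r; lra.
by have := key _ l0; rewrite xlogxE mulrDr mulr1 addrK.
Qed.

End XlogxLimits.

Section EntropyUsc.
Context {R : realType} {d : measure_display} {T : measurableType d}.

Lemma H_bound (m : set T -> R) (C : finType) (a : T -> C) : fap m -> mcode a ->
  `|H m a| <= ln #|C|%:R.
Proof. by move=> hm ma; rewrite ger0_norm ?H_ge0 // H_ln_card. Qed.

Lemma H_usc (U : set_system nat) {UU : UltraFilter U} (s : nat -> set T -> R) (m : set T -> R)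
  (C : finType) (a : T -> C) : (forall n, fap (s n)) -> mcode a ->
  (forall t, ulim U (s^~ (a @^-1` [set t])) = m (a @^-1` [set t])) ->
  ulim U (fun n => H (s n) a) <= H m a.
Proof.
move=> hs ma hm.
have b01 t n : 0 <= s n (a @^-1` [set t]) <= 1 by apply: fap_le1.
have bx t : ubnd U (fun n => xlogx (s n (a @^-1` [set t]))).
  by exists 1; apply: nearW => n; exact: xlogx_bound.
rewrite /H ulimN; last exact: ubnd_sum.
rewrite lerN2 ulim_sum //; apply: ler_sum => t _.
by rewrite -hm; apply: ulim_xlogx; exact: b01.
Qed.

End EntropyUsc.

Section Misiurewicz.
Context {R : realType} {dX : measure_display} {X : measurableType dX}.
Variables (dist : X -> X -> R) (f g : X -> X) (phi : X -> R).
Hypothesis dM : is_metric dist.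
Hypothesis dK : dcompact dist.
Hypothesis borel : @measurable dX X = <<s dopen dist >>.
Hypothesis fK : cancel f g.
Hypothesis gK : cancel g f.
Hypothesis cf : dcontinuous dist f.
Hypothesis cg : dcontinuous dist g.
Hypothesis cphi : rcontinuous dist phi.

Let fm := dcontinuous_measurable borel cf.

Section Empirical.
Variables (k : nat -> nat) (E : forall N, 'I_(k N) -> X).
Hypothesis k0 : forall N, (0 < k N)%N.

(* Index shift: the family [E N] is averaged along orbits of length [N.+1]. *)
Definition partZ N : R := \sum_i expR (birkhoff f phi (E (N:=N) i) N.+1).

Definition wgt N (i : 'I_(k N)) : R := expR (birkhoff f phi (E i) N.+1) / partZ N.

Definition orbit_weight N (A : set X) : R := \sum_(i | `[< A (E (N:=N) i) >]) wgt i.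

Definition emp N (A : set X) : R := N.+1%:R^-1 * \sum_(j < N.+1) orbit_weight N (iter j f @^-1` A).

Lemma partZ_gt0 N : 0 < partZ N.
Proof.
rewrite /partZ (bigD1 (Ordinal (k0 N))) //= ltr_pwDl ?expR_gt0 //.
by apply: sumr_ge0 => i _; exact: expR_ge0.
Qed.

Lemma wgt_ge0 N (i : 'I_(k N)) : 0 <= wgt i.
Proof. by rewrite divr_ge0 ?expR_ge0 // ltW // partZ_gt0. Qed.

Lemma wgt_sum N : \sum_(i < k N) wgt i = 1.
Proof. by rewrite -mulr_suml divff // gt_eqF // partZ_gt0. Qed.

Lemma orbit_weight_ge0 N A : 0 <= orbit_weight N A.
Proof. by apply: sumr_ge0 => i _; exact: wgt_ge0. Qed.

Lemma orbit_weight_T N : orbit_weight N setT = 1.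
Proof. by rewrite /orbit_weight -(wgt_sum N); apply: eq_bigl => i; apply/asboolP. Qed.

Lemma orbit_weightU N A B : A `&` B = set0 -> orbit_weight N (A `|` B) = orbit_weight N A + orbit_weight N B.
Proof.
move=> AB; rewrite /orbit_weight (bigID (fun i => `[< A (E (N:=N) i) >])) /=; congr (_ + _); apply: eq_bigl => i.
  apply/andP/asboolP => [[_ /asboolP]//|Ai]; split; apply/asboolP => //; by left.
apply/andP/asboolP => [[/asboolP[Ai|//] /asboolP nA]|Bi]; first by case: nA.
split; first by apply/asboolP; right.
apply/asboolPn => Ai; have : (A `&` B) (E (N:=N) i) by [].
by rewrite AB.
Qed.

Lemma orbit_weight_mono N A B : A `<=` B -> orbit_weight N A <= orbit_weight N B.
Proof.
move=> AB; rewrite -(setDUK AB) orbit_weightU ?lerDl ?orbit_weight_ge0 //.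
by rewrite setDE setICA setICr setI0.
Qed.

Lemma orbit_weight_le1 N A : orbit_weight N A <= 1.
Proof. by rewrite -(orbit_weight_T N); apply: orbit_weight_mono. Qed.

Lemma emp_fap N : fap (emp N).
Proof.
split => [|A _|A B _ _ AB].
- rewrite /emp (eq_bigr (fun=> 1)) => [|j _]; last by rewrite preimage_setT orbit_weight_T.
  by rewrite sumr_const card_ord mulVf // pnatr_eq0.
- by rewrite mulr_ge0 ?invr_ge0 // sumr_ge0 // => j _; exact: orbit_weight_ge0.
- rewrite -mulrDr -big_split /=; congr (_ * _); apply: eq_bigr => j _.
  by rewrite preimage_setU orbit_weightU // -preimage_setI AB preimage_set0.
Qed.

Lemma emp_shift (U : set_system nat) {UU : UltraFilter U} A : \oo `<=` U -> measurable A ->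
  ulim U (fun n => emp n (f @^-1` A)) = ulim U (emp^~ A).
Proof.
move=> Uoo mA.
have b1 : ubnd U (fun n => emp n (f @^-1` A)) by apply: fap_ubnd; [exact: emp_fap|exact: fm].
have b2 : ubnd U (fun n => emp n A) by apply: fap_ubnd; [exact: emp_fap|].
have key n : `|emp n (f @^-1` A) - emp n A| <= n.+1%:R^-1.
  rewrite /emp -mulrBr normrM ger0_norm ?invr_ge0 // ler_piMr ?invr_ge0 //.
  have -> : \sum_(j < n.+1) orbit_weight n (iter j f @^-1` (f @^-1` A)) =
      \sum_(j < n.+1) orbit_weight n (iter j.+1 f @^-1` A).
    by apply: eq_bigr => j _; congr orbit_weight; apply/funext => x; rewrite /preimage /= .
  rewrite -sumrB -(big_mkord xpredT (fun j => orbit_weight n (iter j.+1 f @^-1` A) - orbit_weight n (iter j f @^-1` A))).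
  rewrite telescope_sumr //.
  have h1 := orbit_weight_ge0 n (iter n.+1 f @^-1` A); have h2 := orbit_weight_le1 n (iter n.+1 f @^-1` A).
  have h3 := orbit_weight_ge0 n (iter 0 f @^-1` A); have h4 := orbit_weight_le1 n (iter 0 f @^-1` A).
  by rewrite ler_norml; apply/andP; split; move: h1 h2 h3 h4 => /=; lra.
have small (e : R) : 0 < e -> \forall n \near U, n.+1%:R^-1 <= e.
  move=> e0; apply: Uoo; have := near_infty_natSinv_lt (PosNum e0).
  by apply: filterS => n /ltW.
apply/eqP; rewrite eq_le; apply/andP; split; apply/ler_addgt0Pr => e e0.
  rewrite -[e](ulim_cst (U := U)) -ulimD //; last exact: ubnd_cst.
  apply: ulim_le => //; first by apply: ubndD => //; exact: ubnd_cst.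
  by apply: filterS (small e e0) => n hn; have := key n; move: hn; set v := (_^-1); rewrite ler_norml; lra.
rewrite -[e](ulim_cst (U := U)) -ulimD //; last exact: ubnd_cst.
apply: ulim_le => //; first by apply: ubndD => //; exact: ubnd_cst.
by apply: filterS (small e e0) => n hn; have := key n; move: hn; set v := (_^-1); rewrite ler_norml; lra.
Qed.

(** The finite-length form of the lower bound: [partZ] is expressed by the entropy of the weighted
    family, words of length [N.+1] are cut into windows of length [q], and concavity moves the
    average over starting times inside the entropy. *)
Lemma emp_entropy N (g0 : R) (C : finType) (a : X -> C) (c : C -> R) (e : R) q : mcode a ->
  separated dist f N.+1 g0 (@E N) -> 0 <= g0 ->
  (forall x y, a x = a y -> dist x y <= g0) -> (forall x, phi x <= c (a x) + e) ->
  (0 < q)%N ->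
  ln (partZ N) / N.+1%:R <= H (emp N) (word f a q) / q%:R + q%:R * ln #|C|%:R / N.+1%:R
    + \sum_t c t * emp N (a @^-1` [set t]) + e.
Proof.
move=> ma sep g00 ha hc q0.
pose p : 'I_(k N) -> R := @wgt N.
have p0 : forall i, 0 <= p i by move=> i; exact: wgt_ge0.
have p1 : \sum_i p i = 1 by exact: wgt_sum.
have Z0 := partZ_gt0 N.
have T0 : 0 < N.+1%:R :> R by rewrite ltr0n.
have q0' : 0 < q%:R :> R by rewrite ltr0n.
pose w (i : 'I_(k N)) := [ffun j : 'I_N.+1 => a (iter j f (E i))].
(* The weights [wgt] give equality in the variational inequality, and separation makes the word [w]
   determine the point, since equal words mean orbits within [g0]. *)
have lnZ : ln (partZ N) = ent p w + \sum_i p i * birkhoff f phi (E i) N.+1.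
  have -> : ent p w = ent p id.
    apply: ent_eq => // i j /=; apply/idP/idP => [/eqP/ffunP wij|/eqP -> //].
    apply: contraT => /sep; rewrite ltNge => /negP []; apply/dn_leP => // l lN.
    by apply: ha; have := wij (Ordinal lN); rewrite !ffunE.
  rewrite /ent -sumrN -big_split /=.
  have pE i : pm p id i = p i by rewrite /pm big_pred1_eq.
  transitivity (\sum_i p i * ln (partZ N)); first by rewrite -mulr_suml p1 mul1r.
  apply: eq_bigr => i _; rewrite pE xlogxE -mulrN -mulrDr; congr (_ * _).
  by rewrite /p /wgt ln_div ?posrE ?expR_gt0 // expRK; lra.
have mE0 A : N.+1%:R * emp N A = \sum_(j < N.+1) orbit_weight N (iter j f @^-1` A).
  by rewrite /emp mulrA divff ?mul1r // gt_eqF.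
have h1 := @ent_windows _ _ p p0 p1 C (fun j i => a (iter j f (E i))) q N.+1 q0.
have pmE j (v : {ffun 'I_q -> C}) :
    pm p (fun i => [ffun l : 'I_q => a (iter (j + l) f (E i))]) v =
    orbit_weight N (iter j f @^-1` (word f a q @^-1` [set v])).
  rewrite /pm /orbit_weight; apply: eq_bigl => i; apply/eqP/asboolP => [<-|<-];
  by apply/ffunP => l; rewrite !ffunE addnC iterD.
have h2 : \sum_(j < N.+1) ent p (fun i => [ffun l : 'I_q => a (iter (j + l) f (E i))]) <=
    N.+1%:R * H (emp N) (word f a q).
  rewrite /H mulrN -lerN2 opprK mulr_sumr -sumrN.
  under [leRHS]eq_bigr do rewrite /ent opprK.
  rewrite [leRHS]exchange_big /=; apply: ler_sum => v _.
  under [leRHS]eq_bigr do rewrite pmE.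
  set A := word f a q @^-1` _.
  have mE : N.+1%:R * emp N A = \sum_(j < N.+1) orbit_weight N (iter j f @^-1` A).
    by rewrite /emp mulrA divff ?mul1r // gt_eqF.
  have e0 : 0 <= emp N A by rewrite /emp mulr_ge0 ?invr_ge0 // sumr_ge0 // => *; exact: orbit_weight_ge0.
  move: e0; rewrite le_eqVlt => /orP[/eqP e0|e0].
    rewrite -e0 xlogxE mul0r mulr0 sumr_ge0 // => j _.
    have -> : orbit_weight N (iter j f @^-1` A) = 0.
      apply/eqP; rewrite eq_le orbit_weight_ge0 andbT.
      have : \sum_(i < N.+1) orbit_weight N (iter i f @^-1` A) = 0 by rewrite -mE -e0 mulr0.
      by rewrite (bigD1 j) //= => <-; rewrite lerDl sumr_ge0 // => *; exact: orbit_weight_ge0.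
    by rewrite xlogxE mul0r.
  (* Concavity of entropy, by the tangent at the mean [emp N A]. The case of mean zero was settled
     above: all terms then vanish. *)
  apply: (@le_trans _ _ (\sum_(j < N.+1) (orbit_weight N (iter j f @^-1` A) * (ln (emp N A) + 1) - emp N A))).
    rewrite sumrB -mulr_suml -mE sumr_const card_ord -mulr_natl xlogxE; lra.
  by apply: ler_sum => j _; apply: xlogx_tangent => //; exact: orbit_weight_ge0.
have h3 : \sum_i p i * birkhoff f phi (E i) N.+1 <=
    N.+1%:R * (\sum_t c t * emp N (a @^-1` [set t]) + e).
  apply: (@le_trans _ _ (\sum_i p i * \sum_(j < N.+1) (c (a (iter j f (E i))) + e))).
    by apply: ler_sum => i _; rewrite ler_wpM2l // /birkhoff; apply: ler_sum => j _; exact: hc.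
  under eq_bigr do rewrite mulr_sumr.
  rewrite exchange_big /=.
  have step (j : 'I_N.+1) : \sum_(i < k N) p i * (c (a (iter j f (E i))) + e) =
     \sum_t c t * orbit_weight N (iter j f @^-1` (a @^-1` [set t])) + e.
    under eq_bigr do rewrite mulrDr.
    rewrite big_split /= -mulr_suml p1 mul1r; congr (_ + _).
    rewrite (partition_big (fun i => a (iter j f (E i))) xpredT) //=; apply: eq_bigr => t _.
    rewrite /orbit_weight mulr_sumr; apply: eq_big => [i|i /eqP ->]; last by rewrite mulrC.
    by apply/eqP/asboolP.
  under eq_bigr do rewrite step.
  rewrite big_split /= sumr_const card_ord -[X in _ + X]mulr_natl mulrDr lerD2r.
  rewrite exchange_big /= mulr_sumr; apply: ler_sum => t _.
  by rewrite -mulr_sumr mulrCA mE0.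
have h4 : ent p w <= N.+1%:R * (H (emp N) (word f a q) / q%:R + q%:R * ln #|C|%:R / N.+1%:R).
  have -> : N.+1%:R * (H (emp N) (word f a q) / q%:R + q%:R * ln #|C|%:R / N.+1%:R) =
     (N.+1%:R * H (emp N) (word f a q) + q%:R * (q%:R * ln #|C|%:R)) / q%:R.
    by field; rewrite !gt_eqF.
  by rewrite ler_pdivlMr // mulrC; apply: le_trans h1 _; rewrite lerD2r.
rewrite ler_pdivrMr // lnZ mulrC -addrA mulrDr; exact: lerD.
Qed.

(** The ball code has cells of diameter at most [g0], as [emp_entropy] demands, and null boundaries,
    so for fixed [q] both entropy and average pass to the limit. The word length [q] is arbitrary,
    which yields the entropy rate. *)
Lemma misiurewicz (U : set_system nat) {UU : UltraFilter U} (g0 c : R) (P : probability X R) :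
  \oo `<=` U -> 0 < g0 -> (\forall N \near U, separated dist f N.+1 g0 (@E N)) ->
  (\forall N \near U, N.+1%:R * c <= ln (partZ N)) ->
  wlim dist U emp P -> inv_pr f P ->
  forall e, 0 < e -> exists (C : finType) (a : X -> C), mcode a /\
    c <= hh f (pr P) a + intr P phi + e.
Proof.
move=> Uoo g00 hsep hZ hw iP e e0.
have bphi := rcontinuous_bm dM dK borel cphi.
have e4 : 0 < e / 4 by rewrite divr_gt0.
(* Each radius is small for separation ([g0 / 2]), small for the oscillation of [phi], and carries
   no mass on its sphere. *)
have /choice[r hr] : forall x, exists r : R, [/\ 0 < r, r <= g0 / 2, pr P [set y | dist x y = r] = 0 &
    forall y, dist x y < r -> `|phi x - phi y| < e / 4].
  move=> x; have [s s0 hs] := cphi x e4.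
  have m0 : 0 < Num.min s (g0 / 2) by rewrite lt_min s0 divr_gt0.
  have [r [r0 rm hr]] := null_radius dM borel P x m0.
  move: rm; rewrite lt_min => /andP[rs rg]; exists r; split => //; first exact: ltW.
  by move=> y xy; apply: hs; exact: lt_trans rs.
have [n [z hz]] := finite_cover dM dK (r := r) (fun x => let: And4 h _ _ _ := hr x in h).
pose a := ballcode dist z (fun i => r (z i)).
have ma : mcode a by exact: mcode_ballcode.
pose c0 (t : {ffun 'I_n -> bool}) : R := if [pick i | t i] is Some i then phi (z i) else 0.
have hc0 x : `|phi x - c0 (a x)| <= e / 4.
  rewrite /c0; case: pickP => [i|h].
    by rewrite ffunE; have [_ _ _ hri] := hr (z i) => /hri h; rewrite distrC ltW.
  by have [i hi] := hz x; have := h i; rewrite ffunE hi.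
have ha x y : a x = a y -> dist x y <= g0.
  move=> axy; have [i hi] := hz x.
  have hi' : dist (z i) y < r (z i) by have /ffunP/(_ i) := axy; rewrite !ffunE hi => <-.
  have [_ rg _ _] := hr (z i).
  have := dist_tri dM x (z i) y; rewrite (distC dM x (z i)); lra.
exists {ffun 'I_n -> bool}, a; split => //.
have hI := intr_apx P bphi ma hc0.
rewrite -lerBlDr -lerBlDr; apply: hh_ge => //; first exact: pr_fap.
move=> q q0.
have T q' (w : {ffun 'I_q' -> {ffun 'I_n -> bool}}) : ulim U (emp^~ (word f a q' @^-1` [set w])) = pr P (word f a q' @^-1` [set w]).
  apply: wlim_ballword => //; first exact: emp_fap.
  by move=> i; have [] := hr (z i).
have T1 t : ulim U (emp^~ (a @^-1` [set t])) = pr P (a @^-1` [set t]).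
  have e1 : a @^-1` [set t] = word f a 1 @^-1` [set [ffun=> t]].
    apply/seteqP; split => x /=; first by move=> <-; apply/ffunP => i; rewrite !ffunE ord1.
    by move=> /ffunP/(_ ord0); rewrite !ffunE.
  by rewrite e1 T.
have mw : mcode (word f a q) by exact: mcode_word.
have bH : ubnd U (fun N => H (emp N) (word f a q) / q%:R).
  apply: ubndM; last exact: ubnd_cst.
  exists (ln #|{ffun 'I_q -> {ffun 'I_n -> bool}}|%:R); apply: nearW => N; apply: H_bound => //; exact: emp_fap.
have bS : ubnd U (fun N => \sum_t c0 t * emp N (a @^-1` [set t])).
  apply: ubnd_sum => t; apply: ubndM; first exact: ubnd_cst.
  by apply: fap_ubnd => //; exact: emp_fap.
have small : \forall N \near U, q%:R * ln #|{ffun 'I_n -> bool}|%:R / N.+1%:R <= e / 4.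
  apply: Uoo; have [K hK] := nat_ub (q%:R * ln #|{ffun 'I_n -> bool}|%:R / (e / 4)).
  exists K => // N /= KN; rewrite ler_pdivrMr ?ltr0n // [leRHS]mulrC -ler_pdivrMr //.
  by apply: le_trans hK _; rewrite ler_nat; exact: ltnW.
have main : c <= ulim U (fun N => H (emp N) (word f a q) / q%:R + \sum_t c0 t * emp N (a @^-1` [set t]) + (e / 4 + e / 4)).
  apply: ulim_gec; first by apply: ubndD; [exact: ubndD|exact: ubnd_cst].
  apply: filterS3 hsep hZ small => N sepN ZN sN.
  have hphi x : phi x <= c0 (a x) + e / 4 by have := hc0 x; rewrite ler_norml; lra.
  have := emp_entropy ma sepN (ltW g00) ha hphi q0.
  have : c <= ln (partZ N) / N.+1%:R by rewrite ler_pdivlMr ?ltr0n // mulrC.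
  move=> t1 t2; apply: (le_trans t1); apply: (le_trans t2).
  by rewrite [leRHS]addrA lerD2r addrAC lerD2l; exact: sN.
have hL : ulim U (fun N => H (emp N) (word f a q) / q%:R) <= H (pr P) (word f a q) / q%:R.
  rewrite ulimM; [|by exists (ln #|{ffun 'I_q -> {ffun 'I_n -> bool}}|%:R); apply: nearW => N; apply: H_bound => //; exact: emp_fap|exact: ubnd_cst].
  rewrite ulim_cst ler_pM2r ?invr_gt0 ?ltr0n //; apply: H_usc => //; [exact: emp_fap|move=> t; exact: T].
have hS : ulim U (fun N => \sum_t c0 t * emp N (a @^-1` [set t])) = \sum_t c0 t * pr P (a @^-1` [set t]).
  rewrite ulim_sum; last by move=> t; apply: ubndM; [exact: ubnd_cst|by apply: fap_ubnd => //; exact: emp_fap].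
  apply: eq_bigr => t _; rewrite ulimM; [|exact: ubnd_cst|by apply: fap_ubnd => //; exact: emp_fap].
  by rewrite ulim_cst T1.
move: main; rewrite ulimD; [|exact: ubndD|exact: ubnd_cst].
rewrite ulimD // ulim_cst hS; move: hI; rewrite ler_norml; lra.
Qed.

End Empirical.
End Misiurewicz.

(** * Expansivity and generators *)

Section Expansivity.
Context {R : realType} {X : Type} (dist : X -> X -> R) (f g : X -> X).
Hypothesis dM : is_metric dist.
Hypothesis dK : dcompact dist.
Hypothesis fK : cancel f g.
Hypothesis gK : cancel g f.
Hypothesis cf : dcontinuous dist f.
Hypothesis cg : dcontinuous dist g.

Lemma natSinv_small (e : R) : 0 < e -> exists k, k.+1%:R^-1 < e.
Proof. by move=> e0; have [k _ /(_ k (leqnn k)) /= h] := near_infty_natSinv_lt (PosNum e0); exists k. Qed.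

Lemma closed_sep (K L : set X) : dclosed dist K -> dclosed dist L -> K `&` L = set0 ->
  exists2 r : R, 0 < r & forall x y, K x -> L y -> r <= dist x y.
Proof.
move=> cK cL KL; apply: contrapT => hn.
have /choice[z hz] : forall n : nat, exists z : X * X, [/\ K z.1, L z.2 & dist z.1 z.2 < n.+1%:R^-1].
  move=> n; apply: contrapT => h; apply: hn; exists n.+1%:R^-1; first by rewrite invr_gt0.
  by move=> x y Kx Ly; rewrite leNgt; apply/negP => xy; apply: h; exists (x, y).
have [U [UU Uoo]] := free_ultraT.
have [x hx] := ultra_compact dM dK (U := U) (fun n => (z n).1).
have [y hy] := ultra_compact dM dK (U := U) (fun n => (z n).2).
have Kx : K x by apply: (ucvg_closed hx cK); apply: nearW => n; case: (hz n).
have Ly : L y by apply: (ucvg_closed hy cL); apply: nearW => n; case: (hz n).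
have xy : dist x y <= 0.
  apply/ler_addgt0Pr => e e0; rewrite add0r; apply: (ucvg_dist_le dM hx hy).
  have [k hk] := natSinv_small e0; apply: Uoo; exists k => // n /= kn.
  have [_ _ h] := hz n; apply: ltW; apply: lt_trans h _; apply: le_lt_trans hk.
  by rewrite lef_pV2 ?posrE ?ltr0Sn // ler_nat.
have exy : x = y by apply: (dist0 dM); apply/eqP; rewrite eq_le xy dist_ge0.
have : (K `&` L) x by split => //; rewrite exy.
by rewrite KL.
Qed.

(* Closed sets of points that have a partner at distance [r] shadowing them for times in
   [-h, h]; they decrease to a subset of [NE]. *)
Definition Bh (eps r : R) (h : nat) : set X := [set y | exists z, [/\ r <= dist y z,
  forall j, (j <= h)%N -> dist (iter j f y) (iter j f z) <= eps &
  forall j, (j <= h)%N -> dist (iter j g y) (iter j g z) <= eps]].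

Lemma Bh_closed eps r h : dclosed dist (Bh eps r h).
Proof.
move=> y ny; apply: contrapT => hn.
have /choice[u hu] : forall n : nat, exists u, dist y u < n.+1%:R^-1 /\ Bh eps r h u.
  move=> n; apply: contrapT => hh; apply: hn; exists n.+1%:R^-1; first by rewrite invr_gt0.
  by move=> u yu Bu; apply: hh; exists u.
have /choice[z hz] : forall n, exists z, [/\ r <= dist (u n) z,
    forall j, (j <= h)%N -> dist (iter j f (u n)) (iter j f z) <= eps &
    forall j, (j <= h)%N -> dist (iter j g (u n)) (iter j g z) <= eps].
  by move=> n; have [_ hB] := hu n.
have [U [UU Uoo]] := free_ultraT.
have uy : ucvg dist U u y.
  move=> e e0; have [k hk] := natSinv_small e0; apply: Uoo; exists k => // n /= kn.
  have [h1 _] := hu n; apply: lt_trans h1 _; apply: le_lt_trans hk.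
  by rewrite lef_pV2 ?posrE ?ltr0Sn // ler_nat.
have [w zw] := ultra_compact dM dK (U := U) z.
apply: ny; exists w; split.
- by apply: (ucvg_dist_ge dM uy zw); apply: nearW => n; case: (hz n).
- move=> j jh; apply: (ucvg_dist_le dM (ucvg_cont uy (dcontinuous_iter j cf)) (ucvg_cont zw (dcontinuous_iter j cf))).
  by apply: nearW => n; have [_ + _] := hz n; apply.
- move=> j jh; apply: (ucvg_dist_le dM (ucvg_cont uy (dcontinuous_iter j cg)) (ucvg_cont zw (dcontinuous_iter j cg))).
  by apply: nearW => n; have [_ _] := hz n; apply.
Qed.

Lemma Bh_decr eps r h : Bh eps r h.+1 `<=` Bh eps r h.
Proof. by move=> y [z [h1 h2 h3]]; exists z; split => // j jh; [apply: h2|apply: h3]; rewrite ltnW. Qed.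

Lemma iter_fK m : cancel (iter m f) (iter m g).
Proof. by elim: m => // m IH x; rewrite iterSr /= fK IH. Qed.

Lemma iter_gK m : cancel (iter m g) (iter m f).
Proof. by elim: m => // m IH x; rewrite iterSr /= gK IH. Qed.

Lemma GammaE eps x y : Gamma dist f eps x y <->
  (forall n, dist (iter n f x) (iter n f y) <= eps) /\
  (forall n, dist (iter n g x) (iter n g y) <= eps).
Proof.
split => -[h1 h2]; split => //.
  by move=> n; apply: (h2 n); exact: iter_gK.
by move=> m x' y' ex ey; have := h2 m; rewrite -ex -ey !iter_fK.
Qed.

Lemma Bh_cap eps r : 0 < r -> \bigcap_h Bh eps r h `<=` NE dist f eps.
Proof.
move=> r0 y hy; have /choice[z hz] : forall h : nat, exists z, [/\ r <= dist y z,
    forall j, (j <= h)%N -> dist (iter j f y) (iter j f z) <= eps &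
    forall j, (j <= h)%N -> dist (iter j g y) (iter j g z) <= eps].
  by move=> h; exact: (hy h).
have [U [UU Uoo]] := free_ultraT.
have [w zw] := ultra_compact dM dK (U := U) z.
have cy : ucvg dist U (fun=> y) y by move=> e e0; apply: nearW => n; rewrite distxx.
exists w.
  apply/GammaE; split => n.
    apply: (ucvg_dist_le dM (ucvg_cont cy (dcontinuous_iter n cf)) (ucvg_cont zw (dcontinuous_iter n cf))).
    by apply: Uoo; exists n => // m /= nm; have [_ + _] := hz m; apply.
  apply: (ucvg_dist_le dM (ucvg_cont cy (dcontinuous_iter n cg)) (ucvg_cont zw (dcontinuous_iter n cg))).
  by apply: Uoo; exists n => // m /= nm; have [_ _] := hz m; apply.
move=> wy; have : r <= dist y w.
  by apply: (ucvg_dist_ge dM cy zw); apply: nearW => n; case: (hz n).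
by rewrite wy distxx // leNgt r0.
Qed.

(** Closed pieces exhibiting [NE] as a countable union of closed sets, hence as a Borel set. *)
Definition NEk eps k : set X := \bigcap_h Bh eps k.+1%:R^-1 h.

Lemma NE_bigcup eps : NE dist f eps = \bigcup_k NEk eps k.
Proof.
apply/seteqP; split => [x [y /GammaE[h1 h2] yx]|x [k _]]; last first.
  by apply: Bh_cap; rewrite invr_gt0.
have d0 : 0 < dist x y.
  by rewrite lt_neqAle dist_ge0 // andbT eq_sym; apply/eqP => /(dist0 dM)/esym.
have [k hk] := natSinv_small d0; exists k => // h _; exists y; split => //; exact: ltW.
Qed.

Lemma NEk_closed eps k : dclosed dist (NEk eps k).
Proof. by apply: dclosed_bigcap => h _; exact: Bh_closed. Qed.

Lemma NE_inv eps : f @^-1` NE dist f eps = NE dist f eps.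
Proof.
apply/seteqP; split => x /= [y /GammaE[h1 h2] yx].
  exists (g y); last by move=> e; apply: yx; rewrite -e gK.
  apply/GammaE; split => [[|n]|n].
  - by have := h2 1%N; rewrite /= fK.
  - by have := h1 n; rewrite -iterSr (iterSr n f (g y)) gK.
  - by have := h2 n.+1; rewrite iterSr fK -iterSr.
exists (f y); last by move=> e; apply: yx; rewrite -(fK y) e fK.
apply/GammaE; split => [n|[|n]].
- by have := h1 n.+1; rewrite !iterSr.
- exact: (h1 1%N).
- by have := h2 n; rewrite !(iterSr n g) !fK.
Qed.

End Expansivity.

(** * Partitions of small Bowen diameter as generators *)

Section KolmogorovSinai.
Context {R : realType} {dX : measure_display} {X : measurableType dX}.
Variables (dist : X -> X -> R) (f g : X -> X).
Hypothesis dM : is_metric dist.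
Hypothesis dK : dcompact dist.
Hypothesis borel : @measurable dX X = <<s dopen dist >>.
Hypothesis fK : cancel f g.
Hypothesis gK : cancel g f.
Hypothesis cf : dcontinuous dist f.
Hypothesis cg : dcontinuous dist g.
Variable eps : R.

Let fm := dcontinuous_measurable borel cf.

Lemma NE_measurable : measurable (NE dist f eps).
Proof.
rewrite (NE_bigcup dM dK fK gK cf cg); apply: bigcupT_measurable => k.
apply: (measurable_closed borel); exact: NEk_closed.
Qed.

Lemma Bh_measurable r h : measurable (Bh dist f g eps r h).
Proof. by apply: (measurable_closed borel); exact: Bh_closed. Qed.

Lemma null_small (P : probability X R) (r e : R) : pr P (NE dist f eps) = 0 ->
  0 < r -> 0 < e -> exists h, pr P (Bh dist f g eps r h) < e.
Proof.
move=> P0 r0 e0; have [||h hh] := @pr_decr _ _ _ P (Bh dist f g eps r) e _ _ e0.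
- exact: Bh_measurable.
- exact: Bh_decr.
exists h; apply: lt_le_trans hh _; rewrite -[leRHS]add0r lerD2r -P0.
apply: pr_mono; [|exact: NE_measurable|exact: Bh_cap].
by apply: bigcapT_measurable => k; exact: Bh_measurable.
Qed.

Variable P : probability X R.
Hypothesis iP : inv_pr f P.
Hypothesis P0 : pr P (NE dist f eps) = 0.

Variables (n : nat) (C : finType) (a : X -> C).
Hypothesis n0 : (0 < n)%N.
Hypothesis ma : mcode a.
Hypothesis a_diam : forall x y, a x = a y -> dn dist f n x y <= eps.
Hypothesis eps0 : 0 < eps.

(* Two-sided itineraries, shifted by [n * N] so that only forward iterates occur. *)
Definition itin N x : {ffun 'I_(N + N).+1 -> C} := [ffun j : 'I_(N + N).+1 => a (iter (n * j) f x)].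

Lemma mcode_itin N : mcode (itin N).
Proof. by apply: mcode_ffun => j; exact: mcode_iter. Qed.

Lemma itin_close N x y : itin N x = itin N y ->
  forall i, (i < n * (N + N).+1)%N -> dist (iter i f x) (iter i f y) <= eps.
Proof.
move=> /ffunP e i hi.
have hj : (i %/ n < (N + N).+1)%N by rewrite ltn_divLR // mulnC.
have := e (Ordinal hj); rewrite !ffunE /= => /a_diam /(dn_leP dist f n _ _ (ltW eps0)).
move=> /(_ (i %% n)%N (ltn_pmod _ n0)); rewrite -!iterD addnC mulnC -divn_eq //.
Qed.

Lemma measurable_miscoded (V : finType) (b : X -> V) N (G : {ffun 'I_(N + N).+1 -> C} -> V) :
  mcode b -> measurable [set x | b (iter (n * N) f x) <> G (itin N x)].
Proof.
move=> mb; have mz : mcode (fun x => (b (iter (n * N) f x), itin N x)).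
  by apply: mcode_pair; [exact: mcode_iter|exact: mcode_itin].
have := mcode_set (fun z : V * {ffun 'I_(N + N).+1 -> C} => z.1 != G z.2) mz.
by congr measurable; apply/seteqP; split => x /= /eqP.
Qed.

(** Off a small set, two points with the same itinerary stay within [eps] for times in [[-h, h]] and
    avoid [Bh], so they are closer than [r]. Closed cores of distinct cells of [b] are at least [r]
    apart, so both points have the same value of [b]. *)
Lemma generating (V : finType) (b : X -> V) (k : R) : mcode b -> 0 < k ->
  exists N (G : {ffun 'I_(N + N).+1 -> C} -> V),
   pr P [set x | b (iter (n * N) f x) <> G (itin N x)] <= k.
Proof.
move=> mb k0.
have V0 : (0 < #|V|)%N by apply/card_gt0P; exists (b point).
have V0' : 0 < #|V|%:R :> R by rewrite ltr0n.
have k1 : 0 < k / 2 / #|V|%:R by rewrite !divr_gt0.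
have /choice[K hK] : forall v, exists K, [/\ dclosed dist K, K `<=` b @^-1` [set v] & pr P (b @^-1` [set v] `\` K) < k / 2 / #|V|%:R].
  by move=> v; exact: regular.
have /choice[rr hrr] : forall z : V * V, exists r : R, 0 < r /\ (z.1 != z.2 -> forall x y, K z.1 x -> K z.2 y -> r <= dist x y).
  move=> [v w] /=; have [->|vw] := eqVneq v w; first by exists 1.
  have [|||r r0 hr] := @closed_sep _ _ dist dM dK (K v) (K w).
  - by case: (hK v).
  - by case: (hK w).
  - rewrite -subset0 => x [Kv Kw]; have [_ h1 _] := hK v; have [_ h2 _] := hK w.
    by move/eqP: vw; apply; rewrite -(h1 x Kv) -(h2 x Kw).
  by exists r.
pose r := \big[Num.min/1]_(z : V * V) rr z.
have r0 : 0 < r by rewrite /r; elim/big_ind: _ => // [u v u0 v0|z _]; [rewrite lt_min u0|case: (hrr z)].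
have rle z : r <= rr z by apply: bigmin_le_cond.
have [h hh] := null_small P0 r0 (divr_gt0 k0 (@ltr0n R 2)).
pose Bad := \bigcup_(v in [set: V]) (b @^-1` [set v] `\` K v).
have mK v : measurable (b @^-1` [set v] `\` K v).
  by apply: measurableD; [exact: mb|apply: (measurable_closed borel); case: (hK v)].
have mBad : measurable Bad by apply: fin_bigcup_measurable => // v _; exact: mK.
have pBad : pr P Bad <= k / 2.
  apply: (@le_trans _ _ (\sum_(v <- enum V) pr P (b @^-1` [set v] `\` K v))).
    apply: pr_bigU_le => // x [v _ hx]; exists v => //; exact: enum_In.
  apply: (@le_trans _ _ (\sum_(v <- enum V) k / 2 / #|V|%:R)).
    by apply: ler_sum => v _; apply: ltW; case: (hK v).
  by rewrite big_enum sumr_const -[_ *+ _]mulr_natr divfK // gt_eqF.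
(* Since [n] is at least 1, [N = h] blocks of length [n] on each side cover the times [[-h, h]]. *)
pose N := h; pose good x := ~ Bad (iter (n * N) f x) /\ ~ Bh dist f g eps r h (iter (n * N) f x).
(* The guess is the value of [b] at any good point with this itinerary; all such points agree. The
   default only concerns itineraries without a good point. *)
pose G (u : {ffun 'I_(N + N).+1 -> C}) : V :=
  if pselect (exists x, good x /\ itin N x = u) is left e then b (iter (n * N) f (projT1 (cid e))) else b point.
exists N, G.
have nN : (h <= n * N)%N by rewrite leq_pmull.
have gE j x : (j <= n * N)%N -> iter j g (iter (n * N) f x) = iter (n * N - j) f x.
  by move=> jN; rewrite -{1}(subnKC jN) iterD iter_fK.
have sub : [set x | b (iter (n * N) f x) <> G (itin N x)] `<=` iter (n * N) f @^-1` (Bad `|` Bh dist f g eps r h).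
  move=> y /= hy; apply: contrapT => /not_orP[nb nB]; apply: hy.
  rewrite /G; case: pselect => [e|ne]; last by case: ne; exists y.
  case: (cid e) => x /= [[xb xB] xy].
  apply/eqP; apply: contraT => vw; exfalso.
  have inK z : ~ Bad z -> K (b z) z.
    by move=> nz; apply: contrapT => nK; apply: nz; exists (b z).
  have := (hrr (b (iter (n * N) f y), b (iter (n * N) f x))).2 vw _ _ (inK _ nb) (inK _ xb).
  move=> hd; apply: nB; exists (iter (n * N) f x); split.
  - exact: le_trans (rle _) hd.
  - move=> j jh; rewrite -!iterD; apply: (itin_close (esym xy)).
    have h1 : (n * N + n * N < n * (N + N).+1)%N by rewrite -mulnDr ltn_mul2l n0 ltnS leqnn.
    by apply: leq_ltn_trans h1; rewrite leq_add2r (leq_trans jh).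
  - move=> j jh; rewrite !gE ?(leq_trans jh) //; apply: (itin_close (esym xy)).
    have h1 : (n * N < n * (N + N).+1)%N by rewrite ltn_mul2l n0 ltnS leq_addr.
    by apply: leq_ltn_trans h1; exact: leq_subr.
have mB := Bh_measurable r h.
apply: (@le_trans _ _ (pr P (iter (n * N) f @^-1` (Bad `|` Bh dist f g eps r h)))).
  have mU : measurable (iter (n * N) f @^-1` (Bad `|` Bh dist f g eps r h)).
    by apply: (measurable_iter fm); exact: measurableU.
  apply: pr_mono mU sub.
  exact: (measurable_miscoded G mb).
have mBB : measurable (Bad `|` Bh dist f g eps r h) by exact: measurableU.
rewrite (fap_iter fm iP _ mBB).
apply: le_trans (prU_le P mBad mB) _; have := ltW hh; lra.
Qed.

(** The [n * l] letters of [b0] form [l] blocks, each nearly determined by [(N + N).+1] letters of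
    [a] sampled every [n] steps; in all [l + (N + N)] letters of [a] are used. Fano's inequality
    prices the errors at [e / 2] per block, and the overhead [N + N] vanishes as [l] grows. *)
Lemma kolmogorov_sinai (D : finType) (b0 : X -> D) : mcode b0 ->
  hh f (pr P) b0 <= H (pr P) a / n%:R.
Proof.
move=> mb0; apply/ler_addgt0Pr => e e0.
have e4 : 0 < e / 4 by rewrite divr_gt0.
pose V : finType := {ffun 'I_n -> D}.
pose b : X -> V := word f b0 n.
have mb : mcode b by exact: mcode_word.
have n0' : 0 < n%:R :> R by rewrite ltr0n.
(* Chosen so that [- ln (1 - e')] is [e / 4]; [Lg] then makes the mass of wrong guesses cost at most
   another [e / 4]. *)
pose e' := 1 - expR (- (e / 4)).
have x1 : expR (- (e / 4)) < 1 by rewrite expR_lt1 oppr_lt0.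
have e'0 : 0 < e' by rewrite subr_gt0.
have e'1 : e' < 1 by rewrite ltrBlDr ltrDl expR_gt0.
pose Lg := `|ln #|V|%:R - ln e'| + 1.
have Lg0 : 0 < Lg by rewrite ltr_wpDl.
have k0 : 0 < e / 4 / Lg by rewrite divr_gt0.
have [N [G hG]] := generating mb k0.
pose om := e / 2.
have key l : H (pr P) (word f b0 (n * l)) <= (l + (N + N))%:R * H (pr P) a + l%:R * om.
  pose c x := [ffun j : 'I_(l + (N + N)) => a (iter (n * j) f x)].
  pose bl x := [ffun j : 'I_l => b (iter (n * j) f x)].
  (* The blocks are read [n * N] steps late, in the middle of their two-sided itineraries. *)
  pose Z x := (c x, (bl \o iter (n * N) f) x).
  have mc : mcode c by apply: mcode_ffun => j; exact: mcode_iter.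
  have mbl : mcode bl by apply: mcode_ffun => j; exact: mcode_iter.
  have mbl' : mcode (bl \o iter (n * N) f) by exact: mcode_iter.
  have mZ : mcode Z by exact: mcode_pair.
  have fP := pr_fap P.
  have p0 := jd_ge0 fP mZ; have p1 := jd_sum fP mZ.
  have h1 : H (pr P) (word f b0 (n * l)) <= ent (jd (pr P) Z) snd.
    have -> : ent (jd (pr P) Z) snd = H (pr P) bl.
      by rewrite -(H_ent fP snd mZ) -(H_iter fm iP (n * N) mbl).
    apply: H_le => //; first exact: mcode_word.
    move=> x y /ffunP exy; apply/ffunP => i; rewrite !ffunE.
    have hi := ltn_ord i; have hj : (i %/ n < l)%N by rewrite ltn_divLR // [(l * n)%N]mulnC.
    have := exy (Ordinal hj); rewrite !ffunE /= => /ffunP/(_ (Ordinal (ltn_pmod i n0))).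
    by rewrite !ffunE /= -!iterD addnC mulnC -divn_eq.
  have h2 : ent (jd (pr P) Z) fst <= (l + (N + N))%:R * H (pr P) a.
    apply: le_trans (@ent_fam _ _ _ p0 p1 'I_(l + (N + N)) C _ (fun i z => z.1 i) (enum 'I_(l + (N + N))) fst _) _.
      by move=> [s1 s2] [s1' s2'] h; apply/ffunP => i; apply: (h i); rewrite mem_enum.
    rewrite big_enum /= (eq_bigr (fun=> H (pr P) a)).
      by rewrite sumr_const card_ord mulr_natl.
    move=> i _; rewrite -(H_ent fP (fun z : {ffun 'I_(l + (N + N)) -> C} * {ffun 'I_l -> V} => z.1 i) mZ) -(H_iter fm iP (n * i) ma).
    by congr H; apply/funext => x; rewrite /= ffunE.
  apply: (le_trans h1).
  (* The letters [j] to [j + (N + N)] of the long code, that is the itinerary at time [n * j]; the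
     index is always in range, so the default is never taken. *)
  pose hx (j : 'I_l) (u : {ffun 'I_(l + (N + N)) -> C}) : {ffun 'I_(N + N).+1 -> C} :=
    [ffun i : 'I_(N + N).+1 => if insub (j + i)%N is Some i' then u i' else a point].
  apply: le_trans (@ent_fam_cent _ _ _ p0 p1 'I_l V _ _ _ (fun j z => z.2 j) (enum 'I_l) snd fst hx _) _.
    by move=> [s1 s2] [s1' s2'] h; apply/ffunP => i; apply: (h i); rewrite mem_enum.
  apply: lerD => //.
  rewrite big_enum /= -[l in leRHS]card_ord mulr_natl -sumr_const; apply: ler_sum => j _.
  have hxE x : hx j (c x) = itin N (iter (n * j) f x).
    apply/ffunP => i; rewrite !ffunE.
    have ij : (j + i < l + (N + N))%N.
      by have := ltn_ord j; have := ltn_ord i; rewrite ltnS => h5 h6; rewrite -addSn leq_add.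
    by rewrite insubT /= ffunE /= mulnDr addnC iterD.
  apply: le_trans (@cent_fano _ _ _ p0 p1 V _ (fun z => z.2 j) (hx j \o fst) G (e / 4 / Lg) e' e'0 e'1 _) _.
    rewrite /jd -(fap_bigU fP (fun s : {ffun 'I_(l + (N + N)) -> C} * {ffun 'I_l -> V} => s.2 j != G ((hx j \o fst) s)) mZ).
    apply: le_trans hG; rewrite -(fap_iter fm iP (n * j) (measurable_miscoded G mb)).
    rewrite le_eqVlt; apply/orP; left; apply/eqP; congr (pr P _).
    have e1 x : bl (iter (n * N) f x) j = b (iter (n * N) f (iter (n * j) f x)).
      by rewrite ffunE -!iterD addnC.
    by apply/seteqP; split => x /=; rewrite hxE e1 => /eqP.
  have -> : - ln (1 - e') = e / 4 by rewrite /e' subKr expRK opprK.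
  have : e / 4 / Lg * (ln #|V|%:R - ln e') <= e / 4.
    rewrite -mulrA ler_piMr ?(ltW e4) // mulrC ler_pdivrMr // mul1r.
    by apply: le_trans (ler_norm _) _; rewrite lerDl.
  by rewrite /om; lra.
have [l0 hl0] := nat_ub ((N + N)%:R * H (pr P) a / (e / 2)).
pose l := l0.+1.
have l0' : 0 < l%:R :> R by rewrite ltr0n.
have nl : (0 < n * l)%N by rewrite muln_gt0 n0.
apply: le_trans (hh_le (pr_fap P) fm mb0 nl) _.
rewrite natrM ler_pdivrMr ?mulr_gt0 //.
apply: le_trans (key l) _; rewrite natrD mulrDl.
have -> : (H (pr P) a / n%:R + e) * (n%:R * l%:R) = l%:R * H (pr P) a + n%:R * (l%:R * e).
  by field; rewrite gt_eqF.
have h3 : (N + N)%:R * H (pr P) a <= l%:R * (e / 2).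
  rewrite -ler_pdivrMr ?divr_gt0 //; apply: le_trans hl0 _; rewrite ler_nat; exact: leqnSn.
have h4 : l%:R * e <= n%:R * (l%:R * e).
  by rewrite ler_peMl ?mulr_ge0 ?(ltW e0) // ler1n.
by move: h3 h4; rewrite /om; lra.
Qed.

End KolmogorovSinai.

(** * Ergodic selection *)

Section ErgodicSelection.
Context {R : realType} {dX : measure_display} {X : measurableType dX}.
Variables (dist : X -> X -> R) (f g : X -> X).
Hypothesis dM : is_metric dist.
Hypothesis dK : dcompact dist.
Hypothesis borel : @measurable dX X = <<s dopen dist >>.
Hypothesis fK : cancel f g.
Hypothesis gK : cancel g f.
Hypothesis cf : dcontinuous dist f.
Hypothesis cg : dcontinuous dist g.

Let fm := dcontinuous_measurable borel cf.

Lemma inv_pr_cond (P Q : probability X R) A : measurable A -> f @^-1` A = A -> inv_pr f P ->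
  (forall B, measurable B -> pr Q B = pr P (B `&` A) / pr P A) -> inv_pr f Q.
Proof.
move=> mA iA iP hQ B mB; rewrite !hQ //; last exact: fm.
have e1 : f @^-1` B `&` A = f @^-1` (B `&` A) by rewrite preimage_setI iA.
by rewrite e1 iP //; exact: measurableI.
Qed.

Section CodeLimit.
Context (U : set_system nat) {UU : UltraFilter U}.
Variables (s : nat -> probability X R) (P : probability X R) (C : finType) (a : X -> C).
Hypothesis ma : mcode a.
Hypothesis is_ : forall n, inv_pr f (s n).
Hypothesis sP : wlim dist U (fun n => pr (s n)) P.
Hypothesis tight : forall e, 0 < e -> exists K : C -> set X,
  (forall v, dclosed dist (K v) /\ K v `<=` a @^-1` [set v]) /\
  forall n, pr (s n) (~` \bigcup_v K v) <= e.

(** Closed cores of uniformly almost full mass give an upper bound for the limit mass of each word.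
    Since the masses sum to 1 before and after the limit, all these inequalities are equalities. *)
Lemma closed_code_lim q (w : {ffun 'I_q -> C}) :
  ulim U (fun n => pr (s n) (word f a q @^-1` [set w])) = pr P (word f a q @^-1` [set w]).
Proof.
have mw u : measurable (word f a q @^-1` [set u]) by exact: (mcode_word fm).
have bd A : measurable A -> ubnd U (fun n => pr (s n) A).
  by move=> mA; apply: (fap_ubnd (s := fun n => pr (s n))) => // n; exact: pr_fap.
have le u : ulim U (fun n => pr (s n) (word f a q @^-1` [set u])) <= pr P (word f a q @^-1` [set u]).
  apply/ler_addgt0Pr => e e0; have e1 : 0 < e / q.+1%:R by rewrite divr_gt0.
  have [K [hK hs]] := tight e1; pose O := ~` \bigcup_v K v.
  pose KW := \bigcap_(i in [set: 'I_q]) (iter i f @^-1` K (u i)).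
  have cKW : dclosed dist KW.
    by apply: dclosed_bigcap => i _; apply: dclosed_preimage; [exact: dcontinuous_iter|case: (hK (u i))].
  have KWw : KW `<=` word f a q @^-1` [set u].
    by move=> x hx; apply/ffunP => i; rewrite ffunE; apply: (hK (u i)).2; exact: hx.
  have mKW := measurable_closed borel cKW.
  have defect_measurable : measurable O.
    apply: measurableC; apply: fin_bigcup_measurable => // v _.
    by apply: (measurable_closed borel); case: (hK v).
  have step n : pr (s n) (word f a q @^-1` [set u]) <= pr (s n) KW + e.
    have mD := measurableD (mw u) mKW.
    rewrite -(setDUK KWw) prU //; last by rewrite setDE setICA setICr setI0.
    rewrite lerD2l; apply: (@le_trans _ _ (\sum_(i <- enum 'I_q) pr (s n) (iter i f @^-1` O))).
      apply: pr_bigU_le => //; first by move=> i; exact: (measurable_iter fm).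
      move=> x [xw nK]; apply: contrapT => hn; apply: nK => i _ /=.
      have : ~ O (iter i f x) by move=> Ox; apply: hn; exists i => //; exact: enum_In.
      move=> /contrapT[v _ Kv]; have -> : u i = v.
        by have := (hK v).2 _ Kv; rewrite /= -xw ffunE.
      exact: Kv.
    rewrite big_enum /= (eq_bigr (fun=> pr (s n) O)) => [|i _].
      rewrite sumr_const card_ord; apply: (@le_trans _ _ ((e / q.+1%:R) *+ q)).
        by rewrite lerMn2r hs orbT.
      rewrite -mulr_natr -mulrA ler_piMr ?(ltW e0) // mulrC ler_pdivrMr ?ltr0n // mul1r ler_nat.
      exact: leqnSn.
    by rewrite (fap_iter fm (is_ n)).
  apply: (@le_trans _ _ (ulim U (fun n => pr (s n) KW + e))).
    by apply: ulim_le; [exact: bd|apply: ubndD; [exact: bd|exact: ubnd_cst]|exact: nearW].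
  rewrite ulimD; [|exact: bd|exact: ubnd_cst]; rewrite ulim_cst lerD2r.
  by apply: le_trans (sP.2 KW cKW) _; exact: pr_mono.
have hsum : \sum_u (pr P (word f a q @^-1` [set u]) - ulim U (fun n => pr (s n) (word f a q @^-1` [set u]))) = 0.
  rewrite sumrB (jd_sum (pr_fap P) (mcode_word fm (n := q) ma)) -ulim_sum => [|u]; last exact: bd.
  rewrite (_ : (fun n => _) = fun=> 1) ?ulim_cst ?subrr //.
  by apply/funext => n; exact: (jd_sum (pr_fap (s n)) (mcode_word fm (n := q) ma)).
apply/eqP; rewrite eq_sym -subr_eq0; apply/eqP.
by apply: (psumr_eq0P _ hsum) => // u _; rewrite subr_ge0.
Qed.

Lemma code_lim t : ulim U (fun n => pr (s n) (a @^-1` [set t])) = pr P (a @^-1` [set t]).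
Proof.
have -> : a @^-1` [set t] = word f a 1 @^-1` [set [ffun=> t]].
  apply/seteqP; split => x /=; first by move=> <-; apply/ffunP => i; rewrite !ffunE ord1.
  by move=> /ffunP/(_ ord0); rewrite !ffunE.
exact: closed_code_lim.
Qed.

Lemma hh_ubnd : ubnd U (fun n => hh f (pr (s n)) a).
Proof.
exists (ln #|C|%:R); apply: nearW => n.
by rewrite ger0_norm ?hh_ge0 ?hh_ln_card //; exact: pr_fap.
Qed.

Lemma hh_usc : ulim U (fun n => hh f (pr (s n)) a) <= hh f (pr P) a.
Proof.
apply: hh_ge => //; first exact: pr_fap.
move=> q q0; rewrite ler_pdivlMr ?ltr0n // mulrC.
have mq : mcode (word f a q) by exact: (mcode_word fm).
have bH : ubnd U (fun n => H (pr (s n)) (word f a q)).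
  exists (ln #|{ffun 'I_q -> C}|%:R); apply: nearW => n; apply: H_bound => //; exact: pr_fap.
rewrite -[q%:R](ulim_cst (U := U)) -ulimM; [|exact: ubnd_cst|exact: hh_ubnd].
apply: (@le_trans _ _ (ulim U (fun n => H (pr (s n)) (word f a q)))).
  apply: ulim_le => //; first by apply: ubndM; [exact: ubnd_cst|exact: hh_ubnd].
  apply: nearW => n; rewrite mulrC -ler_pdivlMr ?ltr0n //.
  by apply: (hh_le (pr_fap _) fm).
apply: (H_usc (s := fun n => pr (s n))) => // [n|t]; first exact: pr_fap.
exact: closed_code_lim.
Qed.

End CodeLimit.

(** For singular [P] and [Q], take disjoint closed sets carrying more than half of each, at distance
    at least [r]. On a net finer than [r / 2], the complement of the balls that meet the first set
    misses it and contains the second. *)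
Lemma separating_family : exists (I : nat -> finType) (F : forall n : nat, I n -> set X),
  (forall n i, dclosed dist (F n i)) /\
  forall (P Q : probability X R) A, measurable A -> pr P A = 1 -> pr Q A = 0 ->
    exists n i, pr P (F n i) <> pr Q (F n i).
Proof.
have /choice[z hz] : forall n : nat, exists z : {N : nat & 'I_N -> X},
    forall x, exists i, dist (projT2 z i) x < n.+1%:R^-1.
  move=> n; have n0 (_ : X) : 0 < n.+1%:R^-1 :> R by rewrite invr_gt0.
  by have [N [c hc]] := finite_cover dM dK n0; exists (existT _ N c).
exists (fun n => {set 'I_(projT1 (z n))} : finType).
exists (fun n (t : {set 'I_(projT1 (z n))}) => ~` \bigcup_(i in [set i | i \in t]) [set y | dist (projT2 (z n) i) y < n.+1%:R^-1]).
split; first by move=> n t; apply: dclosedC; apply: dopen_bigcup => i _; exact: dopen_ball.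
move=> P Q A mA PA QA; have h2 : 0 < 1 / 2 :> R by rewrite divr_gt0.
have [K [cK KA hK]] := regular dM borel P mA h2.
have [L [cL LA hL]] := regular dM borel Q (measurableC mA) h2.
have mK := measurable_closed borel cK; have mL := measurable_closed borel cL.
have KL : K `&` L = set0 by rewrite -subset0 => x [/KA ? /LA].
have [r r0 hr] := closed_sep dM dK cK cL KL.
have [n hn] := natSinv_small (divr_gt0 r0 (@ltr0n R 2)).
exists n, [set i : 'I_(projT1 (z n)) | `[< exists2 x, K x & dist (projT2 (z n) i) x < n.+1%:R^-1 >]]%SET.
set F := ~` _.
have family_measurable : measurable F.
  by apply: (measurable_closed borel); apply: dclosedC; apply: dopen_bigcup => i _; exact: dopen_ball.
have PF : pr P F < 1 / 2.
  apply: le_lt_trans hK; rewrite prD // PA -(prC P mK); apply: pr_mono => //; first exact: measurableC.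
  move=> x Fx Kx; apply: Fx; have [i hi] := hz n x; exists i => //=.
  by rewrite inE; apply/asboolP; exists x.
have QF : 1 / 2 < pr Q F.
  move: hL; rewrite prD //; last exact: measurableC.
  rewrite prC // QA => hL; apply: (@lt_le_trans _ _ (pr Q L)); first lra.
  apply: pr_mono => // y Ly [i /=]; rewrite inE => /asboolP[x Kx xi] yi.
  have := hr x y Kx Ly; have := dist_tri dM x (projT2 (z n) i) y; rewrite (distC dM x (projT2 (z n) i)) => h3 h4.
move: xi yi hn; set v := (n.+1%:R^-1); lra.
by move=> e; move: PF; rewrite e; lra.
Qed.

Section Maximiser.
Variables (C : finType) (a : X -> C) (c : C -> R).
Variables (I : nat -> finType) (F : forall n : nat, I n -> set X).
Arguments F : clear implicits.
Variables (K : nat -> C -> set X) (B k : R).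
Hypothesis ma : mcode a.
Hypothesis cF : forall n i, dclosed dist (F n i).
Hypothesis cK : forall j v, dclosed dist (K j v) /\ K j v `<=` a @^-1` [set v].
Hypothesis k0 : 0 < k.
Hypothesis B0 : 0 < B.
Hypothesis sepF : forall (P Q : probability X R) A, measurable A -> pr P A = 1 -> pr Q A = 0 ->
    exists n i, pr P (F n i) <> pr Q (F n i).
Context (U : set_system nat) {UU : UltraFilter U}.
Hypothesis Uoo : \oo `<=` U.

Let O j := ~` \bigcup_v K j v.
Let om n : R := (2 ^+ n.+1)^-1 / #|I n|%:R.

(* [O j] is an open set off which [a] is locally constant; penalising its mass with weights
   tending to infinity makes the entropy rate of [a] upper semicontinuous on sublevel sets. *)
Definition penal L (m : set X -> R) := \sum_(j < L) B * 2 ^+ j * m (O j).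
Definition sqs L (m : set X -> R) := \sum_(n < L) om n * \sum_i m (F n i) ^+ 2.
Definition code_mean (m : set X -> R) := \sum_t c t * m (a @^-1` [set t]).
Definition penal_lim m := ulim U (fun L => penal L m).
Definition sqs_lim m := ulim U (fun L => sqs L m).
Definition tilted_energy m := hh f m a + code_mean m + k * sqs_lim m - penal_lim m.
Definition tame (m : set X -> R) := exists b, forall L, penal L m <= b.

Lemma family_measurable n i : measurable (F n i). Proof. exact: (measurable_closed borel). Qed.
Lemma defect_open j : dopen dist (O j).
Proof.
have -> : O j = \bigcap_v ~` K j v by rewrite /O setC_bigcup.
rewrite -(setCK (\bigcap_v _)); apply: contrapT => hn; apply: hn.
rewrite setC_bigcap.
suff : dclosed dist (\bigcup_v K j v).
  by rewrite /dclosed; congr (dopen _ (~` _)); apply: eq_bigcup => // v _; rewrite setCK.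
suff h : forall r : seq C, dclosed dist (\bigcup_(v in [set v | v \in r]) K j v).
  have := h (enum C); rewrite (_ : [set v | v \in enum C] = setT) //.
  by apply/seteqP; split => v //= _; rewrite mem_enum.
elim => [|v r IH].
  have -> : \bigcup_(v in [set v | v \in [::]]) K j v = set0 by rewrite -subset0 => x [v /=]; rewrite in_nil.
  exact: dclosed0.
rewrite (_ : \bigcup_(_ in _) _ = K j v `|` \bigcup_(v in [set v | v \in r]) K j v).
  by apply: dclosedU => //; case: (cK j v).
apply/seteqP; split => x.
  by move=> [u /=]; rewrite inE => /orP[/eqP ->|ur] Kx; [left|right; exists u].
by move=> [Kx|[u ur Kx]]; [exists v|exists u] => //=; rewrite inE ?eqxx // ur orbT.
Qed.
Lemma defect_measurable j : measurable (O j). Proof. by apply: (measurable_open borel); exact: defect_open. Qed.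

Lemma penal_term_ge0 (P : probability X R) j : 0 <= B * 2 ^+ j * pr P (O j).
Proof. by rewrite !mulr_ge0 ?exprn_ge0 ?pr_ge0 ?(ltW B0). Qed.

Lemma penal_mono (P : probability X R) L L' : (L <= L')%N -> penal L (pr P) <= penal L' (pr P).
Proof.
move=> LL; rewrite -(subnKC LL); elim: (L' - L)%N => [|n IH]; first by rewrite addn0.
by rewrite addnS /penal big_ord_recr /= ler_wpDr // penal_term_ge0.
Qed.

Lemma tame_ubnd (P : probability X R) : tame (pr P) -> ubnd U (fun L => penal L (pr P)).
Proof.
move=> [b hb]; exists b; apply: nearW => L; rewrite ger0_norm //.
by apply: sumr_ge0 => j _; exact: penal_term_ge0.
Qed.

Lemma penal_le_lim (P : probability X R) L : tame (pr P) -> penal L (pr P) <= penal_lim (pr P).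
Proof.
move=> hP; apply: ulim_gec; first exact: tame_ubnd.
by apply: Uoo; exists L => // L' /= LL; exact: penal_mono.
Qed.

Lemma sq_term (P : probability X R) n : 0 <= om n * \sum_i pr P (F n i) ^+ 2 <= (2 ^+ n.+1)^-1.
Proof.
have o0 : 0 <= om n by rewrite mulr_ge0 ?invr_ge0 ?exprn_ge0.
rewrite mulr_ge0 ?sumr_ge0 //=; last by move=> i _; exact: sqr_ge0.
have [I0|I0] := eqVneq #|I n| 0%N.
  by rewrite /om I0 invr0 mulr0 mul0r invr_ge0 exprn_ge0.
rewrite /om -mulrA ler_piMr ?invr_ge0 ?exprn_ge0 // mulrC ler_pdivrMr ?ltr0n ?lt0n // mul1r.
rewrite -sumr_const; apply: ler_sum => i _; rewrite exprn_ile1 ?pr_ge0 //.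
by apply: pr_le1; exact: family_measurable.
Qed.

Lemma sqs_mono (P : probability X R) L L' : (L <= L')%N -> sqs L (pr P) <= sqs L' (pr P).
Proof.
move=> LL; rewrite -(subnKC LL); elim: (L' - L)%N => [|n IH]; first by rewrite addn0.
by rewrite addnS /sqs big_ord_recr /= ler_wpDr //; have /andP[] := sq_term P (L + n).
Qed.

Lemma sqs_tail (P : probability X R) L L' : (L <= L')%N ->
  sqs L' (pr P) + (2 ^+ L')^-1 <= sqs L (pr P) + (2 ^+ L)^-1.
Proof.
move=> LL; rewrite -(subnKC LL); elim: (L' - L)%N => [|n IH]; first by rewrite addn0.
apply: le_trans IH; rewrite addnS /sqs big_ord_recr /= -/(sqs _ _) -addrA lerD2l.
have /andP[_ h] := sq_term P (L + n); apply: le_trans (lerD h (lexx _)) _.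
have -> : 2 ^- (L + n) = 2 ^- (L + n).+1 + 2 ^- (L + n).+1 :> R by rewrite exprS; field; rewrite expf_neq0.
by [].
Qed.

Lemma sqs_01 (P : probability X R) L : 0 <= sqs L (pr P) <= 1.
Proof.
have := sqs_tail P (leq0n L); rewrite {2}/sqs big_ord0 add0r expr0 invr1 => h.
have h0 : 0 <= (2 ^+ L)^-1 :> R by rewrite invr_ge0 exprn_ge0.
apply/andP; split; last lra.
by have := sqs_mono P (leq0n L); rewrite {1}/sqs big_ord0.
Qed.

Lemma sqs_ubnd (P : probability X R) : ubnd U (fun L => sqs L (pr P)).
Proof. by apply: ubnd01 => L; exact: sqs_01. Qed.

Lemma sqs_lim_01 (P : probability X R) : 0 <= sqs_lim (pr P) <= 1.
Proof.
apply/andP; split; [apply: ulim_gec|apply: ulim_lec]; try exact: sqs_ubnd;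
  by apply: nearW => L; have /andP[] := sqs_01 P L.
Qed.

Lemma sqs_lim_tail (P : probability X R) L : sqs L (pr P) <= sqs_lim (pr P) <= sqs L (pr P) + (2 ^+ L)^-1.
Proof.
apply/andP; split; [apply: ulim_gec|apply: ulim_lec]; try exact: sqs_ubnd;
  apply: Uoo; exists L => // L' /= LL; first exact: sqs_mono.
have := sqs_tail P LL; have h0 : 0 <= (2 ^+ L')^-1 :> R by rewrite invr_ge0 exprn_ge0.
lra.
Qed.

Definition code_mean_max := \sum_t `|c t|.

Lemma code_mean_bound (P : probability X R) : `|code_mean (pr P)| <= code_mean_max.
Proof.
apply: le_trans (ler_norm_sum _ _ _) _; apply: ler_sum => t _.
by rewrite normrM ler_piMr // ger0_norm ?pr_ge0 // pr_le1.
Qed.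

Lemma tilted_energy_le (P : probability X R) : tame (pr P) ->
  tilted_energy (pr P) <= ln #|C|%:R + code_mean_max + k - penal_lim (pr P).
Proof.
move=> tP; rewrite /tilted_energy lerD2r; apply: lerD; first apply: lerD.
- by apply: hh_ln_card => //; exact: pr_fap.
- by apply: le_trans (ler_norm _) _; exact: code_mean_bound.
- by rewrite ler_piMr ?(ltW k0) //; have /andP[] := sqs_lim_01 P.
Qed.

Lemma penal_lim_ge0 (P : probability X R) : tame (pr P) -> 0 <= penal_lim (pr P).
Proof. by move=> tP; apply: le_trans (penal_le_lim 0 tP); rewrite /penal big_ord0. Qed.

(* The squares make the functional strictly convex, so a maximiser is not a proper mixture. *)
Lemma tilted_energy_mix (P P1 P2 : probability X R) t A : inv_pr f P -> inv_pr f P1 -> inv_pr f P2 ->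
  tame (pr P) -> 0 < t < 1 -> measurable A -> pr P1 A = 1 -> pr P2 A = 0 ->
  (forall D, measurable D -> pr P D = t * pr P1 D + (1 - t) * pr P2 D) ->
  [/\ tame (pr P1), tame (pr P2) & tilted_energy (pr P) < t * tilted_energy (pr P1) + (1 - t) * tilted_energy (pr P2)].
Proof.
move=> iP i1 i2 tP /andP[t0 t1] mA PA QA hP; have t1' : 0 < 1 - t by rewrite subr_gt0.
have penE L : penal L (pr P) = t * penal L (pr P1) + (1 - t) * penal L (pr P2).
  rewrite /penal !mulr_sumr -big_split /=; apply: eq_bigr => j _; rewrite hP; last exact: defect_measurable.
  by ring.
have pen0 Q L : 0 <= penal L (pr Q) by apply: sumr_ge0 => j _; exact: penal_term_ge0.
have T1 : tame (pr P1).
  have [b hb] := tP; exists (b / t) => L; rewrite ler_pdivlMr // mulrC.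
  by apply: le_trans (hb L); rewrite penE lerDl mulr_ge0 ?(ltW t1').
have T2 : tame (pr P2).
  have [b hb] := tP; exists (b / (1 - t)) => L; rewrite ler_pdivlMr // mulrC.
  by apply: le_trans (hb L); rewrite penE lerDr mulr_ge0 ?(ltW t0).
split => //.
have pE : penal_lim (pr P) = t * penal_lim (pr P1) + (1 - t) * penal_lim (pr P2).
  rewrite /penal_lim; under eq_fun do rewrite penE.
  rewrite ulimD; [|by apply: ubndM; [exact: ubnd_cst|exact: tame_ubnd]..].
  by rewrite !ulimM ?ulim_cst //; try exact: ubnd_cst; exact: tame_ubnd.
have lE : code_mean (pr P) = t * code_mean (pr P1) + (1 - t) * code_mean (pr P2).
  rewrite /code_mean !mulr_sumr -big_split /=; apply: eq_bigr => v _; rewrite hP //.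
  by ring.
have hE : hh f (pr P) a <= t * hh f (pr P1) a + (1 - t) * hh f (pr P2) a.
  apply: hh_mix => //; try exact: pr_fap; by rewrite (ltW t0) (ltW t1).
have [n0 [i0 hne]] := sepF mA PA QA.
(* The defect of convexity of the square: the mean of two squares exceeds the square of the mean by
   [t * (1 - t)] times the squared difference. It is positive at the index separating [P1] from
   [P2]. *)
pose gap := t * (1 - t) * (om n0 * (pr P1 (F n0 i0) - pr P2 (F n0 i0)) ^+ 2).
have om0 n : 0 <= om n by rewrite mulr_ge0 ?invr_ge0 ?exprn_ge0.
have gap0 : 0 < gap.
  apply: mulr_gt0; first exact: mulr_gt0.
  apply: mulr_gt0.
    rewrite mulr_gt0 ?invr_gt0 ?exprn_gt0 ?ltr0n //; by apply/card_gt0P; exists i0.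
  by rewrite lt_neqAle sqr_ge0 andbT eq_sym sqrf_eq0 subr_eq0; apply/eqP.
have sE : sqs_lim (pr P) + gap <= t * sqs_lim (pr P1) + (1 - t) * sqs_lim (pr P2).
  pose df n := t * (1 - t) * (om n * \sum_i (pr P1 (F n i) - pr P2 (F n i)) ^+ 2).
  have df0 n : 0 <= df n.
    by rewrite mulr_ge0 ?(mulr_ge0 (ltW t0)) ?(ltW t1') // mulr_ge0 // sumr_ge0 // => i _; exact: sqr_ge0.
  have sqE L : sqs L (pr P) + \sum_(n < L) df n = t * sqs L (pr P1) + (1 - t) * sqs L (pr P2).
    rewrite /sqs !mulr_sumr -!big_split /=; apply: eq_bigr => n _.
    rewrite /df !mulr_sumr -!big_split /=; apply: eq_bigr => i _; rewrite hP; last exact: family_measurable.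
    by ring.
  have dfL L : (n0 < L)%N -> gap <= \sum_(n < L) df n.
    move=> nL; rewrite (bigD1 (Ordinal nL)) //= -[gap]addr0 lerD ?sumr_ge0 //.
    rewrite /gap /df ler_wpM2l ?(mulr_ge0 (ltW t0)) ?(ltW t1') // ler_wpM2l //.
    by rewrite (bigD1 i0) //= lerDl sumr_ge0 // => i _; exact: sqr_ge0.
  rewrite /sqs_lim -[gap](ulim_cst (U := U)) -ulimD; [|exact: sqs_ubnd|exact: ubnd_cst].
  have eU r (Q : probability X R) : r * ulim U (fun L => sqs L (pr Q)) = ulim U (fun L => r * sqs L (pr Q)).
    by rewrite ulimM ?ulim_cst //; [exact: ubnd_cst|exact: sqs_ubnd].
  rewrite !eU.
  rewrite -ulimD; [|by apply: ubndM; [exact: ubnd_cst|exact: sqs_ubnd]..].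
  apply: ulim_le.
  - by apply: ubndD; [exact: sqs_ubnd|exact: ubnd_cst].
  - by apply: ubndD; apply: ubndM; try exact: ubnd_cst; exact: sqs_ubnd.
  - by apply: Uoo; exists n0.+1 => // L /= nL; rewrite -sqE lerD2l dfL.
have kE := ler_wpM2l (ltW k0) sE; have kg : 0 < k * gap by rewrite mulr_gt0.
rewrite /tilted_energy pE lE; move: hE kE kg; rewrite !mulrDr.
move=> hE kE kg; apply: (@lt_le_trans _ _ (hh f (pr P) a + (t * code_mean (pr P1) + (1 - t) * code_mean (pr P2)) + (k * sqs_lim (pr P) + k * gap) - (t * penal_lim (pr P1) + (1 - t) * penal_lim (pr P2)))).
  by lra.
have e1 : k * (t * sqs_lim (pr P1)) = t * (k * sqs_lim (pr P1)) by ring.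
have e2 : k * ((1 - t) * sqs_lim (pr P2)) = (1 - t) * (k * sqs_lim (pr P2)) by ring.
by rewrite e1 e2 in kE; lra.
Qed.

(** Along a maximising sequence the penalty stays bounded, which gives the tightness that makes the
    entropy rate upper semicontinuous. The penalty is lower semicontinuous because the sets [O j]
    are open, the squares upper semicontinuous because the sets [F n i] are closed. *)
Lemma tilted_energy_max (P0 : probability X R) : inv_pr f P0 -> tame (pr P0) ->
  exists P, [/\ inv_pr f P, tame (pr P) & forall Q, inv_pr f Q -> tame (pr Q) -> tilted_energy (pr Q) <= tilted_energy (pr P)].
Proof.
move=> i0 t0; pose V := [set tilted_energy (pr Q) | Q in [set Q : probability X R | inv_pr f Q /\ tame (pr Q)]].
have hV : has_sup V.
  split; first by exists (tilted_energy (pr P0)), P0.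
  exists (ln #|C|%:R + code_mean_max + k) => _ [Q [iQ tQ] <-]; apply: le_trans (tilted_energy_le tQ) _.
  by rewrite lerBlDr lerDl penal_lim_ge0.
have /choice[s hs] : forall n : nat, exists Q : probability X R,
    [/\ inv_pr f Q, tame (pr Q) & sup V - n.+1%:R^-1 < tilted_energy (pr Q)].
  move=> n; have n0 : 0 < n.+1%:R^-1 :> R by rewrite invr_gt0.
  by have [_ [Q [iQ tQ] <-] h] := sup_adherent n0 hV; exists Q.
have is_ n : inv_pr f (s n) by case: (hs n).
have ts n : tame (pr (s n)) by case: (hs n).
pose b := ln #|C|%:R + code_mean_max + k - sup V + 1.
have hb n : penal_lim (pr (s n)) <= b.
  have [_ _ h] := hs n; have := tilted_energy_le (ts n); have : n.+1%:R^-1 <= 1 :> R by rewrite invf_le1 ?ler1n.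
  by move: h; rewrite /b; set v := (n.+1%:R^-1); lra.
have b0 : 0 <= b by apply: le_trans (hb 0%N); exact: penal_lim_ge0.
have sf n : fap (pr (s n)) by exact: pr_fap.
have [||P [sP iP]] := weak_limit dM dK borel fK gK cf cg (s := fun n => pr (s n)) (U := U).
- exact: sf.
- by move=> A mA; congr (ulim U _); apply/funext => n; exact: is_.
have bd A : measurable A -> ubnd U (fun n => pr (s n) A).
  by move=> mA; exact: (fap_ubnd (s := fun n => pr (s n))).
have bpen L : ubnd U (fun n => penal L (pr (s n))).
  by apply: ubnd_sum => j; apply: ubndM; [exact: ubnd_cst|apply: bd; exact: defect_measurable].
have bpinf : ubnd U (fun n => penal_lim (pr (s n))).
  by exists b; apply: nearW => n; rewrite ger0_norm ?penal_lim_ge0.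
have penP L : penal L (pr P) <= ulim U (fun n => penal_lim (pr (s n))).
  apply: (@le_trans _ _ (ulim U (fun n => penal L (pr (s n))))).
    rewrite /penal ulim_sum => [|j]; last by apply: ubndM; [exact: ubnd_cst|apply: bd; exact: defect_measurable].
    apply: ler_sum => j _; rewrite ulimM; [|exact: ubnd_cst|by apply: bd; exact: defect_measurable].
    by rewrite ulim_cst ler_wpM2l ?mulr_ge0 ?exprn_ge0 ?(ltW B0) //; apply: sP.1; exact: defect_open.
  by apply: ulim_le => //; apply: nearW => n; exact: penal_le_lim.
have tP : tame (pr P) by exists (ulim U (fun n => penal_lim (pr (s n)))).
exists P; split => // Q iQ tQ.
apply: (@le_trans _ _ (sup V)); first by apply: sup_upper_bound => //; exists Q.
(* The penalty weighs [O j] by [B * 2 ^+ j], so its mass is at most [b / (B * 2 ^+ j)] for all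
   members of the sequence. *)
have tight e : 0 < e -> exists K' : C -> set X,
  (forall v, dclosed dist (K' v) /\ K' v `<=` a @^-1` [set v]) /\
  forall n, pr (s n) (~` \bigcup_v K' v) <= e.
  move=> e0; have [j hj] := nat_ub (b / B / e); exists (K j); split => // n.
  have h1 : B * 2 ^+ j * pr (s n) (O j) <= b.
    apply: le_trans (hb n); apply: le_trans (penal_le_lim j.+1 (ts n)).
    by rewrite /penal big_ord_recr /= lerDr sumr_ge0 // => i _; exact: penal_term_ge0.
  have h2 : b / B / e <= 2 ^+ j.
    apply: le_trans hj _; rewrite -natrX ler_nat ltnW // ltn_expl //.
  rewrite -/(O j); move: h1; rewrite -mulrA mulrC -ler_pdivlMr // => h1.
  have h3 : b / B <= e * 2 ^+ j by rewrite [leRHS]mulrC -ler_pdivrMr.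
  have := le_trans h1 h3; rewrite [leLHS]mulrC ler_pM2r // exprn_gt0 //.
have bh : ubnd U (fun n => hh f (pr (s n)) a) by exact: hh_ubnd.
have hh_P : ulim U (fun n => hh f (pr (s n)) a) <= hh f (pr P) a by exact: hh_usc.
have lP : ulim U (fun n => code_mean (pr (s n))) = code_mean (pr P).
  rewrite /code_mean ulim_sum => [|t]; last by apply: ubndM; [exact: ubnd_cst|exact: bd].
  apply: eq_bigr => t _; rewrite ulimM; [|exact: ubnd_cst|exact: bd].
  by rewrite ulim_cst (code_lim ma is_ sP tight).
have bl : ubnd U (fun n => code_mean (pr (s n))) by exists code_mean_max; apply: nearW => n; exact: code_mean_bound.
have bs : ubnd U (fun n => sqs_lim (pr (s n))) by apply: ubnd01 => n; exact: sqs_lim_01.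
have bq L : ubnd U (fun n => sqs L (pr (s n))) by apply: ubnd01 => n; exact: sqs_01.
have sE : ulim U (fun n => sqs_lim (pr (s n))) <= sqs_lim (pr P).
  apply/ler_addgt0Pr => e e0; have [L hL] := natSinv_small e0.
  have hL' : (2 ^+ L)^-1 <= e.
    apply: le_trans (ltW hL); rewrite lef_pV2 ?posrE ?exprn_gt0 ?ltr0n // -natrX ler_nat ltn_expl //.
  apply: (@le_trans _ _ (ulim U (fun n => sqs L (pr (s n)) + e))).
    apply: ulim_le => //; first by apply: ubndD => //; exact: ubnd_cst.
    by apply: nearW => n; have /andP[_ h] := sqs_lim_tail (s n) L; apply: le_trans h _; rewrite lerD2l.
  rewrite ulimD //; last exact: ubnd_cst.
  rewrite ulim_cst lerD2r; have /andP[h _] := sqs_lim_tail P L; apply: le_trans h.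
  have b2 n i : ubnd U (fun m => pr (s m) (F n i) ^+ 2).
    by apply: ubndM; apply: bd; exact: family_measurable.
  rewrite /sqs ulim_sum => [|n]; last by apply: ubndM; [exact: ubnd_cst|apply: ubnd_sum => i; exact: b2].
  apply: ler_sum => n _; rewrite ulimM; [|exact: ubnd_cst|apply: ubnd_sum => i; exact: b2].
  rewrite ulim_cst ler_wpM2l ?mulr_ge0 ?invr_ge0 ?exprn_ge0 // ulim_sum => [|i]; last exact: b2.
  apply: ler_sum => i _; rewrite ulimM; [|by apply: bd; exact: family_measurable..].
  have h1 := sP.2 _ (@cF n i); have h2 : 0 <= ulim U (fun m => pr (s m) (F n i)).
    by apply: ulim_gec; [apply: bd; exact: family_measurable|apply: nearW => m; exact: pr_ge0].
  by rewrite expr2 ler_pM.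
have pE : penal_lim (pr P) <= ulim U (fun n => penal_lim (pr (s n))).
  by apply: ulim_lec; [exact: tame_ubnd|exact: nearW].
have main : sup V <= ulim U (fun n => tilted_energy (pr (s n))).
  apply/ler_addgt0Pr => e e0; rewrite -lerBlDr; apply: ulim_gec.
    rewrite /tilted_energy; apply: ubndD; last exact: ubndN.
    by apply: ubndD; [exact: ubndD|apply: ubndM => //; exact: ubnd_cst].
  have [N hN] := natSinv_small e0; apply: Uoo; exists N => // n /= Nn.
  have [_ _ h] := hs n; apply: le_trans (ltW h); rewrite lerD2l lerN2.
  by apply: le_trans (ltW hN); rewrite lef_pV2 ?posrE ?ltr0n // ler_nat.
apply: (le_trans main); rewrite /tilted_energy ulimD; [|by apply: ubndD; [exact: ubndD|apply: ubndM => //; exact: ubnd_cst]|exact: ubndN].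
rewrite ulimN // ulimD; [|exact: ubndD|by apply: ubndM => //; exact: ubnd_cst].
rewrite ulimD // ulimM //; last exact: ubnd_cst.
rewrite ulim_cst lP; apply: lerB => //; apply: lerD; first by rewrite lerD2r.
by rewrite ler_wpM2l // ltW.
Qed.

Lemma tilted_energy_ergodic (P0 : probability X R) : inv_pr f P0 -> tame (pr P0) ->
  exists P, [/\ ergodic f P, inv_pr f P, tame (pr P) & tilted_energy (pr P0) <= tilted_energy (pr P)].
Proof.
move=> i0 t0; have [P [iP tP hP]] := tilted_energy_max i0 t0; exists P; split; last exact: hP; [|exact: iP|exact: tP].
split; first exact/(invariant_pr fm).
move=> A mA iA; apply: contrapT => /not_orP[nA0 nA1].
have pA0 : 0 < pr P A.
  rewrite lt_neqAle pr_ge0 andbT eq_sym; apply/eqP => h; apply: nA0; by rewrite prE // h.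
have pA1 : pr P A < 1.
  rewrite lt_neqAle pr_le1 // andbT; apply/eqP => h; apply: nA1; by rewrite prE // h.
have mA' := measurableC mA.
have pA0' : 0 < pr P (~` A) by rewrite prC // subr_gt0.
have [P1 h1] := pr_cond mA pA0; have [P2 h2] := pr_cond mA' pA0'.
have i1 : inv_pr f P1 by exact: (inv_pr_cond mA iA iP h1).
have iA' : f @^-1` (~` A) = ~` A by rewrite -preimage_setC iA.
have i2 : inv_pr f P2 by exact: (inv_pr_cond mA' iA' iP h2).
have [|||||T1 T2 hlt] := @tilted_energy_mix P P1 P2 (pr P A) A iP i1 i2 tP.
- by rewrite pA0.
- exact: mA.
- by rewrite h1 // setIid divff // gt_eqF.
- by rewrite h2 // setICr pr0 mul0r.
- move=> D mD; rewrite h1 // h2 // -(prC P mA) mulrC divfK ?gt_eqF // [X in _ = _ + X]mulrC divfK ?gt_eqF //.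
  rewrite -prU; [|exact: measurableI..|by rewrite setIACA setICr setI0].
  by rewrite -setIUr setUCr setIT.
move: hlt; apply/negP; rewrite -leNgt.
have := hP _ i1 T1; have := hP _ i2 T2 => h3 h4.
have h5 := ler_wpM2l (ltW pA0) h4.
have h6 : (1 - pr P A) * tilted_energy (pr P2) <= (1 - pr P A) * tilted_energy (pr P) by rewrite ler_wpM2l // subr_ge0 ltW.
by apply: le_trans (lerD h5 h6) _; rewrite -mulrDl addrC subrK mul1r.
Qed.

End Maximiser.

Variable phi : X -> R.
Hypothesis cphi : rcontinuous dist phi.

(** The closed cores are chosen inside [A], so giving no mass to [A] would cost the full penalty [B]
    of [O 0], more than any gain in energy. The loss is [t / 4] for the penalty of [P], [t / 8] for
    the squares and twice [t / 8] for approximating [phi] by a code. *)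
Lemma ergodic_selection (P : probability X R) A (C : finType) (a : X -> C) t :
  inv_pr f P -> measurable A -> pr P A = 1 -> mcode a -> 0 < t ->
  exists Q, [/\ ergodic f Q, 0 < pr Q A &
    ((hh f (pr P) a + intr P phi - t)%:E <= freeEnergy f phi Q)%E].
Proof.
move=> iP mA PA ma t0.
have bphi := rcontinuous_bm dM dK borel cphi.
have t8 : 0 < t / 8 by rewrite divr_gt0.
have [C' [b [c [mb hc]]]] := rcontinuous_codable dM dK borel cphi t8.
pose D : finType := (C * C')%type; pose ab x : D := (a x, b x).
have mab : mcode ab by exact: mcode_pair.
pose cc (v : D) := c v.2.
have [I [F [cF sepF]]] := separating_family.
pose M := ln #|D|%:R + code_mean_max cc.
have D0 : (0 < #|D|)%N by apply/card_gt0P; exists (ab point).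
have M0 : 0 <= M by rewrite addr_ge0 ?ln_ge0 ?ler1n // sumr_ge0.
(* Entropy plus code mean lies within [[-M, M]], so [B] exceeds every possible difference of
   energies together with the error terms. *)
pose B := M + M + t + 1; have B0 : 0 < B by rewrite /B; lra.
(* The factor [4 ^+ j] beats the penalty weight [2 ^+ j], leaving a geometric series with sum at
   most [t / 4]; [#|D|] counts the cells. *)
have /choice[K hK] : forall jv : nat * D, exists K, [/\ dclosed dist K, K `<=` ab @^-1` [set jv.2] `&` A &
    pr P ((ab @^-1` [set jv.2] `&` A) `\` K) < t / 8 / B / (4 ^+ jv.1) / #|D|%:R].
  by move=> [j v]; apply: regular => //; [exact: measurableI|rewrite !divr_gt0 ?exprn_gt0 ?ltr0n].
pose K' j v := K (j, v).
have cK j v : dclosed dist (K' j v) /\ K' j v `<=` ab @^-1` [set v].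
  by have [h1 h2 _] := hK (j, v); split => // x /h2[].
have [U [UU Uoo]] := free_ultraT.
have k0 : 0 < t / 8 by [].
pose O j := ~` \bigcup_v K' j v.
have PO j : pr P (O j) <= t / 8 / B / 4 ^+ j.
  have mO' := defect_measurable cK j.
  have mKv v : measurable ((ab @^-1` [set v] `&` A) `\` K' j v).
    by apply: measurableD; [exact: measurableI|apply: (measurable_closed borel); case: (cK j v)].
  have e1 : pr P (O j) = pr P (O j `&` A).
    have : pr P (O j) <= pr P (O j `&` A) + pr P (~` A).
      apply: le_trans (prU_le P (measurableI _ _ mO' mA) (measurableC mA)).
      apply: pr_mono => //; first by apply: measurableU; [exact: measurableI|exact: measurableC].
      by move=> x Ox; have [Ax|nAx] := pselect (A x); [left|right].
    rewrite prC // PA subrr addr0 => h; apply/eqP; rewrite eq_le h /=.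
    by apply: pr_mono; [exact: measurableI|exact: mO'|move=> x []].
  rewrite e1; apply: (@le_trans _ _ (\sum_(v <- enum D) pr P ((ab @^-1` [set v] `&` A) `\` K' j v))).
    apply: pr_bigU_le => //; first exact: measurableI.
    move=> x [Ox Ax]; exists (ab x); first exact: enum_In.
    by split => // Kx; apply: Ox; exists (ab x).
  apply: (@le_trans _ _ (\sum_(v <- enum D) t / 8 / B / 4 ^+ j / #|D|%:R)).
    by apply: ler_sum => v _; have [_ _ h] := hK (j, v); apply: ltW.
  by rewrite big_enum sumr_const -[_ *+ _]mulr_natr divfK // gt_eqF // ltr0n.
have penP L : penal K' B L (pr P) <= t / 4.
  have h : penal K' B L (pr P) + t / 4 / 2 ^+ L <= t / 4.
    elim: L => [|L IH]; first by rewrite /penal big_ord0 add0r expr0 divr1.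
    apply: le_trans IH; rewrite /penal big_ord_recr /= -addrA lerD2l.
    have h1 : B * 2 ^+ L * pr P (O L) <= t / 8 / 2 ^+ L.
      apply: (@le_trans _ _ (B * 2 ^+ L * (t / 8 / B / 4 ^+ L))).
        by rewrite ler_wpM2l ?PO // mulr_ge0 ?exprn_ge0 // ltW.
      have -> : 4 ^+ L = 2 ^+ L * 2 ^+ L :> R by rewrite -exprMn; congr (_ ^+ _); ring.
      rewrite le_eqVlt; apply/orP; left; apply/eqP; field.
      by rewrite (gt_eqF B0) expf_neq0.
    have h2 : t / 4 / 2 ^+ L.+1 = t / 8 / 2 ^+ L by rewrite exprS; field; rewrite expf_neq0.
    rewrite -/(O L) h2; apply: le_trans (lerD h1 (lexx _)) _.
    by rewrite -mulrDl ler_wpM2r ?invr_ge0 ?exprn_ge0 //; lra.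
  by apply: le_trans h; rewrite lerDl divr_ge0 ?exprn_ge0 // ltW // divr_gt0.
have tP : tame K' B (pr P) by exists (t / 4).
have [Q [eQ iQ tQ hJ]] := tilted_energy_ergodic cc mab cF cK k0 B0 sepF Uoo iP tP.
exists Q; have lE (Z : probability X R) : `|intr Z phi - code_mean ab cc (pr Z)| <= t / 8.
  by apply: (intr_apx Z bphi mab).
have s01 Z : 0 <= sqs_lim F U (pr Z) <= 1 by exact: sqs_lim_01.
have sP := s01 P; have sQ := s01 Q.
have pP : penal_lim K' B U (pr P) <= t / 4.
  apply: ulim_lec; last exact: nearW; exact: tame_ubnd.
have pQ : 0 <= penal_lim K' B U (pr Q) by exact: penal_lim_ge0.
have hQ : hh f (pr P) ab + code_mean ab cc (pr P) - t / 4 - t / 8 <= hh f (pr Q) ab + code_mean ab cc (pr Q) - penal_lim K' B U (pr Q).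
  move: hJ; rewrite /tilted_energy => hJ.
  have h1 : 0 <= t / 8 * sqs_lim F U (pr P) by rewrite mulr_ge0 ?(ltW k0) //; case/andP: sP.
  have h2 : t / 8 * sqs_lim F U (pr Q) <= t / 8 by rewrite ler_piMr ?(ltW k0) //; case/andP: sQ.
  lra.
have hab : hh f (pr P) a <= hh f (pr P) ab.
  by apply: (hh_mono (pr_fap P) fm) => // x y [].
split => //.
  have h1 := hh_ge0 (pr_fap P) fm mab.
  have h2 := hh_ln_card (pr_fap Q) fm mab.
  have h3 := code_mean_bound cc mab P; have h4 := code_mean_bound cc mab Q.
  have h5 : B * pr Q (O 0%N) <= penal_lim K' B U (pr Q).
    apply: le_trans (penal_le_lim B0 Uoo 1 tQ).
    by rewrite /penal big_ord_recr big_ord0 /= add0r expr0 mulr1.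
  have h6 : B * pr Q (O 0%N) < B.
    move: h3 h4; rewrite !ler_norml => /andP[h3 _] /andP[_ h4].
    have hB : B = ln #|D|%:R + code_mean_max cc + (ln #|D|%:R + code_mean_max cc) + t + 1 by [].
    have lnD : 0 <= ln #|D|%:R :> R by rewrite ln_ge0 ?ler1n.
    apply: (le_lt_trans h5); rewrite [ltRHS]hB; lra.
  have h7 : pr Q (O 0%N) < 1 by rewrite -(ltr_pM2l B0) mulr1.
  have mO' := defect_measurable cK 0.
  apply: (@lt_le_trans _ _ (pr Q (~` O 0%N))); first by rewrite prC // subr_gt0.
  apply: pr_mono => //; first exact: measurableC.
  by rewrite setCK => x [v _ Kx]; have [_ h _] := hK (0%N, v); case: (h x Kx).
apply: le_trans (freeEnergy_ge fm bphi iQ mab); rewrite lee_fin.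
by have := lE P; have := lE Q; rewrite !ler_norml => /andP[? ?] /andP[? ?]; lra.
Qed.

End ErgodicSelection.

(** * Pressure without non-expansive measures *)

Lemma ereal_between {R : realType} (x y : \bar R) : (x < y)%E -> exists c : R, (x < c%:E < y)%E.
Proof.
case: x => [x| |]; case: y => [y| |] //; rewrite ?lte_fin.
- by move=> xy; exists ((x + y) / 2); rewrite !lte_fin; apply/andP; split; lra.
- by move=> _; exists (x + 1); rewrite lte_fin ltry andbT; lra.
- by move=> _; exists (y - 1); rewrite lte_fin ltNyr /=; lra.
- by move=> _; exists 0; rewrite ltry ltNyr.
Qed.

Lemma pr_cond_mix {R : realType} {d : measure_display} {T : measurableType d} (P Q1 Q2 : probability T R) A :
  measurable A -> 0 < pr P A -> pr P A < 1 ->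
  (forall B, measurable B -> pr Q1 B = pr P (B `&` A) / pr P A) ->
  (forall B, measurable B -> pr Q2 B = pr P (B `&` ~` A) / pr P (~` A)) ->
  forall B, measurable B -> pr P B = pr P A * pr Q1 B + (1 - pr P A) * pr Q2 B.
Proof.
move=> mA p0 p1 h1 h2 B mB; have mA' := measurableC mA.
have p0' : 0 < pr P (~` A) by rewrite prC // subr_gt0.
rewrite h1 // h2 // -(prC P mA) mulrC divfK ?gt_eqF // [X in _ = _ + X]mulrC divfK ?gt_eqF //.
rewrite -prU; [|exact: measurableI..|by rewrite setIACA setICr setI0].
by rewrite -setIUr setUCr setIT.
Qed.

Section PressureGap.
Context {R : realType} {dX : measure_display} {X : measurableType dX}.
Variables (dist : X -> X -> R) (f g : X -> X) (phi : X -> R) (eps : R).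
Hypothesis dM : is_metric dist.
Hypothesis dK : dcompact dist.
Hypothesis borel : @measurable dX X = <<s dopen dist >>.
Hypothesis fK : cancel f g.
Hypothesis gK : cancel g f.
Hypothesis cf : dcontinuous dist f.
Hypothesis cg : dcontinuous dist g.
Hypothesis cphi : rcontinuous dist phi.
Hypothesis eps0 : 0 < eps.
Hypothesis gap : (Pperp dist f phi eps < Ptop dist f phi)%E.

Let fm := dcontinuous_measurable borel cf.
Let bphi := rcontinuous_bm dM dK borel cphi.
Let hcphi := rcontinuous_codable dM dK borel cphi.
Let mNE := NE_measurable dM dK borel fK gK cf cg eps.
Let iNE := NE_inv dist fK gK eps.

Lemma Pperp_bound (P : probability X R) (C : finType) (a : X -> C) c : inv_pr f P ->
  pr P (NE dist f eps) = 1 -> mcode a -> (Pperp dist f phi eps <= c%:E)%E ->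
  hh f (pr P) a + intr P phi <= c.
Proof.
move=> iP PN ma hc; apply/ler_addgt0Pr => t t0; rewrite -lerBlDr -lee_fin.
have [Q [eQ QN h]] := ergodic_selection dM dK borel fK gK cf cg cphi iP mNE PN ma t0.
apply: le_trans h _; apply: le_trans hc; apply: ereal_sup_ubound; exists Q => //; split => //.
by rewrite prE // lte_fin.
Qed.

(** Conditioning on the invariant set [NE] and on its complement gives two invariant measures, and
    [hh_mix] bounds the entropy of [P] by theirs. *)
Lemma split_NE_mix (P : probability X R) (C : finType) (a : X -> C) c d : inv_pr f P -> mcode a ->
  (Pperp dist f phi eps <= c%:E)%E ->
  (forall Q : probability X R, inv_pr f Q -> pr Q (NE dist f eps) = 0 -> hh f (pr Q) a + intr Q phi <= d) ->
  hh f (pr P) a + intr P phi <= pr P (NE dist f eps) * c + (1 - pr P (NE dist f eps)) * d.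
Proof.
move=> iP ma hc hQ; have [P0|P0] := eqVneq (pr P (NE dist f eps)) 0.
  by rewrite P0 mul0r add0r subr0 mul1r; exact: hQ.
have p0 : 0 < pr P (NE dist f eps) by rewrite lt_neqAle eq_sym P0 pr_ge0.
have [P1|P1] := eqVneq (pr P (NE dist f eps)) 1.
  by rewrite P1 mul1r subrr mul0r addr0; exact: Pperp_bound.
have mN' := measurableC mNE.
have p1 : pr P (NE dist f eps) < 1 by rewrite lt_neqAle P1 pr_le1.
have p0' : 0 < pr P (~` NE dist f eps) by rewrite prC // subr_gt0.
have [Q1 h1] := pr_cond mNE p0; have [Q2 h2] := pr_cond mN' p0'.
have i1 : inv_pr f Q1 by exact: (inv_pr_cond borel cf mNE iNE iP h1).
have iN' : f @^-1` (~` NE dist f eps) = ~` NE dist f eps by rewrite -preimage_setC iNE.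
have i2 : inv_pr f Q2 by exact: (inv_pr_cond borel cf mN' iN' iP h2).
have t01 : 0 <= pr P (NE dist f eps) <= 1 by rewrite (ltW p0) (ltW p1).
have hmix := pr_cond_mix mNE p0 p1 h1 h2.
have hH : hh f (pr P) a <= pr P (NE dist f eps) * hh f (pr Q1) a + (1 - pr P (NE dist f eps)) * hh f (pr Q2) a.
  by apply: hh_mix => //; exact: pr_fap.
have hI := intr_mix bphi hcphi t01 hmix.
have F1 : hh f (pr Q1) a + intr Q1 phi <= c.
  by apply: Pperp_bound => //; rewrite h1 // setIid divff // gt_eqF.
have F2 : hh f (pr Q2) a + intr Q2 phi <= d.
  by apply: hQ => //; rewrite h2 // setICr pr0 mul0r.
have k1 := ler_wpM2l (ltW p0) F1.
have k2 : (1 - pr P (NE dist f eps)) * (hh f (pr Q2) a + intr Q2 phi) <= (1 - pr P (NE dist f eps)) * d.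
  by rewrite ler_wpM2l // subr_ge0 ltW.
by move: k1 k2 hH; rewrite hI !mulrDr; lra.
Qed.

Lemma split_NE (P : probability X R) (C : finType) (a : X -> C) c d : inv_pr f P -> mcode a ->
  (Pperp dist f phi eps <= c%:E)%E -> c <= d ->
  (forall Q : probability X R, inv_pr f Q -> pr Q (NE dist f eps) = 0 -> hh f (pr Q) a + intr Q phi <= d) ->
  hh f (pr P) a + intr P phi <= d.
Proof.
move=> iP ma hc cd hQ; apply: le_trans (split_NE_mix iP ma hc hQ) _.
have := ler_wpM2l (pr_ge0 P (NE dist f eps)) cd; lra.
Qed.

(** A limit of empirical measures has energy above [c1], which is at least the bound for measures on
    [NE]. Were all measures null on [NE] of energy at most [c1] for the same code, [split_NE] would
    contradict this. *)
Lemma pressure_lower c : (c%:E < Ptop dist f phi)%E -> exists P : probability X R,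
  [/\ inv_pr f P, pr P (NE dist f eps) = 0 &
    exists (C : finType) (a : X -> C), mcode a /\ c <= hh f (pr P) a + intr P phi].
Proof.
move=> hc; have [c0 /andP[h0 h1]] := ereal_between gap.
(* Raising the target above [c0] makes it exceed the non-expansive bound, as [split_NE] requires. *)
pose c1 := Num.max c c0.
have hc1 : (c1%:E < Ptop dist f phi)%E by rewrite /c1; case: (leP c c0).
have [_ [d d0 <-] hd] := ereal_sup_gt hc1.
have [c2 /andP[c12 c2P]] := ereal_between hd; rewrite lte_fin in c12.
have [M hM] := rcontinuous_bounded dM dK cphi.
have hg := Pcol_gt hM c2P.
pose A := [set N | exists k (E : 'I_k -> X), separated dist f N.+1 d E /\
  expR (N.+1%:R * c2) < \sum_i expR (birkhoff f phi (E i) N.+1)].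
have [|U [UU UA Uoo]] := @free_ultra A.
  move=> n; have [[|N] [k [E [Nn N0 sep _ h]]]] := hg n.+1 => //; exists N; first by rewrite -ltnS.
  exists k, E; split => //; apply: lt_le_trans h _; rewrite le_eqVlt; apply/orP; left; apply/eqP.
  by apply: eq_bigr => i _; rewrite (Phi0 _ dM hM).
(* Lengths outside [A] get a one-point family, so that every empirical distribution is defined; the
   ultrafilter ignores them. *)
have /choice[kE hkE] : forall N, exists kE : {k : nat & 'I_k -> X}, (0 < projT1 kE)%N /\
    (A N -> separated dist f N.+1 d (projT2 kE) /\
      expR (N.+1%:R * c2) < \sum_i expR (birkhoff f phi (projT2 kE i) N.+1)).
  move=> N; have [[k [E [sep h]]]|nA] := pselect (A N); last first.
    by exists (existT _ 1%N (fun=> point)); split.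
  exists (existT _ k E); split => //=; rewrite lt0n; apply/eqP => k0.
  by move: E sep h; rewrite k0 => E _; rewrite big_ord0 ltNge expR_ge0.
pose kk N := projT1 (kE N); pose E N : 'I_(kk N) -> X := projT2 (kE N).
have kk0 N : (0 < kk N)%N by case: (hkE N).
have [||P [hP iP]] := weak_limit dM dK borel fK gK cf cg (U := U) (s := emp f phi E).
- by move=> N; exact: emp_fap.
- by move=> B mB; exact: (emp_shift phi borel cf E kk0 Uoo mB).
have sepE : \forall N \near U, separated dist f N.+1 d (E N).
  by apply: filterS UA => N /(hkE N).2[].
have ZE : \forall N \near U, N.+1%:R * c2 <= ln (partZ f phi E N).
  apply: filterS UA => N /(hkE N).2[_ h]; rewrite -[leLHS]expRK.
  by rewrite ler_ln ?posrE ?expR_gt0 ?partZ_gt0 // ltW.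
have c120 : 0 < (c2 - c1) / 2 by rewrite divr_gt0 // subr_gt0.
have [C [a [ma ha]]] := misiurewicz dM dK borel cf cphi kk0 Uoo d0 sepE ZE hP iP c120.
have cc1 : c <= c1 by rewrite le_max lexx.
have c01 : c0 <= c1 by rewrite le_max lexx orbT.
apply: contrapT => hn.
have : hh f (pr P) a + intr P phi <= c1.
  apply: (split_NE iP ma (ltW h0)) => // Q iQ Q0; rewrite leNgt; apply/negP => hlt; apply: hn.
  by exists Q; split => //; exists C, a; split => //; apply: le_trans cc1 (ltW hlt).
lra.
Qed.

Section Net.
Variables (n k : nat) (E : 'I_k -> X) (s r : R).
Hypothesis n0 : (0 < n)%N.
Hypothesis s0 : 0 <= s.
Hypothesis sep : separated dist f n (2 * s) E.
Hypothesis net : forall y, exists i, dn dist f n (E i) y <= r.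

(** A point goes to the centre within [s] when there is one, unique by separation at [2 * s], and
    otherwise to some centre within [r]. *)
Lemma adapted_code : exists w : X -> 'I_k, [/\ mcode w,
  forall i y, dn dist f n (E i) y <= s -> w y = i &
  forall y, dn dist f n (E (w y)) y <= Num.max s r].
Proof.
have [i0 _] := net point.
pose c y := [ffun i : 'I_k => (dn dist f n (E i) y <= s, dn dist f n (E i) y <= r)].
pose h (t : {ffun 'I_k -> bool * bool}) := if [pick i | (t i).1] is Some i then i
  else if [pick i | (t i).2] is Some i then i else i0.
exists (h \o c); split.
- apply: mcode_comp; apply: mcode_ffun => i.
  have mb t : mcode (fun y => dn dist f n (E i) y <= t).
    move=> b; have mt : measurable [set y | dn dist f n (E i) y <= t].
      by apply: (measurable_closed borel); exact: dn_closed.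
    case: b; first exact: mt.
    rewrite (_ : _ @^-1` _ = ~` [set y | dn dist f n (E i) y <= t]); first exact: measurableC.
    by apply/seteqP; split => y /=; [move=> ->|move/negP/negbTE].
  by apply: mcode_pair.
- move=> i y hi; rewrite /= /h; case: pickP => [j|/(_ i)]; rewrite ffunE /= ?hi // => hj.
  apply/eqP; apply: contraT => ji; have := sep ji; apply: contraTT => _; rewrite -leNgt.
  apply: le_trans (dn_tri f dM n _ y _) _; rewrite (dn_sym f dM n y); lra.
- move=> y; rewrite /= /h le_max; case: pickP => [j|_]; rewrite ?ffunE /=; first by move=> ->.
  case: pickP => [j|hn]; rewrite ?ffunE /=; first by move=> ->; rewrite orbT.
  by have [i hi] := net y; have := hn i; rewrite ffunE /= hi.
Qed.

Variable M : R.
Hypothesis phiM : forall x, `|phi x| <= M.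

(** Cells of Bowen diameter at most [2 * r] generate off [NE], so [n] times the entropy rate is at
    most the entropy of the single code [w]; the integral is bounded by [Phi] over cells, and
    [ent_variational] concludes. *)
Lemma net_pressure (w : X -> 'I_k) (P : probability X R) (C : finType) (a : X -> C) (t : R)
  (D : pred 'I_k) (u v : R) : inv_pr f P -> pr P (NE dist f eps) = 0 -> mcode a -> mcode w ->
  (forall y, dn dist f n (E (w y)) y <= r) -> r < t -> 2 * r <= eps ->
  0 < u -> 0 < v ->
  \sum_(i | D i) expR (Phi dist f phi t (E i) n) <= u ->
  \sum_(i | ~~ D i) expR (Phi dist f phi t (E i) n) <= v ->
  n%:R * (hh f (pr P) a + intr P phi) <=
    pr P (w @^-1` [set i | D i]) * ln (2 * u) + (1 - pr P (w @^-1` [set i | D i])) * ln (2 * v).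
Proof.
move=> iP P0 ma mw hw rt r2 u0 v0 hu hv.
have diam x y : w x = w y -> dn dist f n x y <= eps.
  move=> e; have := dn_tri f dM n x (E (w x)) y; rewrite (dn_sym f dM n x (E (w x))).
  have := hw x; have := hw y; rewrite -e; lra.
have h1 := kolmogorov_sinai dM dK borel fK gK cf cg iP P0 n0 mw diam eps0 ma.
have h2 := @intr_birkhoff _ _ _ f fm P phi n _ w (fun i => Phi dist f phi t (E i) n) bphi hcphi iP mw.
have {}h2 : n%:R * intr P phi <= \sum_i Phi dist f phi t (E i) n * pr P (w @^-1` [set i]).
  by apply: h2 => x; apply: (Phi_ge phiM); right; exact: le_lt_trans rt.
have p0 := jd_ge0 (pr_fap P) mw; have p1 := jd_sum (pr_fap P) mw.
have := ent_variational p0 p1 id (phi := fun i => Phi dist f phi t (E i) n) u0 v0 hu hv.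
have pmE i : pm (jd (pr P) w) id i = pr P (w @^-1` [set i]) by rewrite /pm big_pred1_eq.
rewrite -H_self (eq_bigr (fun i => pr P (w @^-1` [set i]) * Phi dist f phi t (E i) n)); last first.
  by move=> i _; rewrite pmE.
rewrite [X in X * ln (2 * u)](eq_bigr (fun i => pr P (w @^-1` [set i]))) => [|i _]; last exact: pmE.
rewrite [X in _ + X * ln (2 * v)](eq_bigr (fun i => pr P (w @^-1` [set i]))) => [|i _]; last exact: pmE.
rewrite -(fap_bigU (pr_fap P) D mw) -(fap_bigU (pr_fap P) (predC D) mw).
have -> : pr P (w @^-1` [set i | predC D i]) = 1 - pr P (w @^-1` [set i | D i]).
  rewrite -(prC P (mcode_set _ mw)); congr (pr P _); apply/seteqP; split => x /= h; exact/negP.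
have n0' : 0 < n%:R :> R by rewrite ltr0n.
move=> h3; rewrite mulrDr; apply: le_trans h3; apply: lerD.
  by rewrite mulrC -ler_pdivlMr.
by apply: le_trans h2 _; apply: ler_sum => i _; rewrite mulrC.
Qed.

End Net.

(** A net for [n = 1] at scale [eps / 4] already generates for measures null on [NE], so its
    partition sum bounds the pressure from above. The gap hypothesis keeps it from being minus
    infinity. *)
Lemma Ptop_fin : exists P : R, Ptop dist f phi = P%:E.
Proof.
have [M hM] := rcontinuous_bounded dM dK cphi.
have e4 : 0 < eps / 4 by rewrite divr_gt0.
have [k [E [_ sep net]]] := max_sep dM dK cf setT 1 e4.
have net' y : exists i, dn dist f 1 (E i) y <= eps / 4 by exact: net.
pose Z := \sum_i expR (Phi dist f phi (eps / 2) (E i) 1).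
have k0 : (0 < k)%N by have [i _] := net' point; apply: leq_ltn_trans (ltn_ord i).
have Z0 : 0 < Z.
  rewrite /Z (bigD1 (Ordinal k0)) //= ltr_pwDl ?expR_gt0 // sumr_ge0 // => i _; exact: expR_ge0.
have bound c : (c%:E < Ptop dist f phi)%E -> c <= ln (2 * Z).
  move=> /pressure_lower[P [iP P0 [C [a [ma ha]]]]]; apply: (le_trans ha).
  have e8 : 0 <= eps / 8 by rewrite divr_ge0 // ltW.
  have sep' : separated dist f 1 (2 * (eps / 8)) E.
    by have -> : 2 * (eps / 8) = eps / 4 by field.
  have [w [mw _ hw]] := adapted_code sep' net'.
  have hw' y : dn dist f 1 (E (w y)) y <= eps / 4.
    by have := hw y; rewrite (max_idPr _) //; lra.
  have := @net_pressure 1 k E _ (ltnSn 0) M hM w P C a (eps / 2) xpredT Z 1 iP P0 ma mw hw'.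
  rewrite mul1r => h; apply: le_trans (h _ _ Z0 ltr01 _ _) _; try lra.
  - by [].
  - by rewrite big_pred0_eq.
  rewrite (_ : _ @^-1` _ = setT); last by apply/seteqP; split.
  by rewrite prT mul1r subrr mul0r addr0.
have [c0 /andP[_ h1]] := ereal_between gap.
case e : (Ptop dist f phi) => [P| |]; first by exists P.
- have := bound (ln (2 * Z) + 1); rewrite e ltry => /(_ isT); lra.
- by rewrite e in h1.
Qed.

End PressureGap.

(** * Counting separated sets *)

Section Counting.
Context {R : realType} {X : Type} (dist : X -> X -> R) (f : X -> X) (phi : X -> R).
Hypothesis dM : is_metric dist.
Hypothesis dK : dcompact dist.
Hypothesis cf : dcontinuous dist f.
Variable M : R.
Hypothesis phiM : forall x, `|phi x| <= M.
Variables (delta eps P0 : R).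
Hypothesis delta0 : 0 < delta.
Hypothesis eps_delta : 40 * delta < eps.
Hypothesis X_pressure : (Pcol dist f phi setT delta 0 <= P0%:E)%E.
Variables (D P G S : set (X * nat)) (p g s : X -> nat -> nat).
Hypothesis D_gt0 : forall q, D q -> (0 < q.2)%N.
Hypothesis decD : decomposition f D P G S p g s.
Hypothesis specGM : forall m, tailWspec dist f (GM D p s m) delta.
Hypothesis bowenG : Bowen dist f phi G eps.
Let C0 := P `|` S `|` [set q | (0 < q.2)%N /\ ~ D q].
Variable eta : R.
Hypothesis eta0 : 0 < eta.
Hypothesis C0_pressure : (Pcol dist f phi C0 delta eps < (P0 - eta)%:E)%E.

Local Notation dn := (dn dist f).
Local Notation Sn := (birkhoff f phi).
Local Notation Phi := (Phi dist f phi).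
Local Notation sepOn := (sepOn dist f).

Let a := 10 * delta.

Lemma a_gt0 : 0 < a. Proof. by rewrite /a mulr_gt0. Qed.
Lemma a_eps : a + 2 * delta <= eps. Proof. by rewrite /a; move: eps_delta delta0; lra. Qed.

Lemma Phi_mono_eps x n : Phi a x n <= Phi eps x n.
Proof.
by apply: (Phi_shift dM phiM); [exact: a_gt0|rewrite dn_xx // add0r; have := a_eps; have := delta0; lra].
Qed.

Lemma M_ge0 (x : X) : 0 <= M. Proof. exact: le_trans (normr_ge0 _) (phiM x). Qed.

Lemma small_bound e r N : 0 < r -> exists b, 0 <= b /\
  forall n (I : finType) (E : I -> X) (A : pred I), (n < N)%N -> sepOn n r E A ->
  \sum_(i | A i) expR (Phi e (E i) n) <= b.
Proof.
move=> r0; elim: N => [|N [b [b0 hb]]]; first by exists 0.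
have [K hK] := sep_bound dM dK cf N r0; exists (b + K%:R * expR (N%:R * M)); split.
  by rewrite addr_ge0 // mulr_ge0 ?expR_ge0.
move=> n I E A; rewrite ltnS leq_eqVlt => /orP[/eqP ->|nN] sep; last first.
  by apply: le_trans (hb _ _ _ _ nN sep) _; rewrite lerDl mulr_ge0 ?expR_ge0.
apply: (@le_trans _ _ (\sum_(i | A i) expR (N%:R * M))).
  by apply: ler_sum => i _; rewrite ler_expR; exact: (Phi_le_norm dist f phiM).
rewrite sumr_const -[_ *+ _]mulr_natl; apply: (@le_trans _ _ (K%:R * expR (N%:R * M))).
  by rewrite ler_wpM2r ?expR_ge0 // ler_nat (hK _ E).
by rewrite lerDr.
Qed.

Definition blk (ns t : nat -> nat) j := (\sum_(i < j) (ns i + t i))%N.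

Lemma blkS ns t j : blk ns t j.+1 = (blk ns t j + ns j + t j)%N.
Proof. by rewrite /blk big_ord_recr /= addnA. Qed.

Lemma blk_le ns t tau j : (forall i, (t i <= tau)%N) -> (blk ns t j <= \sum_(i < j) (ns i + tau))%N.
Proof. by move=> ht; apply: leq_sum => i _; rewrite leq_add2l. Qed.

Lemma blk_end ns t tau j k : (j < k)%N -> (forall i, (t i <= tau)%N) ->
  (blk ns t j + ns j <= \sum_(i < k) (ns i + tau))%N.
Proof.
move=> jk ht; apply: (@leq_trans (\sum_(i < j.+1) (ns i + tau))).
  by rewrite big_ord_recr leq_add ?leq_addr //; exact: blk_le.
rewrite (big_ord_widen k (fun i => ns i + tau)%N jk).
by rewrite [leqRHS](bigID (fun i : 'I_k => (i < j.+1)%N)) leq_addr.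
Qed.

(** The gaps vary, but the orbit is continued to the fixed length with all gaps equal to [tau]; gaps
    and padding together occupy exactly [k * tau] times, each costing at most [M]. *)
Lemma birkhoff_blocks y k tau (ns t : nat -> nat) : (forall i, (t i <= tau)%N) ->
  \sum_(j < k) Sn (iter (blk ns t j) f y) (ns j) - (k * tau)%:R * M <=
  Sn y (\sum_(j < k) (ns j + tau)).
Proof.
move=> ht; pose N := blk ns t; pose Ls j := (\sum_(i < j) ns i)%N.
have h j : \sum_(i < j) Sn (iter (N i) f y) (ns i) - ((N j)%:R - (Ls j)%:R) * M <= Sn y (N j).
  elim: j => [|j IH].
    by rewrite big_ord0 /N /blk /Ls !big_ord0 subrr mul0r subr0 /birkhoff big_ord0.
  rewrite big_ord_recr /= /N blkS -/N -addnA !birkhoff_add /Ls big_ord_recr /= -/(Ls _).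
  have h1 := birkhoff_norm f phiM (iter (ns j) f (iter (N j) f y)) (t j).
  move: h1 IH; rewrite ler_norml !natrD => /andP[h1 _] IH.
  move: h1; rewrite -!iterD => h1; lra.
have Nle := blk_le ns k ht.
have hk := h k; set L := (\sum_(j < k) (ns j + tau))%N.
have hN : (N k + (L - N k) = L)%N by rewrite subnKC.
rewrite -hN birkhoff_add.
have := birkhoff_norm f phiM (iter (N k) f y) (L - N k).
have hL : L = (Ls k + k * tau)%N by rewrite /L big_split /= sum_nat_const card_ord.
rewrite ler_norml natrB // => /andP[h1 _].
move: hk h1; rewrite hL natrD; lra.
Qed.

Definition specOn (C : set (X * nat)) tau :=
  forall (k : nat) (xs : 'I_k -> X) (ns : 'I_k -> nat), (forall i, C (xs i, ns i)) ->
    exists (y : X) (taus : nat -> nat),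
      (forall i, (i.+1 < k)%N -> (1 <= taus i <= tau)%N) /\
      forall j : 'I_k,
        dn (ns j) (iter (\sum_(i < k | (i < j)%N) (ns i + taus i)) f y) (xs j) < delta.

Lemma shadow (C : set (X * nat)) tau k (ns : nat -> nat) (I : finType) (E : I -> X) (u : 'I_k -> I) :
  specOn C tau ->
  (forall l, C (E (u l), ns l)) -> exists yt : X * (nat -> nat),
    [/\ forall i, (yt.2 i <= tau)%N, forall i, (i.+1 < k)%N -> (0 < yt.2 i)%N &
    forall j : 'I_k, dn (ns j) (iter (blk ns yt.2 j) f yt.1) (E (u j)) < delta].
Proof.
move=> spec hC; have [y [taus [h1 h2]]] := spec k (fun j => E (u j)) (fun j => ns j) hC.
have tE i : (i.+1 < k)%N -> minn (taus i) tau = taus i.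
  by move=> /h1/andP[_ /minn_idPl].
(* Specification bounds only the gaps between consecutive segments; truncation at [tau] bounds the
   remaining values without changing those. *)
exists (y, fun i => minn (taus i) tau); split=> [i|i ik|j] /=; first by rewrite geq_minr.
  by rewrite tE //; case/andP: (h1 _ ik).
have := h2 j; congr (dn _ (iter _ _ _) _ < _); rewrite /blk.
rewrite (big_ord_widen_cond k xpredT (fun i => ns i + minn (taus i) tau)%N) ?(ltnW (ltn_ord j)) //=.
by apply: eq_bigr => i ij; rewrite tE // (leq_ltn_trans ij (ltn_ord j)).
Qed.

(** The gap pattern takes at most [tau.+1 ^ k] values, and fixing it fixes the starting times of all
    segments. *)
Definition gapcode k tau (t : nat -> nat) : {ffun 'I_k -> 'I_tau.+1} :=
  [ffun j : 'I_k => inord (t j)].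

Lemma gapcode_blk k tau ns t t' (j : 'I_k) : (forall i, (t i <= tau)%N) -> (forall i, (t' i <= tau)%N) ->
  gapcode k tau t = gapcode k tau t' -> blk ns t j = blk ns t' j.
Proof.
move=> ht ht' /ffunP e; apply: eq_bigr => i _.
have ik : (i < k)%N := ltn_trans (ltn_ord i) (ltn_ord j).
have := e (Ordinal ik); rewrite !ffunE /= => /(congr1 val).
by rewrite /= !inordK ?ltnS // => ->.
Qed.

(** Expanding the power gives all [k]-tuples of segments. For a fixed gap pattern, points shadowing
    distinct tuples are [delta]-separated at the common length, so [b] bounds their sum; patterns
    and gaps cost a constant factor per segment. *)
Lemma glue_power (C : set (X * nat)) tau n k (I : finType) (E : I -> X) (A : pred I) c1 b (x0 : X) :
  specOn C tau ->
  sepOn n (3 * delta) E A -> (forall i, A i -> C (E i, n)) ->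
  (forall i, A i -> forall y, dn n y (E i) < delta -> Phi a (E i) n <= Sn y n + c1) ->
  (forall (J : finType) (F : J -> X) (B : pred J), sepOn (k * (n + tau)) delta F B ->
    \sum_(j | B j) expR (Sn (F j) (k * (n + tau))) <= b) ->
  (\sum_(i | A i) expR (Phi a (E i) n)) ^+ k <= (tau.+1%:R * expR (c1 + tau%:R * M)) ^+ k * b.
Proof.
move=> spec sep hC hPhi hb; pose ns (_ : nat) := n.
have LE : (\sum_(j < k) (ns j + tau) = k * (n + tau))%N by rewrite sum_nat_const card_ord.
pose J : finType := {ffun 'I_k -> I}.
pose BJ (u : J) := u \in ffun_on A.
have /choice[yt hyt] : forall u : J, exists yt : X * (nat -> nat), BJ u ->
    [/\ forall i, (yt.2 i <= tau)%N, forall i, (i.+1 < k)%N -> (0 < yt.2 i)%N &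
    forall j : 'I_k, dn n (iter (blk ns yt.2 j) f yt.1) (E (u j)) < delta].
  move=> u; have [/ffun_onP hu|nu] := boolP (BJ u); last by exists (x0, fun=> 0%N).
  have hu' l : C (E (u l), ns l) by apply: hC; exact: hu.
  have [yt h] := shadow (E := E) (u := u) spec hu'.
  by exists yt.
pose T (u : J) := gapcode k tau (yt u).2.
have sepT t : sepOn (k * (n + tau)) delta (fun u => (yt u).1) (fun u => BJ u && (T u == t)).
  move=> u v /andP[hu /eqP tu] /andP[hv /eqP tv] uv.
  have [j huv] : exists j, u j != v j.
    apply: contrapT => hn; move/eqP: uv; apply; apply/ffunP => j.
    by apply/eqP; apply: contraT => h; case: hn; exists j.
  have [tb _ hj] := hyt u hu; have [tb' _ hj'] := hyt v hv.
  have := sep _ _ (ffun_onP hu j) (ffun_onP hv j) huv.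
  have e : blk ns (yt u).2 j = blk ns (yt v).2 j.
    by apply: (gapcode_blk (tau := tau)) => //; rewrite -/(T u) tu -tv.
  have {}hj := hj j; have := hj' j; rewrite -e // => {}hj'.
  have h1 := dn_tri f dM n (E (u j)) (iter (blk ns (yt u).2 j) f (yt u).1) (E (v j)).
  have h2 := dn_tri f dM n (iter (blk ns (yt u).2 j) f (yt u).1) (iter (blk ns (yt u).2 j) f (yt v).1) (E (v j)).
  have := blk_end ns (ltn_ord j) tb; rewrite LE => /(dn_sub f dM (yt u).1 (yt v).1) h3.
  rewrite (dn_sym f dM n (E (u j)) (iter _ _ _)) in h1; lra.
have step u : BJ u -> \prod_(j < k) expR (Phi a (E (u j)) n) <=
    expR (c1 + tau%:R * M) ^+ k * expR (Sn (yt u).1 (k * (n + tau))).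
  move=> hu; have [tb _ hj] := hyt u hu.
  rewrite -expR_sum -expRM_natl -expRD ler_expR.
  have := birkhoff_blocks (yt u).1 k ns tb; rewrite LE => h1.
  apply: (@le_trans _ _ (\sum_(j < k) (Sn (iter (blk ns (yt u).2 j) f (yt u).1) n + c1))).
    by apply: ler_sum => j _; apply: hPhi => //; exact: (ffun_onP hu j).
  rewrite big_split /= sumr_const card_ord -[c1 *+ k]mulr_natl.
  move: h1; rewrite natrM /ns; set w := \sum_(j < k) _; lra.
have -> : (\sum_(i | A i) expR (Phi a (E i) n)) ^+ k =
    \sum_(u : J | BJ u) \prod_(j < k) expR (Phi a (E (u j)) n).
  by rewrite -[k in LHS]card_ord -prodr_const (bigA_distr_big _ (fun _ i => expR (Phi a (E i) n))).
apply: (@le_trans _ _ (\sum_(u : J | BJ u) expR (c1 + tau%:R * M) ^+ k * expR (Sn (yt u).1 (k * (n + tau))))).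
  exact: ler_sum.
rewrite -mulr_sumr exprMn [tau.+1%:R ^+ k * _]mulrC -mulrA ler_wpM2l ?exprn_ge0 ?expR_ge0 //.
rewrite (partition_big T xpredT) //=.
apply: (@le_trans _ _ (\sum_(t : {ffun 'I_k -> 'I_tau.+1}) b)).
  by apply: ler_sum => t _; exact: hb.
by rewrite sumr_const card_ffun !card_ord -[_ *+ _]mulr_natl natrX.
Qed.

(** The property inherited by net points close to glued orbits, at the total error [4 * delta]; as a
    boolean it can index the sum over the net. *)
Definition shadowed tau k (ns : nat -> nat) (I : finType) (E : I -> X) (A : 'I_k -> pred I) (z : X) : bool :=
  `[< exists t : nat -> nat, [/\ forall j, (t j <= tau)%N, forall j, (j.+1 < k)%N -> (0 < t j)%N &
       exists u : 'I_k -> I, forall l, A l (u l) /\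
         dn (ns l) (E (u l)) (iter (blk ns t l) f z) <= 4 * delta] >].

(* Pushing the glued points to a net of scale [3 * delta] has multiplicity at most
   [tau.+1 ^ k], because the segments are separated at scale [9 * delta]. *)
Lemma glue_net (C : set (X * nat)) tau k (ns : nat -> nat) (I : finType) (E : I -> X)
    (A : 'I_k -> pred I) m (W : 'I_m -> X) c1 :
  specOn C tau ->
  (forall l i, A l i -> C (E i, ns l)) ->
  (forall l : 'I_k, sepOn (ns l) (9 * delta) E (A l)) ->
  (forall l i, A l i -> forall y, dn (ns l) y (E i) <= 4 * delta -> Phi a (E i) (ns l) <= Sn y (ns l) + c1) ->
  (forall y, exists i, dn (\sum_(i < k) (ns i + tau)) (W i) y <= 3 * delta) ->
  \prod_(l < k) (\sum_(i | A l i) expR (Phi a (E i) (ns l))) <=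
   (tau.+1%:R * expR (c1 + tau%:R * M)) ^+ k *
   \sum_(i | shadowed tau ns E A (W i))
     expR (Sn (W i) (\sum_(i < k) (ns i + tau))).
Proof.
move=> spec hC sep hPhi net; set L := (\sum_(i < k) (ns i + tau))%N.
pose J : finType := {ffun 'I_k -> I}.
pose BJ (u : J) := u \in family A.
have [/existsP[u0 hu0]|/existsPn nB] := boolP [exists u, BJ u]; last first.
  rewrite (bigA_distr_big_dep _ (fun (l : 'I_k) i => expR (Phi a (E i) (ns l)))) big_pred0.
    by rewrite mulr_ge0 ?exprn_ge0 ?mulr_ge0 ?expR_ge0 // sumr_ge0 // => i _; exact: expR_ge0.
  by move=> u; exact/negbTE/nB.
have ex u : BJ u -> exists wt : 'I_m * (nat -> nat),
    [/\ forall i, (wt.2 i <= tau)%N, forall i, (i.+1 < k)%N -> (0 < wt.2 i)%N &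
    forall j : 'I_k, dn (ns j) (E (u j)) (iter (blk ns wt.2 j) f (W wt.1)) <= 4 * delta].
  move=> /familyP hu.
  have hu' l : C (E (u l), ns l) by apply: (hC l); exact: hu.
  have [[y t] [/= h1 h2 h3]] := shadow (E := E) (u := u) spec hu'.
  have [i hi] := net y; exists (i, t); split => // j /=.
  have h4 := dn_tri f dM (ns j) (E (u j)) (iter (blk ns t j) f y) (iter (blk ns t j) f (W i)).
  have h5 := dn_sub f dM (W i) y (blk_end ns (ltn_ord j) h1).
  have h6 := h3 j; rewrite (dn_sym f dM _ (E (u j)) (iter _ _ y)) in h4.
  rewrite (dn_sym f dM _ (iter _ _ y) (iter _ _ (W i))) in h4; lra.
have [wt0 _] := ex u0 hu0.
have /choice[wt hwt] : forall u : J, exists wt : 'I_m * (nat -> nat), BJ u ->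
    [/\ forall i, (wt.2 i <= tau)%N, forall i, (i.+1 < k)%N -> (0 < wt.2 i)%N &
    forall j : 'I_k, dn (ns j) (E (u j)) (iter (blk ns wt.2 j) f (W wt.1)) <= 4 * delta].
  move=> u; have [hu|nu] := boolP (BJ u); last by exists wt0.
  by have [wt h] := ex u hu; exists wt.
pose T (u : J) := (gapcode k tau (wt u).2, (wt u).1).
(* With equal gaps and equal net point, the segments at position [j] are within [8 * delta] of each
   other, below their separation. *)
have Tinj u v : BJ u -> BJ v -> T u = T v -> u = v.
  move=> hu hv [e1 e2]; apply/ffunP => j; apply/eqP; apply: contraT => uv.
  have [tb _ hj] := hwt u hu; have [tb' _ hj'] := hwt v hv.
  have := sep j _ _ (familyP hu j) (familyP hv j) uv.
  have {}hj := hj j; have := hj' j; rewrite -e2 -(gapcode_blk ns j tb tb' e1) => {}hj'.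
  have h1 := dn_tri f dM (ns j) (E (u j)) (iter (blk ns (wt u).2 j) f (W (wt u).1)) (E (v j)).
  rewrite (dn_sym f dM _ (iter _ _ _) (E (v j))) in h1; have := delta0; lra.
have step u : BJ u -> \prod_(j < k) expR (Phi a (E (u j)) (ns j)) <=
    expR (c1 + tau%:R * M) ^+ k * expR (Sn (W (wt u).1) L).
  move=> hu; have [tb _ hj] := hwt u hu.
  rewrite -expR_sum -expRM_natl -expRD ler_expR.
  have h1 := birkhoff_blocks (W (wt u).1) k ns tb.
  apply: (@le_trans _ _ (\sum_(j < k) (Sn (iter (blk ns (wt u).2 j) f (W (wt u).1)) (ns j) + c1))).
    apply: ler_sum => j _; apply: (hPhi j); first exact: (familyP hu j).
    by rewrite (dn_sym f dM).
  rewrite big_split /= sumr_const card_ord -[c1 *+ k]mulr_natl.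
  move: h1; rewrite natrM -/L; set w := \sum_(j < k) _; lra.
rewrite (bigA_distr_big_dep _ (fun (l : 'I_k) i => expR (Phi a (E i) (ns l)))).
apply: (@le_trans _ _ (\sum_(u : J | BJ u) expR (c1 + tau%:R * M) ^+ k * expR (Sn (W (wt u).1) L))).
  exact: ler_sum.
rewrite -mulr_sumr exprMn [tau.+1%:R ^+ k * _]mulrC -mulrA ler_wpM2l ?exprn_ge0 ?expR_ge0 //.
pose good (i : 'I_m) := shadowed tau ns E A (W i).
have hgood u : BJ u -> good (wt u).1.
  move=> hu; apply/asboolP; have [h1 h2 h3] := hwt u hu; exists (wt u).2; split => //.
  by exists u => l; split; [exact: (familyP hu l)|].
have -> : \sum_(u : J | BJ u) expR (Sn (W (wt u).1) L) =
    \sum_(z in (T @: BJ)%SET) expR (Sn (W z.2) L).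
  by rewrite big_imset //= => u v hu hv; exact: Tinj.
apply: (@le_trans _ _ (\sum_(z : {ffun 'I_k -> 'I_tau.+1} * 'I_m | good z.2) expR (Sn (W z.2) L))).
  rewrite [leRHS](bigID (fun z => z \in (T @: BJ)%SET)) /= ler_wpDr //.
    by apply: sumr_ge0 => i _; exact: expR_ge0.
  rewrite le_eqVlt; apply/orP; left; apply/eqP; apply: eq_bigl => z.
  by apply/idP/andP => [hz|[]//]; split => //; have /imsetP[u hu ->] := hz; exact: hgood.
rewrite -(pair_big xpredT good (fun _ i => expR (Sn (W i) L))) /=.
by rewrite sumr_const card_ffun !card_ord -[_ *+ _]mulr_natl natrX.
Qed.

(** Prefix and suffix have length at most [m], so for two orbits they change the Birkhoff sum by a
    bounded amount; the core is controlled by the Bowen property of [G]. *)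
Lemma GM_bowen m : exists K, 0 <= K /\ forall x y n, GM D p s m (x, n) -> dn n x y < eps ->
  `|Sn x n - Sn y n| <= K.
Proof.
have [K hK] := bowenG; exists (`|K| + 4 * (m%:R * `|M|)); split.
  by rewrite addr_ge0 // !mulr_ge0.
move=> x y n [Dx [/= pm sm]] xy; have [_ /(_ x n Dx)[en _ Gx _]] := decD.
move: en Gx pm sm; set q := p x n; set q' := s x n; set r := g x n => en Gx pm sm.
have SE z : Sn z n = Sn z q + Sn (iter q f z) r + Sn (iter r f (iter q f z)) q'.
  by rewrite en !birkhoff_add -iterD [(r + q)%N]addnC.
rewrite !SE.
have hG : `|Sn (iter q f x) r - Sn (iter q f y) r| <= `|K|.
  apply: le_trans (ler_norm _); apply: hK => //; apply: le_lt_trans xy.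
  by apply: (dn_sub f dM); rewrite en leq_addr.
have nb z l : (l <= m)%N -> `|Sn z l| <= m%:R * `|M|.
  move=> lm; apply: le_trans (birkhoff_norm f phiM z l) _.
  apply: ler_pM => //; first exact: M_ge0 x.
  - by rewrite ler_nat.
  - exact: ler_norm.
have h1 := nb x q pm; have h2 := nb y q pm.
have h3 := nb (iter r f (iter q f x)) q' sm; have h4 := nb (iter r f (iter q f y)) q' sm.
move: hG h1 h2 h3 h4; rewrite !ler_norml => /andP[? ?] /andP[? ?] /andP[? ?] /andP[? ?] /andP[? ?].
by apply/andP; split; lra.
Qed.

Lemma GM_Phi m : exists c, 0 <= c /\ forall x n, GM D p s m (x, n) ->
  forall y, dn n y x <= 4 * delta -> Phi a x n <= Sn y n + c.
Proof.
have [K [K0 hK]] := GM_bowen m; exists (K + K); split; first by rewrite addr_ge0.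
move=> x n hx y hy.
have h1 : `|Sn x n - Sn y n| <= K.
  by apply: hK => //; rewrite (dn_sym f dM); apply: le_lt_trans hy _; have := eps_delta; have := delta0; lra.
apply: (Phi_le phiM) => z hz; have : `|Sn x n - Sn z n| <= K.
  apply: hK => //; case: hz => [->|h]; first by rewrite dn_xx //; have := eps_delta; have := delta0; lra.
  by apply: lt_le_trans h _; have := a_eps; have := delta0; lra.
by move: h1; rewrite !ler_norml => /andP[? ?] /andP[? ?]; lra.
Qed.

(** Long segments are glued [k] times; the pressure bounds the result at length [k * (n + tau)], and
    the [k]-th root keeps a constant independent of [n]. Lengths below the specification threshold
    have bounded sums. *)
Lemma spec_bound m : exists B, 0 <= B /\
  forall n (I : finType) (E : I -> X) (A : pred I), sepOn n (3 * delta) E A ->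
  (forall i, A i -> GM D p s m (E i, n)) ->
  \sum_(i | A i) expR (Phi a (E i) n) <= B * expR (n%:R * P0).
Proof.
have [N0 [tau spec]] := specGM m.
have d3 : 0 < 3 * delta by rewrite mulr_gt0.
have [b [b0 hb]] := small_bound a N0 d3.
have [c1 [c10 hc1]] := GM_Phi m.
(* The last factor pays for the growth over the padding [tau], at any exponent up to [P0 + 1]. *)
pose B1 := tau.+1%:R * expR (c1 + tau%:R * M) * expR (tau%:R * (`|P0| + 1)).
pose B2 := b * expR (N0%:R * `|P0|).
have B10 : 0 <= B1 by rewrite !mulr_ge0 ?expR_ge0.
have B20 : 0 <= B2 by rewrite mulr_ge0 ?expR_ge0.
exists (B1 + B2); split; first by rewrite addr_ge0.
move=> n I E A sep hA; have e0 := expR_ge0 (n%:R * P0).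
have [nN|Nn] := ltnP n N0.
  apply: le_trans (hb _ _ _ _ nN sep) _; rewrite mulrDl ler_wpDl ?mulr_ge0 //.
  rewrite /B2 -mulrA ler_peMr // -expRD -[leLHS]expR0 ler_expR.
  have : - `|P0| <= P0 by rewrite lerNl ler_normr lexx orbT.
  move=> /(ler_wpM2l (ler0n R n)); have : n%:R * `|P0| <= N0%:R * `|P0| by rewrite ler_wpM2r // ler_nat ltnW.
  rewrite mulrN; lra.
set L := \sum_(i | A i) _.
have [L0|L0] := leP L 0; first by apply: le_trans L0 _; rewrite mulr_ge0 ?addr_ge0.
have [x0 _] : exists x : X, True.
  apply: contrapT => nX; move: L0; rewrite /L big1 ?ltxx // => i _; case: nX; by exists (E i).
have n0 : (0 < n)%N.
  rewrite lt0n; apply/eqP => n0; move: L0; rewrite /L big1 ?ltxx // => i Ai.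
  by have [/D_gt0/= + _] := hA i Ai; rewrite n0.
have n0' : 0 < n%:R :> R by rewrite ltr0n.
(* The pressure gives the exponent [P0 + h] only; since [B1] does not depend on [h], it may tend to
   0 for fixed [n]. *)
suff key h : 0 < h -> h <= 1 -> L <= B1 * expR (n%:R * (P0 + h)).
  apply: (@le_trans _ _ (B1 * expR (n%:R * P0))); last by rewrite ler_wpM2r // lerDl.
  have B1' : 0 < B1 by rewrite !mulr_gt0 ?expR_gt0.
  rewrite -[L]lnK ?posrE // -[B1]lnK ?posrE // -expRD ler_expR; apply/ler_addgt0Pr => e e1.
  have h0 : 0 < Num.min 1 (e / n%:R) by rewrite lt_min ltr01 divr_gt0.
  have := key _ h0; rewrite ge_min lexx => /(_ isT) hL.
  rewrite -ler_expR lnK ?posrE //; apply: le_trans hL _; rewrite -addrA expRD lnK ?posrE //.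
  rewrite ler_wpM2l // ler_expR mulrDr lerD2l; apply: (@le_trans _ _ (n%:R * (e / n%:R))).
    by rewrite ler_wpM2l // ge_min lexx orbT.
  by rewrite mulrC divfK // gt_eqF.
move=> h0 h1.
have hP : (Pcol dist f phi setT delta 0 < (P0 + h)%:E)%E.
  by apply: le_lt_trans X_pressure _; rewrite lte_fin ltrDl.
have [N1 hN1] := Pcol_lt phiM hP.
(* Enough copies for the glued length to exceed the threshold [N1], which depends on [h]. *)
pose k := N1.+1; pose mm := (k * (n + tau))%N.
have mN : (N1 <= mm)%N.
  rewrite /mm; apply: (@leq_trans (k * 1)); first by rewrite muln1 leqnSn.
  by rewrite leq_mul2l (leq_trans n0) ?leq_addr // orbT.
have m0 : (0 < mm)%N by rewrite muln_gt0 /= addn_gt0 n0.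
have h2 : L ^+ k <= (tau.+1%:R * expR (c1 + tau%:R * M)) ^+ k * expR (mm%:R * (P0 + h)).
  apply: (@glue_power [set q | GM D p s m q /\ (N0 <= q.2)%N] tau n k I E A c1 _ x0).
  - exact: spec.
  - exact: sep.
  - by move=> i Ai; split; [exact: hA|].
  - by move=> i Ai y hy; apply: hc1; [exact: hA|have := delta0; lra].
  - move=> J F B' sep'; have := hN1 mm mN m0 J F B' sep' (fun _ _ => Logic.I).
    by under eq_bigr do rewrite (Phi0 _ dM phiM).
move: h2; have -> : expR (mm%:R * (P0 + h)) = expR ((n + tau)%:R * (P0 + h)) ^+ k.
  by rewrite -expRM_natl mulrA -natrM.
have R0 : 0 <= tau.+1%:R * expR (c1 + tau%:R * M) * expR ((n + tau)%:R * (P0 + h)).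
  by rewrite !mulr_ge0 ?expR_ge0.
rewrite -exprMn ler_pXn2r ?nnegrE ?R0 ?(ltW L0) //.
move=> h2; apply: (le_trans h2); rewrite /B1 -[leRHS]mulrA ler_wpM2l ?mulr_ge0 ?expR_ge0 //.
rewrite -expRD ler_expR natrD mulrDl addrC lerD2r ler_wpM2l //.
by rewrite lerD // ler_norm.
Qed.

Lemma C0_bound : exists K0, 0 <= K0 /\
  forall n (I : finType) (E : I -> X) (A : pred I), sepOn n delta E A ->
  (forall i, A i -> C0 (E i, n)) ->
  \sum_(i | A i) expR (Phi eps (E i) n) <= K0 * expR (n%:R * (P0 - eta)).
Proof.
have [N hN] := Pcol_lt phiM C0_pressure.
have [b [b0 hb]] := small_bound eps N.+1 delta0.
pose B2 := b * expR (N.+1%:R * `|P0 - eta|).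
have B20 : 0 <= B2 by rewrite mulr_ge0 ?expR_ge0.
exists (1 + B2); split; first by rewrite addr_ge0.
move=> n I E A sep hA; have e0 := expR_ge0 (n%:R * (P0 - eta)).
have [nN|Nn] := ltnP n N.+1; last first.
  apply: le_trans (hN n (ltnW Nn) (leq_trans _ Nn) I E A sep hA) _ => //.
  by rewrite ler_peMl // lerDl.
apply: le_trans (hb _ _ _ _ nN sep) _; rewrite mulrDl ler_wpDl ?mulr_ge0 //.
rewrite /B2 -mulrA ler_peMr // -expRD -[leLHS]expR0 ler_expR; set q := P0 - eta.
have : - `|q| <= q by rewrite lerNl ler_normr lexx orbT.
move=> /(ler_wpM2l (ler0n R n)); have : n%:R * `|q| <= N.+1%:R * `|q| by rewrite ler_wpM2r // ler_nat ltnW.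
rewrite mulrN; lra.
Qed.

Definition Qbd n beta := forall (I : finType) (E : I -> X) (A : pred I), sepOn n (3 * delta) E A ->
  \sum_(i | A i) expR (Phi a (E i) n) <= beta * expR (n%:R * P0).

Section WithK0.
Variable K0 : R.
Hypothesis K00 : 0 <= K0.
Hypothesis hK0 : forall n (I : finType) (E : I -> X) (A : pred I), sepOn n delta E A ->
  (forall i, A i -> C0 (E i, n)) ->
  \sum_(i | A i) expR (Phi eps (E i) n) <= K0 * expR (n%:R * (P0 - eta)).

(* Coding the prefixes and suffixes by maximal [delta]-separated sets leaves the middle
   segments of each fibre separated at the original scale [3 * delta]. *)
Lemma group_bound u v w (I : finType) (E : I -> X) (A : pred I) beta :
  0 <= beta -> Qbd w beta -> sepOn (u + w + v) (3 * delta) E A ->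
  (forall i, A i -> P (E i, u)) -> (forall i, A i -> S (iter (u + w) f (E i), v)) ->
  \sum_(i | A i) expR (Phi a (E i) (u + w + v)) <=
    K0 * expR (u%:R * (P0 - eta)) * (K0 * expR (v%:R * (P0 - eta))) * (beta * expR (w%:R * P0)).
Proof.
move=> b0 hQ sep hP hS.
have [kA [EA [PA sA nA]]] := max_sep dM dK cf [set y | P (y, u)] u delta0.
have [kS [ES [SS sS nS]]] := max_sep dM dK cf [set y | S (y, v)] v delta0.
have [/existsP[i0 Ai0]|] := boolP [exists i, A i]; last first.
  move=> /existsPn nA0; rewrite big_pred0 => [|i]; last exact/negbTE/nA0.
  by rewrite !mulr_ge0 ?expR_ge0.
have [ja _] := nA _ (hP _ Ai0); have [js _] := nS _ (hS _ Ai0).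
have /choice[al hal] : forall i, exists j, A i -> dn u (EA j) (E i) <= delta.
  move=> i; have [Ai|_] := boolP (A i); last by exists ja.
  by have [j hj] := nA _ (hP _ Ai); exists j.
have /choice[ga hga] : forall i, exists j, A i -> dn v (ES j) (iter (u + w) f (E i)) <= delta.
  move=> i; have [Ai|_] := boolP (A i); last by exists js.
  by have [j hj] := nS _ (hS _ Ai); exists j.
pose x1 j := expR (Phi eps (EA j) u); pose x2 j := expR (Phi eps (ES j) v).
pose x3 i := expR (Phi a (iter u f (E i)) w).
have step i : A i -> expR (Phi a (E i) (u + w + v)) <= x1 (al i) * x2 (ga i) * x3 i.
  move=> Ai; rewrite /x1 /x2 /x3 -!expRD ler_expR.
  have h1 := Phi_add f dM phiM (E i) (u + w) v a_gt0; have h2 := Phi_add f dM phiM (E i) u w a_gt0.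
  have h3 : Phi a (E i) u <= Phi eps (EA (al i)) u.
    apply: (Phi_shift dM phiM); first exact: a_gt0.
    by have := hal i Ai; have := a_eps; have := delta0; lra.
  have h4 : Phi a (iter (u + w) f (E i)) v <= Phi eps (ES (ga i)) v.
    apply: (Phi_shift dM phiM); first exact: a_gt0.
    by have := hga i Ai; have := a_eps; have := delta0; lra.
  lra.
apply: (@le_trans _ _ (\sum_(i | A i) x1 (al i) * x2 (ga i) * x3 i)); first exact: ler_sum.
rewrite (partition_big (fun i => (al i, ga i)) xpredT) //=.
apply: (@le_trans _ _ (\sum_(z : 'I_kA * 'I_kS) x1 z.1 * x2 z.2 * (beta * expR (w%:R * P0)))).
  apply: ler_sum => -[j l] _ /=.
  rewrite (eq_bigr (fun i => x1 j * x2 l * x3 i)) => [|i /andP[_ /eqP[-> ->]] //].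
  rewrite -mulr_sumr ler_wpM2l ?mulr_ge0 ?expR_ge0 //; apply: hQ.
  move=> i i' /andP[Ai /eqP[aij gil]] /andP[Ai' /eqP[ai'j gi'l]] ii'.
  have d3 : 0 <= 3 * delta by rewrite mulr_ge0 // ltW.
  have [kk hk hd] := (dn_gtP f dM (u + w + v) (E i) (E i') d3).1 (sep _ _ Ai Ai' ii').
  have h1 : dn u (E i) (E i') <= 2 * delta.
    have := dn_tri f dM u (E i) (EA j) (E i'); rewrite (dn_sym f dM u (E i) (EA j)).
    by have := hal i Ai; have := hal i' Ai'; rewrite aij ai'j; lra.
  have h2 : dn v (iter (u + w) f (E i)) (iter (u + w) f (E i')) <= 2 * delta.
    have := dn_tri f dM v (iter (u + w) f (E i)) (ES l) (iter (u + w) f (E i')).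
    rewrite (dn_sym f dM v _ (ES l)).
    by have := hga i Ai; have := hga i' Ai'; rewrite gil gi'l; lra.
  have d2 : 0 <= 2 * delta by rewrite mulr_ge0 // ltW.
  have [ku|uk] := ltnP kk u.
    have := (dn_leP dist f u (E i) (E i') d2).1 h1 kk ku; have := delta0; lra.
  have [kw|wk] := ltnP kk (u + w).
    apply/(dn_gtP f dM _ _ _ d3); exists (kk - u)%N; first by rewrite ltn_subLR.
    by rewrite -!iterD subnK.
  have hkv : (kk - (u + w) < v)%N by rewrite ltn_subLR.
  have := (dn_leP dist f v _ _ d2).1 h2 _ hkv; rewrite -!iterD subnK //; have := delta0; lra.
rewrite -mulr_suml ler_wpM2r ?mulr_ge0 ?expR_ge0 //.
rewrite -(pair_bigA _ (fun j l => x1 j * x2 l)) /=.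
under eq_bigr do rewrite -mulr_sumr.
rewrite -mulr_suml; apply: ler_pM; try by apply: sumr_ge0 => j _; exact: expR_ge0.
  by apply: (hK0 (A := xpredT)) => [i j _ _|i _]; [exact: sA|left; left; exact: PA].
by apply: (hK0 (A := xpredT)) => [i j _ _|i _]; [exact: sS|left; right; exact: SS].
Qed.

(** Half of the gain [eta]: one factor [r ^+ (u + v)] makes the sums over prefix and suffix lengths
    converge, the other is at most [r ^+ m]. *)
Let r := expR (- (eta / 2)).

Lemma geo_sum n : \sum_(u < n) r ^+ u <= (1 - r)^-1.
Proof.
have r1 : r < 1 by rewrite /r expR_lt1 oppr_lt0 divr_gt0.
have r0 : 0 <= r by exact: expR_ge0.
have h : \sum_(u < n) r ^+ u * (1 - r) <= 1.
  rewrite (eq_bigr (fun u : 'I_n => r ^+ u - r ^+ u.+1)) => [|u _]; last by rewrite exprS; ring.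
  rewrite -(big_mkord xpredT (fun u => r ^+ u - r ^+ u.+1)) (@telescope_sumr_eq _ 0 n (fun u => - r ^+ u)) // => [|i _]; last by rewrite opprK addrC.
  have : 0 <= r ^+ n by exact: exprn_ge0.
  by rewrite expr0; lra.
by rewrite -[leRHS]mul1r ler_pdivlMr ?subr_gt0 // mulr_suml.
Qed.

(** Such a segment is either outside [D], where the pressure is smaller by [eta], or its prefix and
    suffix together exceed [m]. In the second case the core is strictly shorter than [n], so the
    bound [beta] for shorter lengths enters, multiplied by a small factor. *)
Lemma offGM m n beta : 0 <= beta -> (forall w, (w < n)%N -> Qbd w beta) ->
  forall (I : finType) (E : I -> X) (A : pred I), (0 < n)%N -> sepOn n (3 * delta) E A ->
  (forall i, A i -> ~ GM D p s m (E i, n)) ->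
  \sum_(i | A i) expR (Phi a (E i) n) <=
    (K0 * expR (- (n%:R * eta)) + beta * K0 ^+ 2 * (1 - r)^-1 ^+ 2 * r ^+ m) * expR (n%:R * P0).
Proof.
move=> b0 hQ I E A n0 sep hA.
have r0 : 0 <= r by exact: expR_ge0.
rewrite (bigID (fun i => ~~ `[< D (E i, n) >])) /= mulrDl; apply: lerD.
  rewrite -mulrA -expRD (_ : - _ + _ = n%:R * (P0 - eta)); last by ring.
  apply: le_trans (hK0 (E := E) (A := fun i => A i && ~~ `[< D (E i, n) >]) _ _).
  - by apply: ler_sum => i _; rewrite ler_expR; exact: Phi_mono_eps.
  - move=> i j /andP[Ai _] /andP[Aj _] ij; apply: lt_trans (sep _ _ Ai Aj ij).
    by have := delta0; lra.
  - by move=> i /andP[_ /asboolPn nD]; right.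
pose W i := (inord (p (E i) n) : 'I_n.+1, inord (s (E i) n) : 'I_n.+1).
rewrite (partition_big W xpredT) //=.
pose c := beta * K0 ^+ 2 * r ^+ m * expR (n%:R * P0).
have c0 : 0 <= c by rewrite !mulr_ge0 ?exprn_ge0 ?expR_ge0.
apply: (@le_trans _ _ (\sum_(z : 'I_n.+1 * 'I_n.+1) c * (r ^+ z.1 * r ^+ z.2))).
  apply: ler_sum => -[u v] _ /=; pose A' i := A i && ~~ ~~ `[< D (E i, n) >] && (W i == (u, v)).
  have T0 : 0 <= c * (r ^+ u * r ^+ v) by rewrite !mulr_ge0 ?exprn_ge0.
  have [/existsP[i0 Ai0]|/existsPn nA] := boolP [exists i, A' i]; last first.
    by rewrite big_pred0 // => i; exact/negbTE/nA.
  have hA' i : A' i -> [/\ p (E i) n = u, s (E i) n = v, D (E i, n) & A i].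
    move=> /andP[/andP[Ai]]; rewrite negbK => /asboolP Di /eqP[e1 e2].
    have [_ /(_ _ _ Di)[en _ _ _]] := decD.
    have h1 : (p (E i) n < n.+1)%N by rewrite ltnS [leqRHS]en -addnA leq_addr.
    have h2 : (s (E i) n < n.+1)%N by rewrite ltnS [leqRHS]en leq_addl.
    by split=> //; [rewrite -e1 inordK|rewrite -e2 inordK].
  have [pu sv Di0 Ai0'] := hA' _ Ai0.
  have [_ /(_ _ _ Di0)[en _ _ _]] := decD.
  pose w := g (E i0) n; have enw : n = (u + w + v)%N by rewrite -pu -sv.
  have guw i : A' i -> g (E i) n = w.
    move=> /hA'[pi si Di _]; have [_ /(_ _ _ Di)[e _ _ _]] := decD.
    move: e; rewrite pi si {1}enw => /eqP; rewrite eqn_add2r eqn_add2l => /eqP //.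
  have muv : (m < u + v)%N.
    rewrite ltnNge; apply/negP => h; apply: (hA i0 Ai0'); split => //=; rewrite pu sv.
    by split; apply: leq_trans h; rewrite ?leq_addr ?leq_addl.
  have wn : (w < n)%N by rewrite enw addnAC -[X in (X < _)%N]add0n ltn_add2r (leq_ltn_trans _ muv).
  have := @group_bound u v w I E A' beta b0 (hQ w wn); rewrite -enw => hg.
  apply: le_trans (hg _ _ _) _.
  - by move=> i j /hA'[_ _ _ Ai] /hA'[_ _ _ Aj]; exact: sep.
  - by move=> i /hA'[pi _ Di _]; have [_ /(_ _ _ Di)[_ + _ _]] := decD; rewrite pi.
  - move=> i Ai; have [pi si Di _] := hA' _ Ai; have [_ /(_ _ _ Di)[_ _ _]] := decD.
    by rewrite pi si guw.
  have e1 : expR (n%:R * P0) = expR (u%:R * P0) * expR (w%:R * P0) * expR (v%:R * P0).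
    by rewrite -!expRD -!mulrDl -!natrD -enw.
  have rE k : expR (k%:R * (P0 - eta)) = expR (k%:R * P0) * (r ^+ k * r ^+ k).
    by rewrite /r -!expRM_natl -!expRD; congr expR; field.
  rewrite !rE /c e1.
  have -> : K0 * (expR (u%:R * P0) * (r ^+ u * r ^+ u)) * (K0 * (expR (v%:R * P0) * (r ^+ v * r ^+ v))) * (beta * expR (w%:R * P0))
    = (r ^+ u * r ^+ v) * (beta * K0 ^+ 2 * (expR (u%:R * P0) * expR (w%:R * P0) * expR (v%:R * P0)) * (r ^+ u * r ^+ v)) by ring.
  have -> : beta * K0 ^+ 2 * r ^+ m * (expR (u%:R * P0) * expR (w%:R * P0) * expR (v%:R * P0)) * (r ^+ u * r ^+ v)
    = r ^+ m * (beta * K0 ^+ 2 * (expR (u%:R * P0) * expR (w%:R * P0) * expR (v%:R * P0)) * (r ^+ u * r ^+ v)) by ring.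
  rewrite ler_wpM2r ?mulr_ge0 ?exprn_ge0 ?expR_ge0 // -exprD.
  apply: ler_wiXn2l => //; last exact: ltnW.
  by rewrite /r expR_le1 oppr_le0 divr_ge0 // ltW.
rewrite -mulr_sumr -(pair_bigA _ (fun u v : 'I_n.+1 => r ^+ u * r ^+ v)) /=.
under eq_bigr do rewrite -mulr_sumr.
rewrite -mulr_suml.
have r1 : r < 1 by rewrite /r expR_lt1 oppr_lt0 divr_gt0.
have g0 : 0 <= \sum_(i < n.+1) r ^+ i by apply: sumr_ge0 => i _; exact: exprn_ge0.
apply: (@le_trans _ _ (c * ((1 - r)^-1 * (1 - r)^-1))).
  by rewrite ler_wpM2l //; apply: ler_pM => //; exact: geo_sum.
by rewrite le_eqVlt; apply/orP; left; apply/eqP; rewrite /c; ring.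
Qed.

Lemma r_pow_small e : 0 < e -> exists m, r ^+ m <= e.
Proof.
move=> e0; have e2 : 0 < eta / 2 by rewrite divr_gt0.
have [m hm] := nat_ub (- ln e / (eta / 2)); exists m.
rewrite -[leRHS]lnK ?posrE // /r -expRM_natl ler_expR mulrN lerNl.
by rewrite -ler_pdivrMr.
Qed.

(** Strong induction on the length: for [m] large the recurrence of [offGM] returns at most half of
    the constant it receives, and the segments in [GM] add the fixed amount of [spec_bound]. *)
Lemma Qbd_all : exists B, 0 < B /\ forall n, Qbd n B.
Proof.
have d3 : 0 < 3 * delta by rewrite mulr_gt0.
pose c := K0 ^+ 2 * (1 - r)^-1 ^+ 2 + 1.
have r1 : r < 1 by rewrite /r expR_lt1 oppr_lt0 divr_gt0.
have c0 : 0 < c by rewrite ltr_wpDl // mulr_ge0 ?exprn_ge0 // invr_ge0 subr_ge0 ltW.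
have [m hm] : exists m, r ^+ m <= (2 * c)^-1 by apply: r_pow_small; rewrite invr_gt0 mulr_gt0.
have [BM [BM0 hBM]] := spec_bound m.
have [b [b0 hb]] := small_bound a 1 d3.
(* A supersolution of the recurrence: [K0 + BM + B / 2] is at most [B]; [b] serves the length 0. *)
pose B := 2 * (K0 + BM) + b + 1.
have B0 : 0 < B by rewrite ltr_wpDl // addr_ge0 // mulr_ge0 // addr_ge0.
exists B; split => //; elim/ltn_ind => n IH I E A sep.
move: sep; have [->|n0] := posnP n => sep.
  rewrite mul0r expR0 mulr1; apply: (@le_trans _ _ b); last by rewrite /B; move: K00 BM0; lra.
  exact: hb.
rewrite (bigID (fun i => `[< GM D p s m (E i, n) >])) /=.
apply: (@le_trans _ _ (BM * expR (n%:R * P0) + (K0 * expR (- (n%:R * eta)) + B * K0 ^+ 2 * (1 - r)^-1 ^+ 2 * r ^+ m) * expR (n%:R * P0))).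
  apply: lerD.
    apply: hBM => [i j /andP[Ai _] /andP[Aj _]|i /andP[_ /asboolP]] //; exact: sep.
  apply: offGM => //; first exact: ltW.
  - by move=> i j /andP[Ai _] /andP[Aj _]; exact: sep.
  - by move=> i /andP[_ /asboolPn].
rewrite -mulrDl ler_wpM2r ?expR_ge0 //.
have h1 : K0 * expR (- (n%:R * eta)) <= K0.
  by rewrite ler_piMr // expR_le1 oppr_le0 mulr_ge0 // ltW.
have h2 : B * K0 ^+ 2 * (1 - r)^-1 ^+ 2 * r ^+ m <= B / 2.
  apply: (@le_trans _ _ (B * (c * (2 * c)^-1))).
    rewrite -!mulrA ler_wpM2l ?(ltW B0) // !mulrA; apply: ler_pM => //.
    - by rewrite !mulr_ge0 // invr_ge0 subr_ge0 ltW.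
    - by rewrite exprn_ge0 // expR_ge0.
    - by rewrite /c !expr2 mulrA lerDl.
  by rewrite ler_wpM2l ?(ltW B0) // invfM mulrCA divff ?mulr1 // gt_eqF.
by move: h1 h2; rewrite /B; lra.
Qed.

Lemma tail_small k : 0 < k -> exists m N, forall n (I : finType) (E : I -> X) (A : pred I),
  (N <= n)%N -> (0 < n)%N -> sepOn n (3 * delta) E A ->
  (forall i, A i -> ~ GM D p s m (E i, n)) ->
  \sum_(i | A i) expR (Phi a (E i) n) <= k * expR (n%:R * P0).
Proof.
move=> k0; have [B [B0 hB]] := Qbd_all.
pose c := B * K0 ^+ 2 * (1 - r)^-1 ^+ 2 + 1.
have r1 : r < 1 by rewrite /r expR_lt1 oppr_lt0 divr_gt0.
have r0 : 0 <= r by exact: expR_ge0.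
have c0 : 0 < c by rewrite ltr_wpDl // !mulr_ge0 ?exprn_ge0 ?(ltW B0) // invr_ge0 subr_ge0 ltW.
have [m hm] : exists m, r ^+ m <= k / 2 / c by apply: r_pow_small; rewrite !divr_gt0.
have [N hN] : exists m, r ^+ m <= k / 2 / (K0 + 1) by apply: r_pow_small; rewrite !divr_gt0 // ltr_wpDl.
exists m, N => n I E A Nn n0 sep hA; apply: le_trans (offGM (ltW B0) (fun w _ => hB w) n0 sep hA) _.
rewrite ler_wpM2r ?expR_ge0 //.
have h1 : K0 * expR (- (n%:R * eta)) <= k / 2.
  apply: (@le_trans _ _ ((K0 + 1) * (k / 2 / (K0 + 1)))); last by rewrite mulrC divfK // gt_eqF // ltr_wpDl.
  apply: ler_pM; rewrite ?expR_ge0 ?lerDl //; apply: le_trans hN.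
  apply: (@le_trans _ _ (r ^+ n)); last by apply: ler_wiXn2l => //; exact: ltW.
  rewrite /r -expRM_natl ler_expR mulrN lerN2 ler_wpM2l // ler_pdivrMr //.
  by rewrite ler_pMr // ler1n.
have h2 : B * K0 ^+ 2 * (1 - r)^-1 ^+ 2 * r ^+ m <= k / 2.
  apply: (@le_trans _ _ (c * (k / 2 / c))); last by rewrite mulrC divfK // gt_eqF.
  apply: ler_pM => //; [|exact: exprn_ge0|by rewrite /c lerDl].
  by rewrite !mulr_ge0 ?exprn_ge0 ?(ltW B0) // invr_ge0 subr_ge0 ltW.
lra.
Qed.

End WithK0.
End Counting.

(** * Gibbs bounds *)

Lemma window_sum {R : realType} (F : nat -> R) s n L : (forall i, 0 <= F i) -> (s + n <= L)%N ->
  \sum_(i < n) F (s + i)%N <= \sum_(i < L) F i.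
Proof.
move=> F0 /subnKC <-; rewrite -addnA big_split_ord /= big_split_ord /= addrCA lerDl.
by rewrite addr_ge0 // sumr_ge0.
Qed.

Section Gibbs.
Context {R : realType} {dX : measure_display} {X : measurableType dX}.
Variables (dist : X -> X -> R) (f fi : X -> X) (phi : X -> R) (delta eps P0 M eta : R).
Hypothesis dM : is_metric dist.
Hypothesis dK : dcompact dist.
Hypothesis borel : @measurable dX X = <<s dopen dist >>.
Hypothesis fK : cancel f fi.
Hypothesis gK : cancel fi f.
Hypothesis cf : dcontinuous dist f.
Hypothesis cg : dcontinuous dist fi.
Hypothesis cphi : rcontinuous dist phi.
Hypothesis phiM : forall x, `|phi x| <= M.
Hypothesis delta0 : 0 < delta.
Hypothesis eps_delta : 40 * delta < eps.
Hypothesis gap : (Pperp dist f phi eps < Ptop dist f phi)%E.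
Hypothesis PtopE : Ptop dist f phi = P0%:E.
Variables (D P G S : set (X * nat)) (p g s : X -> nat -> nat).
Hypothesis D_gt0 : forall q, D q -> (0 < q.2)%N.
Hypothesis decD : decomposition f D P G S p g s.
Hypothesis specGM : forall m, tailWspec dist f (GM D p s m) delta.
Hypothesis bowenG : Bowen dist f phi G eps.
Hypothesis eta0 : 0 < eta.
Hypothesis C0_pressure : (Pcol dist f phi (P `|` S `|` [set q | (0 < q.2)%N /\ ~ D q]) delta eps < (P0 - eta)%:E)%E.

Local Notation dn := (dn dist f).
Local Notation Sn := (birkhoff f phi).
Local Notation Phi := (Phi dist f phi (10 * delta)).
Local Notation sepOn := (sepOn dist f).

Let fm := dcontinuous_measurable borel cf.

Lemma eps_gt0 : 0 < eps. Proof. by move: eps_delta delta0; lra. Qed.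

Lemma X_pressure : (Pcol dist f phi setT delta 0 <= P0%:E)%E.
Proof. by rewrite -PtopE; apply: ereal_sup_ubound; exists delta. Qed.

Lemma Q_bound : exists B, 1 <= B /\ forall n, Qbd dist f phi delta P0 n B.
Proof.
have [K0 [K00 hK0]] := C0_bound dM dK cf phiM delta0 C0_pressure.
have [B [B0 hB]] := Qbd_all dM dK cf phiM delta0 eps_delta X_pressure D_gt0 decD specGM bowenG eta0 K00 hK0.
exists (B + 1); split; first by rewrite lerDr ltW.
move=> n I E A sep; apply: le_trans (hB n I E A sep) _.
by rewrite ler_wpM2r ?expR_ge0 // lerDl.
Qed.

Lemma tail_bound k : 0 < k -> exists m N, forall n (I : finType) (E : I -> X) (A : pred I),
  (N <= n)%N -> (0 < n)%N -> sepOn n (3 * delta) E A ->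
  (forall i, A i -> ~ GM D p s m (E i, n)) ->
  \sum_(i | A i) expR (Phi (E i) n) <= k * expR (n%:R * P0).
Proof.
have [K0 [K00 hK0]] := C0_bound dM dK cf phiM delta0 C0_pressure.
exact: (tail_small dM dK cf phiM delta0 eps_delta X_pressure D_gt0 decD specGM bowenG eta0 K00 hK0).
Qed.

(** Measures null on [NE] with energy close to [P0] are tested against the partition given by the
    net; the factor 2 is that of [ent_variational]. *)
Lemma net_lower n k (E : 'I_k -> X) r : (0 < n)%N -> 0 < r -> r <= 9 * delta ->
  separated dist f n r E -> (forall y, exists i, dn n (E i) y <= r) ->
  expR (n%:R * P0) <= 2 * \sum_i expR (Phi (E i) n).
Proof.
move=> n0 r0 r9 sep net; have [i0 _] := net point.
have Z0 : 0 < \sum_i expR (Phi (E i) n).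
  by rewrite (bigD1 i0) //= ltr_pwDl ?expR_gt0 // sumr_ge0 // => i _; exact: expR_ge0.
have n0' : 0 < n%:R :> R by rewrite ltr0n.
rewrite -[leRHS]lnK ?posrE ?mulr_gt0 // ler_expR mulrC -ler_pdivlMr //.
apply/ler_addgt0Pr => e e0; rewrite -lerBlDr ler_pdivlMr // mulrC.
have h : ((P0 - e)%:E < Ptop dist f phi)%E by rewrite PtopE lte_fin ltrBlDr ltrDl.
have [Q [iQ Q0 [C [a [ma ha]]]]] := pressure_lower dM dK borel fK gK cf cg cphi gap h.
have r2 : 0 <= r / 2 by rewrite divr_ge0 // ltW.
have sep' : separated dist f n (2 * (r / 2)) E by have -> : 2 * (r / 2) = r by field.
have [w [mw _ hw]] := adapted_code dM borel cf sep' net.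
have hw' y : dn n (E (w y)) y <= r.
  by have := hw y; rewrite (max_idPr _) //; lra.
have rt : r < 10 * delta by have := delta0; lra.
have r2e : 2 * r <= eps by have := delta0; have := eps_delta; lra.
have h0 : \sum_(i | ~~ xpredT i) expR (Phi (E i) n) <= 1 by rewrite big_pred0_eq.
have := net_pressure dM dK borel fK gK cf cg cphi eps_gt0 n0 phiM iQ Q0 ma mw hw' rt r2e Z0 ltr01 (lexx _) h0.
rewrite (_ : _ @^-1` _ = setT); last by apply/seteqP; split.
rewrite prT mul1r subrr mul0r addr0 => h1; apply: le_trans h1.
by rewrite ler_wpM2l // ltW.
Qed.

Lemma sep_weaken n r r' (I : finType) (E : I -> X) (A : pred I) : r <= r' -> sepOn n r' E A -> sepOn n r E A.
Proof. by move=> rr sep i j Ai Aj ij; apply: le_lt_trans rr (sep _ _ Ai Aj ij). Qed.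

Lemma sep_pred n r k (E : 'I_k -> X) (A : pred 'I_k) : separated dist f n r E -> sepOn n r E A.
Proof. by move=> sep i j _ _; exact: sep. Qed.

(** The whole net carries at least one half of [e^{nP}] and the part outside [GM] at most one
    quarter. *)
Lemma on_GM_lower : exists m N, forall n k (E : 'I_k -> X) r, (N <= n)%N -> (0 < n)%N ->
  3 * delta <= r -> r <= 9 * delta ->
  separated dist f n r E -> (forall y, exists i, dn n (E i) y <= r) ->
  expR (n%:R * P0) / 4 <= \sum_(i | `[< GM D p s m (E i, n) >]) expR (Phi (E i) n).
Proof.
have [|m [N hN]] := @tail_bound (1 / 4); first by rewrite divr_gt0.
exists m, N => n k E r Nn n0 r3 r9 sep net.
have r0 : 0 < r by have := delta0; lra.
have := net_lower n0 r0 r9 sep net; rewrite (bigID (fun i => `[< GM D p s m (E i, n) >])) /=.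
have := hN n _ E (fun i => ~~ `[< GM D p s m (E i, n) >]) Nn n0 (sep_weaken r3 (sep_pred sep)).
by move=> /(_ (fun i => elimT (asboolPn _))); lra.
Qed.

(** Phrased through codes because the entropy is a supremum that need not be attained;
    [equilibriumP] identifies these measures with the equilibrium states. *)
Definition near_equil (nu : probability X R) := forall e, 0 < e -> exists (C : finType) (a : X -> C),
  mcode a /\ P0 - e <= hh f (pr nu) a + intr nu phi.

(** With the complement bounded by [Q_bound], a set of cells carrying half the mass cannot have a
    partition sum much below [e^{nP}], for the two-part bound of [net_pressure] would fall below
    [n * P0]. *)
Lemma katok : exists B, 0 < B /\ forall (nu : probability X R) n k (E : 'I_k -> X) (w : X -> 'I_k) (A : pred 'I_k),
  inv_pr f nu -> pr nu (NE dist f eps) = 0 -> near_equil nu -> (0 < n)%N ->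
  separated dist f n (9 * delta) E -> mcode w -> (forall y, dn n (E (w y)) y <= 9 * delta) ->
  1 / 2 <= pr nu (w @^-1` [set i | A i]) ->
  expR (n%:R * P0) <= B * \sum_(i | A i) expR (Phi (E i) n).
Proof.
have [B [B1 hB]] := Q_bound; have B0 : 0 < B by lra.
exists (4 * B); split; first by rewrite mulr_gt0.
move=> nu n k E w A inu nu0 hnu n0 sep mw hw half.
set u := \sum_(i | A i) _; set q := pr nu _ in half.
have [i0 Ai0] : exists i, A i.
  apply: contrapT => hn; move: half; rewrite /q (_ : _ @^-1` _ = set0) ?pr0; first by lra.
  by rewrite -subset0 => x /= h; apply: hn; exists (w x).
have u0 : 0 < u.
  by rewrite /u (bigD1 i0) //= ltr_pwDl ?expR_gt0 // sumr_ge0 // => i _; exact: expR_ge0.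
have n0' : 0 < n%:R :> R by rewrite ltr0n.
have d39 : 3 * delta <= 9 * delta by have := delta0; lra.
have v0 : 0 < B * expR (n%:R * P0) by rewrite mulr_gt0 ?expR_gt0.
have hv := hB n _ E (fun i => ~~ A i) (sep_weaken d39 (sep_pred sep)).
have rt : 9 * delta < 10 * delta by have := delta0; lra.
have r2e : 2 * (9 * delta) <= eps by have := delta0; have := eps_delta; lra.
have q1 : q <= 1 by apply: pr_le1; exact: mcode_set.
have main : n%:R * P0 <= q * ln (2 * u) + (1 - q) * ln (2 * (B * expR (n%:R * P0))).
  apply/ler_addgt0Pr => e e0; have [C [a [ma ha]]] := hnu _ (divr_gt0 e0 n0').
  have := net_pressure dM dK borel fK gK cf cg cphi eps_gt0 n0 phiM inu nu0 ma mw hw rt r2e u0 v0 (lexx _) hv.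
  have := ler_wpM2l (ltW n0') ha; rewrite mulrBr [n%:R * (e / _)]mulrC divfK ?gt_eqF //.
  rewrite -/q; lra.
have lnE : ln (2 * (B * expR (n%:R * P0))) = ln (2 * B) + n%:R * P0.
  by rewrite mulrA lnM ?posrE ?mulr_gt0 ?expR_gt0 // expRK.
have lB : 0 <= ln (2 * B) by rewrite ln_ge0 //; lra.
rewrite -[leRHS]lnK ?posrE ?mulr_gt0 // ler_expR.
have -> : 4 * B * u = 2 * B * (2 * u) by ring.
rewrite lnM ?posrE ?mulr_gt0 //; set y := n%:R * P0 in main lnE *; set z := ln (2 * u) in main *.
rewrite lnE in main; have h1 : q * (y - z) <= (1 - q) * ln (2 * B) by lra.
have [yz|yz] := leP y z; first lra.
(* As [q] is at least one half, the logarithmic deficit [y - z] is at most [ln (2 * B)], which gives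
   the constant [4 * B]. *)
have h2 : 1 / 2 * (y - z) <= q * (y - z) by rewrite ler_wpM2r // subr_ge0 ltW.
have h3 : (1 - q) * ln (2 * B) <= 1 / 2 * ln (2 * B) by rewrite ler_wpM2r //; lra.
lra.
Qed.

(** Maximal separated sets serve twice: separation makes the limit a measure of maximal energy, and
    the net property catches every glued orbit in [double_gibbs]. *)
Lemma spanning_limit : exists (k : nat -> nat) (W : forall N, 'I_(k N) -> X) (U : set_system nat) (mu : probability X R),
  [/\ UltraFilter U /\ \oo `<=` U,
    forall N, (0 < k N)%N /\ separated dist f N.+1 (3 * delta) (@W N),
    forall N y, exists i, dn N.+1 (W N i) y <= 3 * delta,
    wlim dist U (emp f phi W) mu & inv_pr f mu].
Proof.
have d3 : 0 < 3 * delta by rewrite mulr_gt0.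
have /choice[kE hkE] : forall N, exists kE : {k : nat & 'I_k -> X}, separated dist f N.+1 (3 * delta) (projT2 kE) /\
    forall y, exists i, dn N.+1 (projT2 kE i) y <= 3 * delta.
  move=> N; have [k [E [_ sep net]]] := max_sep dM dK cf setT N.+1 d3.
  by exists (existT _ k E); split => // y; exact: net.
pose k N := projT1 (kE N); pose W N : 'I_(k N) -> X := projT2 (kE N).
have k0 N : (0 < k N)%N by have [i _] := (hkE N).2 point; exact: leq_ltn_trans (ltn_ord i).
have [U [UU Uoo]] := free_ultraT.
have [||mu [hmu imu]] := weak_limit dM dK borel fK gK cf cg (U := U) (s := emp f phi W).
- by move=> N; exact: emp_fap.
- by move=> B mB; exact: (emp_shift phi borel cf W k0 Uoo mB).
by exists k, W, U, mu; split => // N; [split => //; case: (hkE N)|case: (hkE N)].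
Qed.

Section Limit.
Variables (k : nat -> nat) (W : forall N, 'I_(k N) -> X) (U : set_system nat) (mu : probability X R).
Context {UU : UltraFilter U}.
Hypothesis Uoo : \oo `<=` U.
Hypothesis k0 : forall N, (0 < k N)%N.
Hypothesis sepW : forall N, separated dist f N.+1 (3 * delta) (@W N).
Hypothesis netW : forall N y, exists i, dn N.+1 (W (N := N) i) y <= 3 * delta.
Hypothesis hmu : wlim dist U (emp f phi W) mu.
Hypothesis imu : inv_pr f mu.

Lemma limit_equil : near_equil mu.
Proof.
move=> e e0; have e2 : 0 < e / 2 by rewrite divr_gt0.
have [m [N1 hN1]] := on_GM_lower.
have [c [c0 hc]] := GM_Phi dM phiM delta0 eps_delta decD bowenG m.
have d3 : 0 < 3 * delta by rewrite mulr_gt0.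
have [||C [a [ma ha]]] := misiurewicz dM dK borel cf cphi k0 (c := P0 - e / 2) Uoo d3 _ _ hmu imu e2.
- exact: nearW.
- have [N2 hN2] := nat_ub ((c + ln 4) / (e / 2)).
  apply: Uoo; exists (maxn N1 N2) => // N /=; rewrite geq_max => /andP[N1N N2N].
  have h1 := hN1 N.+1 _ (@W N) (3 * delta) (leqW N1N) (ltn0Sn N) (lexx _) _ (sepW (N := N)) (@netW N).
  have {}h1 : expR (N.+1%:R * P0) / 4 <= \sum_(i | `[< GM D p s m (W i, N.+1) >]) expR (Phi (W (N := N) i) N.+1).
    by apply: h1; have := delta0; lra.
  (* The lower bound concerns [Phi], the empirical weights use plain Birkhoff sums; on [GM] they
     differ by a constant, which is absorbed by [e / 2] for long orbits. *)
  have h2 : \sum_(i | `[< GM D p s m (W i, N.+1) >]) expR (Phi (W (N := N) i) N.+1) <= expR c * partZ f phi W N.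
    rewrite /partZ mulr_sumr [leRHS](bigID (fun i => `[< GM D p s m (W i, N.+1) >])) /= ler_wpDr //.
      by apply: sumr_ge0 => i _; rewrite mulr_ge0 ?expR_ge0.
    apply: ler_sum => i /asboolP hi; rewrite -expRD ler_expR addrC; apply: hc => //.
    by rewrite dn_xx // mulr_ge0 // ltW.
  have Z0 := partZ_gt0 f phi W k0 N.
  have h3 := le_trans h1 h2; rewrite ler_pdivrMr // mulrAC in h3.
  have h4 : N.+1%:R * P0 <= c + ln 4 + ln (partZ f phi W N).
    rewrite -ler_expR; apply: le_trans h3 _; by rewrite !expRD !lnK ?posrE.
  have h5 : c + ln 4 <= N.+1%:R * (e / 2).
    rewrite -ler_pdivrMr //; apply: le_trans hN2 _; rewrite ler_nat; exact: leqW.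
  by move: h4 h5; rewrite mulrBr; lra.
exists C, a; split => //; lra.
Qed.

Definition linked n tau k' (E : 'I_k' -> X) (A1 A2 : pred 'I_k') : set X :=
  [set z | exists i j t, [/\ A1 i, A2 j, (t <= tau)%N, dn n (E i) z <= 4 * delta &
     dn n (E j) (iter (n + t) f z) <= 4 * delta]].

Lemma linked_closed n tau k' (E : 'I_k' -> X) (A1 A2 : pred 'I_k') : dclosed dist (linked n tau E A1 A2).
Proof.
pose V (q : 'I_k' * 'I_k' * 'I_tau.+1) := [set z | dn n (E q.1.1) z <= 4 * delta] `&`
  (iter (n + q.2) f @^-1` [set z | dn n (E q.1.2) z <= 4 * delta]).
have cV q : dclosed dist (V q).
  apply: dclosedI; first exact: dn_closed.
  by apply: dclosed_preimage; [exact: dcontinuous_iter|exact: dn_closed].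
have h : forall r : seq ('I_k' * 'I_k' * 'I_tau.+1), dclosed dist [set z | exists2 q, q \in r & A1 q.1.1 /\ A2 q.1.2 /\ V q z].
  elim => [|q r IH].
    rewrite (_ : [set z | _] = set0); first exact: dclosed0.
    by rewrite -subset0 => z [q]; rewrite in_nil.
  have [[h1 h2]|nA] := pselect (A1 q.1.1 /\ A2 q.1.2).
    rewrite (_ : [set z | _] = V q `|` [set z | exists2 q, q \in r & A1 q.1.1 /\ A2 q.1.2 /\ V q z]).
      by apply: dclosedU.
    apply/seteqP; split => z.
      by move=> [q']; rewrite inE => /orP[/eqP ->|qr] [a1 [a2 a3]]; [left|right; exists q'].
    by move=> [Vq|[q' qr a1]]; [exists q => //; rewrite inE eqxx|exists q' => //; rewrite inE qr orbT].
  rewrite (_ : [set z | _] = [set z | exists2 q, q \in r & A1 q.1.1 /\ A2 q.1.2 /\ V q z]) //.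
  apply/seteqP; split => z [q' hq' a1]; last by exists q' => //; rewrite inE hq' orbT.
  move: hq'; rewrite inE => /orP[/eqP e|qr]; last by exists q'.
  by case: nA; move: a1; rewrite e => -[? [? _]].
rewrite (_ : linked _ _ _ _ _ = [set z | exists2 q, q \in enum {: 'I_k' * 'I_k' * 'I_tau.+1} & A1 q.1.1 /\ A2 q.1.2 /\ V q z]).
  exact: h.
apply/seteqP; split => z.
  move=> [i [j [t [a1 a2 tt d1 d2]]]]; exists (i, j, inord t); first by rewrite mem_enum.
  by split => //; split => //; split => //=; rewrite inordK.
move=> [[[i j] t] _ [a1 [a2 [d1 d2]]]]; exists i, j, t; split => //.
by rewrite -ltnS.
Qed.

(** Orbits of length [N.+1] are glued from a filler of length [a], a segment of [A1], one of [A2]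
    and a filler of length [b]. Fillers range over sets of nearly full partition sum, so a fixed
    proportion of the total weight visits [V] at a time between [a] and [a + tau]. Averaging over
    [a] gives the mass of [V]. *)
Lemma double_gibbs m : exists c tau n0, 0 < c /\ forall n k' (E : 'I_k' -> X) (A1 A2 : pred 'I_k'),
  (n0 <= n)%N -> separated dist f n (9 * delta) E ->
  (forall i, A1 i || A2 i -> GM D p s m (E i, n)) ->
  c * ((\sum_(i | A1 i) expR (Phi (E i) n)) * (\sum_(i | A2 i) expR (Phi (E i) n))) <=
    expR (n%:R * P0 *+ 2) * pr mu (linked n tau E A1 A2).
Proof.
have [m1 [N1 hN1]] := on_GM_lower; have [B [B1 hB]] := Q_bound; have B0 : 0 < B by lra.
(* One threshold for the two given families and the fillers, so that a single specification constant
   [tau] serves all four segments. *)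
pose m' := maxn m m1.
have GMm l q : (l <= m')%N -> GM D p s l q -> GM D p s m' q.
  by move=> lm [h1 [h2 h3]]; split => //; split; exact: leq_trans lm.
have [N0 [tau spec]] := specGM m'.
have [c1 [c10 hc1]] := GM_Phi dM phiM delta0 eps_delta decD bowenG m'.
pose Kc := (tau.+1%:R * expR (c1 + tau%:R * M)) ^+ 4.
have Kc0 : 0 < Kc by rewrite exprn_gt0 // mulr_gt0 ?expR_gt0 // ltr0n.
pose Na := (maxn N0 N1).+1.
(* The 16 comes from the lower bound one quarter for each filler, [Kc] from gluing four segments,
   [B] from bounding [partZ], and the exponential from the [4 * tau] times of gaps and padding. *)
pose c2 := expR (- ((4 * tau)%:R * `|P0|)) / (16 * Kc * B).
have c20 : 0 < c2.
  by rewrite divr_gt0 ?expR_gt0 //; apply: mulr_gt0 => //; exact: mulr_gt0.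
have t2 : 0 < 2 * tau.+1%:R :> R by rewrite mulr_gt0 // ltr0n.
exists (c2 / (2 * tau.+1%:R)), tau, N0; split; first by rewrite divr_gt0.
move=> n k' E A1 A2 n0 sep hA.
set X1 := \sum_(i | A1 i) _; set X2 := \sum_(i | A2 i) _.
have X10 : 0 <= X1 by apply: sumr_ge0 => i _; exact: expR_ge0.
have X20 : 0 <= X2 by apply: sumr_ge0 => i _; exact: expR_ge0.
set V := linked n tau E A1 A2; have cV : dclosed dist V by exact: linked_closed.
have mV := measurable_closed borel cV.
pose q := c2 * (X1 * X2) * expR (- (n%:R * P0 *+ 2)).
have q0 : 0 <= q.
  by apply: mulr_ge0; [apply: mulr_ge0; [exact: ltW|exact: mulr_ge0]|exact: expR_ge0].
have d9 : 0 < 9 * delta by rewrite mulr_gt0.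
pose gam N j := orbit_weight f phi W N (iter j f @^-1` V).
have gam0 N j : 0 <= gam N j by exact: orbit_weight_ge0.
have step N a : (Na <= a)%N -> (a + (2 * n + 4 * tau + Na) <= N.+1)%N ->
    q <= \sum_(j < tau.+1) gam N (a + j)%N.
  (* The last filler takes up whatever remains, so that the padded total length is exactly
     [N.+1]. *)
  move=> Naa aN; pose b := (N.+1 - (a + (2 * n + 4 * tau)))%N.
  have hb : (a + (2 * n + 4 * tau) + b = N.+1)%N by rewrite /b subnKC // (leq_trans _ aN) // leq_add2l leq_addr.
  have Nb : (Na <= b)%N by rewrite -(leq_add2l (a + (2 * n + 4 * tau))) hb -addnA.
  have [ka [Ea [_ sepa neta]]] := max_sep dM dK cf setT a d9.
  have [kb [Eb [_ sepb netb]]] := max_sep dM dK cf setT b d9.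
  pose I : finType := ('I_ka + ('I_k' + 'I_kb))%type.
  pose EE (i : I) := match i with inl u => Ea u | inr (inl j) => E j | inr (inr v) => Eb v end.
  (* Gluing expects one index type for all positions; the predicate at each position selects its own
     summand. *)
  pose A (l : 'I_4) (i : I) := match nat_of_ord l, i with
    | 0%N, inl u => `[< GM D p s m1 (Ea u, a) >]
    | 1%N, inr (inl j) => A1 j
    | 2%N, inr (inl j) => A2 j
    | 3%N, inr (inr v) => `[< GM D p s m1 (Eb v, b) >]
    | _, _ => false end.
  pose ns := nth 0%N [:: a; n; n; b].
  have hAC l i : A l i -> GM D p s m' (EE i, ns l) /\ (N0 <= ns l)%N.
    have N0a : (N0 <= Na)%N by rewrite leqW // leq_maxl.
    case: l => -[|[|[|[|//]]]] ll; case: i => [u|[j|v]] //=; rewrite /A /ns /=.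
    - move=> /asboolP h; split; last exact: leq_trans Naa.
      by apply: GMm h; exact: leq_maxr.
    - move=> h; split => //; apply: GMm (leq_maxl _ _) _; apply: hA; by rewrite h.
    - move=> h; split => //; apply: GMm (leq_maxl _ _) _; apply: hA; by rewrite h orbT.
    - move=> /asboolP h; split; last exact: leq_trans Nb.
      by apply: GMm h; exact: leq_maxr.
  have hsep (l : 'I_4) : sepOn (ns l) (9 * delta) EE (A l).
    case: l => -[|[|[|[|//]]]] ll; case=> [u|[j|v]]; case=> [u'|[j'|v']] //= _ _ h; rewrite /ns /=.
    - by apply: sepa; apply: contraNneq h => ->.
    - by apply: sep; apply: contraNneq h => ->.
    - by apply: sep; apply: contraNneq h => ->.
    - by apply: sepb; apply: contraNneq h => ->.
  have LE : (\sum_(i < 4) (ns i + tau))%N = N.+1.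
    by rewrite !big_ord_recl big_ord0 /ns /= -hb; ring.
  have hPhi (l : 'I_4) i : A l i -> forall y, dn (ns l) y (EE i) <= 4 * delta -> Phi (EE i) (ns l) <= Sn y (ns l) + c1.
    by move=> Ai y hy; apply: hc1 => //; case: (hAC l i Ai).
  have hnet y : exists i, dn (\sum_(i < 4) (ns i + tau)) (W (N := N) i) y <= 3 * delta by rewrite LE.
  have hglue := glue_net dM phiM delta0 spec hAC hsep hPhi hnet.
  rewrite -/Kc LE !big_ord_recl big_ord0 mulr1 in hglue.
  rewrite !big_sumType /= !(big_pred0_eq, addr0, add0r) in hglue.
  set Y0 := \sum_(i | _) expR (Phi (Ea i) a) in hglue; set Y3 := \sum_(i | _) expR (Phi (Eb i) b) in hglue.
  rewrite -/X1 -/X2 in hglue.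
  have d39 : 3 * delta <= 9 * delta by have := delta0; lra.
  have a0 : (0 < a)%N by exact: leq_trans Naa.
  have b0 : (0 < b)%N by exact: leq_trans Nb.
  have N1a : (N1 <= Na)%N by rewrite leqW // leq_maxr.
  have hY0 : expR (a%:R * P0) / 4 <= Y0.
    by apply: (hN1 a ka Ea (9 * delta)) => //; [exact: leq_trans Naa|move=> y; exact: neta].
  have hY3 : expR (b%:R * P0) / 4 <= Y3.
    by apply: (hN1 b kb Eb (9 * delta)) => //; [exact: leq_trans Nb|move=> y; exact: netb].
  have Z0 := partZ_gt0 f phi W k0 N.
  have ZB : partZ f phi W N <= B * expR (N.+1%:R * P0).
    apply: le_trans (hB N.+1 _ (@W N) xpredT (sep_pred (sepW (N := N)))).
    by apply: ler_sum => i _; rewrite ler_expR; apply: (Phi_ge phiM); left.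
  pose good (i : 'I_(k N)) := shadowed dist f delta tau ns EE A (W i).
  have hgood : q <= \sum_(i | good i) wgt f phi W i.
    rewrite /wgt -mulr_suml ler_pdivlMr //; set Sg := \sum_(i | _) _.
    have h1 : expR (a%:R * P0) / 4 * (X1 * (X2 * (expR (b%:R * P0) / 4))) <= Kc * Sg.
      apply: le_trans hglue; apply: ler_pM => //.
      - by do 2 (apply: mulr_ge0 => //); rewrite divr_ge0 ?expR_ge0.
      - by rewrite ler_wpM2l // ler_wpM2l.
    have h2 : q * partZ f phi W N <= q * (B * expR (N.+1%:R * P0)) by rewrite ler_wpM2l.
    apply: le_trans h2 _; rewrite -(ler_pM2l Kc0); apply: le_trans h1.
    have e1 : expR (N.+1%:R * P0) = expR (a%:R * P0) * expR (n%:R * P0 *+ 2) * expR ((4 * tau)%:R * P0) * expR (b%:R * P0).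
      by rewrite -!expRD -hb; congr expR; rewrite natrD [(a + _)%:R]natrD [(2 * n + _)%:R]natrD [(2 * n)%:R]natrM; ring.
    have e2 : expR (- (n%:R * P0 *+ 2)) * expR (n%:R * P0 *+ 2) = 1 by rewrite -expRD addNr expR0.
    have e3 : expR (- ((4 * tau)%:R * `|P0|)) * expR ((4 * tau)%:R * P0) <= 1.
      by rewrite -expRD expR_le1 addrC subr_le0 ler_wpM2l // ler_norm.
    pose r := expR (a%:R * P0) * expR (b%:R * P0) * (X1 * X2) / 16.
    have -> : expR (a%:R * P0) / 4 * (X1 * (X2 * (expR (b%:R * P0) / 4))) = r by rewrite /r; field.
    have -> : Kc * (q * (B * expR (N.+1%:R * P0))) =
       r * (expR (- ((4 * tau)%:R * `|P0|)) * expR ((4 * tau)%:R * P0)) * (expR (- (n%:R * P0 *+ 2)) * expR (n%:R * P0 *+ 2)).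
      rewrite e1 /q /c2 /r; field.
      by rewrite (gt_eqF Kc0) (gt_eqF B0).
    rewrite e2 mulr1 ler_piMr // /r !mulr_ge0 ?expR_ge0 ?mulr_ge0 //.
  apply: (le_trans hgood).
  rewrite /gam /orbit_weight (exchange_big_dep xpredT) //=.
  (* The second segment starts after the filler and its gap, at [a + t 0], so the visit occurs for
     [j = t 0]; the delay inside [V] is the next gap [t 1]. *)
  apply: (@le_trans _ _ (\sum_(i | good i) \sum_(j < tau.+1 | `[< (iter (a + j) f @^-1` V) (W (N := N) i) >]) wgt f phi W i)).
    apply: ler_sum => i /asboolP[t [ht _ [u hu]]].
    have w0 := wgt_ge0 f phi W k0 i.
    have j0 : (t 0%N < tau.+1)%N by rewrite ltnS.
    rewrite (bigD1 (Ordinal j0)) /=; first by rewrite lerDl sumr_ge0.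
    apply/asboolP => /=.
    pose l1 : 'I_4 := Ordinal (isT : (1 < 4)%N); pose l2 : 'I_4 := Ordinal (isT : (2 < 4)%N).
    have [j1 [a1 d1]] : exists j1, A1 j1 /\ dn n (E j1) (iter (blk ns t 1) f (W i)) <= 4 * delta.
      by have := hu l1; rewrite /A /=; case: (u l1) => [?|[j1|?]] /= [] // h1 h2; exists j1.
    have [j2 [a2 d2]] : exists j2, A2 j2 /\ dn n (E j2) (iter (blk ns t 2) f (W i)) <= 4 * delta.
      by have := hu l2; rewrite /A /=; case: (u l2) => [?|[j2|?]] /= [] // h1 h2; exists j2.
    exists j1, j2, (t 1%N); split => //.
      by move: d1; rewrite /blk big_ord_recl big_ord0 /= addn0.
    by move: d2; rewrite /blk !big_ord_recl big_ord0 /= addn0 -iterD; congr (dn _ _ (iter _ _ _) <= _); ring.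
  rewrite [leRHS](bigID good) /= lerDl sumr_ge0 // => i _; rewrite sumr_ge0 // => j _.
  exact: wgt_ge0.
(* At least half of the positions are admissible starts once [N] is large, whence the factor 2; each
   visiting time is counted for at most [tau.+1] starts. *)
have lowN : \forall N \near U, q / (2 * tau.+1%:R) <= emp f phi W N V.
  apply: Uoo; exists (2 * (2 * n + 4 * tau + 2 * Na))%N => // N /= hN.
  pose A' := (N.+1 - (2 * n + 4 * tau + 2 * Na))%N.
  have hA' : (A' + (2 * n + 4 * tau + 2 * Na) = N.+1)%N.
    by rewrite subnK // ltnW // ltnS (leq_trans _ hN) // leq_pmull.
  have h2A : (N.+1 <= 2 * A')%N.
    rewrite -(leq_add2r (2 * (2 * n + 4 * tau + 2 * Na))) -mulnDr hA' [(2 * N.+1)%N]mul2n -addnn leq_add2l.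
    exact: leqW.
  have h1 : A'%:R * q <= tau.+1%:R * \sum_(j < N.+1) gam N j.
    apply: (@le_trans _ _ (\sum_(a < A') \sum_(j < tau.+1) gam N (Na + a + j)%N)).
      rewrite mulr_natl -[A' in leLHS]card_ord -sumr_const; apply: ler_sum => a _.
      apply: step; first exact: leq_addr.
      rewrite -hA'; have := ltn_ord a; move=> /ltnW aA.
      by rewrite [leqRHS](_ : _ = Na + A' + (2 * n + 4 * tau + Na))%N ?leq_add2r ?leq_add2l //; ring.
    rewrite exchange_big /= mulr_natl -[tau.+1 in leRHS]card_ord -sumr_const; apply: ler_sum => j _.
    have -> : \sum_(i < A') gam N (Na + i + j)%N = \sum_(i < A') gam N (Na + j + i)%N.
      by apply: eq_bigr => i _; rewrite addnAC.
    apply: window_sum => //; rewrite -hA' [leqLHS](_ : _ = A' + (Na + j))%N; last by ring.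
    rewrite leq_add2l; have := ltn_ord j; rewrite ltnS => jt.
    apply: (@leq_trans (Na + tau)); first by rewrite leq_add2l.
    rewrite [leqRHS](_ : _ = Na + tau + (2 * n + 3 * tau + Na))%N ?leq_addr //; ring.
  rewrite /emp -[\sum_(j < N.+1) _]/(\sum_(j < N.+1) gam N j).
  set T := \sum_(j < N.+1) gam N j in h1 *.
  rewrite ler_pdivrMr // -mulrA ler_pdivlMl ?ltr0n //.
  have h3 : N.+1%:R * q <= 2 * (A'%:R * q).
    by rewrite mulrA -natrM ler_wpM2r // ler_nat.
  apply: (le_trans h3); apply: (@le_trans _ _ (2 * (tau.+1%:R * T))); first by rewrite ler_wpM2l.
  by rewrite mulrA [leRHS]mulrC.
have bV : ubnd U (fun N => emp f phi W N V) by apply: fap_ubnd => // N; exact: emp_fap.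
have h1 : q / (2 * tau.+1%:R) <= pr mu V.
  by apply: le_trans (hmu.2 V cV); exact: ulim_gec.
have e2 : expR (n%:R * P0 *+ 2) * expR (- (n%:R * P0 *+ 2)) = 1 by rewrite -expRD subrr expR0.
have -> : c2 / (2 * tau.+1%:R) * (X1 * X2) = expR (n%:R * P0 *+ 2) * (q / (2 * tau.+1%:R)).
  have gen (x y v u1 u2 : R) : u1 * u2 = 1 -> x * v * y = u1 * (x * y * u2 * v).
    by move=> e; rewrite -[LHS]mul1r -e; ring.
  exact: gen e2.
by rewrite ler_wpM2l ?expR_ge0.
Qed.

End Limit.
End Gibbs.

(** * Uniqueness *)

Section Concavity.
Context {R : realType} {d : measure_display} {T : measurableType d} (f : T -> T).
Hypothesis fm : forall A, measurable A -> measurable (f @^-1` A).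

Lemma xlogx_convex (t x y : R) : 0 <= t <= 1 -> 0 <= x -> 0 <= y ->
  xlogx (t * x + (1 - t) * y) <= t * xlogx x + (1 - t) * xlogx y.
Proof.
move=> /andP[t0 t1] x0 y0; have t1' : 0 <= 1 - t by rewrite subr_ge0.
set m := t * x + (1 - t) * y; have : 0 <= m by rewrite addr_ge0 // mulr_ge0.
rewrite le_eqVlt => /orP[/eqP m0|m0].
  have tx : t * x = 0.
    apply/eqP; rewrite eq_le mulr_ge0 // andbT m0 lerDl mulr_ge0 //.
  have ty : (1 - t) * y = 0 by move: m0; rewrite /m tx add0r.
  by rewrite -m0 !xlogxE !mulrA tx ty !mul0r addr0.
have h1 := ler_wpM2l t0 (xlogx_tangent m0 x0); have h2 := ler_wpM2l t1' (xlogx_tangent m0 y0).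
apply: le_trans (lerD h1 h2); rewrite le_eqVlt; apply/orP; left; apply/eqP.
have gen (w m' : R) : t * (x * w - m') + (1 - t) * (y * w - m') = (t * x + (1 - t) * y) * w - m' by ring.
by rewrite gen -/m xlogxE mulrDr mulr1 addrK.
Qed.

(** Convexity of [xlogx], cell by cell. It is used to see that the average of two equilibrium states
    is one. *)
Lemma hh_concave (m1 m2 m : set T -> R) (t : R) (C : finType) (a : T -> C) :
  fap m1 -> fap m2 -> fap m -> 0 <= t <= 1 ->
  (forall A, measurable A -> m A = t * m1 A + (1 - t) * m2 A) -> mcode a ->
  t * hh f m1 a + (1 - t) * hh f m2 a <= hh f m a.
Proof.
move=> f1 f2 f0 t01 hm ma; have /andP[t0 t1] := t01; have t1' : 0 <= 1 - t by rewrite subr_ge0.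
apply: hh_ge => // n n0; have mw : mcode (word f a n) by exact: mcode_word.
apply: le_trans (lerD (ler_wpM2l t0 (hh_le f1 fm ma n0)) (ler_wpM2l t1' (hh_le f2 fm ma n0))) _.
rewrite !mulrA -mulrDl ler_wpM2r ?invr_ge0 //.
rewrite /H !mulrN -opprD lerN2 !mulr_sumr -big_split /=; apply: ler_sum => w _.
rewrite hm //; apply: xlogx_convex => //; exact: fap_ge0.
Qed.

Lemma hahn_pr (P Q : probability T R) : exists A, [/\ measurable A,
  forall B, measurable B -> B `<=` A -> pr Q B <= pr P B &
  forall B, measurable B -> B `<=` ~` A -> pr P B <= pr Q B].
Proof.
have [A [N [[mA posA] [mN negN] AN AN0]]] :=
  Hahn_decomposition (cadd (charge_of_finite_measure P) (copp (charge_of_finite_measure Q))).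
have E B : measurable B -> cadd (charge_of_finite_measure P) (copp (charge_of_finite_measure Q)) B
    = (pr P B - pr Q B)%:E.
  move=> mB; have e : cadd (charge_of_finite_measure P) (copp (charge_of_finite_measure Q)) B = (P B - Q B)%E by [].
  by rewrite e !prE.
exists A; split => // B mB BA.
  by have h := posA B mB BA; rewrite -subr_ge0 -lee_fin -(E B mB); exact: h.
rewrite -subr_le0 -lee_fin -(E B mB); apply: negN => //.
move=> x Bx; have : (A `|` N) x by rewrite AN.
by case => // Ax; case: (BA x Bx).
Qed.

End Concavity.

Section AverageErgodic.
Context {R : realType} {d : measure_display} {T : measurableType d} (f g : T -> T).
Hypothesis fm : forall A, measurable A -> measurable (f @^-1` A).
Hypothesis gm : forall A, measurable A -> measurable (g @^-1` A).
Hypothesis fK : cancel f g.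

Lemma inv_pr_inverse (P : probability T R) : inv_pr f P -> inv_pr g P.
Proof.
move=> iP A mA; rewrite -iP; last exact: gm.
by congr (pr P _); apply/seteqP; split => x /=; rewrite fK.
Qed.

(* The Hahn set of [P - Q], made invariant by intersecting all its translates, has
   the same [P - Q]-mass. *)
Lemma ergodic_average (P Q : probability T R) : inv_pr f P -> inv_pr f Q ->
  (forall A, measurable A -> f @^-1` A = A ->
     (pr P A = 0 /\ pr Q A = 0) \/ (pr P A = 1 /\ pr Q A = 1)) ->
  forall A, measurable A -> pr P A = pr Q A.
Proof.
move=> iP iQ erg; have [Pos [mPos hp hn]] := hahn_pr P Q.
have mD (A B : set T) : measurable A -> measurable B -> measurable (A `\` B) by exact: measurableD.
(* By invariance the mass leaving [Pos] equals the mass entering it, and the entering points lie in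
   the negative set, where [P] is dominated by [Q]. *)
have sub0 (h : T -> T) : (forall A, measurable A -> measurable (h @^-1` A)) -> inv_pr h P -> inv_pr h Q ->
    pr P (Pos `\` h @^-1` Pos) <= pr Q (Pos `\` h @^-1` Pos).
  move=> hm hP hQ; have mh := hm _ mPos.
  have split (Z : probability T R) A B : measurable A -> measurable B -> pr Z A = pr Z (A `\` B) + pr Z (A `&` B).
    move=> mA mB; rewrite -prU; [|exact: mD|exact: measurableI|by rewrite setDE setIACA setICl setI0].
    by rewrite setUC setUIDK.
  have e1 := split P _ _ mPos mh; have e2 := split Q _ _ mPos mh.
  have e3 := split P _ _ mh mPos; have e4 := split Q _ _ mh mPos.
  have n1 : pr P (h @^-1` Pos `\` Pos) <= pr Q (h @^-1` Pos `\` Pos).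
    by apply: hn; [exact: mD|move=> x []].
  have i1 := hP _ mPos; have i2 := hQ _ mPos.
  rewrite setIC in e3; rewrite setIC in e4; lra.
pose bad (k : nat) : set T := (Pos `\` iter k f @^-1` Pos) `|` (Pos `\` iter k g @^-1` Pos).
have iter_inv (h : T -> T) Z k : (forall A, measurable A -> measurable (h @^-1` A)) -> inv_pr h Z -> inv_pr (iter k h) Z.
  by move=> hm hZ A mA; exact: (fap_iter hm hZ).
have mi (h : T -> T) k A : (forall A, measurable A -> measurable (h @^-1` A)) -> measurable A -> measurable (iter k h @^-1` A).
  by move=> hm mA; exact: measurable_iter.
have iPg := inv_pr_inverse iP; have iQg := inv_pr_inverse iQ.
(* Inside [Pos] the measure [P] dominates [Q], so these are the subsets on which the two masses
   agree. *)
pose null N := [/\ measurable N, N `<=` Pos & pr P N <= pr Q N].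
have nullU A B : null A -> null B -> null (A `|` B).
  move=> [mA sA hA] [mB sB hB]; split; [exact: measurableU|by move=> x []; [exact: sA|exact: sB]|].
  have -> : A `|` B = A `|` (B `\` A) by rewrite setDE setUIr setUCr setIT.
  have dj : A `&` (B `\` A) = set0 by rewrite setDE setICA setICr setI0.
  rewrite !prU //; try exact: mD.
  have h1 : pr Q (B `&` A) <= pr P (B `&` A) by apply: hp; [exact: measurableI|move=> x [_ /sA]].
  have split (Z : probability T R) : pr Z B = pr Z (B `\` A) + pr Z (B `&` A).
    rewrite -prU; [|exact: mD|exact: measurableI|by rewrite setDE setIACA setICl setI0].
    by rewrite setUC setUIDK.
  have := split P; have := split Q; lra.
have nbad k : null (bad k).
  apply: nullU; (split; [by apply: mD => //; exact: mi|by move=> x []|]).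
    by apply: sub0 => [A mA||]; [exact: mi|exact: iter_inv|exact: iter_inv].
  by apply: sub0 => [A mA||]; [exact: mi|exact: iter_inv|exact: iter_inv].
pose F n := \bigcup_(k in [set k | (k < n)%N]) bad k.
have FS n : F n.+1 = F n `|` bad n.
  apply/seteqP; split => x.
    by move=> [k /=]; rewrite ltnS leq_eqVlt => /orP[/eqP ->|kn] hb; [right|left; exists k].
  by move=> [[k /= kn] hb|hb]; [exists k => //=; exact: ltnW|exists n => //=].
have nF n : null (F n).
  elim: n => [|n IH]; last by rewrite FS; exact: nullU.
  rewrite (_ : F 0%N = set0); first by split; [exact: measurable0|exact: sub0set|rewrite !pr0].
  by rewrite -subset0 => x [].
pose A := Pos `\` \bigcup_n F n.
have family_measurable n : measurable (F n) by case: (nF n).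
have mU : measurable (\bigcup_n F n) by exact: bigcupT_measurable.
have mA : measurable A by exact: mD.
have hU : pr P (\bigcup_n F n) <= pr Q (\bigcup_n F n).
  apply/ler_addgt0Pr => e e0; have mon n : F n `<=` F n.+1 by rewrite FS; left.
  have [n hn'] := pr_incr P family_measurable mon e0.
  have : pr Q (F n) <= pr Q (\bigcup_n F n) by apply: pr_mono => // x Fx; exists n.
  have [_ _] := nF n; lra.
have AE x : A x <-> forall k, Pos (iter k f x) /\ Pos (iter k g x).
  split=> [[Px nU] k|h].
    split; apply: contrapT => hk; apply: nU; exists k.+1 => //; exists k => //=; [left|right]; by split.
  split; first by have [] := h 0%N.
  by move=> [n _ [k _ []]] [_]; have [h1 h2] := h k.
have iA : f @^-1` A = A.
  apply/seteqP; split => x /= /AE h; apply/AE => k.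
    split; last by have [_] := h k.+1; rewrite iterSr fK.
    case: k => [|k]; first by have [_ /=] := h 1%N; rewrite fK.
    by have [+ _] := h k; rewrite iterSr.
  split; first by have [+ _] := h k.+1; rewrite iterSr.
  case: k => [|k]; first by have [+ _] := h 1%N.
  by have [_ +] := h k; rewrite iterSr fK.
have dA : pr P A = pr Q A by case: (erg A mA iA) => -[-> ->].
have subP : \bigcup_n F n `<=` Pos by move=> x [n _ Fx]; have [_ + _] := nF n; apply.
have dPos : pr P Pos <= pr Q Pos.
  by move: dA; rewrite /A !prD //; lra.
have dI B : measurable B -> pr P B <= pr Q B.
  move=> mB.
  have split (Z : probability T R) : pr Z B = pr Z (B `\` Pos) + pr Z (B `&` Pos).
    rewrite -prU; [|exact: mD|exact: measurableI|by rewrite setDE setIACA setICl setI0].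
    by rewrite setUC setUIDK.
  have h1 : pr P (B `\` Pos) <= pr Q (B `\` Pos) by apply: hn; [exact: mD|move=> x []].
  have h2 : pr Q (Pos `\` B) <= pr P (Pos `\` B) by apply: hp; [exact: mD|move=> x []].
  have h3 : pr P (B `&` Pos) <= pr Q (B `&` Pos).
    have split' (Z : probability T R) : pr Z Pos = pr Z (Pos `\` B) + pr Z (B `&` Pos).
      rewrite -prU; [|exact: mD|exact: measurableI|by rewrite setDE [B `&` _]setIC setIACA setICl setI0].
      by rewrite [B `&` _]setIC setUC setUIDK.
    have := split' P; have := split' Q; lra.
  by rewrite !split lerD.
move=> B mB; apply/eqP; rewrite eq_le dI //=.
by have := dI _ (measurableC mB); rewrite !prC //; lra.
Qed.

End AverageErgodic.

Section Tubes.
Context {R : realType} {X : Type} (dist : X -> X -> R) (f g : X -> X).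
Hypothesis dM : is_metric dist.
Hypothesis dK : dcompact dist.
Hypothesis fK : cancel f g.
Hypothesis gK : cancel g f.
Hypothesis cf : dcontinuous dist f.
Hypothesis cg : dcontinuous dist g.
Variables (eps : R) (K : set X).
Hypothesis cK : dclosed dist K.

(** Closed neighbourhoods of [K] in the two-sided Bowen metric at the fixed scale [eps]; expansivity
    off [NE] lets them replace neighbourhoods of small radius. *)
Definition tube (h : nat) : set X := [set z | exists y, [/\ K y,
  forall j, (j <= h)%N -> dist (iter j f z) (iter j f y) <= eps &
  forall j, (j <= h)%N -> dist (iter j g z) (iter j g y) <= eps]].

Lemma tube_decr h : tube h.+1 `<=` tube h.
Proof. by move=> y [z [h1 h2 h3]]; exists z; split => // j jh; [apply: h2|apply: h3]; rewrite ltnW. Qed.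

Lemma tube_limit (u : nat -> X) (hs : nat -> nat) z (U : set_system nat) : UltraFilter U ->
  ucvg dist U u z -> (forall n, tube (hs n) (u n)) ->
  exists y, K y /\ forall j, (\forall n \near U, (j <= hs n)%N) ->
    dist (iter j f z) (iter j f y) <= eps /\ dist (iter j g z) (iter j g y) <= eps.
Proof.
move=> UU uz hu; have /choice[v hv] : forall n, exists y, [/\ K y,
    forall j, (j <= hs n)%N -> dist (iter j f (u n)) (iter j f y) <= eps &
    forall j, (j <= hs n)%N -> dist (iter j g (u n)) (iter j g y) <= eps].
  by move=> n; exact: hu.
have [y vy] := ultra_compact dM dK (U := U) v.
exists y; split; first by apply: (ucvg_closed vy cK); apply: nearW => n; case: (hv n).
move=> j hj; split.
  apply: (ucvg_dist_le dM (ucvg_cont uz (dcontinuous_iter j cf)) (ucvg_cont vy (dcontinuous_iter j cf))).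
  by apply: filterS hj => n jn; have [_ h _] := hv n; exact: h.
apply: (ucvg_dist_le dM (ucvg_cont uz (dcontinuous_iter j cg)) (ucvg_cont vy (dcontinuous_iter j cg))).
by apply: filterS hj => n jn; have [_ _ h] := hv n; exact: h.
Qed.

Lemma tube_closed h : dclosed dist (tube h).
Proof.
move=> z nz; apply: contrapT => hn.
have /choice[u hu] : forall n : nat, exists u, dist z u < n.+1%:R^-1 /\ tube h u.
  move=> n; apply: contrapT => hh; apply: hn; exists n.+1%:R^-1; first by rewrite invr_gt0.
  by move=> u yu Bu; apply: hh; exists u.
have [U [UU Uoo]] := free_ultraT.
have uz : ucvg dist U u z.
  move=> e e0; have [k hk] := natSinv_small e0; apply: Uoo; exists k => // n /= kn.
  have [h1 _] := hu n; apply: lt_trans h1 _; apply: le_lt_trans hk.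
  by rewrite lef_pV2 ?posrE ?ltr0Sn // ler_nat.
have [y [Ky hy]] := tube_limit (hs := fun=> h) UU uz (fun n => (hu n).2).
by apply: nz; exists y; split => // j jh; have [] := hy j (nearW _ (fun=> jh)).
Qed.

(** A limit of the shadowed points of [K] stays within [eps] of [z] for all times, so it equals [z]
    or witnesses that [z] is in [NE]. *)
Lemma tube_cap : \bigcap_h tube h `<=` K `|` NE dist f eps.
Proof.
move=> z hz; have [U [UU Uoo]] := free_ultraT.
have cz : ucvg dist U (fun=> z) z by move=> e e0; apply: nearW => n; rewrite distxx.
have [y [Ky hy]] := tube_limit (hs := id) UU cz (fun n => hz n Logic.I).
have hj j : \forall n \near U, (j <= id n)%N by apply: Uoo; exists j.
have [yz|yz] := pselect (y = z); first by left; rewrite -yz.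
right; exists y => //; apply/(GammaE dist fK gK); split => j; by have [] := hy j (hj j).
Qed.

End Tubes.

Section Uniqueness.
Context {R : realType} {dX : measure_display} {X : measurableType dX}.
Variables (dist : X -> X -> R) (f fi : X -> X) (phi : X -> R) (delta eps P0 M eta : R).
Hypothesis dM : is_metric dist.
Hypothesis dK : dcompact dist.
Hypothesis borel : @measurable dX X = <<s dopen dist >>.
Hypothesis fK : cancel f fi.
Hypothesis gK : cancel fi f.
Hypothesis cf : dcontinuous dist f.
Hypothesis cg : dcontinuous dist fi.
Hypothesis cphi : rcontinuous dist phi.
Hypothesis phiM : forall x, `|phi x| <= M.
Hypothesis delta0 : 0 < delta.
Hypothesis eps_delta : 40 * delta < eps.
Hypothesis gap : (Pperp dist f phi eps < Ptop dist f phi)%E.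
Hypothesis PtopE : Ptop dist f phi = P0%:E.
Variables (D P G S : set (X * nat)) (p g s : X -> nat -> nat).
Hypothesis D_gt0 : forall q, D q -> (0 < q.2)%N.
Hypothesis decD : decomposition f D P G S p g s.
Hypothesis specGM : forall m, tailWspec dist f (GM D p s m) delta.
Hypothesis bowenG : Bowen dist f phi G eps.
Hypothesis eta0 : 0 < eta.
Hypothesis C0_pressure : (Pcol dist f phi (P `|` S `|` [set q | (0 < q.2)%N /\ ~ D q]) delta eps < (P0 - eta)%:E)%E.

Local Notation dn := (dn dist f).
Local Notation Phi := (Phi dist f phi (10 * delta)).
Let fm := dcontinuous_measurable borel cf.
Let gm := dcontinuous_measurable borel cg.
Let bphi := rcontinuous_bm dM dK borel cphi.
Let hcphi := rcontinuous_codable dM dK borel cphi.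
Let mNE := NE_measurable dM dK borel fK gK cf cg eps.

Lemma net9 n : exists k (E : 'I_k -> X) (w : X -> 'I_k), [/\ separated dist f n (9 * delta) E, mcode w,
  forall i y, dn n (E i) y <= 4 * delta -> w y = i & forall y, dn n (E (w y)) y <= 9 * delta].
Proof.
have d9 : 0 < 9 * delta by rewrite mulr_gt0.
have [k [E [_ sep net]]] := max_sep dM dK cf setT n d9.
have sep' : separated dist f n (2 * (4 * delta)) E.
  by move=> i j ij; apply: le_lt_trans (sep i j ij); have := delta0; lra.
have net' y : exists i, dn n (E i) y <= 9 * delta by exact: net.
have [w [mw h1 h2]] := adapted_code dM borel cf sep' net'.
exists k, E, w; split => // y; have := h2 y; rewrite (max_idPr _) //; have := delta0; lra.
Qed.

(** The generator bound for a net of length [n.+1], with partition sum at most [B * e^{(n+1)P}],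
    leaves an error [ln (2 * B) / n.+1]. *)
Lemma energy_null (nu : probability X R) (C : finType) (a : X -> C) : inv_pr f nu ->
  pr nu (NE dist f eps) = 0 -> mcode a -> hh f (pr nu) a + intr nu phi <= P0.
Proof.
move=> inu nu0 ma.
have [B [B1 hB]] := Q_bound dM dK cf phiM delta0 eps_delta PtopE D_gt0 decD specGM bowenG eta0 C0_pressure.
have B0 : 0 < B by lra.
have eps0 := eps_gt0 delta0 eps_delta.
apply/ler_addgt0Pr => e e0; have [n hn] := nat_ub (ln (2 * B) / e).
have n0 : (0 < n.+1)%N by []; have n0' : 0 < n.+1%:R :> R by rewrite ltr0n.
have [k [E [w [sep mw _ hw]]]] := net9 n.+1.
have rt : 9 * delta < 10 * delta by have := delta0; lra.
have r2e : 2 * (9 * delta) <= eps by have := delta0; have := eps_delta; lra.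
have d39 : 3 * delta <= 9 * delta by have := delta0; lra.
have hu := hB n.+1 _ E xpredT (sep_weaken d39 (sep_pred sep)).
have u0 : 0 < B * expR (n.+1%:R * P0) by rewrite mulr_gt0 ?expR_gt0.
have h0 : \sum_(i | ~~ xpredT i) expR (Phi (E i) n.+1) <= 1 by rewrite big_pred0_eq.
have := net_pressure dM dK borel fK gK cf cg cphi eps0 n0 phiM inu nu0 ma mw hw rt r2e u0 ltr01 hu h0.
rewrite (_ : _ @^-1` _ = setT); last by apply/seteqP; split.
rewrite prT mul1r subrr mul0r addr0 mulrA lnM ?posrE ?mulr_gt0 ?expR_gt0 // expRK => h.
rewrite -(ler_pM2l n0'); apply: (le_trans h); rewrite mulrDr addrC lerD2l.
rewrite -ler_pdivrMr //; apply: (le_trans hn); rewrite ler_nat; exact: leqnSn.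
Qed.

Lemma Pperp_gap : exists c, (Pperp dist f phi eps <= c%:E)%E /\ c < P0.
Proof.
have [c /andP[h1 h2]] := ereal_between gap; exists c; split; first exact: ltW.
by move: h2; rewrite PtopE lte_fin.
Qed.

Lemma energy_le (nu : probability X R) : inv_pr f nu -> (freeEnergy f phi nu <= P0%:E)%E.
Proof.
move=> inu; apply: freeEnergy_le => // n a ma.
have [c [hc cP]] := Pperp_gap.
apply: (split_NE dM dK borel fK gK cf cg cphi inu ma hc (ltW cP)) => Q iQ Q0.
exact: energy_null.
Qed.

Lemma near_equil_energy (nu : probability X R) : inv_pr f nu -> near_equil f phi P0 nu ->
  (P0%:E <= freeEnergy f phi nu)%E.
Proof.
move=> inu h; apply/lee_addgt0Pr => e e0; have [C [a [ma ha]]] := h e e0.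
rewrite -leeBlDr //; apply: le_trans (freeEnergy_ge fm bphi inu ma).
by rewrite -EFinB lee_fin.
Qed.

(** A mass [q] on [NE] would cost at least [q * (P0 - c)] of energy, and half of that is already
    excluded. *)
Lemma near_equil_null (nu : probability X R) : inv_pr f nu -> near_equil f phi P0 nu ->
  pr nu (NE dist f eps) = 0.
Proof.
move=> inu h; have [c [hc cP]] := Pperp_gap.
apply/eqP; rewrite eq_le pr_ge0 andbT; rewrite leNgt; apply/negP => q0.
set q := pr nu _ in q0; have e0 : 0 < q * (P0 - c) / 2 by rewrite divr_gt0 // mulr_gt0 // subr_gt0.
have [C [a [ma ha]]] := h _ e0.
have := split_NE_mix dM dK borel fK gK cf cg cphi inu ma hc (fun Q iQ Q0 => energy_null iQ Q0 ma).
rewrite -/q; lra.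
Qed.

(** The reference measure [mu] shows that the maximal energy is [P0], so that maximising means
    reaching [P0]. *)
Lemma equilibriumP (nu : probability X R) (mu : probability X R) : inv_pr f mu -> near_equil f phi P0 mu ->
  equilibrium f phi nu <-> inv_pr f nu /\ near_equil f phi P0 nu.
Proof.
move=> imu hmu; split => [[inu hnu]|[inu hnu]]; last first.
  split; first exact/(invariant_pr fm).
  move=> q /(invariant_pr fm) iq; apply: le_trans (energy_le iq) _; exact: near_equil_energy.
have inu' := (invariant_pr fm nu).1 inu; split => // e e0.
have h : ((P0 - e)%:E < freeEnergy f phi nu)%E.
  apply: (@lt_le_trans _ _ P0%:E); first by rewrite lte_fin ltrBlDr ltrDl.
  apply: le_trans (near_equil_energy imu hmu) _; apply: hnu; exact/(invariant_pr fm).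
have [n [a [ma ha]]] := freeEnergy_gt fm bphi inu' h.
by exists 'I_n, a; split => //; exact: ltW.
Qed.

(** By [katok] each measure yields a family of cells of weight comparable to [e^{nP}] near a closed
    part of its own set, so [double_gibbs] bounds the mass of the linked set [V] below. Yet, up to
    tube parts outside [A1] and [A2], a point of [V] would lie in both invariant sets. *)
Lemma no_disjoint_equil (nu1 nu2 : probability X R) A1 A2 :
  inv_pr f nu1 -> inv_pr f nu2 -> near_equil f phi P0 nu1 -> near_equil f phi P0 nu2 ->
  measurable A1 -> measurable A2 -> f @^-1` A1 = A1 -> f @^-1` A2 = A2 -> A1 `&` A2 = set0 ->
  pr nu1 A1 = 1 -> pr nu2 A2 = 1 -> False.
Proof.
move=> i1 i2 h1 h2 mA1 mA2 iA1 iA2 A12 e1 e2.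
have [kW [W [U [mu [[UU Uoo] hW netW hmu imu]]]]] := spanning_limit phi dM dK borel fK gK cf cg delta0.
have kW0 N : (0 < kW N)%N by case: (hW N).
have sepW N : separated dist f N.+1 (3 * delta) (@W N) by case: (hW N).
have neq : near_equil f phi P0 mu.
  exact: (limit_equil dM dK borel fK gK cf cg cphi phiM delta0 eps_delta gap PtopE D_gt0 decD specGM bowenG eta0 C0_pressure Uoo kW0 sepW netW hmu imu).
have mu0 := near_equil_null imu neq.
have [B [B0 hB]] := katok dM dK borel fK gK cf cg cphi phiM delta0 eps_delta PtopE D_gt0 decD specGM bowenG eta0 C0_pressure.
(* Half of the proportion [1 / B] granted by [katok], so that discarding segments outside [GM]
   leaves the other half. *)
have k0 : 0 < 1 / (2 * B) by rewrite divr_gt0 // mulr_gt0.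
have [m [N1 hN1]] := tail_bound dM dK cf phiM delta0 eps_delta PtopE D_gt0 decD specGM bowenG eta0 C0_pressure k0.
have [c [tau [n0 [c0 hc]]]] := double_gibbs dM dK borel fK gK cf cg cphi phiM delta0 eps_delta gap PtopE D_gt0 decD specGM bowenG eta0 C0_pressure Uoo kW0 sepW netW hmu m.
pose rho := c * (1 / (2 * B)) ^+ 2.
have rho0 : 0 < rho by rewrite mulr_gt0 // exprn_gt0.
have t3 : 0 < tau.+3%:R :> R by rewrite ltr0n.
(* One copy of [T1] and [tau.+1] copies of [T2] cover [V], and one spare copy makes the final
   inequality strict. *)
pose e := rho / tau.+3%:R; have e0 : 0 < e by rewrite divr_gt0.
have q14 : 0 < 1 / 4 :> R by rewrite divr_gt0.
have [K1 [cK1 KA1 hK1]] := regular dM borel nu1 mA1 q14.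
have [K2 [cK2 KA2 hK2]] := regular dM borel nu2 mA2 q14.
have tubeM K h : dclosed dist K -> measurable (tube dist f fi eps K h).
  by move=> cK; apply: (measurable_closed borel); exact: tube_closed.
have tubeN K A : measurable A -> dclosed dist K -> K `<=` A ->
    exists h0, forall h, (h0 <= h)%N -> pr mu (tube dist f fi eps K h `\` A) < e.
  move=> mA cK KA; have mK := measurable_closed borel cK.
  have [||h0 hh0] := @pr_decr _ _ _ mu (tube dist f fi eps K) e _ _ e0.
  - by move=> h; exact: tubeM.
  - by move=> h; exact: tube_decr.
  exists h0 => h /subnKC <-; elim: (h - h0)%N => [|l IH].
    rewrite addn0; have capK : pr mu (\bigcap_h tube dist f fi eps K h) <= pr mu K.
      have mc : measurable (\bigcap_h tube dist f fi eps K h) by apply: bigcapT_measurable => k; exact: tubeM.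
      apply: (@le_trans _ _ (pr mu (K `|` NE dist f eps))).
        by apply: pr_mono; [exact: mc|exact: measurableU|exact: (tube_cap dM dK fK gK cf cg cK)].
      by apply: le_trans (prU_le mu mK mNE) _; rewrite mu0 addr0.
    have mT := tubeM K h0 cK.
    have eps0 := eps_gt0 delta0 eps_delta.
    have KT : K `<=` tube dist f fi eps K h0 by move=> x Kx; exists x; split => // j _; rewrite distxx // ltW.
    have : pr mu (tube dist f fi eps K h0 `\` A) <= pr mu (tube dist f fi eps K h0 `\` K).
      by apply: pr_mono; [exact: measurableD|exact: measurableD|move=> x [h2' h3']; split => // /KA].
    rewrite [leRHS]prD //; move: hh0 capK; lra.
  apply: le_lt_trans IH; apply: pr_mono; [by apply: measurableD => //; exact: tubeM..|].
  by rewrite addnS => x [Tx nA]; split => //; exact: tube_decr.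
have [h01 H1] := tubeN K1 A1 mA1 cK1 KA1.
have [h02 H2] := tubeN K2 A2 mA2 cK2 KA2.
pose h := maxn h01 h02; have {}H1 := H1 h (leq_maxl _ _); have {}H2 := H2 h (leq_maxr _ _).
(* The times within [h] of time [h] must lie inside the segment of length [n]. *)
pose n := maxn (maxn n0 N1) (h + h).+1.
have nn0 : (n0 <= n)%N by rewrite leq_max leq_maxl.
have nN1 : (N1 <= n)%N by rewrite leq_max leq_maxr.
have nh : (h + h < n)%N by rewrite leq_maxr.
have n00 : (0 < n)%N by exact: leq_ltn_trans nh.
have [k [E [w [sep mw hw1 hw2]]]] := net9 n.
(* The cells containing a point that is in [K] at time [h]; the shift by [h] turns two-sided tubes
   into forward conditions. *)
pose Dp (K : set X) (i : 'I_k) : bool := `[< exists z, w z = i /\ K (iter h f z) >].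
have half (nu : probability X R) A K : inv_pr f nu -> measurable A -> dclosed dist K -> K `<=` A ->
    pr nu A = 1 -> pr nu (A `\` K) < 1 / 4 -> 1 / 2 <= pr nu (w @^-1` [set i | Dp K i]).
  move=> inu mA cK KA nA hK; have mK := measurable_closed borel cK.
  move: hK; rewrite prD // nA => hK.
  apply: (@le_trans _ _ (pr nu (iter h f @^-1` K))); first by rewrite (fap_iter fm inu) //; lra.
  apply: pr_mono; [exact: (measurable_iter fm)|exact: mcode_set|].
  by move=> z Kz /=; apply/asboolP; exists z.
have null1 := near_equil_null i1 h1; have null2 := near_equil_null i2 h2.
have k1 := hB nu1 n k E w (Dp K1) i1 null1 h1 n00 sep mw hw2 (half nu1 A1 K1 i1 mA1 cK1 KA1 e1 hK1).
have k2 := hB nu2 n k E w (Dp K2) i2 null2 h2 n00 sep mw hw2 (half nu2 A2 K2 i2 mA2 cK2 KA2 e2 hK2).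
pose Gd i := `[< GM D p s m (E i, n) >].
have d39 : 3 * delta <= 9 * delta by have := delta0; lra.
(* The family is restricted to [GM], where gluing is possible; the part removed has weight at most
   [1 / (2 * B)] of [e^{nP}]. *)
have low (Q : pred 'I_k) : expR (n%:R * P0) <= B * \sum_(i | Q i) expR (Phi (E i) n) ->
    1 / (2 * B) * expR (n%:R * P0) <= \sum_(i | Q i && Gd i) expR (Phi (E i) n).
  rewrite (bigID Gd) /= => hQ.
  have := hN1 n _ E (fun i => Q i && ~~ Gd i) nN1 n00 (sep_weaken d39 (sep_pred sep)).
  have hG i : Q i && ~~ Gd i -> ~ GM D p s m (E i, n) by move=> /andP[_ /asboolPn].
  move=> /(_ hG) ht; rewrite -(ler_pM2l B0).
  have ht' := ler_wpM2l (ltW B0) ht.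
  have eB : B * (1 / (2 * B) * expR (n%:R * P0)) = expR (n%:R * P0) / 2 by field; rewrite gt_eqF.
  by rewrite eB in ht' *; rewrite mulrDr in hQ; lra.
have l1 := low _ k1; have l2 := low _ k2.
pose V := linked dist f delta n tau E (fun i => Dp K1 i && Gd i) (fun i => Dp K2 i && Gd i).
have hV : rho <= pr mu V.
  have hA i : (Dp K1 i && Gd i) || (Dp K2 i && Gd i) -> GM D p s m (E i, n).
    by move=> /orP[/andP[_ /asboolP]|/andP[_ /asboolP]].
  have h3 := hc n k E _ _ nn0 sep hA.
  have x0 : 0 <= 1 / (2 * B) * expR (n%:R * P0) by rewrite mulr_ge0 ?expR_ge0 // ltW.
  have h4 := ler_pM x0 x0 l1 l2.
  have h5 := le_trans (ler_wpM2l (ltW c0) h4) h3.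
  have e3 : expR (n%:R * P0 *+ 2) = expR (n%:R * P0) * expR (n%:R * P0) by rewrite mulr2n expRD.
  rewrite -(ler_pM2l (expR_gt0 (n%:R * P0 *+ 2))); apply: le_trans h5.
  rewrite le_eqVlt; apply/orP; left; apply/eqP; rewrite e3 /rho; ring.
have tubeh K i z : Dp K i -> dn n (E i) z <= 4 * delta -> tube dist f fi eps K h (iter h f z).
  move=> /asboolP[y [wy Ky]] iz; exists (iter h f y).
  have yz : dn n z y <= eps.
    have := dn_tri f dM n z (E i) y; have := hw2 y; rewrite wy (dn_sym f dM n z (E i)).
    by have := delta0; have := eps_delta; lra.
  have eps0 := eps_gt0 delta0 eps_delta.
  have yz' := (dn_leP dist f n z y (ltW eps0)).1 yz.
  split => // j jh.
    by rewrite -!iterD; apply: yz'; apply: leq_ltn_trans nh; rewrite leq_add2r.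
  have gE x : iter j fi (iter h f x) = iter (h - j) f x.
    by rewrite -{1}(subnKC jh) iterD (iter_fK fK).
  by rewrite !gE; apply: yz'; apply: leq_ltn_trans nh; apply: (leq_trans (leq_subr _ _)); exact: leq_addr.
pose T1 := tube dist f fi eps K1 h `\` A1; pose T2 := tube dist f fi eps K2 h `\` A2.
have mT1 : measurable T1 by apply: measurableD => //; exact: tubeM.
have mT2 : measurable T2 by apply: measurableD => //; exact: tubeM.
have iterA A q x : f @^-1` A = A -> A (iter q f x) <-> A x.
  by move=> iA; elim: q => // q IH; rewrite -IH iterS -[X in _ <-> X]/(A _) -{2}iA.
have mV : measurable V by apply: (measurable_closed borel); exact: linked_closed.
(* If the tube around [K1] is met inside [A1], then [z] itself is in [A1] by invariance and hence
   not in [A2], so the later visit to the tube around [K2] takes place outside [A2]. *)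
have VT : pr mu V <= pr mu T1 + tau.+1%:R * pr mu T2.
  pose V2 := [set z | exists2 t : 'I_tau.+1, List.In t (enum 'I_tau.+1) & (iter (h + (n + t)) f @^-1` T2) z].
  have mV2 : measurable V2.
    rewrite (_ : V2 = \bigcup_(t in [set: 'I_tau.+1]) (iter (h + (n + t)) f @^-1` T2)).
      by apply: fin_bigcup_measurable => // t _; exact: (measurable_iter fm).
    by apply/seteqP; split => z; [move=> [t _ h3]; exists t|move=> [t _ h3]; exists t => //; exact: enum_In].
  have mTi q T : measurable T -> measurable (iter q f @^-1` T) by move=> mT; exact: measurable_iter.
  have mT1' := mTi h _ mT1.
  apply: (@le_trans _ _ (pr mu (iter h f @^-1` T1 `|` V2))).
    apply: pr_mono => //; first exact: measurableU.
    move=> z [i [j [t [/andP[a1 _] /andP[a2 _] tt d1 d2]]]].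
    have t1 := tubeh _ _ _ a1 d1; have t2 := tubeh _ _ _ a2 d2.
    have [zA|nzA] := pselect (A1 z); last by left; split => // /(iterA _ _ _ iA1).
    right; exists (inord t); first exact: enum_In.
    rewrite inordK ?ltnS // /= iterD; split => // /(iterA _ _ _ iA2) /(iterA _ _ _ iA2) zA2.
    have : (A1 `&` A2) z by split.
    by rewrite A12.
  apply: le_trans (prU_le mu mT1' mV2) _; rewrite (fap_iter fm imu) // lerD2l.
  apply: (@le_trans _ _ (\sum_(t <- enum 'I_tau.+1) pr mu (iter (h + (n + t)) f @^-1` T2))).
    by apply: pr_bigU_le => // t; exact: mTi.
  rewrite big_enum /= (eq_bigr (fun=> pr mu T2)) => [|t _]; last exact: (fap_iter fm imu).
  by rewrite sumr_const card_ord mulr_natl.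
have : pr mu V < tau.+3%:R * e.
  apply: le_lt_trans VT _.
  have h3 : tau.+1%:R * pr mu T2 <= tau.+1%:R * e by rewrite ler_wpM2l // ltW.
  have -> : tau.+3%:R = tau.+1%:R + 1 + 1 :> R by rewrite !natr1.
  by move: H1 h3 e0; rewrite -/T1; lra.
rewrite /e mulrC divfK ?gt_eqF //; lra.
Qed.

(** The energy of [nu] is at most the mean of those of its two conditional measures, and neither
    exceeds [P0]; both are therefore equilibrium states, carried by disjoint invariant sets. *)
Lemma equil_ergodic (nu : probability X R) A : inv_pr f nu -> near_equil f phi P0 nu ->
  measurable A -> f @^-1` A = A -> pr nu A = 0 \/ pr nu A = 1.
Proof.
move=> inu hnu mA iA; apply: contrapT => /not_orP[n0 n1].
have p0 : 0 < pr nu A by rewrite lt_neqAle pr_ge0 andbT eq_sym; apply/eqP.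
have p1 : pr nu A < 1 by rewrite lt_neqAle pr_le1 // andbT; apply/eqP.
have mA' := measurableC mA; have p0' : 0 < pr nu (~` A) by rewrite prC // subr_gt0.
have iA' : f @^-1` (~` A) = ~` A by rewrite -preimage_setC iA.
have [Q1 h1] := pr_cond mA p0; have [Q2 h2] := pr_cond mA' p0'.
have i1 : inv_pr f Q1 by exact: (inv_pr_cond borel cf mA iA inu h1).
have i2 : inv_pr f Q2 by exact: (inv_pr_cond borel cf mA' iA' inu h2).
have hmix := pr_cond_mix mA p0 p1 h1 h2.
have nul := near_equil_null inu hnu.
have N0 (Q : probability X R) B : measurable B -> (forall Z, measurable Z -> pr Q Z = pr nu (Z `&` B) / pr nu B) ->
    pr Q (NE dist f eps) = 0.
  move=> mB hQ; rewrite hQ // (_ : pr nu _ = 0) ?mul0r //.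
  apply/eqP; rewrite eq_le pr_ge0 andbT -nul.
  by apply: pr_mono; [exact: measurableI|exact: mNE|move=> x []].
have t01 : 0 <= pr nu A <= 1 by rewrite (ltW p0) (ltW p1).
have hI := intr_mix bphi hcphi t01 hmix.
have F (C : finType) (a : X -> C) : mcode a -> hh f (pr nu) a + intr nu phi <=
    pr nu A * (hh f (pr Q1) a + intr Q1 phi) + (1 - pr nu A) * (hh f (pr Q2) a + intr Q2 phi).
  move=> ma; have : hh f (pr nu) a <= pr nu A * hh f (pr Q1) a + (1 - pr nu A) * hh f (pr Q2) a.
    by apply: hh_mix => //; exact: pr_fap.
  by rewrite hI !mulrDr; lra.
have q0 : 0 < 1 - pr nu A by rewrite subr_gt0.
have eq1 : near_equil f phi P0 Q1.
  move=> e e0; have [C [a [ma ha]]] := hnu _ (mulr_gt0 p0 e0); exists C, a; split => //.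
  have := energy_null i2 (N0 Q2 _ mA' h2) ma; have := F _ _ ma => hF h3.
  have h4 := ler_wpM2l (ltW q0) h3; rewrite -(ler_pM2l p0); lra.
have eq2 : near_equil f phi P0 Q2.
  move=> e e0; have [C [a [ma ha]]] := hnu _ (mulr_gt0 q0 e0); exists C, a; split => //.
  have := energy_null i1 (N0 Q1 _ mA h1) ma; have := F _ _ ma => hF h3.
  have h4 := ler_wpM2l (ltW p0) h3; rewrite -(ler_pM2l q0); lra.
apply: (no_disjoint_equil i1 i2 eq1 eq2 mA mA' iA iA').
- by rewrite setICr.
- by rewrite h1 // setIid divff // gt_eqF.
- by rewrite h2 // setIid divff // gt_eqF.
Qed.

Lemma equil_unique (nu1 nu2 : probability X R) : inv_pr f nu1 -> inv_pr f nu2 ->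
  near_equil f phi P0 nu1 -> near_equil f phi P0 nu2 ->
  forall A, measurable A -> pr nu1 A = pr nu2 A.
Proof.
move=> i1 i2 h1 h2; apply: (ergodic_average fm gm fK i1 i2) => A mA iA.
have t01 : 0 <= (1 / 2 : R) <= 1 by apply/andP; split; lra.
have [nu hnu] := pr_mix nu1 nu2 t01.
have inu : inv_pr f nu by move=> B mB; rewrite !hnu // ?i1 ?i2 //; exact: fm.
have enu : near_equil f phi P0 nu.
  move=> e e0; have [C1 [a1 [m1 ha1]]] := h1 e e0; have [C2 [a2 [m2 ha2]]] := h2 e e0.
  (* A common refinement is needed because each measure comes with its own code. *)
  pose a x := (a1 x, a2 x); have ma : mcode a by exact: mcode_pair.
  exists (C1 * C2)%type, a; split => //.
  have := hh_concave fm (pr_fap nu1) (pr_fap nu2) (pr_fap nu) t01 hnu ma.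
  rewrite (intr_mix bphi hcphi t01 hnu).
  have : hh f (pr nu1) a1 <= hh f (pr nu1) a by apply: (hh_mono (pr_fap nu1) fm) => // x y [].
  have : hh f (pr nu2) a2 <= hh f (pr nu2) a by apply: (hh_mono (pr_fap nu2) fm) => // x y [].
  lra.
have a1 := pr_le1 nu1 mA; have a2 := pr_le1 nu2 mA.
have b1 := pr_ge0 nu1 A; have b2 := pr_ge0 nu2 A.
have := equil_ergodic inu enu mA iA; rewrite hnu // => -[] e; [left|right]; split; lra.
Qed.

Lemma equil_exists : exists mu, inv_pr f mu /\ near_equil f phi P0 mu.
Proof.
have [kW [W [U [mu [[UU Uoo] hW netW hmu imu]]]]] := spanning_limit phi dM dK borel fK gK cf cg delta0.
have kW0 N : (0 < kW N)%N by case: (hW N).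
have sepW N : separated dist f N.+1 (3 * delta) (@W N) by case: (hW N).
exists mu; split => //.
exact: (limit_equil dM dK borel fK gK cf cg cphi phiM delta0 eps_delta gap PtopE D_gt0 decD specGM bowenG eta0 C0_pressure Uoo kW0 sepW netW hmu imu).
Qed.

End Uniqueness.

Theorem theorem6p1 (R : realType) (dX : measure_display) (X : measurableType dX)
  (dist : X -> X -> R) (f : X -> X) (phi : X -> R) (delta eps : R)
  (D P G S : set (X * nat)) (p g s : X -> nat -> nat) :
  is_metric dist -> dcompact dist ->
  @measurable dX X = <<s dopen dist >> ->
  homeomorphism dist f -> rcontinuous dist phi ->
  0 < delta -> 0 < eps -> 40 * delta < eps ->
  (Pperp dist f phi eps < Ptop dist f phi)%E ->
  (forall q, D q -> (0 < q.2)%N) ->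
  decomposition f D P G S p g s ->
  (forall M : nat, tailWspec dist f (GM D p s M) delta) ->
  Bowen dist f phi G eps ->
  (Pcol dist f phi (P `|` S `|` [set q | (0 < q.2)%N /\ ~ D q]) delta eps
     < Ptop dist f phi)%E ->
  exists mu : probability X R, equilibrium f phi mu /\
    forall nu : probability X R, equilibrium f phi nu ->
      forall A, measurable A -> nu A = mu A.
Proof.
move=> dM dK borel [fi [fK gK cf cg]] cphi delta0 eps0 eps_delta gap D_gt0 decD specGM bowenG C0gap.
have [M phiM] := rcontinuous_bounded dM dK cphi.
have [P0 PtopE] := Ptop_fin dM dK borel fK gK cf cg cphi eps0 gap.
have [c /andP[c1 c2]] := ereal_between C0gap.
(* A real number [c] strictly between the two pressures turns the strict inequality into the
   exponential gain [eta]. *)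
have eta0 : 0 < P0 - c by rewrite subr_gt0; move: c2; rewrite PtopE lte_fin.
have C0p : (Pcol dist f phi (P `|` S `|` [set q | (0 < q.2)%N /\ ~ D q]) delta eps < (P0 - (P0 - c))%:E)%E.
  by rewrite subKr.
have [mu [imu hmu]] := equil_exists dM dK borel fK gK cf cg cphi phiM delta0 eps_delta gap PtopE D_gt0 decD specGM bowenG eta0 C0p.
have eqP' nu := equilibriumP dM dK borel fK gK cf cg cphi phiM delta0 eps_delta gap PtopE D_gt0 decD specGM bowenG eta0 C0p nu imu hmu.
exists mu; split; first exact/eqP'.
move=> nu /eqP'[inu hnu] A mA; rewrite !prE //; congr (_%:E).
exact: (equil_unique dM dK borel fK gK cf cg cphi phiM delta0 eps_delta gap PtopE D_gt0 decD specGM bowenG eta0 C0p inu imu hnu hmu).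
Qed.
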